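(* Suppose a group $\Gamma$ has a finitely generated central subgroup $\Delta$ such that $\Gamma/\Delta$ is a finitely generated, torsion-free, two-step nilpotent group with rank one center. Then $C^*(\Gamma)$ is strongly quasidiagonal.
   Context: Groups are discrete; $C^*(\Gamma)$ is the full group C*-algebra. ''Rank one center'' means that the center is an abelian group of rank one (here, isomorphic to $\mathbb{Z}$). A separable set $\Omega\subset B(H)$, $H$ a separable Hilbert space, is quasidiagonal if there is an increasing sequence of compact self-adjoint projections $P_n$ with $P_n\to1_H$ strongly and $\|P_nT-TP_n\|\to0$ for every $T\in\Omega$. A separable C*-algebra $A$ is strongly quasidiagonal if $\sigma(A)$ is a quasidiagonal set of operators for every representation $\sigma$ of $A$ (on a separable Hilbert space). *)

(* Defs.v *)
From HB Require Import structures.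
From mathcomp Require Import all_boot all_order all_algebra.
From mathcomp Require Import all_classical all_reals all_analysis.
From mathcomp Require Export monoid sesquilinear complex.
Set Implicit Arguments.
Unset Strict Implicit.
Unset Printing Implicit Defensive.
Import Order.TTheory GRing.Theory Num.Theory.
Import numFieldNormedType.Exports.
Local Open Scope quotient_scope.
Local Open Scope classical_set_scope.
Local Open Scope ring_scope.
Local Open Scope complex_scope.

HB.mixin Record isNormalClosed (G : groupType) (S : {pred G}) := {
  gpredJ_normal : forall x y : G, x \in S -> (x ^ y)%g \in S
}.

#[short(type="normalClosed")]
HB.structure Definition NormalClosed (G : groupType) :=
  {S of isNormalClosed G S & GroupClosed G S}.

Section Groups.
Local Open Scope group_scope.

Section Quotient.
Variables (G : groupType) (N : normalClosed G).

Definition coset_eq : rel G := fun x y => x^-1 * y \in N.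

Lemma coset_eq_equiv : equiv_class_of coset_eq.
Proof.
have sym x y : coset_eq x y -> coset_eq y x.
  by rewrite /coset_eq -[y^-1 * x]invgK invgM invgK gpredV.
split=> [x|x y|y x z].
- by rewrite /coset_eq mulVg gpred1.
- by apply/idP/idP; exact: sym.
- move=> xy yz; rewrite /coset_eq.
  have -> : x^-1 * z = (x^-1 * y) * (y^-1 * z) by rewrite -mulgA mulVKg.
  exact: gpredM.
Qed.

Canonical coset_equiv := EquivRelPack coset_eq_equiv.

Definition quotient_group := {eq_quot coset_equiv}.
HB.instance Definition _ := Choice.on quotient_group.
HB.instance Definition _ := EqQuotient.on quotient_group.

Let Q := quotient_group.

Lemma coset_eqP (x y : G) : reflect (\pi_Q x = \pi_Q y) (coset_eq x y).
Proof. exact: eqmodP. Qed.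

Definition qmul : Q -> Q -> Q := fun x y => \pi_Q (repr x * repr y).
Definition qinv : Q -> Q := fun x => \pi_Q (repr x)^-1.
Definition qone : Q := \pi_Q 1.

Lemma pi_qmul (x y : G) : qmul (\pi_Q x) (\pi_Q y) = \pi_Q (x * y).
Proof.
rewrite /qmul; apply/coset_eqP.
have: coset_eq (repr (\pi_Q x)) x by apply/coset_eqP; rewrite reprK.
have: coset_eq (repr (\pi_Q y)) y by apply/coset_eqP; rewrite reprK.
move: (repr _) (repr _) => x' y'; rewrite /coset_eq => hy hx.
have -> : (x' * y')^-1 * (x * y) = (x'^-1 * x) ^ y' * (y'^-1 * y).
  by rewrite /conjg invgM !mulgA mulgK.
by rewrite gpredM // gpredJ_normal.
Qed.

Lemma pi_qinv (x : G) : qinv (\pi_Q x) = \pi_Q x^-1.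
Proof.
rewrite /qinv; apply/coset_eqP.
have: coset_eq (repr (\pi_Q x)) x by apply/coset_eqP; rewrite reprK.
move: (repr _) => x'; rewrite /coset_eq => hx.
have -> : x'^-1^-1 * x^-1 = ((x'^-1 * x) ^ x'^-1)^-1.
  by rewrite /conjg !invgM !invgK !mulgA mulgK.
by rewrite gpredV gpredJ_normal.
Qed.

Lemma qmulA : associative qmul.
Proof.
elim/quotW=> x; elim/quotW=> y; elim/quotW=> z.
by rewrite (pi_qmul y z) (pi_qmul x y) pi_qmul (pi_qmul (x * y)) mulgA.
Qed.

Lemma qmul1g : left_id qone qmul.
Proof. by elim/quotW=> x; rewrite pi_qmul mul1g. Qed.

Lemma qmulg1 : right_id qone qmul.
Proof. by elim/quotW=> x; rewrite pi_qmul mulg1. Qed.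

Lemma qmulVg : left_inverse qone qinv qmul.
Proof. by elim/quotW=> x; rewrite pi_qinv pi_qmul mulVg. Qed.

Lemma qmulgV : right_inverse qone qinv qmul.
Proof. by elim/quotW=> x; rewrite pi_qinv pi_qmul mulgV. Qed.

HB.instance Definition _ :=
  isGroup.Build quotient_group qmulA qmul1g qmulg1 qmulVg qmulgV.

End Quotient.

Definition finitely_generated (G : groupType) (S : {pred G}) : Prop :=
  exists2 s : seq G, {subset s <= S} &
    forall T : groupClosed G, {subset s <= T} -> {subset S <= T}.

Definition torsion_free (G : groupType) : Prop :=
  forall (x : G) (n : nat), (0 < n)%N -> x ^+ n = 1 -> x = 1.

Definition center_pred (G : groupType) : {pred G} :=
  [pred x | `[< forall y, commute x y >]].
#[global] Arguments center_pred : clear implicits.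

Fixpoint upper_central (G : groupType) (n : nat) : set G :=
  if n is n'.+1 then [set x | forall y, upper_central n' [~ x, y]]
  else [set 1].

(* nilpotent of class at most n *)
Definition nilpotent_step (n : nat) (G : groupType) : Prop :=
  @upper_central G n = setT.

Definition expgz (G : groupType) (x : G) (k : int) : G :=
  match k with Posz n => x ^+ n | Negz n => x ^- n.+1 end.

Definition independent (G : groupType) (n : nat) (x : 'I_n -> G) : Prop :=
  forall k : 'I_n -> int, \prod_(i < n) expgz (x i) (k i) = 1 ->
    forall i, k i = 0%R.

(* meant for S a commutative subgroup: maximal size of a Z-independent family *)
Definition abelian_rank (G : groupType) (S : {pred G}) (n : nat) : Prop :=
  (exists x : 'I_n -> G, (forall i, x i \in S) /\ independent x) /\
  ~ (exists x : 'I_n.+1 -> G, (forall i, x i \in S) /\ independent x).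

End Groups.

HB.mixin Record NormedModule_isHilbert (R : realType) (H : Type)
    of CompleteNormedModule R[i] H := {
  hdot : {dot H for @Num.conj R[i]};
  hdot_norm : forall x : H, `|x| ^+ 2 = hdot x x
}.

#[short(type="hilbertType")]
HB.structure Definition Hilbert (R : realType) :=
  {H of NormedModule_isHilbert R H & CompleteNormedModule R[i] H}.

(* Unital C*-algebras. The product is a field of the mixin because a structure
   joining [GRing.NzRing] with a normed module cannot be added below
   [Num.NumDomain], which already inherits from both. *)
HB.mixin Record NormedModule_isCstar (R : realType) (A : Type)
    of CompleteNormedModule R[i] A := {
  cone : A;
  cmul : A -> A -> A;
  star : A -> A;
  cmulA : associative cmul;
  cmul1 : left_id cone cmul;
  cmulr1 : right_id cone cmul;
  cmulDl : left_distributive cmul +%R;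
  cmulDr : right_distributive cmul +%R;
  cmulZl : forall (k : R[i]) (a b : A), cmul (k *: a) b = k *: cmul a b;
  cmulZr : forall (k : R[i]) (a b : A), cmul a (k *: b) = k *: cmul a b;
  starK : involutive star;
  starD : {morph star : a b / a + b};
  starZ : forall (k : R[i]) (a : A), star (k *: a) = Num.conj k *: star a;
  starM : forall a b : A, star (cmul a b) = cmul (star b) (star a);
  cmul_norm : forall a b : A, `|cmul a b| <= `|a| * `|b|;
  cstar_norm : forall a : A, `|cmul (star a) a| = `|a| ^+ 2
}.

#[short(type="cstarAlgType")]
HB.structure Definition CstarAlgebra (R : realType) :=
  {A of NormedModule_isCstar R A & CompleteNormedModule R[i] A}.

Definition separable_space (T : topologicalType) : Prop :=
  exists2 D : set T, countable D & dense D.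

Section Operators.
Variables (R : realType) (H : hilbertType R).
Implicit Types (T P : H -> H) (W : set (H -> H)).

Definition bounded_operator T : Prop := linear T /\ continuous T.

Definition unit_ball : set H := [set x | `|x| <= 1].

Definition opnorm T : R := sup [set complex.Re `|T x| | x in unit_ball].

Definition compact_operator T : Prop := compact (closure (T @` unit_ball)).

Definition adjoint_to T T' : Prop := forall x y, hdot (T x) y = hdot x (T' y).

Definition projection P : Prop :=
  [/\ bounded_operator P, forall x, P (P x) = P x & adjoint_to P P].

Definition separable_operators W : Prop :=
  exists2 D : set (H -> H), D `<=` W /\ countable D &
    forall T, W T -> forall e : R, 0 < e ->
      exists2 S, D S & opnorm (T \- S) < e.

Definition quasidiagonal_set W : Prop :=
  [/\ W `<=` bounded_operator, separable_operators W &
   exists P : nat -> H -> H,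
   [/\ forall n, projection (P n) /\ compact_operator (P n),
       forall n x, hdot (P n x) x <= hdot (P n.+1 x) x,
       forall x, P n x @[n --> \oo] --> x &
       forall T, W T ->
         opnorm ((P n \o T) \- (T \o P n)) @[n --> \oo] --> (0 : R)]].

End Operators.

(* [s] need not be unital (nondegenerate) *)
Definition star_representation (R : realType) (A : cstarAlgType R)
    (H : hilbertType R) (s : A -> H -> H) : Prop :=
  [/\ forall a, bounded_operator (s a),
      forall (k : R[i]) a b x, s (k *: a + b) x = k *: s a x + s b x,
      forall a b x, s (cmul a b) x = s a (s b x) &
      forall a, adjoint_to (s (star a)) (s a)].

Definition strongly_quasidiagonal (R : realType) (A : cstarAlgType R) : Prop :=
  separable_space A /\
  forall (H : hilbertType R) (s : A -> H -> H), separable_space H ->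
    star_representation s -> quasidiagonal_set (range s).

Definition unitary_representation (R : realType) (G : groupType)
    (H : hilbertType R) (p : G -> H -> H) : Prop :=
  [/\ forall g, bounded_operator (p g),
      forall x, p 1%g x = x,
      forall g h x, p (g * h)%g x = p g (p h x) &
      forall g x y, hdot (p g x) (p g y) = hdot x y].

(* the norm of [\sum_i c i * g i] in the full group C*-algebra *)
Definition universal_norm (R : realType) (G : groupType)
    (n : nat) (c : 'I_n -> R[i]) (g : 'I_n -> G) : R :=
  sup [set r | exists (H : hilbertType R) (p : G -> H -> H),
    unitary_representation p /\
    r = opnorm (fun x => \sum_(i < n) c i *: p (g i) x)].

(* [A], with [u] the canonical embedding of [G], is the completion C*(G) of the
   group algebra C[G] in the universal norm; this determines (A, u) up to a
   unique isometric *-isomorphism. *)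
Definition full_group_cstar (R : realType) (G : groupType)
    (A : cstarAlgType R) (u : G -> A) : Prop :=
  [/\ u 1%g = cone /\ (forall g h, u (g * h)%g = cmul (u g) (u h)),
      forall g, star (u g) = u g^-1%g,
      forall n (c : 'I_n -> R[i]) (g : 'I_n -> G),
        `|\sum_(i < n) c i *: u (g i)| = (universal_norm c g)%:C &
      dense [set a | exists n (c : 'I_n -> R[i]) (g : 'I_n -> G),
                       a = \sum_(i < n) c i *: u (g i)]].

(* Main.v *)
Require Import Defs.
From HB Require Import structures.
From mathcomp Require Import all_boot all_order all_algebra.
From mathcomp Require Import all_classical all_reals all_analysis.
From mathcomp Require Import monoid sesquilinear complex ring lra zify.
Set Implicit Arguments.
Unset Strict Implicit.
Unset Printing Implicit Defensive.
Import Order.TTheory GRing.Theory Num.Theory.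
Import numFieldNormedType.Exports.
Local Open Scope classical_set_scope.
Local Open Scope ring_scope.
Local Open Scope complex_scope.

(** Every invariant subspace of a unitary representation of Gamma contains a
nonzero invariant subspace on which the group operators are quasidiagonal.
Approximate characters of central subgroups, found by repeated spectral
cutting, reduce this to a subspace on which the preimage of the center of the
quotient acts nearly by scalars: either such a preimage acts through a finite
quotient, or nearly commuting spectral subspaces of the Heisenberg-like
quotient produce Folner projections. Such pieces exhaust the space, finitely
many of them give one almost commuting finite-rank projection, and a diagonal
argument over the separable algebra gives the increasing sequence. *)

(** The projection must fix prescribed vectors, and this shapes the construction. Once a central
    subgroup [C] acts nearly by a character, the character is moved to one of finite order; it then
    extends to a subgroup [D] of finite index, so the representation it induces is finite
    dimensional. Along a Folner set modulo [C], many approximate copies of that representation are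
    planted in the Hilbert space, away from the prescribed vectors. This takes vectors almost
    orthogonal to their own translates, which come from limits of vector states along weakly null
    nets, averaged over conjugates until they are small on a given finite set. In the manner of Fell
    absorption, the prescribed vectors and their short words embed almost equivariantly into the
    planted copies, and a rotation whose angle varies slowly with word length turns the copies until
    they contain the vectors. Finite index and finite order are available because the group is
    nilpotent with all subgroups finitely generated, so its quotients are residually finite. *)

Lemma sum_cst (R : pzRingType) (n : nat) (c : R) : \sum_(i < n) c = n%:R * c.
Proof. by rewrite sumr_const card_ord mulr_natl. Qed.

(** * Moduli of complex numbers, as real numbers *)

Section ComplexModulus.
Variable R : realType.
Implicit Types z w : R[i].

(** The norm of [R[i]] takes values in [R[i]]. Its real part lives in the ordered field [R], where
    [lra] and [nra] apply; [nm] and [na] below are made for the same reason. *)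
Definition cn z : R := complex.Re `|z|.

Lemma cnE z : `|z| = (cn z)%:C.
Proof. by rewrite /cn normc_def. Qed.

Lemma cn_ge0 z : 0 <= cn z.
Proof. by rewrite -lecR -cnE normr_ge0. Qed.

Lemma cn0 : cn 0 = 0.
Proof. by rewrite /cn normr0. Qed.

Lemma cn1 : cn 1 = 1.
Proof. by rewrite /cn normr1. Qed.

Lemma cnM z w : cn (z * w) = cn z * cn w.
Proof. by apply: (@complexI R); rewrite rmorphM /= -!cnE normrM. Qed.

Lemma cnD z w : cn (z + w) <= cn z + cn w.
Proof. by rewrite -lecR rmorphD /= -!cnE ler_normD. Qed.

Lemma cnN z : cn (- z) = cn z.
Proof. by rewrite /cn normrN. Qed.

Lemma cnB z w : cn (z - w) <= cn z + cn w.
Proof. by rewrite -(cnN w) cnD. Qed.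

Lemma cnBC z w : cn (z - w) = cn (w - z).
Proof. by rewrite -cnN opprB. Qed.

Lemma cn_eq0 z : (cn z == 0) = (z == 0).
Proof. by rewrite -(inj_eq (@complexI R)) -cnE normr_eq0. Qed.

Lemma cnJ z : cn (conjc z) = cn z.
Proof. by rewrite /cn normcJ. Qed.

Lemma cnV z : cn z^-1 = (cn z)^-1.
Proof. by apply: (@complexI R); rewrite fmorphV /= -!cnE normfV. Qed.

Lemma cnX z n : cn (z ^+ n) = cn z ^+ n.
Proof. by elim: n => [|n IH]; rewrite ?expr0 ?cn1 // !exprS cnM IH. Qed.

Lemma cn_real (r : R) : cn r%:C = `|r|.
Proof. by rewrite /cn normc_def /= expr0n addr0 sqrtr_sqr. Qed.

Lemma cn_sqr z : ((cn z) ^+ 2)%:C = z * conjc z.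
Proof. by rewrite rmorphXn /= -cnE sqr_normc. Qed.

Lemma cn_sqr_Re z : cn z ^+ 2 = complex.Re z ^+ 2 + complex.Im z ^+ 2.
Proof. by apply: (@complexI R); rewrite add_Re2_Im2 rmorphXn /= -cnE. Qed.

Lemma Re_le_cn z : complex.Re z <= cn z.
Proof.
apply: le_trans (ler_norm _) _.
by rewrite -lecR -cnE normc_ge_Re.
Qed.

Lemma absRe_le_cn z : `|complex.Re z| <= cn z.
Proof. by rewrite -lecR -cnE normc_ge_Re. Qed.

Lemma absIm_le_cn z : `|complex.Im z| <= cn z.
Proof.
rewrite -(ler_pXn2r (n := 2)) ?nnegrE ?cn_ge0 //.
by rewrite cn_sqr_Re real_normK ?num_real // lerDr sqr_ge0.
Qed.

Lemma cn_le_ReIm z : cn z <= `|complex.Re z| + `|complex.Im z|.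
Proof.
rewrite -(ler_pXn2r (n := 2)) ?nnegrE ?cn_ge0 ?addr_ge0 //.
rewrite cn_sqr_Re sqrrD !real_normK ?num_real //.
by rewrite lerD2r lerDl mulrn_wge0 // mulr_ge0.
Qed.

Lemma cn_sum (I : Type) (r : seq I) (P : pred I) (F : I -> R[i]) :
  cn (\sum_(i <- r | P i) F i) <= \sum_(i <- r | P i) cn (F i).
Proof.
elim/big_rec2 : _ => [|i y1 y2 _ IH]; first by rewrite cn0.
by apply: le_trans (cnD _ _) _; rewrite lerD2l.
Qed.

Lemma ReD z w : complex.Re (z + w) = complex.Re z + complex.Re w.
Proof. by case: z; case: w. Qed.

Lemma ReN z : complex.Re (- z) = - complex.Re z.
Proof. by case: z. Qed.

Lemma ImD z w : complex.Im (z + w) = complex.Im z + complex.Im w.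
Proof. by case: z; case: w. Qed.

Lemma ImN z : complex.Im (- z) = - complex.Im z.
Proof. by case: z. Qed.

Lemma ReJ z : complex.Re (conjc z) = complex.Re z.
Proof. by case: z. Qed.

Lemma ReZ (r : R) z : complex.Re (r%:C * z) = r * complex.Re z.
Proof. by case: z => a b /=; rewrite mul0r subr0. Qed.

Lemma conjZ (r : R) z : conjc (r%:C * z) = r%:C * conjc z.
Proof. by rewrite [LHS]rmorphM; congr (_ * _); rewrite [LHS]conjc_real. Qed.

Lemma conjM z w : conjc (z * w) = conjc z * conjc w.
Proof. exact: rmorphM. Qed.

Lemma Re_sum (I : Type) (r : seq I) (P : pred I) (F : I -> R[i]) :
  complex.Re (\sum_(i <- r | P i) F i) = \sum_(i <- r | P i) complex.Re (F i).
Proof. by elim/big_rec2 : _ => [|i y1 y2 _ <-] //; rewrite ReD. Qed.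

Lemma unimod_inv z : cn z = 1 -> z^-1 = conjc z.
Proof.
move=> h; have z0 : z != 0 by rewrite -cn_eq0 h oner_eq0.
by apply: (mulfI z0); rewrite mulfV // -cn_sqr h expr1n.
Qed.

End ComplexModulus.

(** * Inner product geometry *)

Section Hilbert.
Variables (R : realType) (H : hilbertType R).
Implicit Types (x y z : H) (k l : R[i]).

Definition nm x : R := complex.Re `|x|.

Definition dot : H -> H -> R[i] := fun x y => hdot x y.

Lemma nmE x : `|x| = (nm x)%:C.
Proof. by rewrite /nm RRe_real // ger0_real. Qed.

Lemma nm_ge0 x : 0 <= nm x.
Proof. by rewrite -lecR -nmE normr_ge0. Qed.

Lemma nm0 : nm 0 = 0.
Proof. by rewrite /nm normr0. Qed.

Lemma nmN x : nm (- x) = nm x.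
Proof. by rewrite /nm normrN. Qed.

Lemma nmD x y : nm (x + y) <= nm x + nm y.
Proof. by rewrite -lecR rmorphD /= -!nmE ler_normD. Qed.

Lemma nmB x y : nm (x - y) <= nm x + nm y.
Proof. by rewrite -(nmN y) nmD. Qed.

Lemma nmBC x y : nm (x - y) = nm (y - x).
Proof. by rewrite -nmN opprB. Qed.

Lemma nm_tri x y z : nm (x - z) <= nm (x - y) + nm (y - z).
Proof. by rewrite -(subrKA y) nmD. Qed.

Lemma nmZ k x : nm (k *: x) = cn k * nm x.
Proof. by apply: (@complexI R); rewrite rmorphM /= -nmE normrZ cnE nmE. Qed.

Lemma nm_eq0 x : (nm x == 0) = (x == 0).
Proof. by rewrite -(inj_eq (@complexI R)) -nmE normr_eq0. Qed.

Lemma nm_gt0 x : (0 < nm x) = (x != 0).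
Proof. by rewrite lt_def nm_ge0 andbT nm_eq0. Qed.

Lemma nm_sum (I : Type) (r : seq I) (P : pred I) (F : I -> H) :
  nm (\sum_(i <- r | P i) F i) <= \sum_(i <- r | P i) nm (F i).
Proof.
elim/big_rec2 : _ => [|i y1 y2 _ IH]; first by rewrite nm0.
by apply: le_trans (nmD _ _) _; rewrite lerD2l.
Qed.

Lemma dotDl x y z : dot (x + y) z = dot x z + dot y z.
Proof. by rewrite /dot linearDl. Qed.

Lemma dotDr x y z : dot z (x + y) = dot z x + dot z y.
Proof. by rewrite /dot linearDr. Qed.

Lemma dotZl k x y : dot (k *: x) y = k * dot x y.
Proof. by rewrite /dot linearZl_LR. Qed.

Lemma dotZr k x y : dot x (k *: y) = conjc k * dot x y.
Proof. by rewrite /dot linearZr_LR. Qed.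

Lemma dotC x y : dot y x = conjc (dot x y).
Proof. by rewrite /dot (hermC hdot) expr0 mul1r. Qed.

Lemma dotNl x y : dot (- x) y = - dot x y.
Proof. by rewrite /dot linearNl. Qed.

Lemma dotNr x y : dot x (- y) = - dot x y.
Proof. by rewrite /dot linearNr. Qed.

Lemma dotBl x y z : dot (x - y) z = dot x z - dot y z.
Proof. by rewrite dotDl dotNl. Qed.

Lemma dotBr x y z : dot z (x - y) = dot z x - dot z y.
Proof. by rewrite dotDr dotNr. Qed.

Lemma dot0l x : dot 0 x = 0.
Proof. by rewrite /dot linear0l. Qed.

Lemma dot0r x : dot x 0 = 0.
Proof. by rewrite /dot linear0r. Qed.

Lemma dot_suml (I : Type) (r : seq I) (P : pred I) (F : I -> H) y :
  dot (\sum_(i <- r | P i) F i) y = \sum_(i <- r | P i) dot (F i) y.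
Proof. by elim/big_rec2 : _ => [|i a b _ <-]; rewrite ?dot0l // dotDl. Qed.

Lemma dot_sumr (I : Type) (r : seq I) (P : pred I) (F : I -> H) y :
  dot y (\sum_(i <- r | P i) F i) = \sum_(i <- r | P i) dot y (F i).
Proof. by elim/big_rec2 : _ => [|i a b _ <-]; rewrite ?dot0r // dotDr. Qed.

Lemma dotxx x : dot x x = (nm x ^+ 2)%:C.
Proof. by rewrite /dot -hdot_norm nmE -rmorphXn. Qed.

Lemma Re_dotxx x : complex.Re (dot x x) = nm x ^+ 2.
Proof. by rewrite dotxx. Qed.

Lemma Re_dotC x y : complex.Re (dot y x) = complex.Re (dot x y).
Proof. by rewrite dotC ReJ. Qed.

Lemma cn_dotC x y : cn (dot y x) = cn (dot x y).
Proof. by rewrite dotC cnJ. Qed.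

Lemma nm_sqrD x y :
  nm (x + y) ^+ 2 = nm x ^+ 2 + nm y ^+ 2 + 2 * complex.Re (dot x y).
Proof.
rewrite -!Re_dotxx dotDl !dotDr !ReD (Re_dotC x y).
ring.
Qed.

Lemma nm_sqrB x y :
  nm (x - y) ^+ 2 = nm x ^+ 2 + nm y ^+ 2 - 2 * complex.Re (dot x y).
Proof. by rewrite nm_sqrD nmN dotNr ReN mulrN. Qed.

Lemma dot_eq0C x y : dot x y = 0 -> dot y x = 0.
Proof. by move=> h; rewrite dotC h conjc0. Qed.

Lemma pythag x y : dot x y = 0 -> nm (x + y) ^+ 2 = nm x ^+ 2 + nm y ^+ 2.
Proof. by move=> h; rewrite nm_sqrD h mulr0 addr0. Qed.

Lemma nm_sqr_dot x : ((nm x) ^+ 2)%:C = dot x x.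
Proof. by rewrite dotxx. Qed.

Lemma CS x y : cn (dot x y) <= nm x * nm y.
Proof.
have [->|y0] := eqVneq y 0; first by rewrite dot0r cn0 nm0 mulr0.
have ny : 0 < nm y by rewrite nm_gt0.
pose c := (nm y ^+ 2)^-1%:C * dot x y.
have : 0 <= nm (x - c *: y) ^+ 2 by rewrite sqr_ge0.
rewrite nm_sqrB nmZ dotZr.
have -> : conjc c * dot x y = (cn (dot x y) ^+ 2 / nm y ^+ 2)%:C.
  have -> : conjc c = (nm y ^+ 2)^-1%:C * conjc (dot x y).
    by rewrite /c [LHS]rmorphM; congr (_ * _); rewrite [LHS]conjc_real.
  by rewrite -mulrA (mulrC (conjc _)) -cn_sqr mulrC -[LHS]rmorphM.
have -> : cn c = cn (dot x y) / nm y ^+ 2.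
  by rewrite /c cnM cn_real ger0_norm ?invr_ge0 ?sqr_ge0 // mulrC.
move=> /= h.
suff : cn (dot x y) ^+ 2 <= (nm x * nm y) ^+ 2.
  by rewrite ler_pXn2r ?nnegrE ?cn_ge0 ?mulr_ge0 ?nm_ge0.
rewrite exprMn -ler_pdivrMr ?exprn_gt0 //.
have e : (cn (dot x y) / nm y ^+ 2 * nm y) ^+ 2 = cn (dot x y) ^+ 2 / nm y ^+ 2.
  by field; rewrite gt_eqF.
by rewrite e in h; lra.
Qed.

Lemma Re_dot_le x y : complex.Re (dot x y) <= nm x * nm y.
Proof. exact: le_trans (Re_le_cn _) (CS _ _). Qed.

Lemma dot_inj x y : (forall z, dot x z = dot y z) -> x = y.
Proof.
move=> h; apply/eqP; rewrite -subr_eq0 -nm_eq0 -sqrf_eq0 -Re_dotxx.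
by rewrite dotBl h subrr.
Qed.

Lemma nm_le_sqr x (c : R) : 0 <= c -> nm x ^+ 2 <= c ^+ 2 -> nm x <= c.
Proof. by move=> c0; rewrite ler_pXn2r // nnegrE ?nm_ge0. Qed.

Lemma nm_sqr_sum_orth (I : finType) (P : pred I) (F : I -> H) :
  (forall i j, i != j -> dot (F i) (F j) = 0) ->
  nm (\sum_(i | P i) F i) ^+ 2 = \sum_(i | P i) nm (F i) ^+ 2.
Proof.
move=> h; rewrite -Re_dotxx dot_suml Re_sum; apply: eq_bigr => i Pi.
rewrite dot_sumr (bigD1 i) //= big1 ?addr0 ?Re_dotxx // => j /andP[_ ij].
by rewrite h // eq_sym.
Qed.

(** * Subspaces and finite orthonormal families *)

Definition lsub (L : set H) : Prop :=
  L 0 /\ forall k x y, L x -> L y -> L (k *: x + y).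

Lemma lsub0 L : lsub L -> L 0. Proof. by case. Qed.

Lemma lsubD L x y : lsub L -> L x -> L y -> L (x + y).
Proof. by move=> [_ h] Lx Ly; rewrite -(scale1r x); exact: h. Qed.

Lemma lsubZ L k x : lsub L -> L x -> L (k *: x).
Proof. by move=> [h0 h] Lx; rewrite -(addr0 (k *: x)); exact: h. Qed.

Lemma lsubN L x : lsub L -> L x -> L (- x).
Proof. by move=> h Lx; rewrite -scaleN1r; exact: lsubZ. Qed.

Lemma lsubB L x y : lsub L -> L x -> L y -> L (x - y).
Proof. by move=> h Lx Ly; apply: lsubD => //; exact: lsubN. Qed.

Lemma lsub_sum L (I : Type) (r : seq I) (P : pred I) (F : I -> H) :
  lsub L -> (forall i, P i -> L (F i)) -> L (\sum_(i <- r | P i) F i).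
Proof.
move=> hL h; elim/big_rec: _ => [|i x Pi Lx]; first exact: lsub0.
by apply: lsubD => //; exact: h.
Qed.

(** The span as an intersection: membership is directly the induction principle for properties that
    define a subspace. *)
Definition spn (X : set H) : set H :=
  [set x | forall M, lsub M -> X `<=` M -> M x].

Lemma spn_lsub X : lsub (spn X).
Proof.
split=> [M hM _|k x y hx hy M hM XM]; first exact: lsub0.
by apply: lsubD => //; [apply: lsubZ => //; exact: hx | exact: hy].
Qed.

Lemma spn_sub X : X `<=` spn X.
Proof. by move=> x Xx M _ XM; exact: XM. Qed.

Lemma spn_min X M : lsub M -> X `<=` M -> spn X `<=` M.
Proof. by move=> hM XM x; exact. Qed.

Definition lin (T : H -> H) : Prop := forall k x y, T (k *: x + y) = k *: T x + T y.

Lemma lin0 T : lin T -> T 0 = 0.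
Proof. by move=> h; have := h (-1) 0 0; rewrite scaler0 addr0 scaleN1r addNr. Qed.

Lemma linD T x y : lin T -> T (x + y) = T x + T y.
Proof. by move=> h; have := h 1 x y; rewrite !scale1r. Qed.

Lemma linZ T k x : lin T -> T (k *: x) = k *: T x.
Proof. by move=> h; have := h k x 0; rewrite (lin0 h) !addr0. Qed.

Lemma linN T x : lin T -> T (- x) = - T x.
Proof. by move=> h; rewrite -scaleN1r (linZ _ _ h) scaleN1r. Qed.

Lemma linB T x y : lin T -> T (x - y) = T x - T y.
Proof. by move=> h; rewrite (linD _ _ h) (linN _ h). Qed.

Lemma lin_sum T (I : Type) (r : seq I) (P : pred I) (F : I -> H) : lin T ->
  T (\sum_(i <- r | P i) F i) = \sum_(i <- r | P i) T (F i).
Proof.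
by move=> h; elim/big_rec2: _ => [|i x y _ <-]; rewrite ?(lin0 h) // (linD _ _ h).
Qed.

Definition onf (I : finType) (v : I -> H) : Prop :=
  forall i j, dot (v i) (v j) = (i == j)%:R.

(** Finite-rank projections are always handled through an orthonormal family; dimension and
    orthogonal complement never need a separate theory. *)
Definition pj (I : finType) (v : I -> H) (x : H) : H := \sum_i dot x (v i) *: v i.

Section OnFamily.
Variables (I : finType) (v : I -> H).

Lemma pj_lin : lin (pj v).
Proof.
move=> k x y; rewrite /pj scaler_sumr -big_split /=; apply: eq_bigr => i _.
by rewrite dotDl dotZl scalerDl scalerA.
Qed.

Lemma pj_adj x y : dot (pj v x) y = dot x (pj v y).
Proof.
rewrite /pj dot_suml dot_sumr; apply: eq_bigr => i _.
by rewrite dotZl dotZr (dotC y) mulrC.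
Qed.

Lemma pj_in L x : lsub L -> (forall i, L (v i)) -> L (pj v x).
Proof. by move=> hL h; apply: lsub_sum => // i _; exact: lsubZ. Qed.

Hypothesis ov : onf v.

Lemma dot_pj_v x i : dot (pj v x) (v i) = dot x (v i).
Proof.
rewrite /pj dot_suml (bigD1 i) //= dotZl ov eqxx mulr1 big1 ?addr0 // => j ji.
by rewrite dotZl ov (negPf ji) mulr0.
Qed.

Lemma pj_v i : pj v (v i) = v i.
Proof.
rewrite /pj (bigD1 i) //= ov eqxx scale1r big1 ?addr0 // => j ji.
by rewrite ov eq_sym (negPf ji) scale0r.
Qed.

Lemma pj_idem x : pj v (pj v x) = pj v x.
Proof. by rewrite {1}/pj; apply: eq_bigr => i _; rewrite dot_pj_v. Qed.

Lemma pj_spn x : spn (range v) x -> pj v x = x.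
Proof.
move=> h; apply: (h [set y | pj v y = y]); last by move=> _ [i _ <-]; exact: pj_v.
split=> [/=|k y z /= hy hz]; first exact: lin0 pj_lin.
by rewrite pj_lin hy hz.
Qed.

Lemma nm_sqr_comb (c : I -> R[i]) :
  nm (\sum_i c i *: v i) ^+ 2 = \sum_i cn (c i) ^+ 2.
Proof.
rewrite nm_sqr_sum_orth => [|i j ij]; last first.
  by rewrite dotZl dotZr ov (negPf ij) !mulr0.
apply: eq_bigr => i _; rewrite nmZ exprMn -Re_dotxx ov eqxx /=.
by rewrite mulr1.
Qed.

Lemma pj_pythag x : nm x ^+ 2 = nm (pj v x) ^+ 2 + nm (x - pj v x) ^+ 2.
Proof.
rewrite -pythag; first by rewrite addrC subrK.
by rewrite dotBr -{1}pj_idem pj_adj subrr.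
Qed.

Lemma pj_nm x : nm (pj v x) <= nm x.
Proof. by apply: nm_le_sqr; rewrite ?nm_ge0 // [leRHS]pj_pythag lerDl sqr_ge0. Qed.

Lemma pjc_nm x : nm (x - pj v x) <= nm x.
Proof. by apply: nm_le_sqr; rewrite ?nm_ge0 // [leRHS]pj_pythag lerDr sqr_ge0. Qed.

Lemma pj_comb (c : I -> R[i]) : pj v (\sum_i c i *: v i) = \sum_i c i *: v i.
Proof.
rewrite (lin_sum _ _ _ pj_lin); apply: eq_bigr => i _.
by rewrite (linZ _ _ pj_lin) pj_v.
Qed.

Lemma bessel x : \sum_i cn (dot x (v i)) ^+ 2 <= nm x ^+ 2.
Proof. by rewrite -nm_sqr_comb ler_pXn2r ?nnegrE ?nm_ge0 //; exact: pj_nm. Qed.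

Lemma pj_orth x i : dot (x - pj v x) (v i) = 0.
Proof. by rewrite dotBl dot_pj_v subrr. Qed.

Lemma pj_best x y : pj v y = y -> nm (x - pj v x) <= nm (x - y).
Proof.
move=> hy.
have -> : x - pj v x = (x - y) - pj v (x - y).
  by rewrite (linB _ _ pj_lin) hy opprB addrA subrK.
exact: pjc_nm.
Qed.

End OnFamily.

Lemma onf_nm (I : finType) (v : I -> H) i : onf v -> nm (v i) = 1.
Proof.
move=> ov; apply/eqP; rewrite -(eqrXn2 (n := 2)) ?nm_ge0 // -Re_dotxx ov eqxx.
by rewrite expr1n.
Qed.

Definition ext (I : finType) (v : I -> H) (w : H) : I + unit -> H :=
  fun s => match s with inl i => v i | inr _ => w end.

Lemma ext_onf (I : finType) (v : I -> H) w : onf v ->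
  (forall i, dot w (v i) = 0) -> nm w = 1 -> onf (ext v w).
Proof.
move=> ov h w1 [i|[]] [j|[]].
- exact: ov.
- rewrite /ext dot_eq0C ?h //.
- exact: h.
- by rewrite /ext dotxx w1 expr1n.
Qed.

Lemma pj_ext (I : finType) (v : I -> H) w x :
  pj (ext v w) x = pj v x + dot x w *: w.
Proof. by rewrite /pj big_sumType /= (big_pred1 tt) // => -[]. Qed.

Lemma normalize x : x != 0 -> nm ((nm x)^-1%:C *: x) = 1.
Proof.
rewrite -nm_gt0 => h; rewrite nmZ cn_real ger0_norm ?invr_ge0 ?nm_ge0 //.
by rewrite mulVf // gt_eqF.
Qed.

Lemma onf_extend (I : finType) (v : I -> H) (X : set H) w : onf v -> lsub X ->
  (forall i, X (v i)) -> X w ->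
  exists (J : finType) (u : J -> H), [/\ onf u, forall j, X (u j), pj u w = w &
    forall x, pj v x = x -> pj u x = x].
Proof.
move=> ov hX Xv Xw; have [e|ne] := eqVneq (pj v w) w; first by exists I, v.
pose d := w - pj v w; have d0 : d != 0 by rewrite subr_eq0 eq_sym.
pose e := (nm d)^-1%:C *: d.
have de i : dot e (v i) = 0 by rewrite dotZl pj_orth // mulr0.
have oe : onf (ext v e) by apply: ext_onf => //; exact: normalize.
exists (I + unit)%type, (ext v e); split => //.
- case=> [i|[]] //=; apply: lsubZ => //; apply: lsubB => //.
  exact: pj_in.
- have dwe : dot w e = (nm d)%:C.
    have z : dot (pj v w) e = 0.
      by rewrite /pj dot_suml big1 // => i _; rewrite dotZl (dot_eq0C (de i)) mulr0.
    rewrite -[dot w e]addr0 -[X in _ + X]oppr0 -{1}z -dotBl -/d.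
    rewrite /e dotZr conjc_real dotxx -rmorphM /=; congr (_%:C).
    by rewrite expr2 mulrA mulVf ?mul1r // gt_eqF // nm_gt0.
  rewrite pj_ext dwe /e scalerA -rmorphM /= mulfV ?gt_eqF ?nm_gt0 //.
  by rewrite scale1r addrC subrK.
- move=> x hx; rewrite pj_ext hx.
  suff -> : dot x e = 0 by rewrite scale0r addr0.
  rewrite -hx /pj dot_suml big1 // => i _.
  by rewrite dotZl (dot_eq0C (de i)) mulr0.
Qed.

Lemma gram_schmidt (X : set H) (xs : seq H) : lsub X -> {in xs, forall x, X x} ->
  exists (J : finType) (u : J -> H), [/\ onf u, forall j, X (u j) &
    {in xs, forall x, pj u x = x}].
Proof.
move=> hX; elim: xs => [|x xs IH] h; first by exists 'I_0, (fun=> 0); split => [[]|[]|].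
have [|J [v [ov Xv vK]]] := IH; first by move=> y hy; apply: h; rewrite inE hy orbT.
have [|K [u [ou Xu ux uK]]] := onf_extend ov hX Xv (w := x).
  by apply: h; rewrite inE eqxx.
exists K, u; split => // y; rewrite inE => /orP[/eqP->//|hy].
by apply: uK; exact: vK.
Qed.

End Hilbert.

(** * Completeness and projection onto closed subspaces *)

Section Complete.
Variables (R : realType) (H : hilbertType R).
Implicit Types (x y z : H) (L : set H).

Lemma gt0_complex (e : R[i]) : 0 < e -> e = (complex.Re e)%:C /\ 0 < complex.Re e.
Proof. by case: e => a b; rewrite ltcE /= => /andP[/eqP-> h]. Qed.

Lemma nm_cvgP (u : nat -> H) (l : H) : (u n @[n --> \oo] --> l) <->
  (forall e : R, 0 < e -> exists N, forall n, (N <= n)%N -> nm (u n - l) < e).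
Proof.
split.
  move=> /cvgrPdist_lt h e e0.
  have /h : 0 < e%:C by rewrite ltcR.
  move=> [N _ hN]; exists N => n Nn.
  by have := hN n Nn; rewrite /= nmE ltcR nmBC.
move=> h; apply/cvgrPdist_lt => e /gt0_complex[-> e0].
have [N hN] := h _ e0; exists N => // n /= Nn.
by rewrite nmE ltcR nmBC hN.
Qed.

Lemma nm_complete (u : nat -> H) :
  (forall e : R, 0 < e -> exists N, forall m n, (N <= m)%N -> (N <= n)%N ->
    nm (u m - u n) < e) ->
  exists l, forall e : R, 0 < e -> exists N, forall n, (N <= n)%N -> nm (u n - l) < e.
Proof.
move=> h; have : cvg (u n @[n --> \oo]).
  apply: cauchy_cvg; apply/cauchy_ballP => e /gt0_complex[-> e0].
  have [N hN] := h _ e0; rewrite near_simpl; near=> p.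
  rewrite -ball_normE /= nmE ltcR; apply: hN; near: p.
    exists ([set n | (N <= n)%N], setT) => //=; last by move=> [a b] [].
    by split; [exists N | exact: filterT].
  exists (setT, [set n | (N <= n)%N]) => //=; last by move=> [a b] [].
  by split; [exact: filterT | exists N].
by move=> /cvg_ex[l /nm_cvgP hl]; exists l.
Unshelve. all: by end_near. Qed.

Definition aclosed L := forall x, (forall e : R, 0 < e -> exists2 y, L y & nm (x - y) < e) -> L x.

Lemma aclosed_lim L (u : nat -> H) l : aclosed L -> (forall n, L (u n)) ->
  (forall e : R, 0 < e -> exists N, forall n, (N <= n)%N -> nm (u n - l) < e) -> L l.
Proof.
move=> hL Lu h; apply: hL => e /h[N hN]; exists (u N) => //.
by rewrite nmBC hN.
Qed.

Lemma small_eq0 (a c : R) : 0 <= a -> (forall e, 0 < e -> a <= c * e) -> a = 0.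
Proof.
move=> a0 h; apply/eqP; rewrite eq_le a0 andbT leNgt; apply/negP => a1.
have c0 : 0 < c by have := h 1 ltr01; rewrite mulr1 => /(lt_le_trans a1).
have := h (a / (2 * c)); rewrite divr_gt0 ?mulr_gt0 // => /(_ isT).
have -> : c * (a / (2 * c)) = a / 2 by field; rewrite gt_eqF.
lra.
Qed.

Lemma harmonic_small (c e : R) : 0 < e -> exists N, forall n, (N <= n)%N -> c / n.+1%:R < e.
Proof.
move=> e0; exists (Num.bound `|c / e|) => n hn.
rewrite ltr_pdivrMr ?ltr0n // mulrC -ltr_pdivrMr //.
apply: le_lt_trans (ler_norm _) _.
apply: lt_le_trans (archi_boundP (normr_ge0 _)) _.
by rewrite ler_nat leqW.
Qed.

(* Minimising sequences are Cauchy by the parallelogram law. *)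
Lemma projection_theorem L x : lsub L -> aclosed L ->
  exists2 y, L y & forall z, L z -> dot (x - y) z = 0.
Proof.
move=> sL cL.
pose D := [set nm (x - y) | y in L].
have D0 : D !=set0 by exists (nm (x - 0)); exists 0 => //; exact: (lsub0 sL).
have hD : has_inf D by split=> //; exists 0 => _ [y _ <-]; exact: nm_ge0.
pose d := inf D.
have dle y : L y -> d <= nm (x - y).
  by move=> Ly; apply: (ge_inf hD.2); exists y.
have d0 : 0 <= d by apply: lb_le_inf => // _ [y _ <-]; exact: nm_ge0.
have apx (n : nat) : exists y, L y /\ nm (x - y) ^+ 2 < d ^+ 2 + n.+1%:R^-1.
  have n0 : 0 < n.+1%:R^-1 :> R by rewrite invr_gt0 ltr0n.
  have p0 : 0 < d ^+ 2 + n.+1%:R^-1 by rewrite ltr_wpDl ?sqr_ge0.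
  have e0 : 0 < Num.sqrt (d ^+ 2 + n.+1%:R^-1) - d.
    by rewrite subr_gt0 -{1}(ger0_norm d0) -sqrtr_sqr ltr_sqrt // ltrDl.
  have [_ [y Ly <-]] := inf_adherent e0 hD.
  rewrite -/d subrKC => h; exists y; split=> //.
  rewrite -(sqr_sqrtr (ltW p0)) ltr_pXn2r ?nnegrE ?nm_ge0 ?sqrtr_ge0 //.
pose y n := projT1 (cid (apx n)).
have Ly n : L (y n) by rewrite /y; case: cid => z [].
have yd n : nm (x - y n) ^+ 2 < d ^+ 2 + n.+1%:R^-1 by rewrite /y; case: cid => z [].
have par m n : nm (y m - y n) ^+ 2 <= 2 * (m.+1%:R^-1 + n.+1%:R^-1).
  have mid : d ^+ 2 <= nm (x - 2^-1%:C *: (y m + y n)) ^+ 2.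
    rewrite ler_pXn2r ?nnegrE ?nm_ge0 //; apply: dle.
    by apply: lsubZ => //; apply: lsubD.
  have e1 : x - 2^-1%:C *: (y m + y n) = 2^-1%:C *: ((x - y m) + (x - y n)).
    rewrite addrACA -opprD scalerBr; congr (_ - _).
    rewrite scalerDr -scalerDl -rmorphD /=.
    have -> : 2^-1 + 2^-1 = 1 :> R by field.
    by rewrite scale1r.
  have e2 : y m - y n = (x - y n) - (x - y m).
    by rewrite opprB [RHS]addrC addrA subrK.
  rewrite e1 in mid; rewrite e2 (nm_sqrB (x - y n)); move: mid.
  rewrite nmZ cn_real exprMn (nm_sqrD (x - y m)) (Re_dotC (x - y m)).
  have := yd m; have := yd n.
  move: (nm (x - y n) ^+ 2) (nm (x - y m) ^+ 2) (complex.Re _) => a b c ha hb.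
  have -> : `|2^-1 : R| ^+ 2 = 4^-1 by rewrite real_normK ?num_real //; field.
  move: (m.+1%:R^-1 : R) (n.+1%:R^-1 : R) ha hb => p q; lra.
have [l hl] : exists l, forall e : R, 0 < e -> exists N, forall n, (N <= n)%N -> nm (y n - l) < e.
  apply: nm_complete => e e0.
  have [N hN] := harmonic_small 4 (exprn_gt0 2 e0).
  exists N => m n Nm Nn; rewrite -(ltr_pXn2r (n := 2)) ?nnegrE ?nm_ge0 ?(ltW e0) //.
  apply: le_lt_trans (par m n) _.
  have := hN m Nm; have := hN n Nn.
  by move: (m.+1%:R^-1 : R) (n.+1%:R^-1 : R) => p q; lra.
have Ll : L l by apply: (aclosed_lim cL Ly).
have xl : nm (x - l) <= d.
  apply/ler_addgt0Pr => e e0.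
  have e20 : 0 < e / 2 by rewrite divr_gt0.
  have [N1 hN1] := hl _ e20.
  have e30 : 0 < e * d + e ^+ 2 / 4.
    by rewrite ltr_wpDl ?mulr_ge0 ?(ltW e0) // divr_gt0 ?exprn_gt0.
  have [N2 hN2] := harmonic_small 1 e30.
  pose n := maxn N1 N2.
  have h1 := hN1 n (leq_maxl _ _); have h2 := hN2 n (leq_maxr _ _).
  apply: le_trans (nm_tri _ (y n) _) _.
  have : nm (x - y n) <= d + e / 2.
    apply: nm_le_sqr; first by lra.
    have := yd n; rewrite div1r in h2; move: (n.+1%:R^-1 : R) h2 => p; lra.
  lra.
exists l => // z Lz; apply/eqP; rewrite -cn_eq0 -sqrf_eq0.
(* Moving [l] by [t * a] along [z], with [a] the inner product of [x - l] and [z], changes the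
   squared distance by t |a|^2 (t |z|^2 - 2). Since t |z|^2 <= 1, minimality forces a = 0; the
   summand 1 covers z = 0. *)
pose t := (1 + nm z ^+ 2)^-1.
have z1 : 0 < 1 + nm z ^+ 2 by rewrite ltr_pwDl ?sqr_ge0.
have := dle (l + (t%:C * dot (x - l) z) *: z).
have Ll' : L (l + (t%:C * dot (x - l) z) *: z) by apply: lsubD => //; exact: lsubZ.
move=> /(_ Ll') h; have {}h : nm (x - l) ^+ 2 <= nm (x - (l + (t%:C * dot (x - l) z) *: z)) ^+ 2.
  by rewrite ler_pXn2r ?nnegrE ?nm_ge0 //; exact: le_trans h.
move: h; rewrite opprD addrA (nm_sqrB (x - l)) nmZ dotZr exprMn cnM cn_real.
have -> : conjc (t%:C * dot (x - l) z) * dot (x - l) z = (t * cn (dot (x - l) z) ^+ 2)%:C.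
  rewrite conjZ -mulrA (mulrC (conjc _)) -cn_sqr.
  by rewrite -[LHS]rmorphM.
rewrite /= ger0_norm ?invr_ge0 ?(ltW z1) //.
have t0 : 0 < t by rewrite invr_gt0.
have ht : t * nm z ^+ 2 <= 1.
  by rewrite /t mulrC ler_pdivrMr // mul1r; lra.
set a := cn _; rewrite exprMn => h.
have h2 : t * (a ^+ 2 * (2 - t * nm z ^+ 2)) <= 0.
  have -> : t * (a ^+ 2 * (2 - t * nm z ^+ 2)) = 2 * (t * a ^+ 2) - t ^+ 2 * a ^+ 2 * nm z ^+ 2 by ring.
  lra.
rewrite pmulr_rle0 // in h2.
rewrite eq_le sqr_ge0 andbT.
rewrite pmulr_lle0 // in h2.
lra.
Qed.

End Complete.

(** * Positive spectral subspaces by the square root iteration *)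

Section SpectralCut.
Variables (R : realType) (H : hilbertType R) (L : set H) (B : H -> H).
Hypotheses (sL : lsub L) (cL : aclosed L) (lB : lin B).
Hypotheses (LB : forall x, L x -> L (B x)).
Hypothesis saB : forall x y, L x -> L y -> dot (B x) y = dot x (B y).
Hypothesis B1 : forall x, L x -> nm (B x) <= nm x.

Let T x := x - B (B x).

Let linT : lin T.
Proof. by move=> k x y; rewrite /T !lB scalerBr opprD addrACA. Qed.

Let LT x : L x -> L (T x).
Proof. by move=> Lx; apply: lsubB => //; do 2 apply: LB. Qed.

Let T1 x : L x -> nm (T x) <= nm x.
Proof.
move=> Lx; apply: nm_le_sqr; first exact: nm_ge0.
rewrite nm_sqrB Re_dotC saB ?Re_dotxx; do ?[exact: LB | done].
have : nm (B (B x)) ^+ 2 <= nm (B x) ^+ 2.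
  by rewrite ler_pXn2r ?nnegrE ?nm_ge0 //; apply: B1; exact: LB.
by have := sqr_ge0 (nm (B x)); lra.
Qed.

(** The scalar majorant of [Ysq], namely the same iteration at T = 1. It increases to 1 and
    dominates both the norm of Y_n and that of Y_m - Y_n. At the edge of the spectrum there is no
    contraction, hence the slow rate 2 / (n + 1). *)
Fixpoint ysq (n : nat) : R := if n is m.+1 then 2^-1 * (1 + ysq m ^+ 2) else 0.

Let ysq01 n : 0 <= ysq n <= 1.
Proof.
elim: n => [|n /andP[h0 h1]] /=; first by rewrite lexx ler01.
have : ysq n ^+ 2 <= 1 by rewrite expr_le1.
by have := sqr_ge0 (ysq n); lra.
Qed.

Let ysq_rate n : 1 - ysq n <= 2 / n.+1%:R.
Proof.
elim: n => [|n IH] /=; first by rewrite divr1; lra.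
have := ysq01 n; set y := ysq n in IH *; move=> hy.
have n0 : 0 < n.+1%:R :> R by rewrite ltr0n.
have n1 : 0 < n.+2%:R :> R by rewrite ltr0n.
have nS : n.+2%:R = n.+1%:R + 1 :> R by rewrite -[n.+2]addn1 natrD.
move: IH; rewrite ler_pdivlMr // ler_pdivlMr // nS.
move: (n.+1%:R : R) n0 => a a0 h.
case: (lerP a 1) => ha; first by nra.
have [u hu] : exists u, u = 1 - y by exists (1 - y).
have u0 : 0 <= u by lra.
have -> : 1 - 2^-1 * (1 + y ^+ 2) = u - u ^+ 2 / 2 by rewrite hu; field.
rewrite -hu in h.
have h2 : (u - u ^+ 2 / 2) * (a + 1) = 2 - (u * a - 2) ^+ 2 / 2 * (1 / a) + (u * a - 2) * 0 + ((u - u ^+ 2 / 2) * (a + 1) - 2 + (u * a - 2) ^+ 2 / 2 * (1 / a)) by ring.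
nra.
Qed.

(** The limit solves Y = (T + Y^2) / 2, that is (1 - Y)^2 = 1 - T = B^2, so 1 - Y is the absolute
    value of [B]. *)
Fixpoint Ysq n x : H :=
  if n is m.+1 then 2^-1%:C *: (T x + Ysq m (Ysq m x)) else 0.

Let linY n : lin (Ysq n).
Proof.
elim: n => [|n IH] k x y /=; first by rewrite scaler0 addr0.
by rewrite linT !IH addrACA -(scalerDr k) (scalerDr _ (k *: _)) !scalerA (mulrC _ k).
Qed.

Let LY n x : L x -> L (Ysq n x).
Proof.
elim: n x => [|n IH] x Lx /=; first exact: lsub0.
by apply: lsubZ => //; apply: lsubD => //; [exact: LT | do 2 apply: (IH)].
Qed.

Let halfC (x : H) : nm (2^-1%:C *: x) = 2^-1 * nm x.
Proof. by rewrite nmZ cn_real ger0_norm. Qed.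

Let Y_nm n x : L x -> nm (Ysq n x) <= ysq n * nm x.
Proof.
elim: n x => [|n IH] x Lx; first by rewrite nm0 mul0r.
rewrite [Ysq _ _]/= halfC -[ysq n.+1]/(2^-1 * (1 + ysq n ^+ 2)) -mulrA.
rewrite ler_pM2l ?invr_gt0 // mulrDl mul1r.
apply: le_trans (nmD _ _) _; apply: lerD; first exact: T1.
apply: le_trans (IH _ (LY n Lx)) _; rewrite expr2 -mulrA ler_wpM2l ?IH //.
by case/andP: (ysq01 n).
Qed.

Let ysq_mono m n : (n <= m)%N -> ysq n <= ysq m.
Proof.
suff h k : ysq k <= ysq k.+1.
  by move=> /subnK <-; elim: (m - n)%N => // j IH; rewrite addSn (le_trans IH).
rewrite /=; have /andP[h0 h1] := ysq01 k.
by have := sqr_ge0 (1 - ysq k); rewrite sqrrB expr1n mul1r; lra.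
Qed.

Let Y_diff n m x : (n <= m)%N -> L x ->
  nm (Ysq m x - Ysq n x) <= (ysq m - ysq n) * nm x.
Proof.
elim: n m x => [|n IH] m x nm_ Lx; first by rewrite !subr0; exact: Y_nm.
case: m nm_ => [//|m] nm_; rewrite [Ysq m.+1 x]/= [Ysq n.+1 x]/=.
rewrite -scalerBr halfC opprD addrACA subrr add0r.
have -> : ysq m.+1 - ysq n.+1 = 2^-1 * ((ysq m - ysq n) * (ysq m + ysq n)) by rewrite /=; ring.
rewrite -!mulrA ler_pM2l ?invr_gt0 //.
rewrite -(subrKA (Ysq m (Ysq n x))) -(linB _ _ (linY m)).
have /andP[m0 _] := ysq01 m; have /andP[n0 _] := ysq01 n.
have d0 : 0 <= ysq m - ysq n by rewrite subr_ge0 ysq_mono.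
apply: le_trans (nmD _ _) _; rewrite [X in _ <= _ * X]mulrDl mulrDr; apply: lerD.
  apply: le_trans (Y_nm _ _) _; first by apply: lsubB => //; exact: LY.
  by rewrite mulrCA ler_wpM2l // IH.
apply: le_trans (IH _ _ nm_ (LY n Lx)) _.
by rewrite ler_wpM2l // Y_nm.
Qed.

Let Ycvg x : exists l, L x -> forall n, nm (Ysq n x - l) <= 2 / n.+1%:R * nm x.
Proof.
have [Lx|nLx] := pselect (L x); last by exists 0.
have bd n m : (n <= m)%N -> nm (Ysq m x - Ysq n x) <= 2 / n.+1%:R * nm x.
  move=> le; apply: le_trans (Y_diff le Lx) _; rewrite ler_wpM2r ?nm_ge0 //.
  apply: le_trans (ysq_rate n).
  by rewrite lerD2r; case/andP: (ysq01 m).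
have [l hl] : exists l, forall e : R, 0 < e -> exists N, forall n, (N <= n)%N -> nm (Ysq n x - l) < e.
  apply: nm_complete => e e0.
  have [N hN] := harmonic_small (4 * nm x) e0.
  exists N => m n Nm Nn.
  have b1 := bd N m Nm; have b2 := bd N n Nn; have := hN N (leqnn _).
  apply: le_lt_trans; apply: le_trans (nm_tri _ (Ysq N x) _) _.
  rewrite (nmBC (Ysq N x)).
  by move: (N.+1%:R^-1 : R) b1 b2 => p; lra.
exists l => _ n; apply/ler_addgt0Pr => e e0.
have [N hN] := hl _ e0.
pose m := maxn n N.
apply: le_trans (nm_tri _ (Ysq m x) _) _; apply: lerD.
  by rewrite nmBC; apply: bd; rewrite leq_maxl.
by apply: ltW; apply: hN; rewrite leq_maxr.
Qed.

Let Y x := projT1 (cid (Ycvg x)).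

Let YP x n : L x -> nm (Ysq n x - Y x) <= 2 / n.+1%:R * nm x.
Proof. by move=> Lx; rewrite /Y; case: cid => l /= /(_ Lx). Qed.

Let Y_lim x y (c : R) : L x -> (forall n, nm (Ysq n x - y) <= c / n.+1%:R) -> Y x = y.
Proof.
move=> Lx h; apply/eqP; rewrite -subr_eq0 -nm_eq0; apply/eqP.
apply: (small_eq0 (c := 1)) => [|e e0]; first exact: nm_ge0.
have [N hN] := harmonic_small (2 * nm x + c) e0.
rewrite mul1r; have := hN N (leqnn _) => /ltW; apply: le_trans.
apply: le_trans (nm_tri _ (Ysq N x) _) _.
have := h N; have := YP N Lx; rewrite nmBC.
by move: (N.+1%:R^-1 : R) => p; lra.
Qed.

Let LYl x : L x -> L (Y x).
Proof.
move=> Lx; apply: cL => e e0; have [N hN] := harmonic_small (2 * nm x) e0.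
exists (Ysq N x); first exact: LY.
rewrite nmBC; apply: le_lt_trans (YP N Lx) _.
by rewrite mulrAC hN.
Qed.

Let Y_nm1 x : L x -> nm (Y x) <= nm x.
Proof.
move=> Lx; apply/ler_addgt0Pr => e e0.
have [N hN] := harmonic_small (2 * nm x) e0.
have -> : Y x = Ysq N x - (Ysq N x - Y x) by rewrite subKr.
apply: le_trans (nmB _ _) _; apply: lerD.
  apply: le_trans (Y_nm N Lx) _; rewrite ler_piMl ?nm_ge0 //.
  by case/andP: (ysq01 N).
by apply: le_trans (YP N Lx) _; rewrite mulrAC ltW // hN.
Qed.

Let Ylin k x y : L x -> L y -> Y (k *: x + y) = k *: Y x + Y y.
Proof.
move=> Lx Ly; have Lxy : L (k *: x + y) by apply: lsubD => //; exact: lsubZ.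
apply: (Y_lim (c := 2 * (cn k * nm x + nm y))) => // n.
rewrite linY opprD addrACA -scalerBr; apply: le_trans (nmD _ _) _; rewrite nmZ.
have := YP n Lx; have := YP n Ly; have := cn_ge0 k.
move: (n.+1%:R^-1 : R) (nm (_ - _)) (nm (_ - _)) => p a b k0 hb ha.
have := ler_wpM2l k0 ha; lra.
Qed.

Let YB x y : L x -> L y -> Y (x - y) = Y x - Y y.
Proof.
by move=> Lx Ly; rewrite addrC -scaleN1r Ylin // scaleN1r addrC.
Qed.

Let Ycomm A (c : R) : lin A -> (forall x, L x -> L (A x)) ->
  (forall x, L x -> A (B x) = B (A x)) -> (forall x, L x -> nm (A x) <= c * nm x) ->
  forall x, L x -> A (Y x) = Y (A x).
Proof.
move=> lA LA AB Ac x Lx.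
have AT z : L z -> A (T z) = T (A z).
  by move=> Lz; rewrite /T (linB _ _ lA) !AB //; exact: LB.
have AY n z : L z -> A (Ysq n z) = Ysq n (A z).
  elim: n z => [|n IH] z Lz /=; first exact: (lin0 lA).
  by rewrite (linZ _ _ lA) (linD _ _ lA) AT // !IH //; exact: LY.
apply/esym; apply: (Y_lim (c := 2 * c * nm x)); first exact: LA.
move=> n; rewrite -AY // -(linB _ _ lA).
apply: le_trans (Ac _ _) _; first by apply: lsubB => //; [exact: LY|exact: LYl].
have := YP n Lx; have [c0|c0] := lerP 0 c.
  by move=> h; apply: le_trans (ler_wpM2l c0 h) _; rewrite le_eqVlt; apply/orP; left; apply/eqP; ring.
have := le_trans (nm_ge0 _) (Ac x Lx); rewrite nmulr_rge0 // => x0.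
have -> : nm x = 0 by apply/eqP; rewrite eq_le x0 nm_ge0.
rewrite !mulr0 mul0r => h.
by have -> : nm (Ysq n x - Y x) = 0; [apply/eqP; rewrite eq_le h nm_ge0 | rewrite mulr0].
Qed.

Let Yeq x : L x -> Y x = 2^-1%:C *: (T x + Y (Y x)).
Proof.
move=> Lx; have LYx := LYl Lx.
apply: (Y_lim (c := 4 * nm x)) => // n.
case: n => [|n].
  rewrite [Ysq 0 x]/= add0r nmN halfC divr1.
  have h1 := T1 Lx; have h2 := Y_nm1 LYx; have h3 := Y_nm1 Lx.
  have := nmD (T x) (Y (Y x)); have := nm_ge0 x; lra.
rewrite [Ysq _ _]/= -scalerBr halfC opprD addrACA subrr add0r.
have LYn := LY n Lx.
rewrite -(subrKA (Y (Ysq n x))) -YB //.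
have h1 := YP n LYn; have h2 := Y_nm1 (lsubB sL LYn LYx); have h3 := YP n Lx.
have h4 : nm (Ysq n x) <= nm x.
  by apply: le_trans (Y_nm n Lx) _; rewrite ler_piMl ?nm_ge0 //; case/andP: (ysq01 n).
have n1 : 0 < n.+1%:R :> R by rewrite ltr0n.
have h5 : 2 / n.+1%:R * nm (Ysq n x) <= 2 / n.+1%:R * nm x.
  by apply: ler_wpM2l => //; rewrite divr_ge0 // ltW.
have h6 : n.+1%:R^-1 <= 2 * n.+2%:R^-1 :> R.
  rewrite -[n.+1%:R^-1]mul1r ler_pdivrMr // mulrAC ler_pdivlMr ?ltr0n //.
  by rewrite mul1r -natrM ler_nat mulnS mul2n -addnn addnA leq_addr.
apply: le_trans (ler_wpM2l _ (nmD _ _)) _ => //.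
have h7 := ler_wpM2r (nm_ge0 x) h6.
move: (n.+2%:R^-1 : R) (n.+1%:R^-1 : R) h1 h3 h5 h7 => p q; lra.
Qed.

(* [S] is the absolute value of [B]. *)
Let S x := x - Y x.

Let LS x : L x -> L (S x).
Proof. by move=> Lx; apply: lsubB => //; exact: LYl. Qed.

Let SS x : L x -> S (S x) = B (B x).
Proof.
move=> Lx; have LYx := LYl Lx; rewrite /S YB //.
have h : Y x + Y x = T x + Y (Y x).
  rewrite {1 2}(Yeq Lx) -scalerDl -rmorphD /=.
  have -> : 2^-1 + 2^-1 = 1 :> R by field.
  by rewrite scale1r.
have -> : x - Y x - (Y x - Y (Y x)) = x - (Y x + Y x) + Y (Y x).
  by rewrite !opprD !opprK !addrA.
by rewrite h opprD addrA addrNK /T subKr.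
Qed.

Definition cut_concl (L' : set H) :=
  [/\ lsub L' /\ aclosed L', L' `<=` L, (exists2 x, L' x & x != 0),
    forall x, L' x -> 0 <= complex.Re (dot (B x) x) &
    forall A (c : R), lin A -> (forall x, L x -> L (A x)) ->
      (forall x, L x -> A (B x) = B (A x)) ->
      (forall x, L x -> nm (A x) <= c * nm x) -> forall x, L' x -> L' (A x)].

(** From (S - B)(S + B) = 0 the range of S + B lies in L' = ker (S - B), where B agrees with its
    absolute value. If that range is zero, then B = - S is nonpositive. As [S] is a limit of
    polynomials in [B], the subspace L' is stable under everything that commutes with [B], in
    particular under the group. *)
Lemma spectral_cut :
  (forall x, L x -> complex.Re (dot (B x) x) <= 0) \/ exists L', cut_concl L'.
Proof.
have Spos x : L x -> 0 <= complex.Re (dot (S x) x).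
  move=> Lx; rewrite /S dotBl ReD ReN Re_dotxx subr_ge0.
  apply: le_trans (Re_dot_le _ _) _; rewrite expr2 ler_wpM2r ?nm_ge0 //.
  exact: Y_nm1.
have SB x : L x -> S (B x) = B (S x).
  move=> Lx; rewrite /S (linB _ _ lB); congr (_ - _).
  by apply/esym; apply: (Ycomm (c := 1)) => // y Ly; rewrite mul1r; exact: B1.
have Slin k x y : L x -> L y -> S (k *: x + y) = k *: S x + S y.
  by move=> Lx Ly; rewrite /S Ylin // scalerBr opprD addrACA.
have [h|h] := pselect (forall x, L x -> S x + B x = 0).
  left => x Lx; have -> : B x = - S x by apply/eqP; rewrite -addr_eq0 addrC h.
  by rewrite dotNl ReN oppr_le0 Spos.
have S0 : S 0 = 0 by rewrite /S -[X in Y X](subrr 0) YB ?subrr //; exact: lsub0.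
have SD x y : L x -> L y -> S (x - y) = S x - S y.
  by move=> Lx Ly; rewrite addrC -scaleN1r Slin // scaleN1r addrC.
right; exists [set x | L x /\ S x = B x]; split.
- split.
    split; first by split; [exact: lsub0 | rewrite S0 (lin0 lB)].
    move=> k x y [Lx Sx] [Ly Sy]; split; first by apply: lsubD => //; exact: lsubZ.
    by rewrite Slin // lB Sx Sy.
  move=> x hx; have Lx : L x by apply: cL => e /hx[y [Ly _] xy]; exists y.
  split=> //; apply/eqP; rewrite -subr_eq0 -nm_eq0; apply/eqP.
  apply: (small_eq0 (c := 3)) => [|e /hx[y [Ly Sy] /ltW xy]]; first exact: nm_ge0.
  have Lxy : L (x - y) by exact: lsubB.
  have -> : S x - B x = S (x - y) - B (x - y).
    by rewrite (linB _ _ lB) SD // Sy opprB addrA subrK.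
  rewrite /S; apply: le_trans (nmB _ _) _; have := nmB (x - y) (Y (x - y)).
  have := Y_nm1 Lxy; have := B1 Lxy; lra.
- by move=> x [].
- have [x [Lx hx]] : exists x, L x /\ S x + B x <> 0.
    by apply: contrapT => nh; apply: h => x Lx; apply: contrapT => nx; apply: nh; exists x.
  exists (S x + B x); last exact/eqP.
  have LSx := LS Lx; have LBx := LB Lx.
  split; first by apply: lsubD.
  have -> : S (S x + B x) = S (S x) + S (B x).
    by rewrite -{1}[S x]scale1r Slin // scale1r.
  by rewrite (linD _ _ lB) SS // SB // addrC.
- by move=> x [Lx <-]; exact: Spos.
- move=> A c lA LA AB Ac x [Lx Sx]; split; first exact: LA.
  rewrite -AB // -Sx /S (linB _ _ lA); congr (_ - _).
  by apply/esym; exact: (Ycomm (c := c)).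
Qed.

End SpectralCut.

Section FormBound.
Variables (R : realType) (H : hilbertType R).

(** Positivity of the form at x - K^-1 B x, together with the upper bound at B x, gives |B x|^2 <= K
    Re (B x, x). *)
Lemma form_bound (L : set H) (B : H -> H) (K : R) : lsub L -> lin B -> 0 < K ->
  (forall x, L x -> L (B x)) ->
  (forall x y, L x -> L y -> dot (B x) y = dot x (B y)) ->
  (forall x, L x -> 0 <= complex.Re (dot (B x) x) <= K * nm x ^+ 2) ->
  forall x, L x -> nm (B x) <= K * nm x.
Proof.
move=> sL lB K0 LB saB hB x Lx; have LBx := LB x Lx.
apply: nm_le_sqr; first by rewrite mulr_ge0 ?nm_ge0 // ltW.
have Ly : L (x - K^-1%:C *: B x) by apply: lsubB => //; exact: lsubZ.
have /andP[h1 _] := hB _ Ly; have /andP[_ h2] := hB _ Lx; have /andP[_ h3] := hB _ LBx.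
move: h1; rewrite (linB _ _ lB) (linZ _ _ lB) !dotBl !dotBr !dotZl !dotZr.
rewrite [conjc _]conjc_real (saB _ _ LBx Lx).
rewrite !(ReD, ReN, ReZ) Re_dotxx => h1.
have h4 : 0 <= K^-1 by rewrite invr_ge0 ltW.
have h5 : K^-1 * (K^-1 * complex.Re (dot (B (B x)) (B x))) <= K^-1 * (nm (B x) ^+ 2).
  by rewrite ler_wpM2l // ler_pdivrMl.
have h6 : K^-1 * nm (B x) ^+ 2 <= complex.Re (dot (B x) x).
  move: h1 h5; lra.
move: h6; rewrite ler_pdivrMl // => h6.
by apply: le_trans h6 _; rewrite exprMn expr2 -mulrA ler_pM2l.
Qed.

End FormBound.

(** * Subgroups as sets *)

Section Groups.
Variable Gam : groupType.

(** Subgroups are plain sets: they are defined by comprehension from their action on subspaces that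
    keep changing. *)
Definition sgp (G : set Gam) : Prop :=
  [/\ G 1%g, forall g h, G g -> G h -> G (g * h)%g & forall g, G g -> G g^-1%g].

Lemma sgp1 G : sgp G -> G 1%g. Proof. by case. Qed.
Lemma sgpM G g h : sgp G -> G g -> G h -> G (g * h)%g. Proof. by case=> _ /(_ g h). Qed.
Lemma sgpV G g : sgp G -> G g -> G g^-1%g. Proof. by case=> _ _ /(_ g). Qed.
Lemma sgpX G g n : sgp G -> G g -> G (g ^+ n)%g.
Proof. by move=> sG Gg; elim: n => [|n IH]; [exact: sgp1|rewrite expgS; exact: sgpM]. Qed.
Lemma sgpJ G g h : sgp G -> G g -> G h -> G (g ^ h)%g.
Proof. by move=> sG Gg Gh; rewrite conjgE; apply: sgpM => //; [exact: sgpV|exact: sgpM]. Qed.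
Lemma sgpR G g h : sgp G -> G g -> G h -> G [~ g, h]%g.
Proof. by move=> sG Gg Gh; rewrite commgEl; apply: sgpM => //; [exact: sgpV|exact: sgpJ]. Qed.

End Groups.

(** * Subspaces on which central elements act nearly by scalars *)

Section Localisation.
Variables (R : realType) (H : hilbertType R) (Gam : groupType) (p : Gam -> H -> H).

Definition urep : Prop :=
  [/\ forall g, lin (p g), forall x, p 1%g x = x,
      forall g h x, p (g * h)%g x = p g (p h x) &
      forall g x y, dot (p g x) (p g y) = dot x y].

Hypothesis hp : urep.

Lemma urep_lin g : lin (p g). Proof. by case: hp. Qed.
Lemma urep1 x : p 1%g x = x. Proof. by case: hp => _ ->. Qed.
Lemma urepM g h x : p (g * h)%g x = p g (p h x). Proof. by case: hp => _ _ ->. Qed.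
Lemma urepK g x : p g^-1%g (p g x) = x. Proof. by rewrite -urepM mulVg urep1. Qed.
Lemma urepKV g x : p g (p g^-1%g x) = x. Proof. by rewrite -urepM mulgV urep1. Qed.
Lemma urep_dot g x y : dot (p g x) (p g y) = dot x y. Proof. by case: hp. Qed.
Lemma urep_adj g x y : dot (p g x) y = dot x (p g^-1%g y).
Proof. by rewrite -(urep_dot g^-1%g) urepK. Qed.
Lemma urep_nm g x : nm (p g x) = nm x.
Proof. by apply/eqP; rewrite -(eqrXn2 (n := 2)) ?nm_ge0 // -!Re_dotxx urep_dot. Qed.

Definition invariant (G : set Gam) (L : set H) := forall g x, G g -> L x -> L (p g x).

Definition csub (G : set Gam) (L : set H) : Prop :=
  [/\ lsub L, aclosed L, invariant G L & exists2 x, L x & x != 0].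

(** Commutation is asked only for the operators on [L], so an element can become central when [L]
    shrinks. *)
Definition cen (G : set Gam) (L : set H) (c : Gam) : Prop :=
  G c /\ forall g x, G g -> L x -> p c (p g x) = p g (p c x).

Lemma cen_sub G L L' c : L' `<=` L -> cen G L c -> cen G L' c.
Proof. by move=> sub [Gc h]; split=> // g x Gg /sub; exact: h. Qed.

Variables (G : set Gam) (sG : sgp G).

Lemma cenV L c : invariant G L -> cen G L c -> cen G L c^-1%g.
Proof.
move=> iL [Gc h]; have Gc' := sgpV sG Gc; split => // g x Gg Lx.
rewrite -{1}(urepKV c x) -h ?urepK //; exact: iL.
Qed.

Definition saop (L : set H) (A : H -> H) : Prop :=
  [/\ lin A, forall x, L x -> L (A x),
      forall x y, L x -> L y -> dot (A x) y = dot x (A y),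
      forall x, L x -> nm (A x) <= nm x &
      forall g x, G g -> L x -> A (p g x) = p g (A x)].

Lemma saop_sub L L' A : L' `<=` L -> (forall x, L' x -> L' (A x)) -> saop L A -> saop L' A.
Proof.
move=> sub LA [h1 h2 h3 h4 h5]; split=> //.
- by move=> x y /sub ? /sub; exact: h3.
- by move=> x /sub; exact: h4.
- by move=> g x Gg /sub; exact: h5.
Qed.

(* Cutting at level t, from either side (sign [e]). *)
Lemma cut_level L A (t e : R) : csub G L -> saop L A -> `|t| <= 1 -> `|e| = 1 ->
  (forall x, L x -> e * complex.Re (dot (A x) x) <= e * t * nm x ^+ 2) \/
  exists L', [/\ csub G L', L' `<=` L, forall x, L' x -> L' (A x) &
    forall x, L' x -> e * t * nm x ^+ 2 <= e * complex.Re (dot (A x) x)].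
Proof.
move=> [sL cL iL nL] [lA LA saA A1 AG] t1 e1.
pose B x := (e / 2)%:C *: (A x - t%:C *: x).
have lB : lin B.
  move=> k x y; rewrite /B lA (scalerDr t%:C) opprD addrACA (scalerDr (e / 2)%:C).
  by rewrite (scalerA t%:C) (mulrC t%:C) -(scalerA k t%:C) -scalerBr !scalerA (mulrC k).
have LB x : L x -> L (B x).
  by move=> Lx; apply: lsubZ => //; apply: lsubB => //; [exact: LA|exact: lsubZ].
have saB x y : L x -> L y -> dot (B x) y = dot x (B y).
  move=> Lx Ly; rewrite /B dotZl dotZr [conjc _]conjc_real dotBl dotBr saA //.
  by rewrite dotZl dotZr [conjc _]conjc_real.
have B1 x : L x -> nm (B x) <= nm x.
  move=> Lx; rewrite nmZ cn_real normrM e1 mul1r ger0_norm ?invr_ge0 //.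
  have := nmB (A x) (t%:C *: x); rewrite nmZ cn_real.
  have := A1 x Lx; have := ler_wpM2r (nm_ge0 x) t1; lra.
have Bform x : complex.Re (dot (B x) x) =
    2^-1 * (e * complex.Re (dot (A x) x) - e * t * nm x ^+ 2).
  by rewrite /B dotZl ReZ dotBl dotZl ReD ReN ReZ Re_dotxx; ring.
have [h|[L' [[sL' cL'] L'L nL' pos inv]]] := spectral_cut sL cL lB LB saB B1.
  left => x Lx; have := h x Lx; rewrite Bform; lra.
right; exists L'; split => //.
- split=> // g x Gg L'x; apply: (inv (p g) 1) => //.
  + exact: urep_lin.
  + by move=> z; exact: iL.
  + move=> z Lz; rewrite /B (linZ _ _ (urep_lin g)) (linB _ _ (urep_lin g)).
    by rewrite (linZ _ _ (urep_lin g)) AG.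
  + by move=> z _; rewrite urep_nm mul1r.
- move=> x L'x; apply: (inv A 1) => //.
  + move=> z Lz; rewrite /B (linZ _ _ lA) (linB _ _ lA).
    by rewrite (linZ _ _ lA).
  + by move=> z Lz; rewrite mul1r; exact: A1.
- move=> x L'x; have := pos x L'x; rewrite Bform; lra.
Qed.

(** A lower bound t of the form of [A] is raised in steps of d. Either t + d is already an upper
    bound, and [form_bound] makes A close to t, or cutting at t + d gives a subspace with the larger
    lower bound. In [main], [n] counts the steps left before the bound reaches 1, which a
    contraction cannot exceed. *)
Lemma loc_sa L A (d : R) : csub G L -> saop L A -> 0 < d ->
  exists L' t, [/\ csub G L', L' `<=` L, forall x, L' x -> L' (A x) &
    forall x, L' x -> nm (A x - t%:C *: x) <= d * nm x].
Proof.
move=> csL saA d0.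
pose concl L1 := exists L' t, [/\ csub G L', L' `<=` L1, forall x, L' x -> L' (A x) &
    forall x, L' x -> nm (A x - t%:C *: x) <= d * nm x].
have close L1 t : csub G L1 -> saop L1 A ->
    (forall x, L1 x -> t * nm x ^+ 2 <= complex.Re (dot (A x) x) <= (t + d) * nm x ^+ 2) ->
    concl L1.
  move=> cs1 [lA LA sA A1 AG] h; exists L1, t; split => //.
  have [sL1 _ _ _] := cs1.
  apply: (form_bound (B := fun x => A x - t%:C *: x)) => //.
  - move=> k x y; rewrite lA (scalerDr t%:C) opprD addrACA; congr (_ + _).
    by rewrite (scalerA t%:C) (mulrC t%:C) -(scalerA k t%:C) -scalerBr.
  - by move=> x Lx; apply: lsubB => //; [exact: LA|exact: lsubZ].
  - move=> x y Lx Ly; rewrite dotBl dotBr sA // dotZl dotZr [conjc _]conjc_real //.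
  - move=> x Lx; rewrite dotBl dotZl ReD ReN ReZ Re_dotxx.
    by have := h x Lx; move: (nm x ^+ 2) (complex.Re _) => a b /andP[h1 h2]; apply/andP; split; lra.
have main n : forall L1, csub G L1 -> saop L1 A -> forall t, -1 <= t -> 2 - n%:R * d <= t + 1 ->
    (forall x, L1 x -> t * nm x ^+ 2 <= complex.Re (dot (A x) x)) -> concl L1.
  elim: n => [|n IH] L1 cs1 sa1 t t1 ht lo.
    apply: (close _ t) => // x Lx; rewrite lo //=; have [_ _ _ A1 _] := sa1.
    apply: le_trans (Re_dot_le _ _) _; rewrite expr2 mulrA ler_wpM2r ?nm_ge0 //.
    apply: le_trans (A1 x Lx) _; rewrite -[leLHS]mul1r ler_wpM2r ?nm_ge0 //.
    by rewrite mul0r in ht; lra.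
  have [td|td] := lerP (t + d) 1; last first.
    apply: (close _ t) => // x Lx; rewrite lo //=; have [_ _ _ A1 _] := sa1.
    apply: le_trans (Re_dot_le _ _) _; rewrite expr2 mulrA ler_wpM2r ?nm_ge0 //.
    by apply: le_trans (A1 x Lx) _; rewrite -[leLHS]mul1r ler_wpM2r ?nm_ge0 // ltW.
  have t2 : `|t + d| <= 1 by rewrite ler_norml; apply/andP; split; lra.
  have [h|[L2 [cs2 L21 L2A hi]]] := cut_level cs1 sa1 t2 (normr1 R).
    apply: (close _ t) => // x Lx; rewrite lo //=.
    by have := h x Lx; rewrite !mul1r.
  have [|||L' [t' [a b c e]]] := IH L2 cs2 (saop_sub L21 L2A sa1) (t + d).
  - lra.
  - by move: ht; rewrite -(natr1 n) mulrDl mul1r; lra.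
  - by move=> x L2x; have := hi x L2x; rewrite !mul1r.
  - by exists L', t'; split => //; exact: subset_trans L21.
have [N hN] : exists N : nat, 2 <= N%:R * d.
  have [N hN] := harmonic_small 2 d0; exists N.+1.
  by have := hN N (leqnn _); rewrite ltr_pdivrMr ?ltr0n // mulrC => /ltW.
apply: (main N L csL saA (-1)) => //; first by lra.
move=> x Lx; have [_ _ _ A1 _] := saA.
have := absRe_le_cn (dot (A x) x); rewrite ler_norml => /andP[h _].
have := CS (A x) x; have := ler_wpM2r (nm_ge0 x) (A1 x Lx); rewrite -expr2.
lra.
Qed.

Definition near_scalar (L : set H) (d : R) (c : Gam) (l : R[i]) : Prop :=
  cn l = 1 /\ forall x, L x -> nm (p c x - l *: x) <= d * nm x.

Let reop c x := 2^-1%:C *: (p c x + p c^-1%g x).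
Let imop c x := (2^-1%:C * - 'i%C) *: (p c x - p c^-1%g x).

Lemma saop_re L c : lsub L -> invariant G L -> cen G L c -> saop L (reop c).
Proof.
move=> sL iL hc; have hc' := cenV iL hc; have [Gc cc] := hc; have [Gc' cc'] := hc'.
split.
- move=> k x y; rewrite /reop !urep_lin addrACA -(scalerDr k) (scalerDr 2^-1%:C).
  by rewrite !scalerA (mulrC k).
- by move=> x Lx; apply: lsubZ => //; apply: lsubD => //; exact: iL.
- move=> x y _ _; rewrite /reop dotZl dotZr [conjc _]conjc_real dotDl dotDr.
  by rewrite !urep_adj invgK addrC.
- move=> x _; rewrite /reop nmZ cn_real ger0_norm ?invr_ge0 //.
  by have := nmD (p c x) (p c^-1%g x); rewrite !urep_nm; lra.
- move=> g x Gg Lx; rewrite /reop (linZ _ _ (urep_lin g)) (linD _ _ (urep_lin g)).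
  by rewrite cc // cc'.
Qed.

Lemma cni : cn ('i%C : R[i]) = 1.
Proof. by apply/eqP; rewrite -(eqrXn2 (n := 2)) ?cn_ge0 // cn_sqr_Re /= expr0n add0r. Qed.

Lemma saop_im L c : lsub L -> invariant G L -> cen G L c -> saop L (imop c).
Proof.
move=> sL iL hc; have hc' := cenV iL hc; have [Gc cc] := hc; have [Gc' cc'] := hc'.
split.
- move=> k x y; rewrite /imop !urep_lin opprD addrACA -(scalerBr k) (scalerDr (_ * _)).
  by rewrite !scalerA (mulrC k).
- by move=> x Lx; apply: lsubZ => //; apply: lsubB => //; exact: iL.
- move=> x y _ _; rewrite /imop dotZl dotZr conjZ dotBl dotBr.
  have -> : conjc (- 'i%C) = 'i%C :> R[i] by apply/eqP; rewrite eq_complex /= oppr0 opprK !eqxx.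
  by rewrite !urep_adj invgK mulrN mulNr -mulrN opprB.
- move=> x _; rewrite /imop nmZ cnM cn_real cnN cni ger0_norm ?invr_ge0 //.
  by have := nmB (p c x) (p c^-1%g x); rewrite !urep_nm; lra.
- move=> g x Gg Lx; rewrite /imop (linZ _ _ (urep_lin g)) (linB _ _ (urep_lin g)).
  by rewrite cc // cc'.
Qed.

Lemma reimop c x : p c x = reop c x + 'i%C *: imop c x.
Proof.
rewrite /imop scalerA mulrCA mulrN -expr2 sqr_i opprK mulr1 -scalerDr.
rewrite addrACA subrr addr0 scalerDr -scalerDl -rmorphD /=.
have -> : 2^-1 + 2^-1 = 1 :> R by field.
by rewrite scale1r.
Qed.

Lemma near_scalar_sub L L' d c l : L' `<=` L -> near_scalar L d c l -> near_scalar L' d c l.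
Proof. by move=> sub [h1 h2]; split=> // x /sub; exact: h2. Qed.

Lemma localise L c (d : R) : csub G L -> cen G L c -> 0 < d ->
  exists L' l, [/\ csub G L', L' `<=` L & near_scalar L' d c l].
Proof.
move=> csL hc d0.
(* Localising the real and imaginary parts costs 2 e, moving the scalar [m] to the unit circle
   another 2 e. The bound e <= 1/4 keeps |m| at least 1/2. *)
pose e := Num.min d 1 / 4.
have e0 : 0 < e by rewrite divr_gt0 // lt_min d0 ltr01.
have e1 : e <= 1 / 4 by rewrite ler_pM2r ?invr_gt0 // ge_min lexx orbT.
have ed : 4 * e <= d by rewrite mulrC /e divfK ?ge_min ?lexx.
have [sL cL iL nL] := csL.
have [L1 [t [cs1 L1L _ h1]]] := loc_sa csL (saop_re sL iL hc) e0.
have [sL1 cL1 iL1 nL1] := cs1.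
have [L2 [s [cs2 L21 _ h2]]] := loc_sa cs1 (saop_im sL1 iL1 (cen_sub L1L hc)) e0.
pose m := t%:C + 'i%C * s%:C.
have hm x : L2 x -> nm (p c x - m *: x) <= 2 * e * nm x.
  move=> Lx; rewrite reimop /m scalerDl opprD addrACA -scalerA -scalerBr.
  apply: le_trans (nmD _ _) _; rewrite nmZ cni mul1r.
  by have := h1 x (L21 _ Lx); have := h2 x Lx; lra.
have [_ _ _ [x0 Lx0 x00]] := cs2.
have nx0 : 0 < nm x0 by rewrite nm_gt0.
have m1 : `|cn m - 1| <= 2 * e.
  rewrite -(ler_pM2r nx0); apply: le_trans (hm x0 Lx0).
  rewrite -{1}(ger0_norm (nm_ge0 x0)) -normrM mulrBl mul1r -nmZ -(urep_nm c x0).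
  rewrite ler_norml; apply/andP; split.
    have := nmD (p c x0 - m *: x0) (m *: x0); rewrite subrK; lra.
  have := nmB (p c x0) (p c x0 - m *: x0); rewrite subKr; lra.
have m0 : 0 < cn m by move: m1; rewrite ler_norml => /andP[]; lra.
exists L2, ((cn m)^-1%:C * m); split=> //; first exact: subset_trans L1L.
split; first by rewrite cnM cn_real ger0_norm ?invr_ge0 ?cn_ge0 // mulVf // gt_eqF.
move=> x Lx; apply: le_trans (nm_tri _ (m *: x) _) _.
rewrite -scalerBl nmZ.
have -> : cn (m - (cn m)^-1%:C * m) = `|cn m - 1|.
  rewrite -{1}[m]mul1r -mulrBl cnM -[1 : R[i]]/(1%:C) -rmorphB /= cn_real.
  rewrite -{2}(ger0_norm (cn_ge0 m)) -normrM mulrBl mul1r mulVf //.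
  by rewrite gt_eqF.
have := hm x Lx; have := ler_wpM2r (nm_ge0 x) m1; have := ler_wpM2r (nm_ge0 x) ed; lra.
Qed.

Lemma localise_seq L (cs : seq Gam) (d : R) : csub G L ->
  {in cs, forall c, cen G L c} -> 0 < d ->
  exists L', [/\ csub G L', L' `<=` L & {in cs, forall c, exists l, near_scalar L' d c l}].
Proof.
move=> csL hc d0; elim: cs hc => [|c cs IH] hc; first by exists L; split=> [//|x //|c //].
have [|L1 [cs1 L1L h1]] := IH; first by move=> c' h; apply: hc; rewrite inE h orbT.
have hcc : cen G L c by apply: hc; rewrite inE eqxx.
have [L2 [l [cs2 L21 h2]]] := localise cs1 (cen_sub L1L hcc) d0.
exists L2; split=> //; first exact: subset_trans L1L.
move=> c'; rewrite inE => /orP[/eqP->|/h1[l' hl']]; first by exists l.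
by exists l'; exact: near_scalar_sub hl'.
Qed.

Definition gap (L : set H) (k : R) (w : Gam) := forall x, L x -> k * nm x <= nm (p w x - x).

(** Here |w x - x|^2 = 2 |x|^2 - 2 Re (w x, x). If w is not the identity on [L], some level 1 -
    1/(n+1) is not a lower bound of the real part; the subspace cut below that level has gap sqrt (2
    / (n+1)). *)
Lemma stabilise1 L w : csub G L -> cen G L w ->
  (forall x, L x -> p w x = x) \/
  exists L' k, [/\ csub G L', L' `<=` L, 0 < k & gap L' k w].
Proof.
move=> csL hw; have [sL cL iL nL] := csL; have sa := saop_re sL iL hw.
have rex x : complex.Re (dot (reop w x) x) = complex.Re (dot (p w x) x).
  rewrite /reop dotZl ReZ dotDl ReD (urep_adj w^-1%g) invgK (Re_dotC (p w x)); lra.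
have [h|h] := pselect (forall n x, L x -> (1 - n.+1%:R^-1) * nm x ^+ 2 <= complex.Re (dot (p w x) x)).
  left => x Lx; apply/eqP; rewrite -subr_eq0 -nm_eq0 -sqrf_eq0; apply/eqP.
  apply: (small_eq0 (c := 2 * nm x ^+ 2)) => [|e e0]; first exact: sqr_ge0.
  have [N hN] := harmonic_small 1 e0; have := h N x Lx; have := hN N (leqnn _).
  rewrite div1r nm_sqrB urep_nm; move: (N.+1%:R^-1 : R) => q h1.
  have := ler_wpM2r (sqr_ge0 (nm x)) (ltW h1); lra.
right; have [n hn] : exists n, ~ forall x, L x -> (1 - n.+1%:R^-1) * nm x ^+ 2 <= complex.Re (dot (p w x) x).
  by apply: contrapT => nh; apply: h => n; apply: contrapT => nx; apply: nh; exists n.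
have n0 : 0 < n.+1%:R^-1 :> R by rewrite invr_gt0 ltr0n.
have n1 : n.+1%:R^-1 <= 1 :> R by rewrite invf_le1 ?ltr0n // ler1n.
have t1 : `|1 - n.+1%:R^-1 : R| <= 1.
  by rewrite ler_norml; apply/andP; split; move: (n.+1%:R^-1 : R) n0 n1 => q; lra.
have [hh|[L' [cs' L'L _ hi]]] := cut_level csL sa t1 (normrN1 R).
  by case: hn => x Lx; have := hh x Lx; rewrite rex; move: (n.+1%:R^-1 : R) => q; lra.
exists L', (Num.sqrt (2 * n.+1%:R^-1)); split; [exact: cs' | exact: L'L | |].
  by rewrite sqrtr_gt0 mulr_gt0.
move=> x Lx; rewrite -(ler_pXn2r (n := 2)) ?nnegrE ?mulr_ge0 ?sqrtr_ge0 ?nm_ge0 //.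
rewrite exprMn sqr_sqrtr ?mulr_ge0 ?(ltW n0) // nm_sqrB urep_nm.
by have := hi x Lx; rewrite rex; move: (n.+1%:R^-1 : R) => q; lra.
Qed.

Lemma gap_sub L L' k w : L' `<=` L -> gap L k w -> gap L' k w.
Proof. by move=> sub h x /sub; exact: h. Qed.

Definition stable_on (L : set H) (w : Gam) : Prop :=
  (forall x, L x -> p w x = x) \/ exists2 k, 0 < k & gap L k w.

Lemma stable_sub L L' w : L' `<=` L -> stable_on L w -> stable_on L' w.
Proof.
move=> sub [h|[k k0 h]]; first by left => x /sub; exact: h.
by right; exists k => //; exact: gap_sub h.
Qed.

Lemma stabilise L (W : seq Gam) : csub G L -> {in W, forall w, cen G L w} ->
  exists L', [/\ csub G L', L' `<=` L & {in W, forall w, stable_on L' w}].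
Proof.
move=> csL; elim: W => [|w W IH] hW; first by exists L; split=> [//|x //|c //].
have [|L1 [cs1 L1L h1]] := IH; first by move=> c' h; apply: hW; rewrite inE h orbT.
have hw : cen G L w by apply: hW; rewrite inE eqxx.
have [h|[L2 [k [cs2 L21 k0 h2]]]] := stabilise1 cs1 (cen_sub L1L hw).
  by exists L1; split=> //; move=> c'; rewrite inE => /orP[/eqP->|/h1//]; left.
exists L2; split=> //; first exact: subset_trans L1L.
move=> c'; rewrite inE => /orP[/eqP->|/h1]; first by right; exists k.
exact: stable_sub.
Qed.

End Localisation.

(** * Limits of bounded functions along an ultrafilter *)

Section UltraLimit.
Variables (R : realType) (T : Type) (U : set_system T).
Hypothesis uU : UltraFilter U.

Lemma ultra_limit (f : T -> R) (b : R) : U [set x | `|f x| <= b] ->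
  exists r, forall e, 0 < e -> U [set x | `|f x - r| < e].
Proof.
move=> Ub.
pose D := [set r | U [set x | r <= f x]].
have D0 : D (- b) by apply: filterS Ub => x /=; rewrite ler_norml => /andP[].
have Dub : ubound D b.
  move=> r Dr; have [x [/= h1 h2]] := filter_ex (filterI Dr Ub).
  by apply: le_trans h1 _; apply: le_trans (ler_norm _) h2.
have hs : has_sup D by split; [exists (- b) | exists b].
exists (sup D) => e e0.
have [r Dr hr] := sup_adherent e0 hs.
have U1 : U [set x | sup D - e < f x] by apply: filterS Dr => x /=; exact: lt_le_trans.
have U2 : U [set x | f x < sup D + e].
  have [//|h] := in_ultra_setVsetC [set x | f x < sup D + e] uU.
  have : D (sup D + e) by apply: filterS h => x /= /negP; rewrite -leNgt.
  by move=> /(ub_le_sup hs.2); rewrite gerDl leNgt e0.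
apply: filterS (filterI U1 U2) => x [/= h1 h2].
by rewrite ltr_norml; apply/andP; split; lra.
Qed.

End UltraLimit.

(** * Limits of vector states along weakly null nets *)

Section FreeVectors.
Variables (R : realType) (H : hilbertType R) (Gam : groupType) (p : Gam -> H -> H).
Hypothesis hp : urep p.
Variables (G : set Gam) (L : set H).
Hypotheses (sG : sgp G) (sL : lsub L) (iL : invariant p G L).

Lemma scattered_seq (Pr : H -> Prop) (n : nat) (E : seq H) (T : seq Gam) (d : R) :
  (forall E : seq H, exists x, [/\ L x, nm x = 1, {in E, forall e, cn (dot x e) <= d} & Pr x]) ->
  exists x : nat -> H, forall i, (i < n)%N ->
    [/\ L (x i), nm (x i) = 1, {in E, forall e, cn (dot (x i) e) <= d}, Pr (x i) &
      forall j t, (j < n)%N -> i != j -> t \in T -> cn (dot (p t (x i)) (x j)) <= d].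
Proof.
move=> hPr; elim: n => [|n [x hx]]; first by exists (fun=> 0).
(* Translates by t and by its inverse both enter, so the new vector is almost orthogonal to the
   earlier ones whichever of the two is translated. *)
pose E' := E ++ flatten [seq [seq p t (x i) | t <- T] ++ [seq p t^-1%g (x i) | t <- T] | i <- iota 0 n].
have [y [Ly ny hE hT]] := hPr E'.
exists (fun i => if i == n then y else x i) => i.
have yx j t : (j < n)%N -> t \in T -> cn (dot (p t y) (x j)) <= d /\ cn (dot (p t (x j)) y) <= d.
  move=> jn tT; split.
    rewrite (urep_adj hp); apply: hE; rewrite mem_cat; apply/orP; right.
    apply/flattenP; eexists; first by apply/mapP; exists j; rewrite ?mem_iota.
    by rewrite mem_cat; apply/orP; right; apply/mapP; exists t.
  rewrite cn_dotC; apply: hE; rewrite mem_cat; apply/orP; right.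
  apply/flattenP; eexists; first by apply/mapP; exists j; rewrite ?mem_iota.
  by rewrite mem_cat; apply/orP; left; apply/mapP; exists t.
rewrite ltnS leq_eqVlt => /orP[/eqP->|iln].
  rewrite eqxx; split=> //; first by move=> e he; apply: hE; rewrite mem_cat he.
  move=> j t; rewrite ltnS leq_eqVlt => /orP[/eqP->|jn]; first by rewrite eqxx.
  by rewrite (ltn_eqF jn) => _ tT; have [] := yx j t jn tT.
rewrite (ltn_eqF iln); have [h1 h2 h3 h4 h5] := hx i iln; split=> // j t.
rewrite ltnS leq_eqVlt => /orP[/eqP->|jn].
  by rewrite eqxx => _ tT; have [] := yx i t iln tT.
by rewrite (ltn_eqF jn) => ij tT; exact: h5.
Qed.

Definition infdim := forall E : seq H,
  exists x, [/\ L x, x != 0 & {in E, forall e, dot x e = 0}].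

(* [phi] is a limit of the vector states of a weakly null net of unit vectors. *)
Definition null_state (phi : Gam -> R[i]) := forall (E : seq H) (T : seq Gam) (d : R), 0 < d ->
  exists x, [/\ L x, nm x = 1, {in E, forall e, cn (dot x e) <= d} &
    {in T, forall t, cn (dot (p t x) x - phi t) <= d}].

(** Infinite dimension makes the sets of unit vectors of [L] orthogonal to a finite set a filter
    base. The diagonal coefficients are bounded by 1, so they converge along an ultrafilter
    containing these sets. *)
Lemma null_state_ex : infdim -> exists phi, null_state phi.
Proof.
move=> iD.
pose U0 (E : seq H) := [set x | [/\ L x, nm x = 1 & {in E, forall e, dot x e = 0}]].
pose F : set_system H := [set A | exists E, U0 E `<=` A].
have FF : Filter F.
  split; first by exists [::].
    move=> A B [E1 h1] [E2 h2]; exists (E1 ++ E2) => x [Lx nx hx]; split.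
      by apply: h1; split => // e he; apply: hx; rewrite mem_cat he.
    by apply: h2; split => // e he; apply: hx; rewrite mem_cat he orbT.
  by move=> A B AB [E h]; exists E; exact: subset_trans AB.
have U0n E : U0 E !=set0.
  have [x [Lx x0 hx]] := iD E; exists ((nm x)^-1%:C *: x); split.
  - exact: lsubZ.
  - exact: normalize.
  - by move=> e he; rewrite dotZl hx // mulr0.
have PF : ProperFilter F.
  by split => // -[E h]; have [x /h] := U0n E.
have [V [uV FV]] := ultraFilterLemma PF.
have U0V E : V (U0 E) by apply: FV; exists E.
have bnd t : V [set x | cn (dot (p t x) x) <= 1].
  apply: filterS (U0V [::]) => x [_ nx _] /=.
  by apply: le_trans (CS _ _) _; rewrite urep_nm // nx mulr1.
have re t : exists r, forall e, 0 < e -> V [set x | `|complex.Re (dot (p t x) x) - r| < e].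
  apply: (@ultra_limit R H V uV _ 1); apply: filterS (bnd t) => x /=.
  by apply: le_trans; exact: absRe_le_cn.
have im t : exists r, forall e, 0 < e -> V [set x | `|complex.Im (dot (p t x) x) - r| < e].
  apply: (@ultra_limit R H V uV _ 1); apply: filterS (bnd t) => x /=.
  by apply: le_trans; exact: absIm_le_cn.
pose phi t : R[i] := (projT1 (cid (re t)) +i* projT1 (cid (im t)))%C.
exists phi => E T d d0.
have VT : V [set x | {in T, forall t, cn (dot (p t x) x - phi t) <= d}].
  elim: T => [|t T IH]; first by apply: filterS (U0V [::]).
  have d20 : 0 < d / 2 by rewrite divr_gt0.
  have hre : V [set x | `|complex.Re (dot (p t x) x) - complex.Re (phi t)| < d / 2].
    by rewrite /phi /=; case: cid => r /=; apply.
  have him : V [set x | `|complex.Im (dot (p t x) x) - complex.Im (phi t)| < d / 2].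
    by rewrite /phi /=; case: (cid (im t)) => r /=; apply.
  apply: filterS (filterI IH (filterI hre him)) => x [/= h1 [h2 h3]] t'.
  rewrite inE => /orP[/eqP->|]; last exact: h1.
  apply: le_trans (cn_le_ReIm _) _; rewrite !(ReD, ReN, ImD, ImN).
  by move: h2 h3; move: (`|_|) (`|_|) => a b; lra.
have [x [[Lx nx hx] hT]] := filter_ex (filterI (U0V E) VT).
by exists x; split=> // e he; rewrite hx // cn0 ltW.
Qed.

Variable phi : Gam -> R[i].
Hypothesis hphi : null_state phi.

Lemma null_state_eq t t' : (forall x, L x -> p t x = p t' x) -> phi t = phi t'.
Proof.
move=> h; apply/eqP; rewrite -subr_eq0 -cn_eq0; apply/eqP.
apply: (small_eq0 (c := 2)) => [|e e0]; first exact: cn_ge0.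
have [x [Lx _ _ hT]] := hphi [::] [:: t; t'] e0.
have h1 := hT t; have h2 := hT t'; rewrite !inE eqxx /= in h1; rewrite !inE eqxx orbT in h2.
have := h1 isT; have := h2 isT; rewrite -h //.
move: (dot _ _) => z; have := cnB (z - phi t') (z - phi t).
by rewrite opprB addrC addrA subrK; lra.
Qed.

(** Telescoping: p w - 1 maps the sum of the p (w^i) y to p (w^M) y - y, of norm at most 2, while
    the gap bounds its norm from below by k times that of the sum. *)
Lemma null_state_gap (w t : Gam) (k : R) (M : nat) : G w -> G t -> 0 < k -> gap p L k w ->
  k * cn (\sum_(i < M) phi (w ^+ i * t)%g) <= 2.
Proof.
move=> Gw Gt k0 gw.
apply/ler_addgt0Pr => e e0.
pose d := e / (k * M.+1%:R).
have M0 : 0 < M.+1%:R :> R by rewrite ltr0n.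
have d0 : 0 < d by rewrite divr_gt0 // mulr_gt0.
have [x [Lx nx _ hT]] := hphi [::] [seq (w ^+ i * t)%g | i <- iota 0 M] d0.
pose y := p t x; have Ly : L y by exact: iL.
pose Y := \sum_(i < M) p (w ^+ i)%g y.
have LY : L Y by apply: lsub_sum => // i _; apply: iL => //; exact: sgpX.
have h1 : k * nm Y <= 2.
  apply: le_trans (gw Y LY) _.
  have -> : p w Y - Y = p (w ^+ M)%g y - y.
    rewrite /Y (lin_sum _ _ _ (urep_lin hp w)) -sumrB.
    under eq_bigr do rewrite -(urepM hp) -expgS.
    by rewrite -(big_mkord xpredT (fun i => p (w ^+ i.+1)%g y - p (w ^+ i)%g y)) telescope_sumr // expg0 (urep1 hp).
  by apply: le_trans (nmB _ _) _; rewrite !urep_nm // nx.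
have h2 : cn (\sum_(i < M) phi (w ^+ i * t)%g) <= nm Y + M%:R * d.
  have -> : \sum_(i < M) phi (w ^+ i * t)%g =
      dot Y x - \sum_(i < M) (dot (p (w ^+ i * t)%g x) x - phi (w ^+ i * t)%g).
    rewrite sumrB /Y dot_suml opprB addrC.
    under [X in _ - _ + X]eq_bigr do rewrite -(urepM hp).
    by rewrite subrK.
  apply: le_trans (cnB _ _) _; apply: lerD.
    by apply: le_trans (CS _ _) _; rewrite nx mulr1.
  apply: le_trans (cn_sum _ _ _) _.
  rewrite -sum_cst; apply: ler_sum => i _.
  by apply: hT; apply/mapP; exists (i : nat) => //; rewrite mem_iota /=.
have h3 : k * (M%:R * d) <= e.
  rewrite /d; have -> : k * (M%:R * (e / (k * M.+1%:R))) = e * (M%:R / M.+1%:R).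
    by field; rewrite !gt_eqF.
  by rewrite ler_piMr ?(ltW e0) // ler_pdivrMr // mul1r ler_nat.
have := ler_wpM2l (ltW k0) h2; rewrite mulrDr; lra.
Qed.

(** The vectors p (t i) x are nearly orthonormal, so their sum has norm about sqrt M; pairing it
    with x bounds the sum of the values of [phi]. *)
Lemma null_state_orth (M : nat) (t : nat -> Gam) (d b : R) : 0 < d -> 0 <= b ->
  (forall i j, (i < M)%N -> (j < M)%N -> i != j -> cn (phi ((t j)^-1 * t i)%g) <= d) ->
  M%:R + 2 * M%:R ^+ 2 * d <= b ^+ 2 ->
  cn (\sum_(i < M) phi (t i)) <= b + M%:R * d.
Proof.
move=> d0 b0 hd hb.
have [x [Lx nx _ hT]] := hphi [::] ([seq t i | i <- iota 0 M] ++
  [seq ((t ij.2)^-1 * t ij.1)%g | ij <- allpairs pair (iota 0 M) (iota 0 M)]) d0.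
pose Y := \sum_(i < M) p (t i) x.
have hY : nm Y ^+ 2 <= b ^+ 2.
  apply: le_trans hb; rewrite -Re_dotxx /Y dot_suml Re_sum.
  have -> : M%:R + 2 * M%:R ^+ 2 * d = \sum_(i < M) (1 + \sum_(j < M) (2 * d)).
    rewrite sum_cst sum_cst; ring.
  apply: ler_sum => i _; rewrite dot_sumr Re_sum (bigD1 i) //= [X in _ <= 1 + X](bigD1 i) //= addrA.
  rewrite urep_dot // dotxx nx expr1n /=; apply: lerD; first by lra.
  apply: ler_sum => j ji; apply: le_trans (Re_le_cn _) _.
  have -> : dot (p (t i) x) (p (t j) x) = dot (p ((t j)^-1 * t i)%g x) x.
    by rewrite (urepM hp) (urep_adj hp (t j)^-1%g) invgK.
  have h1 : cn (dot (p ((t j)^-1 * t i)%g x) x - phi ((t j)^-1 * t i)%g) <= d.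
    apply: hT; rewrite mem_cat; apply/orP; right; apply/mapP; exists (i : nat, j : nat) => //.
    by apply/allpairsP; exists (i : nat, j : nat); rewrite !mem_iota /=.
  have h2 := hd i j (ltn_ord i) (ltn_ord j); rewrite eq_sym in ji.
  have {}h2 := h2 ji.
  have := cnD (dot (p ((t j)^-1 * t i)%g x) x - phi ((t j)^-1 * t i)%g) (phi ((t j)^-1 * t i)%g).
  by rewrite subrK; lra.
have -> : \sum_(i < M) phi (t i) = dot Y x - \sum_(i < M) (dot (p (t i) x) x - phi (t i)).
  by rewrite sumrB /Y dot_suml opprB addrC subrK.
apply: le_trans (cnB _ _) _; apply: lerD.
  by apply: le_trans (CS _ _) _; rewrite nx mulr1; exact: nm_le_sqr.
apply: le_trans (cn_sum _ _ _) _.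
rewrite -sum_cst; apply: ler_sum => i _.
by apply: hT; rewrite mem_cat; apply/orP; left; apply/mapP; exists (i : nat) => //; rewrite mem_iota /=.
Qed.

Lemma null_state_seq (n : nat) (E : seq H) (T : seq Gam) (d : R) : 0 < d ->
  exists x : nat -> H, forall i, (i < n)%N ->
    [/\ L (x i), nm (x i) = 1, {in E, forall e, cn (dot (x i) e) <= d},
      {in T, forall t, cn (dot (p t (x i)) (x i) - phi t) <= d} &
      forall j t, (j < n)%N -> i != j -> t \in T -> cn (dot (p t (x i)) (x j)) <= d].
Proof.
move=> d0; apply: (@scattered_seq (fun x => {in T, forall t, cn (dot (p t x) x - phi t) <= d})).
by move=> E'; exact: hphi.
Qed.

Definition avg (n : nat) (h : nat -> Gam) (f : Gam -> R[i]) (t : Gam) : R[i] :=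
  n%:R^-1 * \sum_(i < n) f (t ^ (h i))%g.

(** The average is realised by the normalised sum of p (h i) (x i), where every x i approximates
    [phi] and the x i are scattered: the cross terms are negligible and the diagonal ones are the
    values of [phi] at conjugates. The case t = 1 computes the norm. *)
Lemma null_state_avg (n : nat) (h : nat -> Gam) : (0 < n)%N -> (forall i, G (h i)) ->
  null_state (avg n h phi).
Proof.
move=> n0 Gh E T d d0.
have n0R : 0 < n%:R :> R by rewrite ltr0n.
(* The numerator and the squared norm of [Y] are each wrong by at most n^2 d', hence after division
   by n a total of 2 n d' <= d. The 1/2 gives |Y|^2 >= n/2. *)
pose d' := Num.min d (1 / 2) / (2 * n%:R).
have d'0 : 0 < d' by rewrite divr_gt0 ?mulr_gt0 // lt_min d0 /=; lra.
have d'd : 2 * n%:R * d' <= d by rewrite mulrC /d' divfK ?ge_min ?lexx // gt_eqF // mulr_gt0.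
have d'1 : n%:R * d' <= 1 / 2.
  have : 2 * n%:R * d' <= 1 / 2 by rewrite mulrC /d' divfK ?ge_min ?lexx ?orbT // gt_eqF // mulr_gt0.
  have : 0 < n%:R * d' by rewrite mulr_gt0.
  by rewrite -mulrA => ? ?; lra.
pose I := iota 0 n.
pose T' := [seq ((h ij.2)^-1 * t * h ij.1)%g | t <- 1%g :: T, ij <- allpairs pair I I].
pose E' := [seq p (h i)^-1%g e | e <- E, i <- I].
have [x hx] := null_state_seq n E' T' d'0.
have inT' t i j : t \in 1%g :: T -> (i < n)%N -> (j < n)%N -> ((h j)^-1 * t * h i)%g \in T'.
  move=> tT hi hj; apply/allpairsP; exists (t, (i, j)); split => //=.
  by apply/allpairsP; exists (i, j); rewrite !mem_iota.
pose Y := \sum_(i < n) p (h i) (x i).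
have LY : L Y by apply: lsub_sum => // i _; apply: iL; [exact: Gh | by case: (hx i (ltn_ord i))].
have main t : t \in 1%g :: T ->
    cn (dot (p t Y) Y - \sum_(i < n) phi (t ^ (h i))%g) <= n%:R ^+ 2 * d'.
  move=> tT; rewrite /Y (lin_sum _ _ _ (urep_lin hp t)) dot_suml -sumrB.
  apply: le_trans (cn_sum _ _ _) _.
  have -> : n%:R ^+ 2 * d' = \sum_(i < n) \sum_(j < n) d'.
    by rewrite !sum_cst; ring.
  apply: ler_sum => i _; rewrite dot_sumr (bigD1 i) //= [X in _ <= X](bigD1 i) //= addrAC.
  have e j : dot (p t (p (h i) (x i))) (p (h j) (x j)) = dot (p ((h j)^-1 * t * h i)%g (x i)) (x j).
    by rewrite !(urepM hp) (urep_adj hp (h j)^-1%g) invgK.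
  have [_ _ _ h4 h5] := hx i (ltn_ord i).
  apply: le_trans (cnD _ _) _; apply: lerD.
    by rewrite e conjgE -mulgA in h4 *; rewrite mulgA; apply: h4; exact: inT'.
  apply: le_trans (cn_sum _ _ _) _; apply: ler_sum => j ji.
  by rewrite e; apply: h5 => //; [rewrite eq_sym | exact: inT'].
have nY : `|nm Y ^+ 2 - n%:R| <= n%:R ^+ 2 * d'.
  have := main 1%g; rewrite inE eqxx /= => /(_ isT).
  have -> : \sum_(i < n) phi (1 ^ (h i))%g = n%:R%:C.
    have e1 : phi 1%g = 1.
      apply/eqP; rewrite -subr_eq0 -cn_eq0; apply/eqP.
      apply: (small_eq0 (c := 1)) => [|e e0]; first exact: cn_ge0.
      have [z [_ nz _ hz]] := hphi [::] [:: 1%g] e0.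
      have := hz 1%g; rewrite inE eqxx => /(_ isT).
      by rewrite (urep1 hp) dotxx nz expr1n cnBC mul1r.
    under eq_bigr do rewrite conj1g e1.
    by rewrite sumr_const card_ord -(rmorph_nat (real_complex R)).
  by rewrite (urep1 hp) dotxx -rmorphB /= cn_real.
have nY2 : n%:R / 2 <= nm Y ^+ 2.
  move: nY; rewrite ler_norml => /andP[h1 _].
  have : n%:R ^+ 2 * d' <= n%:R * (1 / 2) by rewrite expr2 -mulrA ler_pM2l.
  lra.
have n1 : 1 <= n%:R :> R by rewrite ler1n.
have nY0 : 1 / 2 <= nm Y.
  by rewrite -(ler_pXn2r (n := 2)) ?nnegrE ?nm_ge0 //; lra.
have Y0 : Y != 0 by rewrite -nm_gt0; lra.
pose z := (nm Y)^-1%:C *: Y.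
have nz : nm z = 1 by exact: normalize.
have ez : Y = (nm Y)%:C *: z.
  by rewrite /z scalerA -rmorphM /= mulfV ?scale1r // gt_eqF // nm_gt0.
exists z; split=> //; first exact: lsubZ.
- move=> e eE; rewrite /z dotZl cnM cn_real ger0_norm ?invr_ge0 ?nm_ge0 //.
  have : cn (dot Y e) <= n%:R * d'.
    rewrite /Y dot_suml; apply: le_trans (cn_sum _ _ _) _.
    rewrite -sum_cst; apply: ler_sum => i _.
    have [_ _ h3 _ _] := hx i (ltn_ord i); rewrite (urep_adj hp); apply: h3.
    by apply/allpairsP; exists (e, i : nat); split=> //; rewrite mem_iota /=.
  move=> h1; rewrite mulrC ler_pdivrMr ?nm_gt0 //.
  apply: le_trans h1 _; apply: le_trans (_ : d * (1 / 2) <= _); first by lra.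
  by rewrite ler_pM2l.
- move=> t tT; have := main t; rewrite inE tT orbT => /(_ isT).
  set S := \sum_(i < n) _; rewrite {1 2}ez (linZ _ _ (urep_lin hp t)) dotZl dotZr.
  rewrite [conjc _]conjc_real mulrA -rmorphM /= -expr2.
  set q := dot _ _ => h1.
  have q1 : cn q <= 1 by apply: le_trans (CS _ _) _; rewrite urep_nm // nz mulr1.
  rewrite -(ler_pM2l n0R) -[X in X * cn _](ger0_norm (ltW n0R)) -cn_real -cnM.
  have -> : n%:R%:C * (q - avg n h phi t) =
      ((nm Y ^+ 2)%:C * q - S) - (nm Y ^+ 2 - n%:R)%:C * q.
    have -> : n%:R%:C * (q - avg n h phi t) = n%:R%:C * q - S.
      rewrite mulrBr /avg mulrA -(rmorph_nat (real_complex R)) -fmorphV /= -rmorphM /=.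
      by rewrite mulfV ?gt_eqF // mul1r.
    by rewrite rmorphB /=; ring.
  apply: le_trans (cnB _ _) _; rewrite cnM cn_real.
  have h2 : `|nm Y ^+ 2 - n%:R| * cn q <= n%:R ^+ 2 * d' * 1.
    by apply: ler_pM => //; exact: cn_ge0.
  have := ler_wpM2l (ltW n0R) d'd; rewrite mulrA; lra.
Qed.

End FreeVectors.

(** * Making a state small on a finite set by averaging over conjugates *)

Section Stages.
Variables (R : realType) (H : hilbertType R) (Gam : groupType) (p : Gam -> H -> H).
Hypothesis hp : urep p.
Variables (G : set Gam) (L : set H).
Hypotheses (sG : sgp G) (sL : lsub L) (iL : invariant p G L).

Lemma cenM c d : cen p G L c -> cen p G L d -> cen p G L (c * d)%g.
Proof.
move=> [Gc hc] [Gd hd]; split; first exact: sgpM.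
by move=> g x Gg Lx; rewrite !(urepM hp) hd // hc //; exact: iL.
Qed.

Lemma cen1 : cen p G L 1%g.
Proof. by split=> [|g x _ _]; [exact: sgp1 | rewrite !(urep1 hp)]. Qed.

Lemma cenX c n : cen p G L c -> cen p G L (c ^+ n)%g.
Proof. by move=> hc; elim: n => [|n IH]; [exact: cen1 | rewrite expgS; exact: cenM]. Qed.

Lemma cenJ c h x : cen p G L c -> G h -> L x -> p (c ^ h)%g x = p c x.
Proof.
move=> [Gc hc] Gh Lx; rewrite conjgE !(urepM hp) hc // (urepK hp) //.
Qed.

Lemma conj_shift s c h x : G s -> G h -> cen p G L c -> L x ->
  p ((s * c) ^ h)%g x = p (s * ([~ s, h] * c))%g x.
Proof.
move=> Gs Gh hc Lx; rewrite conjMg (urepM hp (s ^ h)%g). rewrite (cenJ hc Gh Lx).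
by rewrite -(urepM hp) mulgA commgEl mulVKg.
Qed.

Lemma conj_power s c y i x : G s -> G y -> cen p G L [~ s, y]%g -> cen p G L c -> L x ->
  p ((s * c) ^ (y ^+ i))%g x = p ([~ s, y] ^+ i * (s * c))%g x.
Proof.
move=> Gs Gy hw hc; elim: i x => [|i IH] x Lx; first by rewrite conjg1 mul1g.
have Gy' := sgpV sG Gy.
have [Gwi hwi] := cenX i hw.
have Lyx : L (p y x) by exact: iL.
have Gsc : G (s * c)%g by apply: sgpM => //; case: hc.
have pJ u z : p (u ^ y)%g z = p y^-1%g (p u (p y z)).
  by rewrite -(urepM hp u) -(urepM hp y^-1%g).
rewrite expgSr conjgM pJ IH // (urepM hp ([~ s, y] ^+ i)%g).
rewrite -hwi //; last exact: iL.
rewrite -pJ (conj_shift Gs Gy hc Lx).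
have Lcx : L (p c x) by apply: iL => //; case: hc.
rewrite (urepM hp s) (urepM hp [~ s, y]%g) -(hw.2 s) //.
by rewrite -!(urepM hp) expgSr !mulgA.
Qed.

Lemma cn_avg n (h : nat -> Gam) f t (d : R) : (0 < n)%N ->
  (forall i, (i < n)%N -> cn (f (t ^ h i)%g) <= d) -> cn (avg n h f t) <= d.
Proof.
move=> n0 hd; have n0R : 0 < n%:R :> R by rewrite ltr0n.
rewrite /avg cnM cnV -(rmorph_nat (real_complex R)) cn_real ger0_norm ?(ltW n0R) //.
rewrite ler_pdivrMl // -sum_cst; apply: le_trans (cn_sum _ _ _) _.
by apply: ler_sum => i _; exact: hd.
Qed.

(** Averaging over conjugation by powers of y turns the value at s c into a mean over powers of
    [s, y], small by [null_state_gap]. The bound is uniform in the central factor c because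
    conjugation by h sends s c to s ([s, h] c), of the same form: later averages do not spoil
    earlier bounds. *)
Lemma stage_gap (S : seq Gam) (d : R) (phi : Gam -> R[i]) : 0 < d ->
  null_state p L phi ->
  {in S, forall s, [/\ G s, forall h, G h -> cen p G L [~ s, h]%g &
    exists y k, [/\ G y, 0 < k & gap p L k [~ s, y]%g]]} ->
  exists psi, null_state p L psi /\
    {in S, forall s c, cen p G L c -> cn (psi (s * c)%g) <= d}.
Proof.
move=> d0 hphi; elim: S => [|s S IH] hS; first by exists phi.
have [|psi [npsi hpsi]] := IH; first by move=> s' h; apply: hS; rewrite inE h orbT.
have [Gs cs [y [k [Gy k0 gk]]]] : [/\ G s, forall h, G h -> cen p G L [~ s, h]%g &
    exists y k, [/\ G y, 0 < k & gap p L k [~ s, y]%g]] by apply: hS; rewrite inE eqxx.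
have [M hM] := harmonic_small (2 / k) d0.
pose h i := (y ^+ i)%g.
have Gh i : G (h i) by exact: sgpX.
exists (avg M.+1 h psi); split; first exact: (null_state_avg hp sL iL npsi).
move=> s'; rewrite inE => /orP[/eqP->|s'S] c hc; last first.
  have [Gs' cs' _] : [/\ G s', forall h, G h -> cen p G L [~ s', h]%g &
    exists y k, [/\ G y, 0 < k & gap p L k [~ s', y]%g]] by apply: hS; rewrite inE s'S orbT.
  apply: cn_avg => // i _.
  rewrite (null_state_eq npsi (t' := (s' * ([~ s', h i] * c))%g)); last first.
    by move=> x Lx; exact: conj_shift.
  by apply: hpsi => //; apply: cenM => //; exact: cs'.
have Gsc : G (s * c)%g by apply: sgpM => //; case: hc.
have M0 : 0 < M.+1%:R :> R by rewrite ltr0n.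
rewrite /avg cnM cnV -(rmorph_nat (real_complex R)) cn_real ger0_norm ?(ltW M0) //.
rewrite ler_pdivrMl //.
have -> : \sum_(i < M.+1) psi ((s * c) ^ h i)%g = \sum_(i < M.+1) psi ([~ s, y] ^+ i * (s * c))%g.
  apply: eq_bigr => i _; apply: (null_state_eq npsi) => x Lx.
  by apply: conj_power => //; exact: cs.
have := null_state_gap hp sG sL iL npsi M.+1 (cs y Gy).1 Gsc k0 gk.
rewrite -ler_pdivlMl // => /le_trans; apply.
have := hM M (leqnn _) => /ltW; rewrite ler_pdivrMr // mulrC => h1.
by rewrite [leRHS]mulrC.
Qed.

(** With M > 8 / e^2 and b = M e / 2, the term M is at most half of b^2; d <= e^2 / 16 gives the
    other half, and d <= e / 2 the last inequality. *)
Lemma stage_params (e : R) : 0 < e -> exists (M : nat) (d b : R),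
  [/\ (0 < M)%N, 0 < d, 0 <= b, M%:R + 2 * M%:R ^+ 2 * d <= b ^+ 2 & b + M%:R * d <= M%:R * e].
Proof.
move=> e0; have e20 : 0 < e ^+ 2 by rewrite exprn_gt0.
have [N hN] := harmonic_small 8 e20.
have := hN N (leqnn _); rewrite ltr_pdivrMr ?ltr0n // => {}hN.
pose d := Num.min (e ^+ 2 / 16) (e / 2).
have d0 : 0 < d by rewrite lt_min !divr_gt0.
have d1 : d <= e ^+ 2 / 16 by rewrite ge_min lexx.
have d2 : d <= e / 2 by rewrite ge_min lexx orbT.
exists N.+1, d, (N.+1%:R * e / 2).
have n0 : 0 < N.+1%:R :> R by rewrite ltr0n.
move: (N.+1%:R : R) n0 hN => n n0 hN; split=> //.
- by rewrite divr_ge0 ?mulr_ge0 ?(ltW n0) ?(ltW e0).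
- have h1 := ler_wpM2l (ltW n0) (ltW hN).
  have n20 : 0 <= n ^+ 2 by rewrite sqr_ge0.
  have h2 := ler_wpM2l n20 d1.
  have -> : (n * e / 2) ^+ 2 = n ^+ 2 * e ^+ 2 / 4 by field.
  have e1 : n * (e ^+ 2 * n) = n ^+ 2 * e ^+ 2 by ring.
  rewrite e1 in h1; have e2 : n ^+ 2 * (e ^+ 2 / 16) = n ^+ 2 * e ^+ 2 / 16 by ring.
  rewrite e2 in h2; rewrite -mulrA; move: (n ^+ 2 * e ^+ 2) (n ^+ 2 * d) h1 h2 => u v.
  lra.
- have := ler_wpM2l (ltW n0) d2; lra.
Qed.

(** Smallness now comes from near orthogonality instead of a gap: the quotients of the conjugates of
    s n by distinct powers of y fall into [Q], where the state is already small. Invariance of [Q]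
    and of the cosets s N under conjugation preserves the bounds obtained before. *)
Lemma stage_orth (Q N : set Gam) (S : seq Gam) (M : nat) (d b e : R) (phi : Gam -> R[i]) :
  (0 < M)%N -> 0 < d -> 0 <= b -> M%:R + 2 * M%:R ^+ 2 * d <= b ^+ 2 ->
  b + M%:R * d <= M%:R * e ->
  null_state p L phi -> (forall t, Q t -> cn (phi t) <= d) ->
  (forall t h, Q t -> G h -> Q (t ^ h)%g) ->
  {in S, forall s, (forall n h, N n -> G h -> exists2 m, N m & ((s * n) ^ h = s * m)%g) /\
    exists2 y, G y & forall n i j, N n -> (i < M)%N -> (j < M)%N -> i != j ->
      Q (((s * n) ^ (y ^+ j))^-1 * (s * n) ^ (y ^+ i))%g} ->
  exists psi, [/\ null_state p L psi, forall t, Q t -> cn (psi t) <= d &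
    {in S, forall s n, N n -> cn (psi (s * n)%g) <= e}].
Proof.
move=> M0 d0 b0 hb he nphi hphi QJ; elim: S => [|s S IH] hS; first by exists phi.
have [|psi [npsi Qpsi hpsi]] := IH; first by move=> s' h; apply: hS; rewrite inE h orbT.
have [NJ [y Gy hy]] : (forall n h, N n -> G h -> exists2 m, N m & ((s * n) ^ h = s * m)%g) /\
    exists2 y, G y & forall n i j, N n -> (i < M)%N -> (j < M)%N -> i != j ->
      Q (((s * n) ^ (y ^+ j))^-1 * (s * n) ^ (y ^+ i))%g by apply: hS; rewrite inE eqxx.
pose h i := (y ^+ i)%g.
have Gh i : G (h i) by exact: sgpX.
exists (avg M h psi); split; first exact: (null_state_avg hp sL iL npsi).
  by move=> t Qt; apply: cn_avg => // i _; apply: Qpsi; exact: QJ.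
move=> s'; rewrite inE => /orP[/eqP->|s'S] n Nn; last first.
  have [NJ' _] : (forall n h, N n -> G h -> exists2 m, N m & ((s' * n) ^ h = s' * m)%g) /\
    exists2 y, G y & forall n i j, N n -> (i < M)%N -> (j < M)%N -> i != j ->
      Q (((s' * n) ^ (y ^+ j))^-1 * (s' * n) ^ (y ^+ i))%g by apply: hS; rewrite inE s'S orbT.
  apply: cn_avg => // i _; have [m Nm ->] := NJ' n (h i) Nn (Gh i).
  exact: hpsi.
have M0R : 0 < M%:R :> R by rewrite ltr0n.
rewrite /avg cnM cnV -(rmorph_nat (real_complex R)) cn_real ger0_norm ?(ltW M0R) //.
rewrite ler_pdivrMl //; apply: le_trans he.
apply: (null_state_orth hp npsi (t := fun i => ((s * n) ^ h i)%g)) => // i j iM jM ij.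
by apply: Qpsi; exact: hy.
Qed.

(* What the main construction needs: unit vectors almost orthogonal to a given
   finite set, and to their own translates under [S]. *)
Definition free_vectors (S : seq Gam) := forall (E : seq H) (d : R), 0 < d ->
  exists x, [/\ L x, nm x = 1, {in E, forall e, cn (dot x e) <= d} &
    {in S, forall s, cn (dot (p s x) x) <= d}].

Lemma free_of_states (S : seq Gam) :
  (forall d : R, 0 < d -> exists2 phi, null_state p L phi & {in S, forall s, cn (phi s) <= d}) ->
  free_vectors S.
Proof.
move=> h E d d0; have d20 : 0 < d / 2 by rewrite divr_gt0.
have [phi nphi hphi] := h _ d20.
have [x [Lx nx hE hS]] := nphi E S _ d20.
exists x; split=> //.
  by move=> e /hE he; lra.
move=> s sS; have := hS s sS; have := hphi s sS.
have := cnD (dot (p s x) x - phi s) (phi s); rewrite subrK; lra.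
Qed.

End Stages.

(** * Calculus of almost commuting operators *)

Section AlmostCommuting.
Variables (R : realType) (H : hilbertType R).
Implicit Types (X Y U : H -> H) (e : R).

Definition bnd X (c : R) := forall x, nm (X x) <= c * nm x.
Definition adj X X' := forall x y, dot (X x) y = dot x (X' y).
Definition acm U e X := forall x, nm (U (X x) - X (U x)) <= e * nm x.

Lemma adj_sym X X' : adj X X' -> adj X' X.
Proof. by move=> h x y; rewrite dotC -h -dotC. Qed.

Lemma nm_dual (x : H) (c : R) : 0 <= c ->
  (forall y, complex.Re (dot x y) <= c * nm y) -> nm x <= c.
Proof.
move=> c0 h; have [->|x0] := eqVneq x 0; first by rewrite nm0.
by have := h x; rewrite Re_dotxx expr2 ler_pM2r // nm_gt0.
Qed.

Lemma bnd_adj X X' c : 0 <= c -> adj X X' -> bnd X c -> bnd X' c.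
Proof.
move=> c0 a b x; apply: nm_dual => [|y]; first by rewrite mulr_ge0 ?nm_ge0.
rewrite Re_dotC -a; apply: le_trans (Re_dot_le _ _) _.
by rewrite -mulrA (mulrC (nm x)) mulrA ler_wpM2r ?nm_ge0.
Qed.

Lemma acm_adj U U' X X' e : 0 <= e -> adj U U' -> adj X X' -> acm U' e X -> acm U e X'.
Proof.
move=> e0 aU aX h x; apply: nm_dual => [|y]; first by rewrite mulr_ge0 ?nm_ge0.
have -> : dot (U (X' x) - X' (U x)) y = dot x (X (U' y) - U' (X y)).
  by rewrite dotBl dotBr aU (adj_sym aX) (adj_sym aX (U x)) aU.
apply: le_trans (Re_dot_le _ _) _; rewrite nmBC -mulrA mulrCA.
by rewrite ler_wpM2l ?nm_ge0.
Qed.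

Lemma acmM U X Y e1 e2 a b : lin X -> 0 <= e1 -> 0 <= a -> acm U e1 X -> acm U e2 Y ->
  bnd X a -> bnd Y b -> acm U (e1 * b + a * e2) (fun x => X (Y x)).
Proof.
move=> lX e10 a0 hX hY bX bY x.
have -> : U (X (Y x)) - X (Y (U x)) = (U (X (Y x)) - X (U (Y x))) + X (U (Y x) - Y (U x)).
  by rewrite (linB _ _ lX) addrA subrK.
apply: le_trans (nmD _ _) _; rewrite mulrDl; apply: lerD.
  by apply: le_trans (hX _) _; rewrite -mulrA ler_wpM2l.
by apply: le_trans (bX _) _; rewrite -mulrA ler_wpM2l.
Qed.

Lemma acmD U X Y e1 e2 : lin U -> acm U e1 X -> acm U e2 Y -> acm U (e1 + e2) (fun x => X x + Y x).
Proof.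
move=> lU hX hY x; rewrite (linD _ _ lU) opprD addrACA mulrDl.
by apply: le_trans (nmD _ _) _; apply: lerD.
Qed.

Lemma acmN U X e : lin U -> acm U e X -> acm U e (fun x => - X x).
Proof. by move=> lU h x; rewrite (linN _ lU) -opprD nmN. Qed.

Lemma acm_le U X e e' : e <= e' -> acm U e X -> acm U e' X.
Proof. by move=> le h x; apply: le_trans (h x) _; rewrite ler_wpM2r ?nm_ge0. Qed.

(* Almost invariance of the range of a projection under U and its adjoint. *)
Lemma acm_pj (I : finType) (v : I -> H) U U' e : onf v -> lin U -> adj U U' -> 0 <= e ->
  (forall x, pj v x = x -> nm (U x - pj v (U x)) <= e * nm x) ->
  (forall x, pj v x = x -> nm (U' x - pj v (U' x)) <= e * nm x) ->
  acm U (2 * e) (pj v).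
Proof.
move=> ov lU aU e0 h h' x.
have lP := pj_lin v; pose y := pj v (U (x - pj v x)).
have -> : U (pj v x) - pj v (U x) = (U (pj v x) - pj v (U (pj v x))) - y.
  by rewrite /y (linB _ _ lU) (linB _ _ lP) opprB addrA subrK.
have hy : nm y <= e * nm x.
  have py : pj v y = y by rewrite /y pj_idem.
  have zP : pj v (x - pj v x) = 0 by rewrite (linB _ _ lP) pj_idem // subrr.
  have h1 : nm y ^+ 2 = complex.Re (dot (x - pj v x) (U' y - pj v (U' y))).
    rewrite -Re_dotxx dotBr -(pj_adj v (x - pj v x)) zP dot0l subr0 -aU.
    by rewrite {1}/y pj_adj py.
  have h2 : nm y ^+ 2 <= nm x * (e * nm y).
    rewrite h1; apply: le_trans (Re_dot_le _ _) _; apply: ler_pM; rewrite ?nm_ge0 //.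
      exact: pjc_nm.
    exact: h'.
  have [->|y0] := eqVneq y 0; first by rewrite nm0 mulr_ge0 ?nm_ge0.
  by move: h2; rewrite expr2 mulrA ler_pM2r ?nm_gt0 // mulrC.
apply: le_trans (nmB _ _) _.
have := h (pj v x) (pj_idem ov x); have := ler_wpM2l e0 (pj_nm ov x); lra.
Qed.

End AlmostCommuting.

(** * Slowly varying cut-offs along a filtration *)

Section Filtration.
Variables (R : realType) (H : hilbertType R) (Gam : groupType) (p : Gam -> H -> H).
Hypothesis hp : urep p.
Variables (F : seq Gam) (P : nat -> H -> H).
Hypothesis FV : {in F, forall h, h^-1%g \in F}.
Hypothesis linP : forall j, lin (P j).
Hypothesis P0 : forall x, P 0 x = 0.
Hypothesis adjP : forall j x y, dot (P j x) y = dot x (P j y).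
Hypothesis PP : forall i j x, (i <= j)%N -> P j (P i x) = P i x.
Hypothesis PF : forall h j x, h \in F -> P j.+1 (p h (P j x)) = p h (P j x).

Lemma PPl i j x : (i <= j)%N -> P i (P j x) = P i x.
Proof.
by move=> ij; apply: dot_inj => z; rewrite adjP adjP PP // adjP.
Qed.

Let Q j x := P j.+1 x - P j x.

Lemma P_pythag j x : nm (P j.+1 x) ^+ 2 = nm (P j x) ^+ 2 + nm (Q j x) ^+ 2.
Proof.
rewrite -pythag; first by rewrite addrC subrK.
by rewrite adjP /Q (linB _ _ (linP j)) PPl // PP // subrr dot0r.
Qed.

Lemma P_nm j x : nm (P j x) <= nm x.
Proof.
apply: nm_le_sqr; first exact: nm_ge0.
have -> : nm x ^+ 2 = nm (P j x) ^+ 2 + nm (x - P j x) ^+ 2.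
  rewrite -pythag; first by rewrite addrC subrK.
  by rewrite adjP (linB _ _ (linP j)) PP // subrr dot0r.
by rewrite lerDl sqr_ge0.
Qed.

Lemma sum_Q_sqr m x : \sum_(j < m) nm (Q j x) ^+ 2 = nm (P m x) ^+ 2.
Proof.
elim: m => [|m IH]; first by rewrite big_ord0 P0 nm0 expr0n.
by rewrite big_ord_recr /= IH P_pythag.
Qed.

Variable m : nat.

(* The operator equal to f j on the j-th layer, and to f m off the filtration. *)
Definition diag (f : nat -> R) x := \sum_(j < m) (f j)%:C *: Q j x + (f m)%:C *: (x - P m x).

Lemma diag_lin f : lin (diag f).
Proof.
move=> k x y; rewrite /diag (linP m) opprD addrACA -(scalerBr k) (scalerDr (f m)%:C).
rewrite [in RHS](scalerDr k) scaler_sumr [RHS]addrACA -big_split /=; congr (_ + (_ + _)).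
  apply: eq_bigr => j _; rewrite /Q !linP opprD addrACA -(scalerBr k) (scalerDr (f j)%:C).
  by rewrite !scalerA (mulrC k).
by rewrite !scalerA (mulrC k).
Qed.

Let QQ i j x : Q i (Q j x) = if i == j then Q j x else 0.
Proof.
have [->|] := eqVneq i j.
  rewrite /Q (linB _ _ (linP j.+1)) (linB _ _ (linP j)).
  by rewrite !(PP _ (leqnn _)) (PP x (leqnSn j)) (PPl x (leqnSn j)) subrr subr0.
rewrite neq_ltn => /orP[ij|ji]; rewrite /Q (linB _ _ (linP i.+1)) (linB _ _ (linP i)).
  have h1 : (i.+1 <= j.+1)%N by exact: ltnW.
  have h2 : (i <= j.+1)%N by exact: ltnW.
  by rewrite (PPl x h1) (PPl x ij) (PPl x h2) (PPl x (ltnW ij)) !subrr.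
have h1 : (j.+1 <= i.+1)%N by exact: ltnW.
by rewrite (PP x h1) (PP x (ltnW h1)) (PP x ji) (PP x (ltnW ji)) subrr.
Qed.

Let PmQ j x : (j < m)%N -> P m (Q j x) = Q j x.
Proof. by move=> jm; rewrite /Q (linB _ _ (linP m)) !PP // ltnW. Qed.

Let QPm j x : (j < m)%N -> Q j (P m x) = Q j x.
Proof. by move=> jm; rewrite /Q !PPl // ltnW. Qed.

Lemma sumQ x : \sum_(j < m) Q j x = P m x.
Proof.
rewrite -(big_mkord xpredT (fun j => P j.+1 x - P j x)) telescope_sumr //.
by rewrite P0 subr0.
Qed.

Lemma diagM f g x : diag f (diag g x) = diag (fun j => f j * g j) x.
Proof.
have Qd j : (j < m)%N -> Q j (diag g x) = (g j)%:C *: Q j x.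
  move=> jm; have lQ : lin (Q j).
    by move=> k y z; rewrite /Q !linP opprD addrACA -scalerBr.
  rewrite /diag (linD _ _ lQ) (linZ _ _ lQ) (linB _ _ lQ) QPm // subrr scaler0 addr0.
  rewrite (lin_sum _ _ _ lQ) (bigD1 (Ordinal jm)) //= (linZ _ _ lQ) QQ eqxx.
  rewrite big1 ?addr0 // => i ij; rewrite (linZ _ _ lQ) QQ eq_sym.
  by rewrite (negPf (_ : (i : nat) != j)) ?scaler0.
have Pd : diag g x - P m (diag g x) = (g m)%:C *: (x - P m x).
  rewrite /diag (linD _ _ (linP m)) (linZ _ _ (linP m)) (linB _ _ (linP m)) PP // subrr.
  rewrite scaler0 addr0 (lin_sum _ _ _ (linP m)) [X in _ - X](_ : _ = \sum_(j < m) (g j)%:C *: Q j x).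
    by rewrite addrAC subrr add0r.
  by apply: eq_bigr => j _; rewrite (linZ _ _ (linP m)) PmQ.
rewrite {1}/diag Pd scalerA -rmorphM /=; congr (_ + _).
by apply: eq_bigr => j _; rewrite Qd // scalerA -rmorphM.
Qed.

Lemma diagD f g x : diag f x + diag g x = diag (fun j => f j + g j) x.
Proof.
rewrite /diag addrACA -big_split /= -scalerDl -rmorphD /=; congr (_ + _).
by apply: eq_bigr => j _; rewrite -scalerDl -rmorphD.
Qed.

Lemma eq_diag f g x : (forall j, (j <= m)%N -> f j = g j) -> diag f x = diag g x.
Proof.
move=> h; rewrite /diag h //; congr (_ + _); apply: eq_bigr => j _.
by rewrite h // ltnW.
Qed.

Lemma diag_const c x : diag (fun=> c) x = c%:C *: x.
Proof. by rewrite /diag -scaler_sumr sumQ -scalerDr addrC subrK. Qed.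

Lemma diag_adj f x y : dot (diag f x) y = dot x (diag f y).
Proof.
have aQ j u w : dot (Q j u) w = dot u (Q j w) by rewrite /Q dotBl dotBr !adjP.
rewrite /diag dotDl dotDr dotZl dotZr dotBl dotBr adjP [conjc _]conjc_real.
rewrite dot_suml dot_sumr; congr (_ + _); apply: eq_bigr => j _.
by rewrite dotZl dotZr aQ [conjc _]conjc_real.
Qed.

Lemma diag_P1 f x : (0 < m)%N -> P 1 x = x -> diag f x = (f 0)%:C *: x.
Proof.
move=> m0 hx; rewrite /diag -{2 3}hx PP // hx subrr scaler0 addr0.
rewrite (bigD1 (Ordinal m0)) //= /Q hx P0 subr0 big1 ?addr0 // => j j0.
rewrite -hx !PP ?subrr ?scaler0 //; case: j j0 => [[|j]] //.
Qed.

Lemma diag_in f x : f m = 0 -> P m (diag f x) = diag f x.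
Proof.
move=> fm; rewrite /diag fm scale0r addr0 (lin_sum _ _ _ (linP m)).
by apply: eq_bigr => j _; rewrite (linZ _ _ (linP m)) PmQ.
Qed.

Lemma diag_pres f x : P m x = x -> P m (diag f x) = diag f x.
Proof.
move=> hx; rewrite /diag hx subrr scaler0 addr0 (lin_sum _ _ _ (linP m)).
by apply: eq_bigr => j _; rewrite (linZ _ _ (linP m)) PmQ.
Qed.

Lemma diagP f x : f m = 0 -> diag f (P m x) = diag f x.
Proof.
move=> fm; rewrite /diag fm !scale0r; congr (_ + _).
by apply: eq_bigr => j _; rewrite QPm.
Qed.

Lemma diag_bnd f (c : R) : (forall j, (j <= m)%N -> `|f j| <= c) -> bnd (diag f) c.
Proof.
move=> h x; have c0 : 0 <= c := le_trans (normr_ge0 _) (h 0 (leq0n _)).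
apply: nm_le_sqr; first by rewrite mulr_ge0 ?nm_ge0.
rewrite -Re_dotxx diag_adj diagM /diag dotDr ReD dotZr [conjc _]conjc_real ReZ.
rewrite dot_sumr Re_sum.
have e2 : complex.Re (dot x (x - P m x)) = nm (x - P m x) ^+ 2.
  rewrite -Re_dotxx dotBl (adjP m x (x - P m x)) (linB _ _ (linP m)) PP // subrr.
  by rewrite dot0r subr0.
have e3 : nm x ^+ 2 = \sum_(j < m) nm (Q j x) ^+ 2 + nm (x - P m x) ^+ 2.
  rewrite sum_Q_sqr -pythag; first by rewrite addrC subrK.
  by rewrite adjP (linB _ _ (linP m)) PP // subrr dot0r.
have sq j : (j <= m)%N -> f j * f j <= c ^+ 2.
  by move=> jm; rewrite -expr2 -real_normK ?num_real // ler_pXn2r ?nnegrE // h.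
rewrite e2 exprMn e3 mulrDr; apply: lerD; last by rewrite ler_wpM2r ?sqr_ge0 ?sq.
rewrite mulr_sumr; apply: ler_sum => j _.
have e1 : complex.Re (dot x (Q j x)) = nm (Q j x) ^+ 2.
  rewrite -Re_dotxx {2}/Q dotBl !adjP -dotBr; congr (complex.Re (dot _ _)).
  by rewrite -/(Q j (Q j x)) QQ eqxx.
rewrite dotZr [conjc _]conjc_real ReZ e1 ler_wpM2r ?sqr_ge0 // sq //.
exact: ltnW.
Qed.

Let A h j x := p h (P j x) - P j (p h (P j x)).

Let A_orth h i j x y : h \in F -> i != j -> dot (A h i x) (A h j y) = 0.
Proof.
move=> hF; have lt u w a b : (u < w)%N -> dot (A h u a) (A h w b) = 0.
  move=> uw; have -> : A h u a = P w (A h u a).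
    rewrite /A (linB _ _ (linP w)) (@PP u w) ?(ltnW uw) //; congr (_ - _).
    by rewrite -{1}(PF u a hF) -[in RHS](PF u a hF) PP.
  rewrite adjP /A (linB _ _ (linP w)) PP // subrr dot0r //.
by rewrite neq_ltn => /orP[/lt//|/lt h1]; rewrite dotC h1 conjc0.
Qed.

Let A_nm h j x : h \in F -> nm (A h j.+1 x) <= nm (Q j x).
Proof.
move=> hF; have -> : A h j.+1 x = p h (Q j x) - P j.+1 (p h (Q j x)).
  rewrite /A /Q (linB _ _ (urep_lin hp h)) (linB _ _ (linP j.+1)) PF //.
  by rewrite opprB addrA subrK.
rewrite -(urep_nm hp h (Q j x)).
apply: nm_le_sqr; first exact: nm_ge0.
have -> : nm (p h (Q j x)) ^+ 2 = nm (P j.+1 (p h (Q j x))) ^+ 2 +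
    nm (p h (Q j x) - P j.+1 (p h (Q j x))) ^+ 2.
  rewrite -pythag; first by rewrite addrC subrK.
  by rewrite adjP (linB _ _ (linP _)) PP // subrr dot0r.
by rewrite lerDr sqr_ge0.
Qed.

Let TA (f : nat -> R) h x := \sum_(j < m) (f j.+1 - f j)%:C *: A h j.+1 x.

Let TA_bnd f h (a : R) : h \in F -> (forall j, (j < m)%N -> `|f j.+1 - f j| <= a) ->
  0 <= a -> bnd (TA f h) a.
Proof.
move=> hF hf a0 x; apply: nm_le_sqr; first by rewrite mulr_ge0 ?nm_ge0.
rewrite /TA nm_sqr_sum_orth => [|i j ij]; last first.
  by rewrite dotZl dotZr A_orth ?mulr0 // eqSS.
rewrite exprMn; apply: le_trans (_ : \sum_(j < m) a ^+ 2 * nm (Q j x) ^+ 2 <= _).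
  apply: ler_sum => j _; rewrite nmZ cn_real exprMn.
  apply: ler_pM; rewrite ?sqr_ge0 //.
    by rewrite ler_pXn2r ?nnegrE ?normr_ge0 ?hf.
  by rewrite ler_pXn2r ?nnegrE ?nm_ge0 ?A_nm.
rewrite -mulr_sumr sum_Q_sqr ler_wpM2l ?sqr_ge0 //.
by rewrite ler_pXn2r ?nnegrE ?nm_ge0 ?P_nm.
Qed.

Let TA' (f : nat -> R) h x := \sum_(j < m) (f j.+1 - f j)%:C *: P j.+1 (p h (x - P j.+1 x)).

Let TA_adj f h : adj (TA f h) (TA' f h^-1%g).
Proof.
move=> x y; rewrite /TA /TA' dot_suml dot_sumr; apply: eq_bigr => j _.
rewrite dotZl dotZr [conjc _]conjc_real; congr (_ * _).
by rewrite /A dotBl adjP -dotBr (urep_adj hp) adjP.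
Qed.

(** Summation by parts expresses the commutator through (f (j+1) - f j) [p h, P (j+1)]. The halves
    (1 - P) p h P have mutually orthogonal ranges, and each sees only layer j because p h maps P j
    into P (j+1). So the sum costs the Lipschitz constant once, not m times. The other halves are
    adjoints of such sums for the inverse of h. *)
Lemma diag_acm f h (a : R) : h \in F -> 0 <= a ->
  (forall j, (j < m)%N -> `|f j.+1 - f j| <= a) -> acm (p h) (2 * a) (diag f).
Proof.
move=> hF a0 hf x.
have -> : p h (diag f x) - diag f (p h x) = TA' f h x - TA f h x.
  have lh := urep_lin hp h.
  pose c j := p h (P j x) - P j (p h x).
  have c0 : c 0 = 0 by rewrite /c !P0 (lin0 lh) subrr.
  have e1 : p h (diag f x) - diag f (p h x) =
      \sum_(j < m) (f j)%:C *: (c j.+1 - c j) - (f m)%:C *: c m.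
    rewrite /diag (linD _ _ lh) (linZ _ _ lh) (linB _ _ lh) (lin_sum _ _ _ lh).
    rewrite opprD addrACA -scalerBr -sumrB; congr (_ + _).
      apply: eq_bigr => j _; rewrite (linZ _ _ lh) -scalerBr /Q (linB _ _ lh) /c.
      by congr (_ *: _); rewrite !opprB addrACA [RHS]addrACA; congr (_ + _); rewrite addrC.
    rewrite -scalerN /c; congr (_ *: _).
    by rewrite !opprB addrC addrA subrK.
  rewrite e1 /TA /TA' -sumrB.
  have -> : \sum_(j < m) (f j)%:C *: (c j.+1 - c j) - (f m)%:C *: c m =
      \sum_(j < m) - ((f j.+1 - f j)%:C *: c j.+1).
    elim: (m) => [|n IH]; first by rewrite !big_ord0 c0 scaler0 subrr.
    rewrite !big_ord_recr /= -IH; move: (c n.+1) (c n) (bigop.body _ _ _) => u v w.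
    by rewrite -!addrA; congr (_ + _); rewrite scalerBr rmorphB /= scalerBl opprB -addrA addrCA.
  apply: eq_bigr => j _; rewrite -scalerBr -scalerN; congr (_ *: _).
  rewrite /c /A (opprB (p h _)) (linB _ _ lh) (linB _ _ (linP j.+1)).
  by rewrite opprB addrA subrK.
apply: le_trans (nmB _ _) _.
have hF' := FV hF.
have h1 := TA_bnd hF hf a0 x.
have := bnd_adj a0 (TA_adj f h^-1%g) (TA_bnd hF' hf a0) x; rewrite invgK; lra.
Qed.

End Filtration.

Section LinearClosure.
Variables (R : realType) (H : hilbertType R).
Implicit Types X Y : H -> H.

Lemma lin_id : lin (fun x : H => x). Proof. by []. Qed.

Lemma lin_add X Y : lin X -> lin Y -> lin (fun x => X x + Y x).
Proof. by move=> hX hY k x y; rewrite hX hY addrACA -scalerDr. Qed.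

Lemma lin_opp X : lin X -> lin (fun x => - X x).
Proof. by move=> hX k x y; rewrite hX opprD -scalerN. Qed.

Lemma lin_comp X Y : lin X -> lin Y -> lin (fun x => X (Y x)).
Proof. by move=> hX hY k x y; rewrite hY hX. Qed.

Lemma dot3l (x y z w : H) : dot (x + (- y + z)) w = dot x w + (- dot y w + dot z w).
Proof. by rewrite !dotDl dotNl. Qed.

Lemma dot3r (x y z w : H) : dot w (x + (- y + z)) = dot w x + (- dot w y + dot w z).
Proof. by rewrite !dotDr dotNr. Qed.

End LinearClosure.

(** * Rotating an almost invariant subspace onto prescribed vectors *)

Section Absorption.
Variables (R : realType) (H : hilbertType R) (Gam : groupType) (p : Gam -> H -> H).
Hypothesis hp : urep p.
Variables (F : seq Gam) (P : nat -> H -> H).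
Hypothesis FV : {in F, forall h, h^-1%g \in F}.
Hypothesis linP : forall j, lin (P j).
Hypothesis P0 : forall x, P 0 x = 0.
Hypothesis adjP : forall j x y, dot (P j x) y = dot x (P j y).
Hypothesis PP : forall i j x, (i <= j)%N -> P j (P i x) = P i x.
Hypothesis PF : forall h j x, h \in F -> P j.+1 (p h (P j x)) = p h (P j x).
Variables (m : nat) (I : finType) (t : I -> H) (J J' : H -> H) (e : R).
Hypotheses (m0 : (0 < m)%N) (e0 : 0 <= e) (ot : onf t).
Hypothesis tP : forall i, P m.+1 (t i) = 0.
Hypothesis hK : {in F, forall h, acm (p h) e (pj t)}.
Hypotheses (lJ : lin J) (aJ : adj J J').
Hypothesis JK : forall x, pj t (J x) = J x.
Hypothesis Jiso : forall x y, dot (J (P m.+1 x)) (J (P m.+1 y)) = dot (P m.+1 x) (P m.+1 y).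
Hypothesis JF : forall h x, h \in F ->
  nm (p h (J (P m x)) - J (p h (P m x))) <= e * nm (P m x).

Let sg (j : nat) : R := 1 - j%:R / m%:R.
(** On a layer of weight s, the operator [V] below is the rotation J x -> (1 - s^2) J x + s sqrt (2
    - s^2) x, which is why the sum of squares is 2. In this form the root is at least 1 and so as
    Lipschitz as [sg]; a factor sqrt (1 - s^2) would not be Lipschitz at s = 1. *)
Let tau (j : nat) : R := Num.sqrt (2 - sg j ^+ 2).
Let a : R := m%:R^-1.

Let m0R : 0 < m%:R :> R. Proof. by rewrite ltr0n. Qed.
Let a0 : 0 < a. Proof. by rewrite invr_gt0. Qed.

Let sg01 j : (j <= m)%N -> 0 <= sg j <= 1.
Proof.
move=> jm; have h : 0 <= j%:R / m%:R :> R by rewrite divr_ge0 // ltW.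
have h' : j%:R / m%:R <= 1 :> R by rewrite ler_pdivrMr // mul1r ler_nat.
by rewrite /sg; apply/andP; split; lra.
Qed.

Let sg0 : sg 0 = 1. Proof. by rewrite /sg mul0r subr0. Qed.
Let sgm : sg m = 0. Proof. by rewrite /sg divff ?subrr // gt_eqF. Qed.

Let sg_diff j : sg j.+1 - sg j = - a.
Proof. by rewrite /sg -(natr1 j) /a; field; rewrite gt_eqF. Qed.

Let tau_sq j : (j <= m)%N -> tau j * tau j = 2 - sg j ^+ 2.
Proof.
move=> /sg01 /andP[h1 h2]; rewrite -expr2 sqr_sqrtr //.
have : sg j ^+ 2 <= 1 by rewrite expr_le1.
lra.
Qed.

Let tau_ge1 j : (j <= m)%N -> 1 <= tau j.
Proof.
move=> jm; rewrite -(ler_pXn2r (n := 2)) ?nnegrE ?sqrtr_ge0 // expr2 [leRHS]expr2 tau_sq //.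
have /andP[h1 h2] := sg01 jm.
have : sg j ^+ 2 <= 1 by rewrite expr_le1.
lra.
Qed.

Let tau_diff j : (j < m)%N -> `|tau j.+1 - tau j| <= a.
Proof.
move=> jm; have h1 := tau_sq jm; have h2 := tau_sq (ltnW jm).
have g1 := tau_ge1 jm; have g2 := tau_ge1 (ltnW jm).
have /andP[s1 s2] := sg01 jm; have /andP[s3 s4] := sg01 (ltnW jm).
have d := sg_diff j; have a00 := a0.
have k : (tau j.+1 - tau j) * (tau j.+1 + tau j) = a * (sg j + sg j.+1).
  have -> : (tau j.+1 - tau j) * (tau j.+1 + tau j) = tau j.+1 * tau j.+1 - tau j * tau j by ring.
  by rewrite h1 h2 -[a]opprK -d; ring.
have pos : 0 < tau j.+1 + tau j by lra.
have -> : tau j.+1 - tau j = a * (sg j + sg j.+1) / (tau j.+1 + tau j).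
  by rewrite -k mulfK // gt_eqF.
rewrite ger0_norm; last first.
  by apply: divr_ge0; [apply: mulr_ge0; [exact: ltW | exact: addr_ge0] | exact: ltW].
rewrite ler_pdivrMr // ler_pM2l //; lra.
Qed.

Let tau_le2 j : (j <= m)%N -> `|tau j| <= 2.
Proof.
move=> jm; rewrite ger0_norm ?sqrtr_ge0 // -(ler_pXn2r (n := 2)) ?nnegrE ?sqrtr_ge0 //.
by rewrite expr2 tau_sq //; have := sqr_ge0 (sg j); lra.
Qed.

Let S := diag P m sg.
Let Tt := diag P m tau.
Let X x := J (S x).
Let X' y := S (J' y).

Let lS : lin S. Proof. exact: diag_lin. Qed.
Let lT : lin Tt. Proof. exact: diag_lin. Qed.
Let lX : lin X. Proof. by move=> k x y; rewrite /X lS lJ. Qed.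

Let lJ' : lin J'.
Proof.
move=> k x y; apply: dot_inj => z; rewrite (adj_sym aJ) !dotDl !dotZl.
by rewrite (adj_sym aJ x) (adj_sym aJ y).
Qed.

Let lX' : lin X'. Proof. by move=> k x y; rewrite /X' lJ' lS. Qed.

Let aX : adj X X'. Proof. by move=> x y; rewrite /X /X' aJ diag_adj. Qed.

Let PS x : P m.+1 (S x) = S x.
Proof. by rewrite /S -(diag_in linP PP _ sgm) PP. Qed.

Let PmS x : P m (S x) = S x. Proof. exact: diag_in. Qed.

Let Jnm z : P m.+1 z = z -> nm (J z) = nm z.
Proof.
move=> hz; apply/eqP; rewrite -(eqrXn2 (n := 2)) ?nm_ge0 // -!Re_dotxx -hz Jiso.
by rewrite hz.
Qed.

Let bS : bnd S 1.
Proof.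
by apply: (diag_bnd linP P0 adjP PP) => j /sg01 /andP[h1 h2]; rewrite ger0_norm.
Qed.

Let bT : bnd Tt 2. Proof. exact: (diag_bnd linP P0 adjP PP). Qed.

Let bX : bnd X 1. Proof. by move=> x; rewrite /X Jnm. Qed.
Let bX' : bnd X' 1. Proof. exact: bnd_adj aX bX. Qed.

Let eta := e + 2 * a.

Let eta0 : 0 <= eta. Proof. by rewrite /eta addr_ge0 // mulr_ge0 // ltW. Qed.
Let acS h : h \in F -> acm (p h) (2 * a) S.
Proof.
move=> hF; apply: (diag_acm hp FV linP P0 adjP PP PF hF (ltW a0)) => j jm.
by rewrite sg_diff normrN ger0_norm // ltW.
Qed.

Let acT h : h \in F -> acm (p h) (2 * a) Tt.
Proof. by move=> hF; exact: (diag_acm hp FV linP P0 adjP PP PF hF (ltW a0)). Qed.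

Let acX h : h \in F -> acm (p h) eta X.
Proof.
move=> hF x; rewrite /X.
have -> : p h (J (S x)) - J (S (p h x)) =
    (p h (J (P m (S x))) - J (p h (P m (S x)))) + J (p h (S x) - S (p h x)).
  by rewrite PmS (linB _ _ lJ) addrA subrK.
apply: le_trans (nmD _ _) _; rewrite /eta mulrDl; apply: lerD.
  apply: le_trans (JF _ hF) _; rewrite PmS ler_wpM2l //.
  by have := bS x; rewrite mul1r.
rewrite Jnm; first exact: acS.
by rewrite (linB _ _ (linP _)) PS -[S x]PmS PF.
Qed.

Let aU h : adj (p h) (p h^-1%g). Proof. by move=> x y; exact: urep_adj. Qed.

Let acX' h : h \in F -> acm (p h) eta X'.
Proof. by move=> hF; apply: (acm_adj eta0 (aU h) aX); apply: acX; exact: FV. Qed.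

(** On the range of [pj t] this is an isometry: it sends J x to x where the weight is 1, fixes J x
    where the weight is 0, and interpolates slowly in between. *)
Let V x := x + (- X (X' x) + Tt (X' x)).
Let V' x := x + (- X (X' x) + X (Tt x)).

Let lV : lin V.
Proof.
by apply: lin_add; [exact: lin_id | apply: lin_add; [apply: lin_opp|]; exact: lin_comp].
Qed.

Let aV : adj V V'.
Proof.
move=> x y; rewrite /V /V' dot3l dot3r aX (adj_sym aX); congr (_ + (_ + _)).
by rewrite {1}/Tt (diag_adj adjP) (adj_sym aX).
Qed.

Let acV h : h \in F -> acm (p h) (5 * eta) V.
Proof.
move=> hF; have lh := urep_lin hp h.
have h1 : acm (p h) 0 (fun x => x) by move=> x; rewrite subrr nm0 mul0r.
have h2 : acm (p h) (eta * 1 + 1 * eta) (fun x => X (X' x)).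
  by apply: acmM => //; [exact: acX | exact: acX'].
have h3 : acm (p h) ((2 * a) * 1 + 2 * eta) (fun x => Tt (X' x)).
  apply: acmM => //; [ | exact: acT | exact: acX'].
  by have := a0; lra.
apply: (acm_le _ (acmD lh h1 (acmD lh (acmN lh h2) h3))).
by rewrite /eta; have := e0; have := a0; lra.
Qed.

Let bV : bnd V 4.
Proof.
move=> x; rewrite /V; apply: le_trans (nmD _ _) _.
have h1 := nmD (- X (X' x)) (Tt (X' x)); rewrite nmN in h1.
have h2 := bX (X' x); have h3 := bT (X' x); have h4 := bX' x.
lra.
Qed.

Let bV' : bnd V' 4. Proof. exact: bnd_adj aV bV. Qed.

Let acV' h : h \in F -> acm (p h) (5 * eta) V'.
Proof.
move=> hF; apply: (acm_adj _ (aU h) aV); last by apply: acV; exact: FV.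
by have := eta0; lra.
Qed.

Let st x : S (S x) + Tt (Tt x) = 2%:C *: x.
Proof.
rewrite /S /Tt !diagM // diagD -(diag_const P0 m 2); apply: eq_diag => j jm.
by rewrite tau_sq // expr2 addrC subrK.
Qed.

Let v i := V (t i).

Let tJ i x : dot (t i) (P m x) = 0.
Proof. by rewrite -(PP x (leqnSn m)) -adjP tP dot0l. Qed.

(** With b = X' (t i) and c = X' (t j), the inner product changes by - 2 (b, c) + (b, (S^2 + Tt^2)
    c), which vanishes by [st]. The remaining cross terms vanish since the range of [pj t] is
    orthogonal to the filtration. *)
Let v_onf : onf v.
Proof.
move=> i j; rewrite -(ot i j) /v /V.
have inPm x : P m (X' x) = X' x by rewrite /X' PmS.
have TPm x : P m (Tt (X' x)) = Tt (X' x) by exact: diag_pres.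
have JP x y : dot (J x) (P m y) = 0.
  rewrite -JK /pj dot_suml big1 // => k _.
  by rewrite dotZl tJ mulr0.
have tT k x : dot (t k) (Tt (X' x)) = 0 by rewrite -TPm tJ.
have JT x y : dot (J x) (Tt (X' y)) = 0 by rewrite -TPm JP.
rewrite dot3l !dot3r tT.
rewrite (dotC (t j) (Tt _)) tT conjc0 /X JT (dotC (J _) (Tt _)) JT conjc0 !oppr0 !addr0 !add0r.
set b := X' (t i); set c := X' (t j).
have e1 : dot (t i) (J (S c)) = dot b c by rewrite -(adj_sym aJ) -diag_adj.
have e2 : dot (J (S b)) (t j) = dot b c by rewrite aJ /S diag_adj.
have e3 : dot (J (S b)) (J (S c)) = dot (S b) (S c).
  by rewrite -[S b]PS -[S c]PS Jiso.
rewrite e1 e2 e3 {1}/S diag_adj // {1}/Tt diag_adj //.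
have h : dot b (S (S c)) + dot b (Tt (Tt c)) = dot b c + dot b c.
  rewrite -dotDr st dotZr [conjc _]conjc_real (rmorph_nat (real_complex R)).
  by rewrite mulr_natl mulr2n.
rewrite -/Tt -/S (_ : dot b (S (S c)) = dot b c + dot b c - dot b (Tt (Tt c))).
  by ring.
by rewrite -h addrK.
Qed.

(** [pj v] is V (pj t) V', where both outer factors have norm at most 4 and commutators at most 5
    eta, eta = e + 2/m. The product has commutator at most 40 eta + 16 e <= 56 (e + 2/m). *)
Lemma absorption : exists v : I -> H,
  [/\ onf v, forall x, P 1 x = x -> pj v x = x,
      {in F, forall h, acm (p h) (56 * (e + 2 / m%:R)) (pj v)} &
      forall L, lsub L -> (forall i, L (t i)) -> (forall x, L (J x)) ->
        (forall j x, L (P j x)) -> forall i, L (v i)].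
Proof.
exists v; split; first exact: v_onf.
- move=> x hx; have S1 : S x = x by rewrite /S diag_P1 // sg0 scale1r.
  have T1 : Tt x = x.
    rewrite /Tt diag_P1 //; have -> : tau 0 = 1.
      by rewrite /tau sg0 expr1n (_ : 2 - 1 = 1) ?sqrtr1 //; lra.
    by rewrite scale1r.
  have Px : P m x = x by rewrite -hx PP.
  have XJ : X' (J x) = x.
    have Px1 : P m.+1 x = x by rewrite -Px PP.
    rewrite /X' /S -(diagP adjP PP _ sgm).
    have -> : P m (J' (J x)) = x.
      apply: dot_inj => z; rewrite adjP (adj_sym aJ) -[in LHS]Px1.
      by rewrite -(PP z (leqnSn m)) Jiso PP // Px1 -adjP Px.
    exact: S1.
  have VJ : V (J x) = x.
    by rewrite /V XJ /X S1 T1 addrA subrr add0r.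
  have : V (pj t (J x)) = x by rewrite JK.
  rewrite /pj (lin_sum _ _ _ lV).
  under eq_bigr do rewrite (linZ _ _ lV).
  by move=> <-; exact: (pj_comb v_onf).
- move=> h hF.
  have vE x : pj v x = V (pj t (V' x)).
    rewrite /pj (lin_sum _ _ _ lV); apply: eq_bigr => i _.
    by rewrite (linZ _ _ lV) -(adj_sym aV).
  have h1 : acm (p h) (e * 4 + 1 * (5 * eta)) (fun x => pj t (V' x)).
    apply: acmM => //; [exact: pj_lin | exact: hK | exact: acV' | ].
    by move=> x; rewrite mul1r; exact: pj_nm.
  have b1 : bnd (fun x => pj t (V' x)) 4.
    by move=> x; apply: le_trans (pj_nm ot _) _; exact: bV'.
  have h2 : acm (p h) ((5 * eta) * 4 + 4 * (e * 4 + 1 * (5 * eta))) (fun x => V (pj t (V' x))).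
    by apply: acmM => //; [have := eta0; lra | exact: acV].
  move=> x; rewrite !vE; apply: le_trans (h2 x) _; rewrite ler_wpM2r ?nm_ge0 //.
  by rewrite /eta -/a; have := e0; have := a0; lra.
- move=> L sL Lt LJ LP i; rewrite /v /V; apply: lsubD => //; apply: lsubD => //.
    by apply: lsubN => //; exact: LJ.
  have -> : Tt (X' (t i)) = P m (Tt (X' (t i))) by rewrite (diag_pres linP PP) // /X' PmS.
  exact: LP.
Qed.

End Absorption.

(** * Perturbing almost orthonormal families; matching orthogonal sums *)

Section AlmostOrthonormal.
Variables (R : realType) (H : hilbertType R).

(** Gram-Schmidt with error control, one vector per induction step. Indices are natural numbers for
    the sake of the induction; [almost_onf] transports the result to a finite type. *)
Lemma almost_onf_nat (N : nat) (d : R) : 0 < d -> exists2 d' : R, 0 < d' &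
  forall (X : set H) (I : finType) (e : I -> H) (u : nat -> H), lsub X -> onf e ->
    (forall k, X (e k)) -> (forall i, X (u i)) ->
    (forall i, (i < N)%N -> nm (pj e (u i)) <= d') ->
    (forall i j, (i < N)%N -> (j < N)%N -> cn (dot (u i) (u j) - (i == j)%:R) <= d') ->
    exists z : nat -> H, forall i, (i < N)%N ->
      [/\ X (z i), forall k, dot (z i) (e k) = 0, nm (z i - u i) <= d &
        forall j, (j < N)%N -> dot (z i) (z j) = (i == j)%:R].
Proof.
elim: N d => [|N IH] d d0; first by exists 1 => // *; exists (fun=> 0).
pose c := Num.min d 1; have c0 : 0 < c by rewrite lt_min d0 ltr01.
have cd : c <= d by rewrite ge_min lexx.
have c1 : c <= 1 by rewrite ge_min lexx orbT.
have N0 : 0 < N.+1%:R :> R by rewrite ltr0n.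
(* Each of the N coefficients of [w0] is at most 3 d3, so the total correction stays below c/4. *)
pose d3 := c / (16 * N.+1%:R).
have d30 : 0 < d3 by rewrite divr_gt0 ?mulr_gt0.
have [d' d'0 hd'] := IH d3 d30.
pose d5 := Num.min d' d3.
have d50 : 0 < d5 by rewrite lt_min d'0 d30.
have d5d' : d5 <= d' by rewrite ge_min lexx.
have d5d3 : d5 <= d3 by rewrite ge_min lexx orbT.
exists d5 => // X I e u sX oe Xe Xu he hu.
have [||z hz] := hd' X I e u sX oe Xe Xu.
- by move=> i iN; apply: le_trans (he i (ltnW iN)) _.
- by move=> i j iN jN; apply: le_trans (hu i j (ltnW iN) (ltnW jN)) _.
pose w0 := \sum_(k < N) dot (u N) (z k) *: z k.
pose w := u N - pj e (u N) - w0.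
have Nd3 : N.+1%:R * d3 <= c / 16.
  by rewrite /d3 le_eqVlt; apply/orP; left; apply/eqP; field; rewrite gt_eqF.
have NS : N.+1%:R = N%:R + 1 :> R by rewrite -(natr1 N).
have Nge : 0 <= N%:R :> R by [].
have d3c : d3 <= c / 16.
  by move: Nd3; rewrite NS mulrDl mul1r; have := mulr_ge0 Nge (ltW d30); lra.
have nu : `|nm (u N) - 1| <= d5.
  have := hu N N (ltnSn _) (ltnSn _); rewrite eqxx dotxx -[1%:R]/(1%:C) -rmorphB /= cn_real.
  apply: le_trans.
  have -> : nm (u N) ^+ 2 - 1 = (nm (u N) - 1) * (nm (u N) + 1) by ring.
  rewrite normrM ler_peMr // ger0_norm; have := nm_ge0 (u N); lra.
have nu2 : nm (u N) <= 2 by move: nu; rewrite ler_norml => /andP[_]; lra.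
have hw0 : nm w0 <= N%:R * (3 * d3).
  apply: le_trans (nm_sum _ _ _) _; rewrite -sum_cst; apply: ler_sum => k _.
  have [_ _ zu zz] := hz k (ltn_ord k).
  have nz : nm (z k) = 1.
    apply/eqP; rewrite -(eqrXn2 (n := 2)) ?nm_ge0 // -Re_dotxx zz // eqxx.
    by rewrite expr1n.
  rewrite nmZ nz mulr1.
  have -> : dot (u N) (z k) = dot (u N) (z k - u k) + (dot (u N) (u k) - (N == k :> nat)%:R).
    by rewrite (gtn_eqF (ltn_ord k)) subr0 -dotDr subrK.
  apply: le_trans (cnD _ _) _.
  have h1 := hu N k (ltnSn _) (ltnW (ltn_ord k)).
  have h2 := CS (u N) (z k - u k).
  have h3 : nm (u N) * nm (z k - u k) <= 2 * d3 by apply: ler_pM; rewrite ?nm_ge0.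
  lra.
have huw : nm (u N - w) <= c / 4.
  have -> : u N - w = pj e (u N) + w0 by rewrite /w -addrA -opprD subKr.
  apply: le_trans (nmD _ _) _; have := he N (ltnSn _).
  by move: Nd3; rewrite NS mulrDl mul1r; lra.
have nw : `|1 - nm w| <= c / 4 + c / 16.
  have h1 := nmD (u N - w) w; rewrite subrK in h1.
  have h2 := nmB (u N) (u N - w); rewrite subKr in h2.
  move: nu; rewrite !ler_norml => /andP[h3 h4]; apply/andP; split; lra.
have w0' : 1 / 2 <= nm w by move: nw; rewrite ler_norml => /andP[]; lra.
have wn : w != 0 by rewrite -nm_gt0; lra.
pose zN := (nm w)^-1%:C *: w.
have nzN : nm zN = 1 by exact: normalize.
have dwe k : dot w (e k) = 0.
  rewrite /w dotBl pj_orth // /w0 dot_suml big1 ?subrr // => l _.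
  by have [_ h _ _] := hz l (ltn_ord l); rewrite dotZl h mulr0.
have dwz k : (k < N)%N -> dot w (z k) = 0.
  move=> kN; have [_ h _ zz] := hz k kN.
  rewrite /w !dotBl {1}/pj dot_suml [X in _ - X - _]big1 => [|l _]; last first.
    by rewrite dotZl (dotC (z k)) h conjc0 mulr0.
  rewrite subr0 /w0 dot_suml (bigD1 (Ordinal kN)) //= dotZl zz // eqxx mulr1.
  rewrite big1 ?addr0 ?subrr // => l lk.
  have [_ _ _ zz'] := hz l (ltn_ord l).
  by rewrite dotZl zz' // (negPf (_ : (l : nat) != k)) ?mulr0.
have XzN : X zN.
  apply: lsubZ => //; apply: lsubB => //; first by apply: lsubB => //; exact: pj_in.
  by apply: lsub_sum => // k _; apply: lsubZ => //; case: (hz k (ltn_ord k)).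
exists (fun i => if i == N then zN else z i) => i.
rewrite ltnS leq_eqVlt => /orP[/eqP->|iN].
  rewrite eqxx; split=> //.
  - by move=> k; rewrite /zN dotZl dwe mulr0.
  - apply: le_trans (nm_tri _ w _) _; rewrite (nmBC w).
    have -> : nm (zN - w) = `|1 - nm w|.
      rewrite /zN -{3}[w]scale1r -scalerBl nmZ -[1 : R[i]]/(1%:C) -rmorphB /= cn_real.
      rewrite -{2}(ger0_norm (nm_ge0 w)) -normrM mulrBl mul1r mulVf //.
      by rewrite nm_eq0.
    lra.
  - move=> j; rewrite ltnS leq_eqVlt => /orP[/eqP->|jN].
      by rewrite eqxx dotxx nzN expr1n.
    by rewrite (ltn_eqF jN) (gtn_eqF jN) /zN dotZl dwz // mulr0.
have [h1 h2 h3 h4] := hz i iN; rewrite (ltn_eqF iN); split=> //.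
- apply: le_trans h3 _; lra.
- move=> j; rewrite ltnS leq_eqVlt => /orP[/eqP->|jN].
    by rewrite eqxx (ltn_eqF iN) dotC /zN dotZl dwz // mulr0 conjc0.
  by rewrite (ltn_eqF jN) h4.
Qed.

Lemma almost_onf (K : finType) (d : R) : 0 < d -> exists2 d' : R, 0 < d' &
  forall (X : set H) (I : finType) (e : I -> H) (u : K -> H), lsub X -> onf e ->
    (forall k, X (e k)) -> (forall i, X (u i)) ->
    (forall i, nm (pj e (u i)) <= d') ->
    (forall i j, cn (dot (u i) (u j) - (i == j)%:R) <= d') ->
    exists z : K -> H, [/\ onf z, forall i, X (z i), forall i k, dot (z i) (e k) = 0 &
       forall i, nm (z i - u i) <= d].
Proof.
move=> d0; have [d' d'0 h] := almost_onf_nat #|K| d0; exists d' => //.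
move=> X I e u sX oe Xe Xu he hu.
pose u' n := if insub n is Some k then u (enum_val (k : 'I_#|K|)) else 0.
have u'E n (hn : (n < #|K|)%N) : u' n = u (enum_val (Ordinal hn)).
  by rewrite /u' insubT.
have [|||z hz] := h X I e u' sX oe Xe.
- by move=> n; rewrite /u'; case: insub => // ; exact: lsub0.
- by move=> n hn; rewrite u'E.
- move=> i j hi hj; rewrite !u'E.
  by have := hu (enum_val (Ordinal hi)) (enum_val (Ordinal hj)); rewrite (inj_eq enum_val_inj).
exists (fun k => z (enum_rank k)); split.
- by move=> i j; have [_ _ _ ->] := hz _ (ltn_ord (enum_rank i)); rewrite // (inj_eq (@ord_inj _)) (inj_eq enum_rank_inj).
- by move=> i; have [] := hz _ (ltn_ord (enum_rank i)).
- by move=> i; have [] := hz _ (ltn_ord (enum_rank i)).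
- move=> i; have [_ _ + _] := hz _ (ltn_ord (enum_rank i)).
  by rewrite u'E (_ : Ordinal _ = enum_rank i) ?enum_rankK //; exact: val_inj.
Qed.

End AlmostOrthonormal.

Section Transfer.
Variables (R : realType) (H : hilbertType R) (n : nat).

(** Off the bad sets [mu] matches the terms one to one at cost d each. The at most b^2 bad terms are
    mutually orthogonal, so each side loses b c and not b^2 c. *)
Lemma transfer_sum (Z Z' : 'I_n -> H) (B B' : {set 'I_n}) (mu mu' : 'I_n -> 'I_n) (c d b : R) :
  0 <= c -> 0 <= b ->
  (forall i j, i != j -> dot (Z i) (Z j) = 0) ->
  (forall i j, i != j -> dot (Z' i) (Z' j) = 0) ->
  (forall i, nm (Z i) <= c) -> (forall i, nm (Z' i) <= c) ->
  (forall i, i \notin B -> mu i \notin B' /\ mu' (mu i) = i) ->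
  (forall i, i \notin B' -> mu' i \notin B /\ mu (mu' i) = i) ->
  (forall i, i \notin B -> nm (Z i - Z' (mu i)) <= d) -> 0 <= d ->
  #|B|%:R <= b ^+ 2 -> #|B'|%:R <= b ^+ 2 ->
  nm (\sum_i Z i - \sum_i Z' i) <= n%:R * d + 2 * b * c.
Proof.
move=> c0 b0 oZ oZ' hZ hZ' hmu hmu' hd d0 hB hB'.
have bad (W : 'I_n -> H) (D : {set 'I_n}) : (forall i j, i != j -> dot (W i) (W j) = 0) ->
    (forall i, nm (W i) <= c) -> #|D|%:R <= b ^+ 2 -> nm (\sum_(i in D) W i) <= b * c.
  move=> oW hW hD; apply: nm_le_sqr; first by rewrite mulr_ge0.
  rewrite nm_sqr_sum_orth // exprMn.
  apply: le_trans (_ : \sum_(i in D) c ^+ 2 <= _).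
    by apply: ler_sum => i _; rewrite ler_pXn2r ?nnegrE ?nm_ge0.
  by rewrite sumr_const -mulr_natl ler_wpM2r ?sqr_ge0.
rewrite (bigID (mem B)) [\sum_i Z' i](bigID (mem B')) /=.
have -> : \sum_(i | i \notin B') Z' i = \sum_(i | i \notin B) Z' (mu i).
  rewrite (reindex_onto mu mu') => [|i iB]; last by have [] := hmu' i iB.
  apply: eq_bigl => i; apply/andP/idP => [[h1 /eqP h2]|h1].
    by rewrite -h2; have [] := hmu' _ h1.
  by have [h2 h3] := hmu i h1; rewrite h2 h3 eqxx.
rewrite opprD addrACA -sumrB.
apply: le_trans (nmD _ _) _; rewrite [leRHS]addrC; apply: lerD; last first.
  apply: le_trans (nm_sum _ _ _) _.
  apply: le_trans (_ : \sum_(i | i \notin B) d <= _).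
    by apply: ler_sum => i; exact: hd.
  rewrite sumr_const -[leLHS]mulr_natl ler_wpM2r // ler_nat.
  by apply: leq_trans (max_card _) _; rewrite card_ord.
apply: le_trans (nmB _ _) _.
have h1 := bad Z B oZ hZ hB; have h2 := bad Z' B' oZ' hZ' hB'.
rewrite (mulrC 2) mulrAC; lra.
Qed.

End Transfer.

(** * Planting copies of a finite dimensional induced representation *)

Section Model.
Variables (R : realType) (H : hilbertType R) (Gam : groupType) (p : Gam -> H -> H).
Hypothesis hp : urep p.
Variables (G : set Gam) (L : set H).
Hypotheses (sG : sgp G) (sL : lsub L) (iL : invariant p G L).
Variables (C D : set Gam) (psi : Gam -> R[i]).
Hypotheses (sD : sgp D) (DG : D `<=` G) (CD : C `<=` D).
Hypothesis psi1 : forall d, D d -> cn (psi d) = 1.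
Hypothesis psiM : forall d d', D d -> D d' -> psi (d * d')%g = psi d * psi d'.
Hypothesis CJ : forall c g, C c -> G g -> D (c ^ g)%g /\ psi (c ^ g)%g = psi c.
Variables (q : nat) (r : 'I_q -> Gam) (ix : Gam -> 'I_q).
Hypothesis Gr : forall i, G (r i).
Hypothesis ixP : forall g, G g -> D ((r (ix g))^-1 * g)%g.
Hypothesis r_inj : forall i j, D ((r i)^-1 * r j)%g -> i = j.
Variables (n : nat) (s : 'I_n -> Gam).
Hypotheses (n0 : (0 < n)%N) (Gs : forall j, G (s j)).
Hypothesis s_inj : forall i j, D ((s i)^-1 * s j)%g -> i = j.
Variables (A : finType) (zeta : 'I_n * (A * 'I_q) -> H) (eta : A * 'I_q -> H) (f : A -> H).
Hypotheses (ozeta : onf zeta) (of_ : onf f) (Leta : forall b, L (eta b)).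

Implicit Types (k : Gam -> R[i]).

(** The function space of the representation of [G] induced from the character [psi] of [D], with
    [tr] as its action. *)
Definition eqv k := forall g d, G g -> D d -> k (g * d)%g = (psi d)^-1 * k g.

Definition tr (g : Gam) k : Gam -> R[i] := fun x => k (g^-1 * x)%g.

Definition ip k k' : R[i] := \sum_i k (r i) * conjc (k' (r i)).

Lemma tr_eqv g k : G g -> eqv k -> eqv (tr g k).
Proof.
move=> Gg hk x d Gx Dd; rewrite /tr mulgA hk //.
by apply: sgpM => //; exact: sgpV.
Qed.

Lemma psi_unit d : D d -> (psi d)^-1 * conjc (psi d)^-1 = 1.
Proof.
by move=> Dd; rewrite -cn_sqr cnV psi1 // invr1 expr1n.
Qed.

(** Left multiplication by g permutes the cosets r i D, and changing a representative multiplies k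
    and k' by the same unimodular scalar. *)
Lemma ip_shift g k k' : G g -> eqv k -> eqv k' ->
  \sum_i k (g * r i)%g * conjc (k' (g * r i)%g) = ip k k'.
Proof.
move=> Gg hk hk'.
pose h i := ix (g * r i)%g.
have Ggr i : G (g * r i)%g by exact: sgpM.
have hinj : injective h.
  move=> i j e; apply: r_inj.
  have h1 := ixP (Ggr i); have h2 := ixP (Ggr j); rewrite -/(h i) -/(h j) -e in h1 h2.
  have := sgpM sD (sgpV sD h1) h2.
  by rewrite !invgM invgK -!mulgA !(mulKg, mulVKg).
rewrite /ip [RHS](reindex_inj hinj) /=; apply: eq_bigr => i _.
have e : (g * r i)%g = (r (h i) * ((r (h i))^-1 * (g * r i)))%g by rewrite mulVKg.
rewrite e hk ?hk'; do ?exact: ixP; do ?exact: Gr.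
by rewrite conjM mulrACA psi_unit ?mul1r //; exact: ixP.
Qed.

Lemma ip_tr g k k' : G g -> eqv k -> eqv k' -> ip (tr g k) (tr g k') = ip k k'.
Proof. by move=> Gg hk hk'; rewrite /ip /tr; apply: ip_shift => //; exact: sgpV. Qed.

Definition dl (i : 'I_q) : Gam -> R[i] := fun x => if `[< D ((r i)^-1 * x)%g >] then (psi ((r i)^-1 * x)%g)^-1 else 0.

(** The cyclic vector of the induced representation. Its translates by elements of distinct cosets
    of [D] are orthonormal ([ip_trk0]). *)
Definition k0 : Gam -> R[i] := fun x => if `[< D x >] then (psi x)^-1 else 0.

Lemma psi_one : psi 1%g = 1.
Proof.
have h := psiM (sgp1 sD) (sgp1 sD); rewrite mul1g in h.
have nz : psi 1%g != 0 by rewrite -cn_eq0 psi1 ?oner_eq0 //; exact: sgp1.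
by apply: (mulfI nz); rewrite -h mulr1.
Qed.

Lemma Dmulr x d : D d -> D (x * d)%g <-> D x.
Proof.
move=> Dd; split=> [h|h]; last exact: sgpM.
by have := sgpM sD h (sgpV sD Dd); rewrite mulgK.
Qed.

Lemma k0_eqv : eqv k0.
Proof.
move=> g d Gg Dd; rewrite /k0; case: asboolP => [h|h].
  have Dg : D g by apply/(Dmulr g Dd).
  by rewrite asboolT // psiM // invfM mulrC.
by rewrite asboolF ?mulr0 // => Dg; apply: h; exact: sgpM.
Qed.

Lemma dl_k0 i x : dl i x = k0 ((r i)^-1 * x)%g.
Proof. by []. Qed.

Lemma dl_eqv i : eqv (dl i).
Proof. exact: (tr_eqv (Gr i) k0_eqv). Qed.

Lemma dl_r i j : dl i (r j) = (i == j)%:R.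
Proof.
rewrite /dl; have [->|ij] := eqVneq i j.
  by rewrite mulVg asboolT ?psi_one ?invr1 //; exact: sgp1.
by rewrite asboolF // => /r_inj e; rewrite e eqxx in ij.
Qed.

Lemma ip_dl k i : ip k (dl i) = k (r i).
Proof.
rewrite /ip (bigD1 i) //= dl_r eqxx conjc1 mulr1 big1 ?addr0 // => j ji.
by rewrite dl_r eq_sym (negPf ji) conjc0 mulr0.
Qed.

Lemma eqv_sum k x : eqv k -> G x -> k x = \sum_i k (r i) * dl i x.
Proof.
move=> hk Gx; rewrite (bigD1 (ix x)) //= big1 ?addr0 => [|i ixx].
  have e : k x = k (r (ix x) * ((r (ix x))^-1 * x))%g by rewrite mulVKg.
  by rewrite e hk; [rewrite /dl (asboolT (ixP Gx)) mulrC | exact: Gr | exact: ixP].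
rewrite /dl asboolF ?mulr0 // => h; case/negP: ixx; apply/eqP; apply: r_inj.
have := sgpM sD h (sgpV sD (ixP Gx)).
by rewrite invgM invgK mulgA mulgK.
Qed.

Lemma ip_k0 g g' : G g -> G g' -> ip (tr g k0) (tr g' k0) = conjc (k0 (g'^-1 * g)%g).
Proof.
move=> Gg Gg'.
have e : ip (tr g k0) (tr g' k0) = ip k0 (tr (g^-1 * g')%g k0).
  rewrite -(ip_tr Gg k0_eqv (tr_eqv (sgpM sG (sgpV sG Gg) Gg') k0_eqv)).
  by apply: eq_bigr => i _; rewrite /tr !invgM !invgK mulgA mulgK.
rewrite e /ip; pose i0 := ix 1%g; have Di0 : D (r i0).
  by rewrite -[r i0]invgK; apply: sgpV => //; rewrite -[_^-1%g]mulg1; apply: ixP; exact: sgp1.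
rewrite (bigD1 i0) //= big1 ?addr0 => [|i ii]; last first.
  rewrite {1}/k0 asboolF ?mul0r // => Di; case/negP: ii; apply/eqP; apply: r_inj.
  by apply: sgpM => //; exact: sgpV.
rewrite /tr invgM invgK -(mulgA g'^-1%g) {1}/k0 (asboolT Di0).
rewrite mulgA k0_eqv //; last by apply: sgpM => //; exact: sgpV.
by rewrite conjM mulrA psi_unit ?mul1r.
Qed.

Let sq : R[i] := (Num.sqrt n%:R)^-1%:C.

Let n0R : 0 < n%:R :> R. Proof. by rewrite ltr0n. Qed.

Let sq_sq : (Num.sqrt n%:R)^-1 * (Num.sqrt n%:R)^-1 * n%:R = 1 :> R.
Proof.
have h : Num.sqrt n%:R * Num.sqrt n%:R = n%:R :> R by rewrite -expr2 sqr_sqrtr // ltW.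
rewrite -{3}h -invfM h mulVf // gt_eqF //.
Qed.

(** The copy with label a. Since zeta (j, b) is close to p (s j) (eta b), this is nearly n^(-1/2)
    times the sum over j of p (s j) applied to the combination of the eta (a, i) with coefficients k
    (s j r i): a mean over the Folner set that makes the embedding almost equivariant. *)
Definition TT (a : A) k : H := sq *: \sum_j \sum_i k (s j * r i)%g *: zeta (j, (a, i)).

Lemma TT_lin a c k k' : TT a (fun x => c * k x + k' x) = c *: TT a k + TT a k'.
Proof.
rewrite /TT scalerA mulrC -scalerA -scalerDr; congr (_ *: _).
rewrite scaler_sumr -big_split /=; apply: eq_bigr => j _.
rewrite scaler_sumr -big_split /=; apply: eq_bigr => i _.
by rewrite scalerDl scalerA.
Qed.

Lemma TT_scale a c k : TT a (fun x => c * k x) = c *: TT a k.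
Proof.
rewrite /TT scalerA mulrC -scalerA; congr (_ *: _).
rewrite scaler_sumr; apply: eq_bigr => j _.
by rewrite scaler_sumr; apply: eq_bigr => i _; rewrite scalerA.
Qed.

Lemma TT_ext a k k' : (forall x, G x -> k x = k' x) -> TT a k = TT a k'.
Proof.
move=> h; congr (_ *: _); apply: eq_bigr => j _; apply: eq_bigr => i _.
by rewrite h //; exact: sgpM.
Qed.

Lemma TT_sum a (I : finType) (c : I -> R[i]) (k : I -> Gam -> R[i]) :
  TT a (fun x => \sum_i c i * k i x) = \sum_i c i *: TT a (k i).
Proof.
rewrite /TT; under [RHS]eq_bigr do rewrite scalerA mulrC -scalerA.
rewrite -scaler_sumr; congr (_ *: _).
under [RHS]eq_bigr do rewrite scaler_sumr; rewrite [RHS]exchange_big /=.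
apply: eq_bigr => j _; under [RHS]eq_bigr do rewrite scaler_sumr; rewrite [RHS]exchange_big /=.
apply: eq_bigr => i _; rewrite scaler_suml; apply: eq_bigr => l _.
by rewrite scalerA.
Qed.

Lemma dot_TT a a' k k' : eqv k -> eqv k' -> dot (TT a k) (TT a' k') = (a == a')%:R * ip k k'.
Proof.
move=> hk hk'; rewrite /TT dotZl dotZr [conjc _]conjc_real mulrA.
have -> : dot (\sum_j \sum_i k (s j * r i)%g *: zeta (j, (a, i)))
    (\sum_j \sum_i k' (s j * r i)%g *: zeta (j, (a', i))) = n%:R * ((a == a')%:R * ip k k').
  rewrite -sum_cst dot_suml; apply: eq_bigr => j _.
  rewrite -(ip_shift (Gs j) hk hk') dot_suml mulr_sumr; apply: eq_bigr => i _.
  rewrite dot_sumr (bigD1 j) //= dot_sumr (bigD1 i) //= dotZl dotZr ozeta.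
  rewrite [X in _ + X + _]big1 => [|i' ii]; last first.
    by rewrite dotZl dotZr ozeta !xpair_eqE eqxx /= [i == _]eq_sym (negPf ii) andbF !mulr0.
  rewrite [X in _ + X]big1 => [|j' jj]; last first.
    rewrite dot_sumr big1 // => i' _.
    by rewrite dotZl dotZr ozeta !xpair_eqE [j == _]eq_sym (negPf jj) !mulr0.
  by rewrite !addr0 !xpair_eqE !eqxx andbT /= mulrA mulrC.
rewrite mulrA -(rmorph_nat (real_complex R) n) -!rmorphM /= sq_sq mul1r //.
Qed.

Definition tt_ (ai : A * 'I_q) : H := TT ai.1 (dl ai.2).

Lemma tt_onf : onf tt_.
Proof.
move=> [a i] [a' i']; rewrite /tt_ /= dot_TT; do ?exact: dl_eqv.
by rewrite ip_dl dl_r -natrM mulnb xpair_eqE.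
Qed.

Lemma TT_tt a k : eqv k -> TT a k = \sum_i k (r i) *: tt_ (a, i).
Proof.
move=> hk; rewrite (@TT_ext a k (fun x => \sum_i k (r i) * dl i x)); last first.
  by move=> x; exact: eqv_sum.
exact: TT_sum.
Qed.

Lemma pj_TT a k : eqv k -> pj tt_ (TT a k) = TT a k.
Proof.
move=> hk; apply: (pj_spn tt_onf); rewrite TT_tt //.
apply: lsub_sum; first exact: spn_lsub.
move=> i _; apply: (@lsubZ _ _ _ _ _ (spn_lsub _)).
by move=> M _; apply; exists (a, i).
Qed.

Definition ee (la : 'I_n * A) : H := TT la.2 (tr (s la.1) k0).

Lemma ip_trk0 g j j' : G g -> ip (tr (g * s j)%g k0) (tr (g * s j')%g k0) = (j == j')%:R.
Proof.
move=> Gg; rewrite ip_k0; do ?exact: sgpM.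
rewrite invgM -mulgA mulKg /k0; have [->|jj] := eqVneq j j'.
  by rewrite mulVg (asboolT (sgp1 sD)) psi_one invr1 conjc1.
rewrite asboolF ?conjc0 // => /s_inj e.
by rewrite e eqxx in jj.
Qed.

Lemma ee_onf_gen g : G g -> onf (fun la : 'I_n * A => TT la.2 (tr (g * s la.1)%g k0)).
Proof.
move=> Gg [j a] [j' a'] /=; rewrite dot_TT ?ip_trk0 // -?natrM ?mulnb ?xpair_eqE 1?andbC //.
all: by apply: tr_eqv; [exact: sgpM | exact: k0_eqv].
Qed.

Lemma ee_onf : onf ee.
Proof.
by have := ee_onf_gen (sgp1 sG) => h la lb; have := h la lb; rewrite !mul1g.
Qed.

(** Fell's trick: x goes to n^(-1/2) times the sum of (s j) k0 tensor (s j)^-1 x, the second factor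
    expanded in the basis [f]. If h s j = s j' c, then h moves the first factor to psi c times the
    translate at j', and the second factor of h x at j' is nearly psi c times that of x at j. *)
Definition JJ (x : H) : H := sq *: \sum_la dot (p (s la.1)^-1%g x) (f la.2) *: ee la.

Definition JJ' (y : H) : H := sq *: \sum_la dot y (ee la) *: p (s la.1) (f la.2).

Lemma JJ_lin : lin JJ.
Proof.
move=> c x y; rewrite /JJ scalerA mulrC -scalerA -scalerDr; congr (_ *: _).
rewrite scaler_sumr -big_split /=; apply: eq_bigr => la _.
by rewrite (urep_lin hp) dotDl dotZl scalerDl scalerA.
Qed.

Lemma JJ_adj : adj JJ JJ'.
Proof.
move=> x y; rewrite /JJ /JJ' dotZl dotZr [conjc _]conjc_real; congr (_ * _).
rewrite dot_suml dot_sumr; apply: eq_bigr => la _.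
by rewrite dotZl dotZr (urep_adj hp) invgK -dotC mulrC.
Qed.

Let Es : set H := [set x | forall j, pj f (p (s j)^-1%g x) = p (s j)^-1%g x].

Lemma JJ_dot x y : Es x -> dot (JJ x) (JJ y) = dot x y.
Proof.
move=> Ex; rewrite /JJ dotZl dotZr [conjc _]conjc_real mulrA.
have -> : dot (\sum_la dot (p (s la.1)^-1%g x) (f la.2) *: ee la)
   (\sum_la dot (p (s la.1)^-1%g y) (f la.2) *: ee la) = n%:R * dot x y.
  rewrite -sum_cst dot_suml.
  under eq_bigr => la _.
    rewrite dot_sumr (bigD1 la) //= big1 ?addr0 => [|lb lab]; last first.
      by rewrite dotZl dotZr ee_onf eq_sym (negPf lab) !mulr0.
    rewrite dotZl dotZr ee_onf eqxx mulr1.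
    over.
  rewrite -(pair_bigA _ (fun j a => dot (p (s j)^-1%g x) (f a) * conjc (dot (p (s j)^-1%g y) (f a)))) /=.
  apply: eq_bigr => j _; rewrite -(urep_dot hp (s j)^-1%g x) -[in RHS]Ex /pj dot_suml.
  by apply: eq_bigr => a _; rewrite dotZl -dotC.
by rewrite mulrA -(rmorph_nat (real_complex R) n) -!rmorphM /= sq_sq mul1r.
Qed.

Lemma JJ_nm x : Es x -> nm (JJ x) = nm x.
Proof.
by move=> Ex; apply/eqP; rewrite -(eqrXn2 (n := 2)) ?nm_ge0 // -!Re_dotxx JJ_dot.
Qed.

Lemma JJ_TT x : JJ x = \sum_a TT a (fun z => \sum_j (sq * dot (p (s j)^-1%g x) (f a)) * tr (s j) k0 z).
Proof.
rewrite /JJ; under [RHS]eq_bigr do rewrite TT_sum.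
rewrite exchange_big /= scaler_sumr.
rewrite (pair_bigA _ (fun j a => (sq * dot (p (s j)^-1%g x) (f a)) *: TT a (tr (s j) k0))) /=.
by apply: eq_bigr => la _; rewrite scalerA.
Qed.

Lemma eqv_lincomb (I : finType) (c : I -> R[i]) (k : I -> Gam -> R[i]) :
  (forall i, eqv (k i)) -> eqv (fun z => \sum_i c i * k i z).
Proof.
move=> hk g d Gg Dd; rewrite mulr_sumr; apply: eq_bigr => i _.
by rewrite hk // mulrCA.
Qed.

Lemma pj_JJ x : pj tt_ (JJ x) = JJ x.
Proof.
rewrite JJ_TT (lin_sum _ _ _ (pj_lin _)); apply: eq_bigr => a _.
apply: pj_TT; apply: eqv_lincomb => j.
by apply: tr_eqv => //; exact: k0_eqv.
Qed.

Lemma TT_in (X : set H) a k : lsub X -> (forall z, X (zeta z)) -> X (TT a k).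
Proof.
move=> sX hX; apply: lsubZ => //; apply: lsub_sum => // j _.
by apply: lsub_sum => // i _; exact: lsubZ.
Qed.

Lemma JJ_in (X : set H) x : lsub X -> (forall z, X (zeta z)) -> X (JJ x).
Proof.
by move=> sX hX; rewrite JJ_TT; apply: lsub_sum => // a _; exact: TT_in.
Qed.

(** * Almost equivariance *)

Variables (F : seq Gam) (b d d3 : R).
Hypotheses (FG : {in F, forall h, G h}) (FV : {in F, forall h, h^-1%g \in F}).
Hypotheses (sCg : sgp C) (b0 : 0 <= b) (d0 : 0 <= d) (d30 : 0 <= d3).

(** The Folner boundary: cosets of [C] in the finite set which h moves out of it. *)
Definition Bad (h : Gam) : {set 'I_n} := [set j | ~~ [exists j', `[< C ((s j')^-1 * h * s j)%g >]]].

Hypothesis Fol : {in F, forall h, #|Bad h|%:R <= b ^+ 2}.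
Hypothesis near : forall h j j' x, h \in F -> C ((s j')^-1 * h * s j)%g -> L x ->
  nm (p ((s j')^-1 * h * s j)%g x - psi ((s j')^-1 * h * s j)%g *: x) <= d * nm x.
Hypothesis zeta_near : forall j b, nm (zeta (j, b) - p (s j) (eta b)) <= d3.

Definition mu (h : Gam) (j : 'I_n) : 'I_n :=
  odflt j [pick j' | `[< C ((s j')^-1 * h * s j)%g >]].

Lemma muP h j : j \notin Bad h -> C ((s (mu h j))^-1 * h * s j)%g.
Proof.
rewrite inE negbK => /existsP[j' /asboolP h1]; rewrite /mu.
by case: pickP => [j'' /asboolP //|/(_ j')]; rewrite asboolT.
Qed.

Lemma muK h j : j \notin Bad h -> mu h j \notin Bad h^-1%g /\ mu h^-1%g (mu h j) = j.
Proof.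
move=> hj; have hC := muP hj.
have hC' : C ((s j)^-1 * h^-1 * s (mu h j))%g.
  by have := sgpV sCg hC; rewrite !invgM invgK mulgA.
have nB : mu h j \notin Bad h^-1%g.
  by rewrite inE negbK; apply/existsP; exists j; rewrite asboolT.
split=> //; have h2 := muP nB.
apply: s_inj; apply: CD; have := sgpM sCg h2 (sgpV sCg hC').
by rewrite !invgM !invgK -!mulgA !(mulVKg, mulKg).
Qed.

Let N : R := #|{: A * 'I_q}|%:R.

Let Th j (w : A * 'I_q -> R[i]) : H := \sum_b w b *: zeta (j, b).
Let Th0 (w : A * 'I_q -> R[i]) : H := \sum_b w b *: eta b.

Let Th_sqr j w : nm (Th j w) ^+ 2 = \sum_b cn (w b) ^+ 2.
Proof.
rewrite /Th (nm_sqr_comb (v := fun b => zeta (j, b))) // => b1 b2.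
by rewrite ozeta xpair_eqE eqxx.
Qed.

Let Th_orth j j' w w' : j != j' -> dot (Th j w) (Th j' w') = 0.
Proof.
move=> jj; rewrite /Th dot_suml big1 // => b1 _; rewrite dot_sumr big1 // => b2 _.
by rewrite dotZl dotZr ozeta xpair_eqE (negPf jj) !mulr0.
Qed.

Let Th_near j w (c : R) : 0 <= c -> \sum_b cn (w b) ^+ 2 <= c ^+ 2 ->
  nm (Th j w - p (s j) (Th0 w)) <= N * d3 * c.
Proof.
move=> c0 hw; rewrite /Th /Th0 (lin_sum _ _ _ (urep_lin hp _)) -sumrB.
apply: le_trans (nm_sum _ _ _) _.
apply: le_trans (_ : \sum_(b : A * 'I_q) d3 * c <= _); last first.
  by rewrite sumr_const -[leLHS]mulr_natl mulrA.
apply: ler_sum => b1 _; rewrite (linZ _ _ (urep_lin hp _)) -scalerBr nmZ mulrC.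
apply: ler_pM; rewrite ?nm_ge0 ?cn_ge0 //.
rewrite -(ler_pXn2r (n := 2)) ?nnegrE ?cn_ge0 //; apply: le_trans hw.
by rewrite (bigD1 b1) //= lerDl sumr_ge0 // => i _; rewrite sqr_ge0.
Qed.

Definition YY (k : A -> Gam -> R[i]) : H := \sum_a TT a (k a).

Let YY_Th (k : A -> Gam -> R[i]) : YY k = sq *: \sum_j Th j (fun ai => k ai.1 (s j * r ai.2)%g).
Proof.
rewrite /YY /TT -scaler_sumr exchange_big /=; congr (_ *: _); apply: eq_bigr => j _.
by rewrite /Th (pair_bigA _ (fun a i => k a (s j * r i)%g *: zeta (j, (a, i)))) /=;
  apply: eq_bigr => -[a i] _.
Qed.

Definition mass (k : A -> Gam -> R[i]) : R := \sum_a \sum_i cn (k a (r i)) ^+ 2.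

Lemma mass_shift (k : A -> Gam -> R[i]) g : (forall a, eqv (k a)) -> G g ->
  \sum_(ai : A * 'I_q) cn (k ai.1 (g * r ai.2)%g) ^+ 2 = mass k.
Proof.
move=> hk Gg; rewrite -(pair_bigA _ (fun a i => cn (k a (g * r i)%g) ^+ 2)) /=.
apply: eq_bigr => a _; apply: (@complexI R); have := ip_shift Gg (hk a) (hk a).
rewrite !rmorph_sum /= /ip; under eq_bigr do rewrite -cn_sqr.
by under [RHS]eq_bigr do rewrite -cn_sqr.
Qed.

Lemma YY_sqr (k : A -> Gam -> R[i]) : (forall a, eqv (k a)) -> nm (YY k) ^+ 2 = mass k.
Proof.
move=> hk; rewrite /YY nm_sqr_sum_orth => [|a a' aa]; last first.
  by rewrite dot_TT // (negPf aa) mul0r.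
apply: eq_bigr => a _; rewrite -Re_dotxx dot_TT // eqxx mul1r /ip Re_sum.
by apply: eq_bigr => i _; rewrite -cn_sqr.
Qed.

Hypothesis Nd3 : N * d3 <= 1.

Let sn : R := Num.sqrt n%:R.
Let sn0 : 0 < sn. Proof. by rewrite sqrtr_gt0. Qed.

(** The bound of [transfer_sum], scaled by n^(-1/2): each good index costs 2 N d3 for replacing zeta
    by translates of eta and 2 d for the near scalars, and the boundary has at most b^2 indices on
    either side. *)
Definition err : R := sn^-1 * (n%:R * (2 * (N * d3) + 2 * d) + 2 * b).

Lemma err_ge0 : 0 <= err.
Proof.
apply: mulr_ge0; first by rewrite invr_ge0 ltW.
have Nd : 0 <= N * d3 by rewrite mulr_ge0.
by apply: addr_ge0; apply: mulr_ge0 => //; apply: addr_ge0; apply: mulr_ge0.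
Qed.

(** At a good index h s j = s j' c. Moving c past r i conjugates it, which leaves psi unchanged by
    [CJ], so the coefficient acquires the inverse of psi c, while p c contributes nearly psi c to
    the vector; the two cancel. *)
Lemma YY_near (k : A -> Gam -> R[i]) h : (forall a, eqv (k a)) -> h \in F ->
  nm (p h (YY k) - YY (fun a => tr h (k a))) <= err * nm (YY k).
Proof.
move=> hk hF; have Gh := FG hF; have Gh' := sgpV sG Gh; have hF' := FV hF.
set c := nm (YY k); have c0 : 0 <= c by exact: nm_ge0.
have hk' a : eqv (tr h (k a)) by exact: tr_eqv.
have c2 : c ^+ 2 = mass k by exact: YY_sqr.
pose w j (ai : A * 'I_q) := k ai.1 (s j * r ai.2)%g.
pose w' j (ai : A * 'I_q) := k ai.1 (h^-1 * s j * r ai.2)%g.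
have mw j : \sum_b cn (w j b) ^+ 2 = c ^+ 2 by rewrite c2 /w mass_shift.
have mw' j : \sum_b cn (w' j b) ^+ 2 = c ^+ 2.
  by rewrite c2 /w' mass_shift //; exact: sgpM.
rewrite !YY_Th (linZ _ _ (urep_lin hp h)) (lin_sum _ _ _ (urep_lin hp h)) -scalerBr nmZ.
rewrite cn_real ger0_norm ?invr_ge0 ?sqrtr_ge0 // /err -mulrA ler_wpM2l ?invr_ge0 ?sqrtr_ge0 //.
have -> : \sum_j Th j (fun ai => tr h (k ai.1) (s j * r ai.2)%g) = \sum_j Th j (w' j).
  apply: eq_bigr => j _; apply: eq_bigr => ai _; congr (_ *: _).
  by rewrite /tr /w' mulgA.
have Thc j v : \sum_b cn (v b) ^+ 2 = c ^+ 2 -> nm (Th j v) <= c.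
  by move=> hv; apply: nm_le_sqr => //; rewrite Th_sqr hv.
have Ndc : 0 <= N * d3 by rewrite mulr_ge0.
rewrite mulrDl -mulrA; apply: (transfer_sum (B := Bad h) (B' := Bad h^-1%g) (mu := mu h) (mu' := mu h^-1%g)) => //.
- by move=> i j ij; rewrite (urep_dot hp) Th_orth.
- by move=> i j ij; rewrite Th_orth.
- by move=> j; rewrite (urep_nm hp); apply: Thc; exact: mw.
- by move=> j; apply: Thc; exact: mw'.
- by move=> j; exact: muK.
- by move=> j hj; have := muK hj; rewrite invgK.
- move=> j hj; have hC := muP hj; set j' := mu h j in hC *; set cc := (_ * _ * _)%g in hC.
  have Dc := CD hC; have Gc := DG Dc.
  have pc : psi cc != 0 by rewrite -cn_eq0 psi1 // oner_eq0.
  have e1 : Th j (w j) = (psi cc)^-1 *: Th j (w' j').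
    rewrite /Th scaler_sumr; apply: eq_bigr => -[a i] _; rewrite scalerA; congr (_ *: _).
    rewrite /w /w' /=.
    have -> : (s j * r i = h^-1 * s j' * r i * (cc ^ r i))%g.
      by rewrite -mulgA -conjgC /cc !mulgA mulgK mulVg mul1g.
    have [D1 p1] := CJ hC (Gr i).
    by rewrite hk ?p1 //; apply: sgpM => //; exact: sgpM.
  have sj : (h * s j = s j' * cc)%g by rewrite /cc !mulgA mulgV mul1g.
  pose x0 := Th0 (w' j').
  have Lx0 : L x0 by apply: lsub_sum => // i _; exact: lsubZ.
  have t1 : nm (Th j (w' j') - p (s j) x0) <= N * d3 * c by apply: Th_near; rewrite ?mw'.
  have t2 : nm (Th j' (w' j') - p (s j') x0) <= N * d3 * c by apply: Th_near; rewrite ?mw'.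
  have nx0 : nm x0 <= 2 * c.
    have h1 := Thc j' _ (mw' j').
    have := nmB (Th j' (w' j')) (Th j' (w' j') - p (s j') x0); rewrite subKr (urep_nm hp).
    have := ler_wpM2r c0 Nd3; lra.
  have h3 := near hF hC Lx0.
  rewrite e1 (linZ _ _ (urep_lin hp h)).
  have e2 : p h (p (s j) x0) = p (s j') (p cc x0) by rewrite -!(urepM hp) sj.
  pose z1 := (psi cc)^-1 *: p h (Th j (w' j') - p (s j) x0).
  pose z2 := (psi cc)^-1 *: p (s j') (p cc x0 - psi cc *: x0).
  have -> : (psi cc)^-1 *: p h (Th j (w' j')) - Th j' (w' j') =
      z1 + z2 - (Th j' (w' j') - p (s j') x0).
    rewrite /z1 /z2 (linB _ _ (urep_lin hp h)) (linB _ _ (urep_lin hp (s j'))) e2.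
    rewrite (linZ _ _ (urep_lin hp (s j'))) !scalerBr scalerA mulVf // scale1r.
    by rewrite opprB !addrA !subrK.
  apply: le_trans (nmB _ _) _.
  have n1 : nm z1 <= N * d3 * c.
    by rewrite /z1 nmZ cnV psi1 // invr1 mul1r (urep_nm hp).
  have n2 : nm z2 <= d * (2 * c).
    rewrite /z2 nmZ cnV psi1 // invr1 mul1r (urep_nm hp).
    by apply: le_trans h3 _; rewrite ler_wpM2l.
  have := nmD z1 z2; lra.
- by rewrite !mulr_ge0 // !addr_ge0 // !mulr_ge0.
- exact: Fol.
- exact: Fol.
Qed.

Lemma JJ_near x h : L x -> Es x -> Es (p h x) -> h \in F ->
  nm (p h (JJ x) - JJ (p h x)) <= 2 * err * nm x.
Proof.
move=> Lx Ex Ehx hF; have Gh := FG hF; have Gh' := sgpV sG Gh; have hF' := FV hF.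
pose k a := (fun z => \sum_j (sq * dot (p (s j)^-1%g x) (f a)) * tr (s j) k0 z).
have hk a : eqv (k a).
  by apply: eqv_lincomb => j; apply: tr_eqv => //; exact: k0_eqv.
have eJ : JJ x = YY k by rewrite JJ_TT.
have h1 := YY_near hk hF; rewrite -eJ JJ_nm // in h1.
apply: le_trans (nm_tri _ (YY (fun a => tr h (k a))) _) _.
have -> : 2 * err * nm x = err * nm x + err * nm x by ring.
apply: lerD => //.
pose Yl l := \sum_a dot (p (s l)^-1%g x) (f a) *: TT a (tr (h * s l)%g k0).
pose Wl l := \sum_a dot (p (s l)^-1%g (p h x)) (f a) *: TT a (tr (s l) k0).
have -> : YY (fun a => tr h (k a)) = sq *: \sum_l Yl l.
  rewrite /YY /Yl exchange_big /= scaler_sumr; apply: eq_bigr => a _.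
  rewrite -[tr h (k a)]/(fun z => \sum_j (sq * dot (p (s j)^-1%g x) (f a)) * tr (s j) k0 (h^-1 * z)%g).
  rewrite (TT_sum a _ (fun j z => tr (s j) k0 (h^-1 * z)%g)) scaler_sumr.
  apply: eq_bigr => l _; rewrite scalerA; congr (_ *: _); apply: TT_ext => z _.
  by rewrite /tr invgM mulgA.
have -> : JJ (p h x) = sq *: \sum_l Wl l.
  by rewrite /JJ /Wl (pair_bigA _ (fun l a => dot (p (s l)^-1%g (p h x)) (f a) *: TT a (tr (s l) k0))).
rewrite -scalerBr nmZ cn_real ger0_norm ?invr_ge0 ?sqrtr_ge0 // /err -mulrA.
rewrite ler_wpM2l ?invr_ge0 ?sqrtr_ge0 //.
have Ndc : 0 <= N * d3 by rewrite mulr_ge0.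
have nx := nm_ge0 x.
have bes y g j (o : onf (fun la : 'I_n * A => TT la.2 (tr (g * s la.1)%g k0))) :
    nm (\sum_a dot y (f a) *: TT a (tr (g * s j)%g k0)) <= nm y.
  apply: nm_le_sqr; first exact: nm_ge0.
  rewrite (nm_sqr_comb (v := fun a => TT a (tr (g * s j)%g k0))); first exact: bessel.
  by move=> a a'; have := o (j, a) (j, a') => /= ->; rewrite xpair_eqE eqxx.
have ort g j j' (c c' : A -> R[i]) (o : onf (fun la : 'I_n * A => TT la.2 (tr (g * s la.1)%g k0))) :
    j != j' -> dot (\sum_a c a *: TT a (tr (g * s j)%g k0)) (\sum_a c' a *: TT a (tr (g * s j')%g k0)) = 0.
  move=> jj; rewrite dot_suml big1 // => a _; rewrite dot_sumr big1 // => a' _.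
  by rewrite dotZl dotZr; have := o (j, a) (j', a') => /= ->; rewrite xpair_eqE (negPf jj) !mulr0.
have oh := ee_onf_gen Gh; have o1 := ee_onf_gen (sgp1 sG).
rewrite mulrDl -mulrA; apply: (transfer_sum (B := Bad h) (B' := Bad h^-1%g) (mu := mu h) (mu' := mu h^-1%g)) => //.
- by move=> i j ij; exact: ort.
- by move=> i j ij; have := ort _ i j _ _ o1 ij; rewrite !mul1g; apply.
- by move=> j; apply: le_trans (bes _ _ _ oh) _; rewrite (urep_nm hp).
- by move=> j; have := bes (p (s j)^-1%g (p h x)) _ j o1; rewrite mul1g !(urep_nm hp).
- by move=> j; exact: muK.
- by move=> j hj; have := muK hj; rewrite invgK.
- move=> j hj; have hC := muP hj; rewrite /Yl /Wl; set j' := mu h j in hC *.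
  set cc := (_ * _ * _)%g in hC.
  have Dc := CD hC; have Gc := DG Dc.
  have sj : (h * s j = s j' * cc)%g by rewrite /cc !mulgA mulgV mul1g.
  have psiV : psi cc^-1%g = (psi cc)^-1.
    have pc : psi cc != 0 by rewrite -cn_eq0 psi1 // oner_eq0.
    by apply: (mulfI pc); rewrite -psiM ?mulgV ?psi_one ?mulfV //; exact: sgpV.
  have e1 a : TT a (tr (h * s j)%g k0) = psi cc *: TT a (tr (s j') k0).
    rewrite -TT_scale; apply: TT_ext => z Gz.
    have Gy : G ((s j')^-1 * z)%g by apply: sgpM => //; exact: sgpV.
    have [D1 p1] := CJ (sgpV sCg hC) Gy.
    rewrite /tr sj invgM -mulgA conjgC k0_eqv // p1 psiV invrK //.
  pose v := p (s j')^-1%g (p h x).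
  pose u := p (s j)^-1%g x.
  have uv : v = p cc u by rewrite /v /u /cc -!(urepM hp) mulgK.
  have -> : \sum_a dot u (f a) *: TT a (tr (h * s j)%g k0) - \sum_a dot v (f a) *: TT a (tr (s j') k0)
      = \sum_a dot (psi cc *: u - v) (f a) *: TT a (tr (1 * s j')%g k0).
    rewrite -sumrB; apply: eq_bigr => a _; rewrite e1 mul1g dotBl dotZl scalerBl scalerA.
    by rewrite mulrC.
  apply: le_trans (bes _ _ _ o1) _; rewrite nmBC uv.
  have Lu : L u by apply: iL => //; exact: sgpV.
  apply: le_trans (near hF hC Lu) _; rewrite /u (urep_nm hp).
  by have := mulr_ge0 Ndc nx; have := mulr_ge0 d0 nx; lra.
- by rewrite !mulr_ge0 // !addr_ge0 // !mulr_ge0.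
- exact: Fol.
- exact: Fol.
Qed.

Lemma tt_acm h : h \in F -> acm (p h) (2 * err) (pj tt_).
Proof.
have main h' x : h' \in F -> pj tt_ x = x -> nm (p h' x - pj tt_ (p h' x)) <= err * nm x.
  move=> hF hx; pose k a := (fun z => \sum_i dot x (tt_ (a, i)) * dl i z).
  have hk a : eqv (k a) by apply: eqv_lincomb => i; exact: dl_eqv.
  have ex : x = YY k.
    rewrite -{1}hx /pj /YY /k; under [RHS]eq_bigr do rewrite TT_sum.
    by rewrite (pair_bigA _ (fun a i => dot x (tt_ (a, i)) *: TT a (dl i))) /=;
      apply: eq_bigr => -[].
  apply: le_trans (_ : nm (p h' x - YY (fun a => tr h' (k a))) <= _).
    apply: (pj_best tt_onf); rewrite /YY (lin_sum _ _ _ (pj_lin _)).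
    by apply: eq_bigr => a _; apply: pj_TT; apply: tr_eqv => //; exact: FG.
  by rewrite {1 2}ex; exact: YY_near.
move=> hF; have lh := urep_lin hp h; have aU : adj (p h) (p h^-1%g) by move=> x y; exact: urep_adj.
apply: (acm_pj tt_onf lh aU err_ge0) => x hx; apply: main => //.
exact: FV.
Qed.

End Model.

(** * Almost commuting projections through given vectors *)

Section MainLemma.
Variables (R : realType) (H : hilbertType R) (Gam : groupType) (p : Gam -> H -> H).
Hypothesis hp : urep p.

(** The range is required to lie in [X], so projections for orthogonal subspaces can be added; [X]
    itself need not be closed. *)
Definition qd (F : seq Gam) (e : R) (X : set H) := forall xs : seq H, {in xs, forall x, X x} ->
  exists (I : finType) (v : I -> H), [/\ onf v, forall i, X (v i),
    {in xs, forall x, pj v x = x} & {in F, forall h, acm (p h) e (pj v)}].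

Variables (F : seq Gam) (xs : seq H).

(** Level 0 is empty and level 1 is [xs], so that the spans start at zero and [P 1] in [absorption]
    is the span of the prescribed vectors. *)
Fixpoint words (j : nat) : seq H :=
  match j with
  | 0 => [::]
  | 1 => xs
  | j'.+1 => words j' ++ [seq p h x | h <- F, x <- words j']
  end.

Lemma words_mono i j x : (i <= j)%N -> x \in words i -> x \in words j.
Proof.
elim: j => [|[|j] IH]; first by rewrite leqn0 => /eqP->.
  by case: i {IH} => [|[|i]].
rewrite leq_eqVlt => /orP[/eqP->//|ij xi].
by rewrite mem_cat (IH _ xi).
Qed.

Lemma words_shift h j x : h \in F -> x \in words j -> p h x \in words j.+1.
Proof.
case: j => [|j] hF hx //; rewrite [words _]/= mem_cat; apply/orP; right.
by apply/allpairsP; exists (h, x).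
Qed.

Lemma filtration_ex : exists (I : nat -> finType) (v : forall j, I j -> H),
  [/\ forall j, onf (v j), forall j i, spn [set` words j] (v j i) &
      forall j x, x \in words j -> pj (v j) x = x].
Proof.
have h j : exists (J : finType) (u : J -> H), [/\ onf u,
    forall i, spn [set` words j] (u i) & {in words j, forall x, pj u x = x}].
  by apply: gram_schmidt => [|x hx]; [exact: spn_lsub | exact: spn_sub].
pose I j := projT1 (cid (h j)); have h2 j := projT2 (cid (h j)).
pose v j := projT1 (cid (h2 j)).
by exists I, v; split=> j; have [? ? ?] := projT2 (cid (h2 j)).
Qed.

End MainLemma.

Section MainLemma2.
Variables (R : realType) (H : hilbertType R) (Gam : groupType) (p : Gam -> H -> H).
Hypothesis hp : urep p.
Variables (G : set Gam) (L : set H).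
Hypotheses (sG : sgp G) (sL : lsub L) (iL : invariant p G L).
Variables (C D : set Gam) (psi : Gam -> R[i]).
Hypotheses (sCg : sgp C) (sD : sgp D) (DG : D `<=` G) (CD : C `<=` D).
Hypothesis psi1 : forall d, D d -> cn (psi d) = 1.
Hypothesis psiM : forall d d', D d -> D d' -> psi (d * d')%g = psi d * psi d'.
Hypothesis CJ : forall c g, C c -> G g -> D (c ^ g)%g /\ psi (c ^ g)%g = psi c.
Variables (q : nat) (r : 'I_q -> Gam) (ix : Gam -> 'I_q).
Hypothesis Gr : forall i, G (r i).
Hypothesis ixP : forall g, G g -> D ((r (ix g))^-1 * g)%g.
Hypothesis r_inj : forall i j, D ((r i)^-1 * r j)%g -> i = j.
Variables (n : nat) (s : 'I_n -> Gam).
Hypotheses (n0 : (0 < n)%N) (Gs : forall j, G (s j)).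
Hypothesis s_inj : forall i j, D ((s i)^-1 * s j)%g -> i = j.
Variables (F : seq Gam) (b d e : R).
Hypotheses (FG : {in F, forall h, G h}) (FV : {in F, forall h, h^-1%g \in F}).
Hypotheses (b0 : 0 <= b) (d0 : 0 <= d) (e0 : 0 < e).
Hypothesis Fol : {in F, forall h, #|Bad C s h|%:R <= b ^+ 2}.
Hypothesis near : forall h j j' x, h \in F -> C ((s j')^-1 * h * s j)%g -> L x ->
  nm (p ((s j')^-1 * h * s j)%g x - psi ((s j')^-1 * h * s j)%g *: x) <= d * nm x.
Hypothesis small : 112 * ((Num.sqrt n%:R)^-1 * (n%:R * (2 * d) + 2 * b)) <= e / 2.
Hypothesis free : forall (E : seq H) (d' : R), 0 < d' ->
  exists x, [/\ L x, nm x = 1, {in E, forall y, cn (dot x y) <= d'} &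
    forall i j, i != j -> cn (dot (p ((s j)^-1 * s i)%g x) x) <= d'].

(** Free vectors are scattered so that their translates by the s j are nearly orthonormal and nearly
    orthogonal to the word filtration. Perturbed to exact orthogonality, they carry the model of the
    induced representation, and [absorption] rotates it onto [xs]. *)
Lemma main_lemma : qd p F e L.
Proof.
move=> xs Lxs.
have [I [v [ov vW vK]]] := filtration_ex p F xs.
pose P j x := pj (v j) x.
have linP j : lin (P j) by exact: pj_lin.
have spnP j x : spn [set` words p F xs j] (P j x) by apply: pj_in; [exact: spn_lsub | exact: vW].
have fixP j x : spn [set` words p F xs j] x -> P j x = x.
  move=> h; apply: (h [set y | P j y = y]); last by move=> y /= hy; exact: vK.
  split=> [|k y z /= hy hz]; first exact: (lin0 (linP j)).
  by rewrite linP hy hz.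
have P0 x : P 0 x = 0.
  have h : spn [set` words p F xs 0] (P 0 x) by [].
  by apply: (h [set y | y = 0]) => [|y //]; split=> // k y z /= -> ->; rewrite scaler0 addr0.
have adjP j x y : dot (P j x) y = dot x (P j y) by exact: pj_adj.
have PP i j x : (i <= j)%N -> P j (P i x) = P i x.
  move=> ij; apply: fixP; apply: (spnP i x); first exact: spn_lsub.
  by move=> y hy; apply: spn_sub; exact: words_mono hy.
have PF h j x : h \in F -> P j.+1 (p h (P j x)) = p h (P j x).
  move=> hF; apply: fixP; have lh := urep_lin hp h.
  apply: (spnP j x [set y | spn [set` words p F xs j.+1] (p h y)]).
    split=> [|k y z /= hy hz]; first by rewrite /= (lin0 lh); exact: (lsub0 (spn_lsub _)).
    by rewrite lh; apply: (spn_lsub _).2.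
  by move=> y hy; apply: spn_sub; exact: words_shift.
have LW j x : x \in words p F xs j -> L x.
  elim: j x => [|[|j] IH] x //; first exact: Lxs.
  rewrite [words _ _ _ _]/= mem_cat => /orP[|/allpairsP[[h y] [hF hy ->]]]; first exact: IH.
  by apply: iL; [exact: FG | exact: IH].
have LP j x : L (P j x).
  by apply: (spnP j x) => // y; exact: LW.
have [m m0 hm] : exists2 m, (0 < m)%N & 112 / m%:R <= e / 4.
  have e4 : 0 < e / 4 by rewrite divr_gt0.
  have [N hN] := harmonic_small 112 e4.
  by exists N.+1 => //; apply: ltW; exact: hN.
(* The family [f] has to span all the translates of level m + 1 by inverses of the s j: that is what
   makes [JJ] isometric there. *)
pose fl := [seq p (s j)^-1%g (v m.+1 k) | j <- enum 'I_n, k <- enum (I m.+1)].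
have Lv j k : L (v j k) by rewrite -(pj_v (ov j)); exact: LP.
have [|A [f [of_ Lf fK]]] := gram_schmidt (X := L) (xs := fl) sL.
  by move=> _ /allpairsP[[j k] [_ _ ->]]; apply: iL => //=; exact: sgpV.
have Es x : P m.+1 x = x -> forall j, pj f (p (s j)^-1%g x) = p (s j)^-1%g x.
  move=> hx j; rewrite -hx /P /pj -/(pj f _) (lin_sum _ _ _ (urep_lin hp _)).
  rewrite (lin_sum _ _ _ (pj_lin _)); apply: eq_bigr => k _.
  rewrite (linZ _ _ (urep_lin hp _)) (linZ _ _ (pj_lin _)) fK //.
  by apply/allpairsP; exists (j, k); rewrite !mem_enum.
pose Nq : R := (#|{: A * 'I_q}|)%:R.
have Nq0 : 0 <= Nq by [].
have sn0 : 0 < Num.sqrt n%:R :> R by rewrite sqrtr_gt0 ltr0n.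
have n0R : 0 < n%:R :> R by rewrite ltr0n.
have k0 : 0 < (Num.sqrt n%:R)^-1 * n%:R :> R by apply: mulr_gt0 => //; rewrite invr_gt0.
(* The final error is 112 err + 112/m. Hypothesis [small] accounts for e/2 of it, the choice of m
   for e/4; the d3 term of err is multiplied by 224, and 896 = 4 * 224 gives it the last e/4. *)
have [t0 [t00 t01 t02]] : exists t0 : R,
    [/\ 0 < t0, t0 <= 1 & t0 <= e / (896 * ((Num.sqrt n%:R)^-1 * n%:R))].
  exists (Num.min 1 (e / (896 * ((Num.sqrt n%:R)^-1 * n%:R)))); split.
  - rewrite lt_min ltr01 /=; refine (divr_gt0 e0 (mulr_gt0 _ k0)); rewrite ltr0n; reflexivity.
  - by rewrite ge_min lexx.
  - by rewrite ge_min lexx orbT.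
have [d3 d30 Nd3] : exists2 d3 : R, 0 < d3 & Nq * d3 <= t0.
  have Nq1 : 0 < Nq + 1 by rewrite ltr_wpDl.
  exists (t0 / (Nq + 1)); first exact: divr_gt0.
  rewrite mulrA ler_pdivrMr // mulrC; apply: ler_wpM2l; first exact: ltW.
  by rewrite lerDl.
have Nd31 : Nq * d3 <= 1 by exact: le_trans Nd3 _.
have [d' d'0 hGS] := @almost_onf R H ('I_n * (A * 'I_q))%type d3 d30.
pose dd := d' / (#|I m.+1|%:R + 1).
have k1 : 0 < #|I m.+1|%:R + 1 :> R by rewrite ltr_wpDl.
have dd0 : 0 < dd by rewrite divr_gt0.
have ddd' : dd <= d' by rewrite /dd ler_pdivrMr // ler_peMr ?(ltW d'0) // lerDr.
pose T := [seq ((s ij.2)^-1 * s ij.1)%g | ij <- enum {: 'I_n * 'I_n}].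
pose E := [seq p (s j)^-1%g (v m.+1 k) | j <- enum 'I_n, k <- enum (I m.+1)].
have [et het] := scattered_seq hp #|{: A * 'I_q}| E T (fun E' => free E' dd0).
pose eta (ai : A * 'I_q) := et (enum_rank ai).
have eP ai := het _ (ltn_ord (enum_rank ai)).
have Leta ai : L (eta ai) by have [] := eP ai.
pose u (z : 'I_n * (A * 'I_q)) := p (s z.1) (eta z.2).
have [|||z [oz Lz zv zu]] := hGS L _ (v m.+1) u sL (ov _) (Lv _).
- by move=> [j ai]; exact: iL.
- move=> [j ai]; rewrite /pj; apply: le_trans (nm_sum _ _ _) _.
  apply: le_trans (_ : \sum_(k : I m.+1) dd <= _).
    apply: ler_sum => k _; rewrite nmZ (onf_nm k (ov _)) mulr1 (urep_adj hp).
    have [_ _ h _ _] := eP ai; apply: h.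
    by apply/allpairsP; exists (j, k); rewrite !mem_enum.
  rewrite sumr_const -[leLHS]mulr_natl /dd mulrA ler_pdivrMr // mulrC.
  by rewrite ler_wpM2l ?(ltW d'0) // lerDl.
- move=> [j ai] [j' ai'].
  have -> : dot (u (j, ai)) (u (j', ai')) = dot (p ((s j')^-1 * s j)%g (eta ai)) (eta ai').
    by rewrite /u /= (urepM hp) (urep_adj hp (s j')^-1%g) invgK.
  have [_ n1 _ h1 h2] := eP ai.
  have [<-|aa] := eqVneq ai ai'.
    rewrite xpair_eqE eqxx andbT; have [<-|jj] := eqVneq j j'.
      by rewrite mulVg (urep1 hp) dotxx n1 expr1n subrr cn0 ltW.
    by rewrite subr0; apply: le_trans (h1 _ _ jj) _.
  rewrite xpair_eqE (negPf aa) andbF subr0; apply: le_trans ddd'.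
  apply: h2 => //; first by apply: contra aa => /eqP/ord_inj/enum_rank_inj->.
  by apply/mapP; exists (j, j'); rewrite // mem_enum.
have zn j ai : nm (z (j, ai) - p (s j) (eta ai)) <= d3 by exact: zu.
have Pz x : P m.+1 (z x) = 0.
  by rewrite /P /pj big1 // => k _; rewrite zv scale0r.
have ot := tt_onf sG sD psi1 psiM Gr ixP r_inj n0 Gs oz.
have l0 : lsub [set y | P m.+1 y = 0].
  by split=> [|k x y /= hx hy]; rewrite /= ?(lin0 (linP _)) // linP hx hy scaler0 addr0.
have tP i : P m.+1 (tt_ D psi r s z i) = 0 by exact: (@TT_in _ _ _ q r n s A z _ i.1 (dl D psi r i.2) l0 Pz).
pose er := err q n A b d d3.
have er0 : 0 <= 2 * er by apply: mulr_ge0 => //; apply: err_ge0 => //; exact: ltW.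
have tacm : {in F, forall h, acm (p h) (2 * er) (pj (tt_ D psi r s z))}.
  move=> h hF; apply: (@tt_acm _ _ _ p hp G L sG sL C D psi sD DG CD psi1 psiM CJ q r ix
    Gr ixP r_inj n s n0 Gs s_inj A z eta oz Leta F b d d3) => //; exact: ltW.
have JF h x : h \in F -> nm (p h (JJ p D psi r s z f (P m x)) - JJ p D psi r s z f (p h (P m x)))
    <= 2 * er * nm (P m x).
  move=> hF; apply: (@JJ_near _ _ _ p hp G L sG sL iL C D psi sD DG CD psi1 psiM CJ q r ix
    Gr ixP r_inj n s n0 Gs s_inj A z eta f oz of_ Leta F b d d3) => //.
  - exact: ltW.
  - by apply: Es; apply: PP.
  - by apply: Es; apply: PF.
have Jiso x y : dot (JJ p D psi r s z f (P m.+1 x)) (JJ p D psi r s z f (P m.+1 y))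
    = dot (P m.+1 x) (P m.+1 y).
  have hx := Es _ (PP m.+1 m.+1 x (leqnn _)).
  exact: (JJ_dot hp sG sD psi1 psiM Gr ixP r_inj n0 Gs s_inj oz _ hx).
have [w [ow w1 wF wL]] := @absorption _ _ _ p hp F P FV linP P0 adjP PP PF m _ _
   (JJ p D psi r s z f) (JJ' p D psi r s z f) (2 * er) m0 er0 ot tP tacm
   (JJ_lin hp D psi r s z f) (JJ_adj hp D psi r s z f)
   (fun x => @pj_JJ _ _ _ p G sG D psi sD psi1 psiM q r ix Gr ixP r_inj n s n0 Gs A z f oz x)
   Jiso JF.
exists _, w; split=> //.
- apply: wL => // [i|x]; first exact: (@TT_in _ _ _ q r n s A z _ i.1 (dl D psi r i.2) sL Lz).
  exact: JJ_in.
- by move=> x hx; apply: w1; exact: vK.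
- move=> h hF x; apply: le_trans (wF h hF x) _; apply: ler_wpM2r; first exact: nm_ge0.
  have : (Num.sqrt n%:R)^-1 * n%:R * (Nq * d3) <= e / 896.
    apply: le_trans (_ : (Num.sqrt n%:R)^-1 * n%:R * (e / (896 * ((Num.sqrt n%:R)^-1 * n%:R))) <= _).
      apply: ler_wpM2l; first exact: ltW.
      exact: le_trans Nd3 _.
    move: ((Num.sqrt n%:R)^-1 * n%:R : R) k0 => k k0.
    by rewrite invfM mulrCA [k * _]mulrCA divff ?mulr1 // gt_eqF.
  rewrite /er /err -/Nq; move: small hm.
  move: ((Num.sqrt n%:R)^-1 : R) (n%:R : R) (m%:R^-1 : R) (Nq * d3) => k N q0 c h1 h2 h3; lra.
Qed.

End MainLemma2.

(** * Homomorphisms on subsets and quotients by sets *)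

Section SetMorphisms.
Variables (Gam K : groupType) (G : set Gam) (f : Gam -> K).
Hypothesis sG : sgp G.
Local Open Scope group_scope.

Definition shom := forall g h, G g -> G h -> f (g * h) = f g * f h.
Hypothesis fM : shom.

Lemma shom1 : f 1 = 1.
Proof. by apply: (mulgI (f 1)); rewrite -fM ?mulg1 //; exact: sgp1. Qed.

Lemma shomV g : G g -> f g^-1 = (f g)^-1.
Proof.
move=> Gg; apply: (mulgI (f g)); rewrite -fM ?mulgV ?shom1 //; exact: sgpV.
Qed.

Lemma shomJ g h : G g -> G h -> f (g ^ h) = f g ^ f h.
Proof.
move=> Gg Gh; rewrite !conjgE !fM ?shomV //; first exact: sgpV.
exact: sgpM.
Qed.

Lemma shomR g h : G g -> G h -> f [~ g, h] = [~ f g, f h].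
Proof.
by move=> Gg Gh; rewrite !commgEl fM ?shomV ?shomJ //; [exact: sgpV | exact: sgpJ].
Qed.

Lemma shomX g n : G g -> f (g ^+ n) = f g ^+ n.
Proof.
move=> Gg; elim: n => [|n IH]; first exact: shom1.
by rewrite !expgS fM ?IH //; exact: sgpX.
Qed.

Lemma shom_eq g h : G g -> G h -> f (g^-1 * h) = 1 -> f g = f h.
Proof.
move=> Gg Gh; rewrite fM ?shomV //; last exact: sgpV.
by move=> /(congr1 (fun k => f g * k)); rewrite mulVKg mulg1.
Qed.

Lemma eq_shom g h : G g -> G h -> f g = f h -> f (g^-1 * h) = 1.
Proof. by move=> Gg Gh e; rewrite fM ?shomV ?e ?mulVg //; exact: sgpV. Qed.

End SetMorphisms.

Section QuotientBySets.
Variables (Gam : groupType) (G C : set Gam).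
Hypotheses (sG : sgp G) (sC : sgp C).
Hypothesis nC : forall c g, C c -> G g -> C (c ^ g)%g.
Local Open Scope group_scope.

Let cls (g : Gam) : set Gam := [set h | G h /\ C (g^-1 * h)].
Let rho (g : Gam) : Gam := xget 1 (cls g).

Let rhoP g : G g -> G (rho g) /\ C (g^-1 * rho g).
Proof.
move=> Gg; apply: (@xgetPex _ 1 (cls g)); exists g; split=> //.
by rewrite mulVg; exact: sgp1.
Qed.

Let rho_eq g h : G g -> G h -> C (g^-1 * h) -> rho g = rho h.
Proof.
move=> Gg Gh Cgh; congr (xget _ _); apply/seteqP; split=> k /= [Gk Ck]; split=> //.
  have -> : h^-1 * k = (g^-1 * h)^-1 * (g^-1 * k) by rewrite invgM invgK -mulgA mulVKg.
  by apply: sgpM => //; exact: sgpV.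
have -> : g^-1 * k = (g^-1 * h) * (h^-1 * k) by rewrite -mulgA mulVKg.
exact: sgpM.
Qed.

Let eq_rho g h : G g -> G h -> rho g = rho h -> C (g^-1 * h).
Proof.
move=> Gg Gh e; have [G1 C1] := rhoP Gg; have [G2 C2] := rhoP Gh.
have -> : g^-1 * h = (g^-1 * rho g) * (h^-1 * rho g)^-1 by rewrite invgM invgK -mulgA mulVKg.
by rewrite {2}e; apply: sgpM => //; exact: sgpV.
Qed.

(** The carrier of the quotient consists of the chosen coset representatives. This yields a genuine
    [groupType] although [G] and [C] are only sets. *)
Let T := {g : Gam | `[< G g /\ rho g = g >]}.
Let rho_sub (g : Gam) (Gg : G g) : `[< G (rho g) /\ rho (rho g) = rho g >].
Proof. by have [h1 h2] := rhoP Gg; apply/asboolP; split=> //; exact/esym/(rho_eq Gg h1 h2). Qed.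
Let f_ (g : Gam) (Gg : G g) : T := exist _ (rho g) (rho_sub Gg).
Let TG (x : T) : G (sval x). Proof. by case: x => g /= /asboolP[]. Qed.
Let fP g h (Gg : G g) (Gh : G h) : C (g^-1 * h) -> f_ Gg = f_ Gh.
Proof. by move=> c; apply: val_inj => /=; exact: rho_eq. Qed.
Let f_sval (x : T) : f_ (TG x) = x.
Proof. by apply: val_inj => /=; case: x => g /= /asboolP[]. Qed.

Let tmul (x y : T) : T := f_ (sgpM sG (TG x) (TG y)).
Let tinv (x : T) : T := f_ (sgpV sG (TG x)).
Let tone : T := f_ (sgp1 sG).

Let fM g h (Gg : G g) (Gh : G h) : tmul (f_ Gg) (f_ Gh) = f_ (sgpM sG Gg Gh).
Proof.
apply: fP => /=; have [G1 C1] := rhoP Gg; have [G2 C2] := rhoP Gh.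
have -> : (rho g * rho h)^-1 * (g * h) = ((g^-1 * rho g)^-1) ^ rho h * (h^-1 * rho h)^-1.
  by rewrite conjgE !invgM !invgK !mulgA mulgK.
by apply: sgpM => //; [apply: nC => //|]; exact: sgpV.
Qed.

Let tmulA : associative tmul.
Proof.
move=> x y z; rewrite -(f_sval x) -(f_sval y) -(f_sval z) !fM.
by apply: fP; rewrite -[X in _ * X]mulgA mulVg; exact: sgp1.
Qed.
Let tmul1 : left_id tone tmul.
Proof. by move=> x; rewrite -(f_sval x) fM; apply: fP; rewrite mul1g mulVg; exact: sgp1. Qed.
Let t1mul : right_id tone tmul.
Proof. by move=> x; rewrite -(f_sval x) fM; apply: fP; rewrite mulg1 mulVg; exact: sgp1. Qed.
Let tinvE g (Gg : G g) : tinv (f_ Gg) = f_ (sgpV sG Gg).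
Proof.
apply: fP => /=; have [G1 C1] := rhoP Gg; rewrite invgK.
have -> : rho g * g^-1 = (g^-1 * rho g) ^ g^-1 by rewrite conjgE invgK mulgA mulVKg.
by apply: nC => //; exact: sgpV.
Qed.
Let tVmul : left_inverse tone tinv tmul.
Proof.
move=> x; rewrite -(f_sval x) tinvE fM; apply: fP; rewrite mulVg invg1 mul1g; exact: sgp1.
Qed.
Let tmulV : right_inverse tone tinv tmul.
Proof.
move=> x; rewrite -(f_sval x) tinvE fM; apply: fP; rewrite mulgV invg1 mul1g; exact: sgp1.
Qed.

HB.instance Definition _ := Choice.on T.
HB.instance Definition _ := isGroup.Build T tmulA tmul1 t1mul tVmul tmulV.

Lemma quotient_by_sets : exists (K : groupType) (f : Gam -> K),
  [/\ shom G f, forall g, G g -> (f g = 1 <-> C g) & forall k, exists2 g, G g & f g = k].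
Proof.
(* The map is total on the ambient group; outside [G] it takes the default value 1. *)
exists T, (fun g => if pselect (G g) is left Gg then f_ Gg else tone); split.
- move=> g h Gg Gh; case: pselect => [Ggh|[]]; last exact: sgpM sG Gg Gh.
  case: pselect => // Gg'; case: pselect => // Gh'.
  by rewrite [RHS]fM; congr f_; exact: Prop_irrelevance.
- move=> g Gg; case: pselect => // Gg'; split=> [h|Cg].
    by have := eq_rho (sgp1 sG) Gg' (esym (congr1 val h)); rewrite invg1 mul1g.
  by apply/esym/fP; rewrite invg1 mul1g.
- move=> k; exists (sval k); first exact: TG.
  case: pselect => [h|[]]; last exact: TG.
  by rewrite -[RHS]f_sval; congr f_; exact: Prop_irrelevance.
Qed.

End QuotientBySets.

(** * Polynomial growth in nilpotency class two *)

Section Growth.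
Local Open Scope group_scope.

Definition wprod (K : groupType) (w : seq K) : K := foldr *%g 1 w.

Lemma wprod_cat (K : groupType) (w w' : seq K) : wprod (w ++ w') = wprod w * wprod w'.
Proof. by elim: w => [|x w IH] /=; rewrite ?mul1g // IH mulgA. Qed.

Lemma wprod_nseq (K : groupType) n (x : K) : wprod (nseq n x) = x ^+ n.
Proof. by elim: n => [|n IH] //=; rewrite IH expgS. Qed.

(** Central letters can be collected, so a word is determined by its exponents, each at most m. *)
Lemma central_cover (K : groupType) (ys : seq K) (m : nat) :
  {in ys, forall y k, commute y k} ->
  exists2 T : seq K, (size T <= m.+1 ^ size ys)%N &
    forall w, {subset w <= ys} -> (size w <= m)%N -> wprod w \in T.
Proof.
elim: ys => [|y ys IH] cy.
  exists [:: 1] => //= -[|x w] h // _; first by rewrite inE.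
  by have := h x; rewrite mem_head => /(_ isT).
have [|T sT hT] := IH; first by move=> z hz; apply: cy; rewrite inE hz orbT.
exists [seq y ^+ i * t | i <- iota 0 m.+1, t <- T].
  by rewrite size_allpairs size_iota /= expnS leq_mul2l sT orbT.
move=> w hw sw.
suff [i [w' [h1 h2 h3]]] : exists i w', [/\ {subset w' <= ys}, (i + size w' = size w)%N &
    wprod w = y ^+ i * wprod w'].
  apply/allpairsP; exists (i, wprod w'); rewrite mem_iota; split=> //.
    by rewrite add0n ltnS (leq_trans _ sw) // -h2 leq_addr.
  by apply: hT => //; rewrite (leq_trans _ sw) // -h2 leq_addl.
elim: w hw {sw} => [|x w IHw] hw; first by exists 0%N, [::]; split=> //=; rewrite mul1g.
have [|i [w' [h1 h2 h3]]] := IHw; first by move=> z hz; apply: hw; rewrite inE hz orbT.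
have := hw x (mem_head _ _); rewrite inE => /orP[/eqP->|xys].
  by exists i.+1, w'; split=> //=; [rewrite addSn h2 | rewrite h3 expgS mulgA].
exists i, (x :: w'); split.
- by move=> z; rewrite inE => /orP[/eqP->//|]; exact: h1.
- by rewrite /= addnS h2.
- have e : x * y ^+ i = y ^+ i * x.
    by apply: commuteX; apply: commute_sym; apply: cy; exact: mem_head.
  by rewrite /= h3 mulgA e -mulgA.
Qed.

(** The summand 1 is the exponent of the first letter; the recursive term counts words in the k'
    other letters; 2 k' counts words of length n^2 in the k' commutators, since n^2 + 1 <= (n +
    1)^2. *)
Fixpoint growth_degree (k : nat) : nat :=
  if k is k'.+1 then (1 + (growth_degree k' + 2 * k'))%N else 0%N.

(* Move every occurrence of the first letter to the front: each jump costs one central commutator. *)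
Lemma class2_cover (K : groupType) (xs : seq K) (n : nat) :
  (forall a b c : K, commute [~ a, b] c) ->
  exists2 T : seq K, (size T <= n.+1 ^ growth_degree (size xs))%N &
    forall w, {subset w <= xs} -> (size w <= n)%N -> wprod w \in T.
Proof.
move=> K2; elim: xs => [|x xs [T sT hT]].
  exists [:: 1] => //= -[|x w] h // _; first by rewrite inE.
  by have := h x; rewrite mem_head => /(_ isT).
have [|T' sT' hT'] := @central_cover K [seq [~ y, x] | y <- xs] (n * n).
  by move=> _ /mapP[y _ ->] k.
exists [seq x ^+ i * u | i <- iota 0 n.+1, u <- [seq t * t' | t <- T, t' <- T']].
  rewrite !size_allpairs size_iota /= expnD expn1 leq_mul2l /= expnD leq_mul //.
  apply: leq_trans sT' _; rewrite size_map expnM.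
  case: (size xs) => [|k]; first by rewrite !expn0.
  by rewrite leq_exp2r // expnS expn1; apply: ltn_mul.
move=> w hw sw.
suff [i [w' [c [[h1 h2] h3 h4 h5]]]] : exists i w' c, [/\ {subset w' <= xs} /\
    {subset c <= [seq [~ y, x] | y <- xs]}, (i + size w' = size w)%N,
    (size c <= size w * size w)%N & wprod w = x ^+ i * (wprod w' * wprod c)].
  apply/allpairsP; exists (i, wprod w' * wprod c); rewrite mem_iota; split=> //.
    by rewrite add0n ltnS (leq_trans _ sw) // -h3 leq_addr.
  apply/allpairsP; exists (wprod w', wprod c) => /=; split=> //.
    by apply: hT => //; rewrite (leq_trans _ sw) // -h3 leq_addl.
  by apply: hT' => //; apply: leq_trans h4 _; exact: leq_mul.
elim: w hw {sw} => [|y w IHw] hw.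
  by exists 0%N, [::], [::]; split=> //=; rewrite !mul1g.
have [|i [w' [c [[h1 h2] h3 h4 h5]]]] := IHw; first by move=> z hz; apply: hw; rewrite inE hz orbT.
have := hw y (mem_head _ _); rewrite inE => /orP[/eqP->|yxs].
  exists i.+1, w', c; split=> //=; [by rewrite addSn h3 | | by rewrite h5 expgS mulgA].
  by apply: leq_trans h4 _; apply: leq_mul.
exists i, (y :: w'), (nseq i [~ y, x] ++ c); split.
- split=> z; first by rewrite inE => /orP[/eqP->//|]; exact: h1.
  by rewrite mem_cat => /orP[|/h2//]; rewrite mem_nseq => /andP[_ /eqP->]; exact: map_f.
- by rewrite /= addnS h3.
- rewrite size_cat size_nseq /= mulSn mulnS addnA; apply: leq_add => //.
  by rewrite -h3 (leq_trans (leq_addr (size w') i)) // addSn leqW // leq_addr.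
have e : y * x ^+ i = x ^+ i * y * [~ y, x] ^+ i.
  elim: (i) => [|j IH]; first by rewrite !mulg1 mul1g.
  have e1 : [~ y, x] ^+ j * x = x * [~ y, x] ^+ j.
    by apply/esym/commuteX/commute_sym/K2.
  rewrite expgSr mulgA IH -(mulgA (x ^+ j * y)) e1 !mulgA -(mulgA (x ^+ j) y x) (commgC y x).
  by rewrite expgS !mulgA.
rewrite /= wprod_cat wprod_nseq h5 mulgA e -!mulgA; congr (_ * (_ * _)).
by rewrite !mulgA; congr (_ * _); apply/esym/commuteX; apply: commute_sym; exact: K2.
Qed.

End Growth.

Section SlowGrowth.
Variable R : realType.

Lemma bernoulli_le (e : R) m : 0 <= e -> 1 + m%:R * e <= (1 + e) ^+ m.
Proof.
move=> e0; elim: m => [|m IH]; first by rewrite mul0r addr0 expr0.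
rewrite exprS; apply: le_trans (_ : (1 + e) * (1 + m%:R * e) <= _); last first.
  by apply: ler_wpM2l => //; rewrite addr_ge0.
rewrite -natr1; have : 0 <= m%:R * e * e by rewrite !mulr_ge0.
by move: (m%:R : R) => k; lra.
Qed.

Lemma poly_lt_exp (P : nat) (e : R) : 0 < e -> exists N : nat, N.+1%:R ^+ P < (1 + e) ^+ N.
Proof.
move=> e0; pose K : R := P.+1%:R + P.+1%:R / e.
have K0 : 0 <= K by rewrite addr_ge0 // divr_ge0 // ltW.
pose m := Num.bound (K ^+ P / e).
have hm : K ^+ P < 1 + m%:R * e.
  have := archi_boundP (divr_ge0 (exprn_ge0 P K0) (ltW e0)).
  rewrite -/m ltr_pdivrMr // => h; apply: lt_trans h _; by rewrite ltrDr.
exists (m * P.+1)%N; rewrite exprM.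
have h0 : 0 <= 1 + m%:R * e by rewrite addr_ge0 // mulr_ge0 // ltW.
apply: lt_le_trans (_ : (1 + m%:R * e) ^+ P.+1 <= _); last first.
  by apply: lerXn2r; rewrite ?nnegrE ?exprn_ge0 // ?bernoulli_le // ?addr_ge0 // ltW.
apply: le_lt_trans (_ : (K * (1 + m%:R * e)) ^+ P < _).
  apply: lerXn2r; rewrite ?nnegrE ?mulr_ge0 // -natr1 natrM /K.
  have -> : (P.+1%:R + P.+1%:R / e) * (1 + m%:R * e)
    = m%:R * P.+1%:R + P.+1%:R + (P.+1%:R * m%:R * e + P.+1%:R / e) :> R.
    by field; rewrite gt_eqF.
  rewrite -[leLHS]addr0 lerD //; last by rewrite addr_ge0 ?mulr_ge0 // ?invr_ge0 ltW.
  by rewrite lerD2l ler1n.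
rewrite exprMn exprS; rewrite ltr_pM2r //.
apply: exprn_gt0; by rewrite ltr_pwDl // mulr_ge0 // ltW.
Qed.

(** [N] precedes the sequence in the quantifiers: one bound on the radius must serve all quotients
    with the same growth degree. *)
Lemma slow_growth (P : nat) (e : R) : 0 < e -> exists N : nat, forall a : nat -> nat,
  (forall n, (0 < a n)%N) -> (forall n, (a n <= n.+1 ^ P)%N) ->
  exists2 n, (n < N)%N & (a n.+1)%:R <= (1 + e) * (a n)%:R.
Proof.
move=> e0; have [N hN] := poly_lt_exp P e0; exists N => a a0 aP.
apply: contrapT => h.
have hk k : (k <= N)%N -> (1 + e) ^+ k <= (a k)%:R.
  elim: k => [_|k IH kN]; first by rewrite expr0 ler1n.
  have [le|lt] := leP (a k.+1)%:R ((1 + e) * (a k)%:R); first by case: h; exists k.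
  apply: le_trans (ltW lt); rewrite exprS; apply: ler_wpM2l; last exact: IH (ltnW kN).
  by rewrite addr_ge0 // ltW.
have := hk N (leqnn _); apply/negP; rewrite -ltNge; apply: le_lt_trans hN.
by rewrite -natrX ler_nat.
Qed.

End SlowGrowth.

(** * Folner sets modulo a subgroup *)

Section Folner.
Local Open Scope group_scope.

Fixpoint ball (K : groupType) (F : seq K) (n : nat) : seq K :=
  if n is n'.+1 then [seq h * b | h <- F, b <- ball F n'] else [:: 1].

Lemma ball_wprod (K : groupType) (F : seq K) n b : b \in ball F n ->
  exists w, [/\ {subset w <= F}, size w = n & b = wprod w].
Proof.
elim: n b => [|n IH] b; first by rewrite inE => /eqP->; exists [::].
move=> /allpairsP[[h c] [/= hF /IH[w [h1 <- ->]] ->]]; exists (h :: w); split=> // z.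
by rewrite inE => /orP[/eqP->|/h1].
Qed.

Lemma ball_mono (K : groupType) (F : seq K) m n b : 1 \in F -> (m <= n)%N ->
  b \in ball F m -> b \in ball F n.
Proof.
move=> F1 mn bm; rewrite -(subnK mn); elim: (n - m)%N => [//|k IH].
by apply/allpairsP; exists (1, b); rewrite /= mul1g.
Qed.

Lemma ball_in (K : groupType) (F : seq K) n (G : set K) b : sgp G ->
  {in F, forall h, G h} -> b \in ball F n -> G b.
Proof.
move=> sG FG; elim: n b => [|n IH] b; first by rewrite inE => /eqP->; exact: sgp1.
by move=> /allpairsP[[h c] [/= hF /IH Gc ->]]; apply: sgpM => //; exact: FG.
Qed.

(** In the class two quotient some ball of radius below N grows by a factor of at most 1 + e. The
    list [S] is the ball of radius N of the ambient group, hence fixed before [G] and [C]; later [C]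
    depends on subspaces that are cut according to [S]. *)
Lemma folner (R : realType) (Gam : groupType) (F : seq Gam) (e : R) : (0 < e)%R -> 1 \in F ->
  exists S : seq Gam,
   (forall G, sgp G -> {in F, forall h, G h} -> {in S, forall s, G s}) /\
   forall G C : set Gam, sgp G -> sgp C -> C `<=` G -> (forall c g, C c -> G g -> C (c ^ g)) ->
    {in F, forall h, G h} -> (forall a b c, G a -> G b -> G c -> C [~ [~ a, b], c]) ->
    exists n (s : 'I_n -> Gam), [/\ (0 < n)%N, forall j, s j \in S,
      forall i j, C ((s i)^-1 * s j) -> i = j &
      {in F, forall h, #|Bad C s h|%:R <= e * n%:R}%R].
Proof.
move=> e0 F1; have [N hN] := slow_growth (growth_degree (size F)) e0.
exists (ball F N); split=> [G sG FG s|G C sG sC CG nC FG cl2]; first exact: ball_in.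
have [K [f [fM f1 fsur]]] := quotient_by_sets sG sC nC.
have K2 (a b c : K) : commute [~ a, b] c.
  have [a' Ga <-] := fsur a; have [b' Gb <-] := fsur b; have [c' Gc <-] := fsur c.
  apply/commgP/eqP; have Gab : G [~ a', b'] by exact: sgpR.
  by rewrite -(shomR sG fM) // -(shomR sG fM) //; apply/(f1 _ (sgpR sG Gab Gc)); exact: cl2.
pose F' := [seq f h | h <- F].
have fball n b : b \in ball F' n -> exists2 w, w \in ball F n & b = f w.
  elim: n b => [|n IH] b.
    by rewrite inE => /eqP->; exists 1; rewrite ?inE // (shom1 sG fM).
  move=> /allpairsP[[k c] [/= /mapP[h hF ->] /IH[w wb ->] ->]].
  exists (h * w); first by apply/allpairsP; exists (h, w).
  by rewrite fM //; [exact: FG | exact: ball_in wb].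
have F'1 : 1 \in F' by rewrite -(shom1 sG fM) map_f.
pose B n := undup (ball F' n).
have B1 n : 1 \in B n by rewrite mem_undup; apply: (ball_mono (m := 0)) => //; rewrite inE.
have aP n : (size (B n) <= n.+1 ^ growth_degree (size F))%N.
  have [T sT hT] := class2_cover F' n K2; rewrite size_map in sT; apply: leq_trans sT.
  apply: uniq_leq_size; first exact: undup_uniq.
  by move=> b; rewrite mem_undup => /ball_wprod[w [h1 h2 ->]]; apply: hT; rewrite ?h2.
have [|n nN hn] := hN (fun n => size (B n)) _ aP.
  by move=> n; have := B1 n; case: (B n).
have uB m : uniq (B m) by exact: undup_uniq.
have hs (j : 'I_(size (B n))) : {s | s \in ball F n /\ f s = nth 1 (B n) j}.
  apply: cid; have : nth 1 (B n) j \in ball F' n by rewrite -mem_undup mem_nth.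
  by move=> /fball[s sb es]; exists s.
pose s j := sval (hs j).
have sb j : s j \in ball F n by have [] := svalP (hs j).
have fs j : f (s j) = nth 1 (B n) j by have [] := svalP (hs j).
have Gs j : G (s j) by exact: ball_in (sb j).
exists (size (B n)), s; split=> //.
- by have := B1 n; case: (B n).
- by move=> j; apply: ball_mono (ltnW nN) (sb j).
- move=> i j Cij; have : f (s i) = f (s j).
    by apply: (shom_eq sG fM) => //; apply/f1 => //; apply: sgpM => //; exact: sgpV.
  by rewrite !fs => /eqP; rewrite nth_uniq // => /eqP/ord_inj.
(* Bad indices produce distinct points of the next ball lying outside the present one, so they are
   at most as many as the ball gains. *)
- move=> h hF; have Gh := FG h hF; pose X := [seq f h * nth 1 (B n) (val j) | j <- enum (Bad C s h)].
  have uX : uniq X.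
    rewrite map_inj_in_uniq ?enum_uniq // => i j _ _ /mulgI /eqP.
    by rewrite nth_uniq ?ltn_ord // => /eqP/val_inj.
  have XB : {in X, forall k, k \notin B n}.
    move=> _ /mapP[j + ->]; rewrite mem_enum inE; apply: contra => /(nthP 1)[i iB ei].
    apply/existsP; exists (Ordinal iB); apply/asboolP.
    have Ghs : G (h * s j) by exact: sgpM.
    rewrite -mulgA; apply/f1; first by apply: sgpM => //; exact: sgpV.
    by apply: (eq_shom sG fM) => //; rewrite fM // !fs ei.
  have : (size (B n ++ X) <= size (B n.+1))%N.
    apply: uniq_leq_size => [|k].
      rewrite cat_uniq (uB n) uX andbT /=; apply/hasPn => k; exact: XB.
    rewrite mem_cat !mem_undup => /orP[|/mapP[j _ ->]]; first exact: ball_mono.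
    apply/allpairsP; exists (f h, nth 1 (B n) j); split=> //=; first exact: map_f.
    by rewrite -mem_undup mem_nth.
  rewrite size_cat size_map -cardE -(ler_nat R) natrD.
  by move: (size (B n))%:R%R (size (B n.+1))%:R%R (#|_|)%:R%R hn => x y z; lra.
Qed.

End Folner.

(** * Finite generation, finite index and cyclic subgroups *)

Section FinitenessConditions.
Variable Gam : groupType.
Implicit Types (A B D G S T : set Gam).
Local Open Scope group_scope.

Definition fgen S := exists2 l : seq Gam, {in l, forall g, S g} &
  forall T, sgp T -> {in l, forall g, T g} -> S `<=` T.

Definition noeth := forall S, sgp S -> fgen S.

Definition fin_mod S B := exists2 l : seq Gam, {in l, forall t, S t} &
  forall g, S g -> exists2 t, t \in l & B (t^-1 * g).

Lemma fin_mod_trans S B D : sgp S -> B `<=` S -> fin_mod S B -> fin_mod B D -> fin_mod S D.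
Proof.
move=> sS BS [l lS hl] [l' lB hl']; exists [seq t * u | t <- l, u <- l'].
  by move=> _ /allpairsP[[t u] [/= hlt hu ->]]; apply: sgpM => //; [exact: lS | exact/BS/lB].
move=> g Sg; have [t tl Bt] := hl _ Sg; have [u ul Du] := hl' _ Bt.
by exists (t * u); [apply/allpairsP; exists (t, u) | rewrite invgM -mulgA].
Qed.

Lemma fin_mod_map S B (Y : eqType) (phi : Gam -> Y) (ly : seq Y) : sgp S ->
  (forall g, S g -> phi g \in ly) ->
  (forall g h, S g -> S h -> phi g = phi h -> B (g^-1 * h)) -> fin_mod S B.
Proof.
move=> sS h1 h2; pose c y := xget 1 [set g | S g /\ phi g = y].
exists [seq c y | y <- ly].
  move=> _ /mapP[y _ ->]; rewrite /c; case: xgetP => [g _ []//|_]; exact: sgp1.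
move=> g Sg; exists (c (phi g)); first exact/map_f/h1.
have [Sc ec] : S (c (phi g)) /\ phi (c (phi g)) = phi g.
  by apply: (@xgetPex _ 1 [set g' | S g' /\ phi g' = phi g]); exists g.
exact: h2.
Qed.

Lemma fin_mod_I G A B : sgp G -> sgp A -> sgp B -> fin_mod G A -> fin_mod G B ->
  fin_mod G (A `&` B).
Proof.
move=> sG sA sB [l lG hl] [l' lG' hl'].
have ex g : exists t, G g -> [/\ t.1 \in l, t.2 \in l', A (t.1^-1 * g) & B (t.2^-1 * g)].
  have [Gg|] := pselect (G g); last by exists (1, 1).
  by have [t tl At] := hl _ Gg; have [u ul Bu] := hl' _ Gg; exists (t, u).
pose phi g := sval (cid (ex g)).
have phiP g (Gg : G g) := svalP (cid (ex g)) Gg.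
apply: (@fin_mod_map _ _ _ phi [seq (t, u) | t <- l, u <- l']) => // [g Gg|g h Gg Gh e].
  have [h1 h2 _ _] := phiP _ Gg; apply/allpairsP; exists (phi g); split=> //.
  by case: (phi g).
have [_ _ a b] := phiP _ Gg; have [_ _ a' b'] := phiP _ Gh; rewrite -/(phi g) -/(phi h) e in a b a' b'.
have k t : g^-1 * h = (t^-1 * g)^-1 * (t^-1 * h) by rewrite invgM invgK -mulgA mulVKg.
split; [rewrite (k (phi h).1) | rewrite (k (phi h).2)]; apply: sgpM => //; exact: sgpV.
Qed.

Lemma commX_central (y g : Gam) n : (forall h, commute [~ y, g] h) -> [~ y ^+ n, g] = [~ y, g] ^+ n.
Proof.
move=> c; rewrite [LHS]commgEl conjXg.
have -> : y ^ g = y * [~ y, g] by rewrite commgEl mulVKg.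
by rewrite expgMn ?mulKg //; apply: commute_sym; exact: c.
Qed.

(** Integer powers of z, written as quotients of natural powers because [^+] has natural
    exponents. *)
Definition cyc (z : Gam) : set Gam := [set g | exists i j, g = z ^+ i * z ^- j].

Lemma zpM (z : Gam) i j k l : (z ^+ i * z ^- j) * (z ^+ k * z ^- l) = z ^+ (i + k) * z ^- (j + l).
Proof.
have c : z ^- j * z ^+ k = z ^+ k * z ^- j.
  exact: esym (commuteV (commuteX2 k j (commute_refl z))).
by rewrite mulgA -(mulgA (z ^+ i)) c mulgA -expgnDr -mulgA -invgM -expgnDr (addnC l).
Qed.

Lemma zpV (z : Gam) i j : (z ^+ i * z ^- j)^-1 = z ^+ j * z ^- i.
Proof. by rewrite invgM invgK. Qed.

Lemma zp_split (z : Gam) i j :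
  (exists2 n, z ^+ i * z ^- j = z ^+ n & (i = j + n)%N) \/
  (exists2 n, (z ^+ i * z ^- j)^-1 = z ^+ n & (j = i + n)%N).
Proof.
have [ij|ij] := leqP j i; [left; exists (i - j)%N | right; exists (j - i)%N]; rewrite ?subnKC //.
- by rewrite expgnFr.
- by rewrite zpV expgnFr // ltnW.
- exact: ltnW.
Qed.

Lemma cyc_sgp z : sgp (cyc z).
Proof.
split=> [|_ _ [i [j ->]] [k [l ->]]|_ [i [j ->]]].
- by exists 0%N, 0%N; rewrite mulgV.
- by exists (i + k)%N, (j + l)%N; rewrite zpM.
- by exists j, i; rewrite zpV.
Qed.

Lemma cyc_id z : cyc z z.
Proof. by exists 1%N, 0%N; rewrite invg1 mulg1. Qed.

Lemma expg_eq_torsion (z : Gam) a b : a != b -> z ^+ a = z ^+ b -> exists2 n, (0 < n)%N & z ^+ n = 1.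
Proof.
wlog ab : a b / (a < b)%N => [hw ne e|_ e].
  by move: (ne); rewrite neq_ltn => /orP[h|h]; [exact: (hw a b) | apply: (hw b a); rewrite // eq_sym].
by exists (b - a)%N; [rewrite subn_gt0 | rewrite (expgnFr _ (ltnW ab)) -e mulgV].
Qed.

End FinitenessConditions.

Section Quotients.
Variables (Gam K : groupType) (G : set Gam) (f : Gam -> K).
Hypotheses (sG : sgp G) (fM : shom G f).
Local Open Scope group_scope.

Lemma sgp_preim (T : set K) : sgp T -> sgp [set g | G g /\ T (f g)].
Proof.
move=> sT; split=> [|g h [Gg Tg] [Gh Th]|g [Gg Tg]] /=.
- by rewrite (shom1 sG fM); split; exact: sgp1.
- by rewrite fM //; split; exact: sgpM.
- by rewrite (shomV sG fM) //; split; exact: sgpV.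
Qed.

(** Euclidean division: generators of the kernel, together with an element over the least positive
    power of z that occurs, generate [S]. If no positive power occurs, [S] maps to 1 and the kernel
    is all of it. *)
Lemma fgen_ext (S : set Gam) (z : K) : sgp S -> S `<=` G ->
  fgen [set s | S s /\ f s = 1] -> (forall s, S s -> cyc z (f s)) -> fgen S.
Proof.
move=> sS SG [l lS hl] Sz.
have [[k [k0 [s0 Ss0 fs0]] kmin]|none] := pselect (exists2 k, (0 < k)%N /\ (exists2 s, S s & f s = z ^+ k) &
    forall k', (0 < k')%N -> (exists2 s, S s & f s = z ^+ k') -> (k <= k')%N); last first.
  have hz s n : S s -> f s = z ^+ n -> f s = 1.
    move=> Ss e; apply: contrapT => ne; apply: none.
    pose P k := `[< (0 < k)%N /\ exists2 s, S s & f s = z ^+ k >].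
    have exP : exists k, P k.
      exists n; apply/asboolP; split; last by exists s.
      by case: n e => // e; case: ne.
    case: (ex_minnP exP) => k /asboolP[k0 hk] kmin; exists k => // k' k'0 hk'.
    by apply: kmin; apply/asboolP.
  exists l => [g /lS[]//|T sT lT s Ss]; apply: hl => //; split=> //.
  have [i [j e]] := Sz _ Ss; have [[n e1 _]|[n e1 _]] := zp_split z i j.
    by apply: (hz _ n) => //; rewrite e.
  have : f s^-1 = 1 by apply: (hz _ n); [exact: sgpV | rewrite (shomV sG fM) ?e //; exact: SG].
  by rewrite (shomV sG fM) //; [move/(congr1 inv); rewrite invgK invg1 | exact: SG].
exists (s0 :: l) => [g|T sT lT]; first by rewrite inE => /orP[/eqP->//|/lS[]].
have Ts0 : T s0 by apply: lT; exact: mem_head.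
have Tl : {in l, forall g, T g} by move=> g gl; apply: lT; rewrite inE gl orbT.
have main s n : S s -> f s = z ^+ n -> T s.
  move=> Ss e; pose s' := s * (s0 ^+ (n %/ k))^-1.
  have Sx : S (s0 ^+ (n %/ k)) by exact: sgpX.
  have Ss' : S s' by apply: sgpM => //; exact: sgpV.
  have fs' : f s' = z ^+ (n %% k).
    have e2 : z ^+ n = z ^+ (n %% k) * z ^+ k ^+ (n %/ k).
      by rewrite -expgnA -expgnDr mulnC addnC -divn_eq.
    have Gx := SG _ Sx; rewrite (fM (SG _ Ss) (sgpV sG Gx)) (shomV sG fM Gx).
    by rewrite (shomX sG fM _ (SG _ Ss0)) fs0 e e2 mulgK.
  have r0 : (n %% k = 0)%N.
    apply/eqP; rewrite -leqn0 leqNgt; apply/negP => r0.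
    have := kmin _ r0 (ex_intro2 _ _ s' Ss' fs').
    by rewrite leqNgt ltn_mod k0.
  have : T s' by apply: hl => //; split=> //; rewrite fs' r0.
  by move=> Ts'; rewrite -(mulgVK (s0 ^+ (n %/ k)) s); apply: sgpM => //; exact: sgpX.
move=> s Ss; have [i [j e]] := Sz _ Ss; have [[n e1 _]|[n e1 _]] := zp_split z i j.
  by apply: (main _ n) => //; rewrite e.
rewrite -(invgK s); apply: sgpV => //; apply: (main _ n); first exact: sgpV.
by rewrite (shomV sG fM) ?e //; exact: SG.
Qed.

Hypothesis fsur : forall k, exists2 g, G g & f g = k.

Lemma noeth_quot : noeth Gam -> noeth K.
Proof.
move=> nG S sS; have [l lS hl] := nG _ (sgp_preim sS).
exists (map f l) => [_ /mapP[g /lS[_ Sg] ->]//|T sT lT k Sk].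
have [g Gg e] := fsur k; rewrite -e.
have [//||//] := hl _ (sgp_preim sT) _ g; last by split; rewrite ?e.
by move=> h hlh; split; [have [] := lS _ hlh | apply/lT/map_f].
Qed.

Lemma fin_mod_preim (N : set K) : fin_mod setT N -> fin_mod G [set g | G g /\ N (f g)].
Proof.
move=> [l _ hl]; pose c k := sval (cid2 (fsur k)).
have cP k : G (c k) /\ f (c k) = k by rewrite /c; case: (cid2 _).
exists (map c l) => [_ /mapP[k _ ->]|g Gg]; first by have [] := cP k.
have [//|t tl Nt] := hl (f g); exists (c t); first exact: map_f.
have [Gc fc] := cP t; split; first by apply: sgpM => //; exact: sgpV.
by rewrite fM ?(shomV sG fM) ?fc //; exact: sgpV.
Qed.

Lemma shom_foldR x (l : seq Gam) : G x -> {in l, forall g, G g} ->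
  G (foldl commg x l) /\ f (foldl commg x l) = foldl commg (f x) (map f l).
Proof.
elim: l x => [|y l IH] x Gx lG //=; have Gy : G y by apply: lG; exact: mem_head.
have [|h1 h2] := IH [~ x, y] (sgpR sG Gx Gy); first by move=> g gl; apply: lG; rewrite inE gl orbT.
by rewrite h2 (shomR sG fM).
Qed.

Lemma lift_seq (l : seq K) : exists2 l', {in l', forall g, G g} & map f l' = l.
Proof.
elim: l => [|k l [l' h1 h2]]; first by exists [::].
have [g Gg e] := fsur k; exists (g :: l'); last by rewrite /= h2 e.
by move=> h; rewrite inE => /orP[/eqP->|/h1].
Qed.

End Quotients.

(** * Finite nilpotent quotients and residual finiteness *)

Section FiniteNilpotent.
Local Open Scope group_scope.

Lemma common_exponent (K : groupType) (l : seq K) :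
  {in l, forall x, exists2 n, (0 < n)%N & x ^+ n = 1} ->
  exists2 n, (0 < n)%N & {in l, forall x, x ^+ n = 1}.
Proof.
elim: l => [|x l IH] hl; first by exists 1%N.
have [|n n0 hn] := IH; first by move=> y yl; apply: hl; rewrite inE yl orbT.
have [m m0 hm] := hl x (mem_head _ _); exists (m * n)%N; first by rewrite muln_gt0 m0.
move=> y; rewrite inE => /orP[/eqP->|yl]; first by rewrite expgnA hm expg1n.
by rewrite mulnC expgnA hn // expg1n.
Qed.

Lemma expg_modn (K : groupType) (x : K) n k : x ^+ n = 1 -> x ^+ (k %% n) = x ^+ k.
Proof. by move=> xn; rewrite [in RHS](divn_eq k n) expgnDr mulnC expgnA xn expg1n mul1g. Qed.

Lemma fg_torsion_abelian (K : groupType) (l : seq K) : (forall x y : K, commute x y) ->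
  {in l, forall x, exists2 n, (0 < n)%N & x ^+ n = 1} ->
  exists2 L : seq K, sgp [set` L] & {subset l <= L}.
Proof.
move=> ab; elim: l => [|x l IH] hl.
  exists [:: 1] => //; split=> [|g h|g].
  - exact: mem_head.
  - by rewrite /= !inE => /eqP-> /eqP->; rewrite mulg1.
  - by rewrite /= !inE => /eqP->; rewrite invg1.
have [|L sL lL] := IH; first by move=> y yl; apply: hl; rewrite inE yl orbT.
have [n n0 xn] := hl x (mem_head _ _).
have mem i t : t \in L -> x ^+ i * t \in [seq x ^+ i * t | i <- iota 0 n, t <- L].
  move=> tL; apply/allpairsP; exists ((i %% n)%N, t) => /=; split=> //.
    by rewrite mem_iota add0n ltn_mod.
  by rewrite expg_modn.
have L1 : 1 \in L := sgp1 sL.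
exists [seq x ^+ i * t | i <- iota 0 n, t <- L].
  split=> [|_ _ /allpairsP[[i t] [/= _ tL ->]] /allpairsP[[j u] [/= _ uL ->]]|_ /allpairsP[[i t] [/= hi tL ->]]] /=.
  - by rewrite -[1]mulg1 -(expg0 x); exact: mem.
  - have -> : x ^+ i * t * (x ^+ j * u) = x ^+ (i + j) * (t * u).
      by rewrite expgnDr !mulgA; congr (_ * _); rewrite -!mulgA; congr (_ * _); exact: ab.
    by apply: mem; exact: (sgpM sL tL uL).
  - have -> : (x ^+ i * t)^-1 = x ^+ (n - i) * t^-1.
      move: hi; rewrite mem_iota add0n => /ltnW hi.
      by rewrite (expgnFr _ hi) xn mul1g invgM; exact: ab.
    by apply: mem; exact: (sgpV sL tL).
move=> y; rewrite inE => /orP[/eqP->|yl].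
  by have := mem 1%N 1 L1; rewrite expg1 mulg1.
by have := mem 0%N y (lL y yl); rewrite expg0 mul1g.
Qed.

Lemma fg_torsion (Gam : groupType) (S B : set Gam) : sgp S -> sgp B ->
  (forall b s, B b -> S s -> B (b ^ s)) -> (forall s t, S s -> S t -> B [~ s, t]) ->
  fgen S -> (forall s, S s -> exists2 n, (0 < n)%N & B (s ^+ n)) ->
  fin_mod S B /\ exists2 n, (0 < n)%N & forall s, S s -> B (s ^+ n).
Proof.
move=> sS sB nB cB [l lS hl] tor.
have [K [f [fM f1 fsur]]] := quotient_by_sets sS sB nB.
have ab (x y : K) : commute x y.
  have [s Ss <-] := fsur x; have [t St <-] := fsur y.
  apply/commgP/eqP; rewrite -(shomR sS fM) //; apply/f1; last exact: cB.
  exact: sgpR.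
have torK (x : K) : exists2 n, (0 < n)%N & x ^+ n = 1.
  have [s Ss <-] := fsur x; have [n n0 Bn] := tor s Ss; exists n => //.
  by rewrite -(shomX sS fM) //; apply/f1 => //; exact: sgpX.
have [L sL lL] := fg_torsion_abelian (l := map f l) ab (fun x _ => torK x).
have SL s : S s -> f s \in L.
  move=> Ss; have [|//] := hl _ (sgp_preim sS fM sL) _ s Ss.
  by move=> g gl; split; [exact: lS | apply: lL; exact: map_f].
split.
  apply: (@fin_mod_map _ _ _ _ f L) => // g h Sg Sh e.
  apply/f1; first by apply: sgpM => //; exact: sgpV.
  exact: (eq_shom sS fM).
have [n n0 hn] := common_exponent (l := L) (fun x _ => torK x).
exists n => // s Ss; apply/f1; first exact: sgpX.
by rewrite (shomX sS fM) // hn //; exact: SL.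
Qed.

(** Nilpotency of class at most c through left-normed commutators of weight c + 1, a form that lifts
    along a surjection entry by entry. *)
Definition nil (c : nat) (K : groupType) := forall (x : K) (l : seq K), size l = c -> foldl commg x l = 1.

Lemma nil_quot (Gam K : groupType) (G : set Gam) (f : Gam -> K) c : sgp G -> shom G f ->
  (forall k, exists2 g, G g & f g = k) ->
  (forall x l, G x -> {in l, forall g, G g} -> size l = c -> f (foldl commg x l) = 1) -> nil c K.
Proof.
move=> sG fM fsur h k l sl; have [x Gx <-] := fsur k.
have [l' Gl' e] := lift_seq fsur l; rewrite -e.
have [_ <-] := shom_foldR sG fM Gx Gl'; apply: h => //.
by rewrite -sl -e size_map.
Qed.

(** Induction on the class. The centre Z is finite, of some exponent e, and the centre of the
    quotient by Z is again torsion: for y central modulo Z, [y^e, g] = [y, g]^e = 1. *)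
Lemma nilp_finite c (K : groupType) : noeth K -> nil c K ->
  (forall z : K, (forall g, commute z g) -> exists2 n, (0 < n)%N & z ^+ n = 1) ->
  exists L : seq K, forall g, g \in L.
Proof.
elim: c K => [|c IH] K nK nil_ tor.
  by exists [:: 1] => g; have /= -> := nil_ g [::] erefl; rewrite inE.
pose Z : set K := [set z | forall g, commute z g].
have sZ : sgp Z.
  split=> [g|z w hz hw g|z hz g] /=; first by apply: commute_sym; exact: commute1.
    by apply/commute_sym/commuteM; apply/commute_sym; [exact: hz|exact: hw].
  by apply/commute_sym/commuteV/commute_sym; exact: hz.
have s1 : sgp [set (1 : K)] by split=> [//|_ _ -> ->|_ ->] /=; rewrite ?mulg1 ?invg1.
have sT : sgp [set: K] by [].
have [||||fZ [e e0 he]] := @fg_torsion K Z [set 1] sZ s1.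
- by move=> b s -> _; rewrite /= conj1g.
- by move=> s t hs _; apply/eqP/commgP; exact: hs.
- exact: nK.
- by move=> z hz; have [n n0 hn] := tor z hz; exists n.
have nZ z g : Z z -> setT g -> Z (z ^ g).
  by move=> hz _; have /conjg_fixP-> : [~ z, g] == 1 by apply/commgP.
have [K1 [f [fM f1 fsur]]] := quotient_by_sets sT sZ nZ.
have [|||L1 hL1] := IH K1.
- exact: (noeth_quot sT fM fsur nK).
- apply: (nil_quot sT fM fsur) => x l _ _ sl; apply/f1 => // g.
  by apply/commgP/eqP; have := nil_ x (rcons l g); rewrite size_rcons foldl_rcons sl => ->.
- move=> k hk; have [y _ ey] := fsur k; exists e => //; rewrite -ey -(shomX sT fM) //.
  apply/f1 => // g; have cy h : Z [~ y, h].
    apply/f1 => //; rewrite (shomR sT fM) // ey; apply/eqP/commgP; exact: hk.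
  by apply/commgP; rewrite commX_central; [apply/eqP; exact: he | exact: cy].
have fK : fin_mod setT Z.
  apply: (@fin_mod_map _ _ _ _ f L1) => // g h _ _ e1; apply/f1 => //.
  exact: (eq_shom sT fM).
have [l _ hl] := fin_mod_trans sT (fun _ _ => I) fK fZ.
exists l => g; have [//|t tl /= e1] := hl g.
by rewrite -(mulVKg t g) e1 mulg1.
Qed.

(* A normal subgroup maximal among those missing [x] has finite index: every central
   element modulo it generates a subgroup containing [x], hence is torsion. *)
Lemma residually_finite c (K : groupType) (x : K) : noeth K -> nil c K -> x <> 1 ->
  exists N : set K, [/\ sgp N, forall n g, N n -> N (n ^ g), ~ N x & fin_mod setT N].
Proof.
move=> nK nil_ x1.
pose P (N : set K) := [/\ ~ N x, forall a b, N a -> N b -> N (a * b),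
  forall a, N a -> N a^-1 & forall a g, N a -> N (a ^ g)].
have [F FP totF|N [[Nx NM NV NJ] maxN]] := @Zorn_bigcup K P.
  split=> [[X FX /= Xx]|a b [X FX Xa] [Y FY Yb]|a [X FX Xa]|a g [X FX Xa]].
  - by have [] := FP _ FX.
  - have [XY|YX] := totF _ _ FX FY.
      by exists Y => //; have [_ h _ _] := FP _ FY; apply: h => //; exact: XY.
    by exists X => //; have [_ h _ _] := FP _ FX; apply: h => //; exact: YX.
  - by exists X => //; have [_ _ h _] := FP _ FX; exact: h.
  - by exists X => //; have [_ _ _ h] := FP _ FX; exact: h.
have [a Na] : exists a, N a.
  apply: contrapT => nN; apply: (maxN [set 1]).
    split=> [a Na|h]; first by case: nN; exists a.
    by apply: nN; exists 1; exact: h.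
  by split=> [/esym/esym//|_ _ -> ->|_ ->|_ g ->] /=; rewrite ?mulg1 ?invg1 ?conj1g.
have sN : sgp N by split=> //; rewrite -(mulVg a); apply: NM => //; exact: NV.
have sT : sgp [set: K] by [].
have [Q [f [fM f1 fsur]]] := quotient_by_sets sT sN (fun n g Nn _ => NJ n g Nn).
have fx : f x <> 1 by move/(f1 x I).
have tor (z : Q) : (forall g, commute z g) -> exists2 n, (0 < n)%N & z ^+ n = 1.
  move=> cz; apply: contrapT => ntor.
  have inj i j : z ^+ i = z ^+ j -> i = j.
    move=> e; apply/eqP/negPn/negP => ne; apply: ntor; exact: expg_eq_torsion ne e.
  have hx n : (0 < n)%N -> cyc (z ^+ n) (f x).
    move=> n0; apply: contrapT => nx.
    have sM := sgp_preim sT fM (cyc_sgp (z ^+ n)).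
    apply: (maxN [set g | setT g /\ cyc (z ^+ n) (f g)]).
      split=> [g Ng|h]; first by split=> //; exists 0%N, 0%N; rewrite mulgV; apply/f1.
      have [y _ ey] := fsur z; have : N (y ^+ n).
        by apply: h; split=> //; rewrite (shomX sT fM) // ey; exact: cyc_id.
      move/(f1 _ I); rewrite (shomX sT fM) // ey -(expg0 z) => /inj e.
      by rewrite e in n0.
    split=> [[_ //]|g h|g|g h [_ [i [j e]]]].
    - exact: sgpM sM.
    - exact: sgpV sM.
    - split=> //; exists i, j; rewrite (shomJ sT fM) // e; apply/conjg_fixP/commgP.
      apply/commute_sym/commuteM; first by do 2! apply: commuteX; apply/commute_sym/cz.
      by apply/commuteV; do 2! apply: commuteX; apply/commute_sym/cz.
  have [i [j e1]] := hx 1%N isT; rewrite !expg1 in e1.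
  have ij : i != j by apply/eqP => e; apply: fx; rewrite e1 e mulgV.
  (* Here f x = z^i z^-j and the expression is 2 |i - j|. By maximality f x would also be a power of
     z^(2 |i - j|), making |i - j| a multiple of its double. *)
  have k0 : (0 < 2 * (i + j - 2 * minn i j))%N by rewrite muln_gt0 /= subn_gt0; lia.
  have [u [v e2]] := hx _ k0.
  have : z ^+ (i + (2 * (i + j - 2 * minn i j)) * v) = z ^+ (j + (2 * (i + j - 2 * minn i j)) * u).
    move: (2 * _)%N e2 => m e2; rewrite !expgnDr !expgnA.
    have cc k b : commute (z ^+ k) b by apply/commute_sym/commuteX/commute_sym/cz.
    have -> : z ^+ i = z ^+ m ^+ u * z ^+ m ^- v * z ^+ j by rewrite -e2 e1 mulgVK.
    by rewrite -[LHS]mulgA (cc j (z ^+ m ^+ v)) mulgA mulgVK; exact/esym/cc.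
  move/inj; move: ij; clear => ij.
  have [d [d0 h]] : exists d, (0 < d)%N /\ ((i + j - 2 * minn i j = d /\ i = j + d) \/
      (i + j - 2 * minn i j = d /\ j = i + d))%N.
    exists (i + j - 2 * minn i j)%N; lia.
  case: h => -[-> ->] e.
    have {e} /eqP : (d * (1 + 2 * v) = d * (2 * u))%N by nia.
    by rewrite eqn_pmul2l // => /eqP; lia.
  have {e} /eqP : (d * (1 + 2 * u) = d * (2 * v))%N by nia.
  by rewrite eqn_pmul2l // => /eqP; lia.
have [|||L hL] := @nilp_finite c Q => //.
- exact: (noeth_quot sT fM fsur nK).
- by apply: (nil_quot sT fM fsur) => y l _ _ sl; rewrite nil_ // (shom1 sT fM).
exists N; split=> //; apply: (@fin_mod_map _ _ _ _ f L) => // g h _ _ e.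
by apply/f1 => //; exact: (eq_shom sT fM).
Qed.

End FiniteNilpotent.

(** * All subgroups are finitely generated *)

Section Polycyclic.
Variable Gam : groupType.
Local Open Scope group_scope.

Definition poly_normal (B : set Gam) := [/\ sgp B, forall b g, B b -> B (b ^ g) &
  forall S, sgp S -> S `<=` B -> fgen S].

Lemma poly_step (B : set Gam) c : poly_normal B -> (forall g, B [~ c, g]) ->
  exists B', [/\ poly_normal B', B `<=` B' & B' c].
Proof.
move=> [sB nB fB] hc; have sT : sgp [set: Gam] by [].
have [K [f [fM f1 fsur]]] := quotient_by_sets sT sB (fun b g hb _ => nB b g hb).
pose B' := [set g | setT g /\ cyc (f c) (f g)].
have sB' : sgp B' := sgp_preim sT fM (cyc_sgp (f c)).
have BB' : B `<=` B'.
  by move=> b Bb; split=> //; exists 0%N, 0%N; rewrite mulgV; apply/f1.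
exists B'; split=> //; last by split=> //; exact: cyc_id.
split=> [//|b g [_ [i [j e]]]|S sS SB'].
- split=> //; exists i, j; rewrite (shomJ sT fM) // e; apply/conjg_fixP/commgP.
  have cz k : commute (f c) k.
    have [h _ <-] := fsur k; apply/commgP/eqP; rewrite -(shomR sT fM) //; exact/f1.
  apply/commute_sym/commuteM; first by apply: commuteX; apply/commute_sym/cz.
  by apply/commuteV; apply: commuteX; apply/commute_sym/cz.
- apply: (fgen_ext sT fM (z := f c) sS) => // [|s /SB'[]//].
  apply: fB => [|s [_ /f1]]; last exact.
  have := sgp_preim sT fM (T := [set 1]) _; set X := [set g | _].
  have -> : [set s | S s /\ f s = 1] = S `&` X.
    by apply/seteqP; split=> s /=; [move=> [? ?] | move=> [? [_ ?]]]; split.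
  case=> [|X1 XM XV]; first by split=> [//|_ _ -> ->|_ ->] /=; rewrite ?mulg1 ?invg1.
  split; first by split; [exact: sgp1 | exact: X1].
    by move=> g h [Sg Xg] [Sh Xh]; split; [exact: sgpM | exact: XM].
  by move=> g [Sg Xg]; split; [exact: sgpV | exact: XV].
Qed.

Lemma poly_steps (B : set Gam) (l : seq Gam) : poly_normal B -> (forall c g, c \in l -> B [~ c, g]) ->
  exists B', [/\ poly_normal B', B `<=` B' & {in l, forall c, B' c}].
Proof.
elim: l B => [|c l IH] B pB hl; first by exists B; split=> [//|g //|g].
have hc g : B [~ c, g] by apply: hl; exact: mem_head.
have [B1 [p1 BB1 B1c]] := poly_step pB hc.
have [|B2 [p2 B12 hB2]] := IH B1 p1.
  by move=> d g dl; apply/BB1/hl; rewrite inE dl orbT.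
exists B2; split=> // [|d]; first exact: subset_trans BB1 B12.
by rewrite inE => /orP[/eqP->|/hB2//]; exact: B12.
Qed.

Lemma centralizer_sgp (B : set Gam) c : sgp B -> (forall b g, B b -> B (b ^ g)) ->
  sgp [set g | B [~ c, g]].
Proof.
move=> sB nB; split=> [|g h hg hh|g hg] /=; first by rewrite commg1; exact: sgp1.
  have -> : [~ c, g * h] = [~ c, h] * [~ c, g] ^ h.
    by rewrite !commgEl conjgM (conjMg c^-1) conjVg; move: (c ^ g ^ h) (c ^ h) => a b; rewrite !mulgA mulgK.
  by apply: sgpM => //; exact: nB.
have -> : [~ c, g^-1] = ([~ c, g] ^ g^-1)^-1.
  by rewrite !commgEl (conjMg c^-1) conjgK conjVg invgM invgK.
by apply: sgpV => //; exact: nB.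
Qed.

(** A central series refined by cyclic steps: the generators of [Dl], then the commutators of [xs],
    then [xs], each family being central modulo the previous subgroup. For the last one, the
    elements whose commutator with x lies in that subgroup form a subgroup, so only generators have
    to be tested. *)
Lemma poly_noeth (Dl : set Gam) (xs : seq Gam) : sgp Dl -> (forall d g, Dl d -> commute d g) ->
  fgen Dl -> (forall T, sgp T -> Dl `<=` T -> {in xs, forall x, T x} -> forall g, T g) ->
  (forall x y w, Dl [~ [~ x, y], w]) -> noeth Gam.
Proof.
move=> sD cD [ds dsD hds] gen cl.
have c1 d g : Dl d -> [~ d, g] = 1 by move=> Dd; apply/eqP/commgP; exact: cD.
have [|c g cds|B1 [p1 _ h1]] := @poly_steps [set 1] ds.
- split=> [|b g ->|S sS S1] /=; last first.
  + by exists [::] => // T sT _ g /S1 ->; exact: sgp1.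
  + by rewrite conj1g.
  + by split=> [//|_ _ -> ->|_ ->] /=; rewrite ?mulg1 ?invg1.
- by apply: c1; exact: dsD.
have [s1 n1 _] := p1; have DB1 : Dl `<=` B1 by exact: hds.
have [|B2 [p2 B12 h2]] := @poly_steps B1 [seq [~ x, y] | x <- xs, y <- xs] p1.
  by move=> _ g /allpairsP[[x y] [_ _ ->]]; apply: DB1; exact: cl.
have [s2 n2 _] := p2.
have [|B3 [p3 B23 h3]] := @poly_steps B2 xs p2.
  move=> x g xxs; apply: (gen _ (centralizer_sgp x s2 n2)) => [d Dd|y yxs] /=.
    have -> : [~ x, d] = 1 by rewrite -invgR c1 // invg1.
    exact: sgp1.
  by apply: h2; apply/allpairsP; exists (x, y).
have [s3 _ f3] := p3; move=> S sS; apply: f3 => // g _.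
by apply: (gen _ s3) => //; apply: subset_trans B23; apply: subset_trans B12.
Qed.

End Polycyclic.

(** * Extending characters of finite order to finite index *)

Section ExtendCharacter.
Local Open Scope group_scope.

Lemma residually_finite_seq c (K : groupType) (X : seq K) : noeth K -> nil c K ->
  exists N : set K, [/\ sgp N, forall n g, N n -> N (n ^ g), fin_mod setT N &
    {in X, forall x, N x -> x = 1}].
Proof.
move=> nK nil_; elim: X => [|x X [N [sN nN fN hN]]].
  by exists setT; split=> //; exists [:: 1] => // g _; exists 1; rewrite ?inE.
have [->|/eqP x1] := eqVneq x 1.
  by exists N; split=> // y; rewrite inE => /orP[/eqP->|/hN].
have [N' [sN' nN' Nx fN']] := residually_finite nK nil_ x1.
exists (N `&` N'); split.
- split=> [|g h [? ?] [? ?]|g [? ?]]; by [split; exact: sgp1 | split; exact: sgpM | split; exact: sgpV].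
- by move=> n g [? ?]; split; [exact: nN | exact: nN'].
- exact: fin_mod_I.
- by move=> y; rewrite inE => /orP[/eqP->|yX] [Ny N'y //]; exact: hN.
Qed.

Variables (R : realType) (Gam : groupType) (G C : set Gam) (chi : Gam -> R[i]) (M c : nat).
Hypotheses (nG : noeth Gam) (sG : sgp G) (sC : sgp C) (CG : C `<=` G) (M0 : (0 < M)%N).
Hypothesis chiM : forall a b, C a -> C b -> chi (a * b) = (chi a * chi b)%R.
Hypothesis chiX : forall a, C a -> (chi a ^+ M = 1)%R.
Hypothesis cC : forall a g, C a -> G g -> C [~ a, g] /\ (chi [~ a, g] = 1)%R.
Hypothesis nilC : forall x l, G x -> {in l, forall g, G g} -> size l = c ->
  C (foldl commg x l) /\ (chi (foldl commg x l) = 1)%R.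

Lemma chi_neq0 a : C a -> chi a != 0%R.
Proof.
move=> Ca; apply/eqP => e; have := chiX Ca; rewrite e expr0n gtn_eqF //=.
by move/esym/eqP; rewrite oner_eq0.
Qed.

Lemma chi1 : chi 1 = 1%R.
Proof.
have C1 := sgp1 sC; apply: (mulfI (chi_neq0 C1)).
by rewrite -chiM // mulg1 mulr1.
Qed.

Lemma chiV a : C a -> chi a^-1 = (chi a)^-1%R.
Proof.
move=> Ca; apply: (mulfI (chi_neq0 Ca)).
by rewrite -chiM ?mulgV ?chi1 ?mulfV ?chi_neq0 //; exact: sgpV.
Qed.

Lemma cn_chi a : C a -> cn (chi a) = 1%R.
Proof.
move=> Ca; have : (cn (chi a) ^+ M = 1)%R by rewrite -cnX chiX // cn1.
by move/eqP; rewrite pexpr_eq1 ?cn_ge0 // => /eqP.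
Qed.

Let ker : set Gam := [set a | C a /\ chi a = 1%R].

Let sker : sgp ker.
Proof.
split=> [|a b [Ca ea] [Cb eb]|a [Ca ea]]; first by split; [exact: sgp1 | exact: chi1].
  by split; [exact: sgpM | rewrite chiM // ea eb mulr1].
by split; [exact: sgpV | rewrite chiV // ea invr1].
Qed.

(** Modulo the kernel of [chi] the image of [C] is finite, because [chi] takes values among the M-th
    roots of unity. Residual finiteness gives a normal subgroup N of finite index avoiding its
    nontrivial elements and its nontrivial differences with [S]. Then a n -> chi a is well defined
    on D = C N, and D meets [S] inside [C]. *)
Lemma extend_char (S : seq Gam) : {in S, forall s, G s} ->
  exists (D : set Gam) (psi : Gam -> R[i]),
   [/\ sgp D, C `<=` D, D `<=` G, fin_mod G D & {in S, forall s, D s -> C s}] /\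
   [/\ forall d, D d -> cn (psi d) = 1%R,
      forall d d', D d -> D d' -> psi (d * d') = (psi d * psi d')%R & forall a, C a -> psi a = chi a].
Proof.
move=> SG.
have nker a g : ker a -> G g -> ker (a ^ g).
  move=> [Ca ea] Gg; have [h1 h2] := cC Ca Gg.
  have -> : a ^ g = a * [~ a, g] by rewrite commgEl mulVKg.
  by split; [exact: sgpM | rewrite chiM // ea h2 mulr1].
have [K [f [fM f1 fsur]]] := quotient_by_sets sG sker nker.
have [rs hrs] := closed_field_poly_normal ('X^M - 1%:P : {poly R[i]})%R.
have chi_rs a : C a -> chi a \in rs.
  move=> Ca; rewrite -root_prod_XsubC.
  have p0 : (lead_coef ('X^M - 1%:P : {poly R[i]}) != 0)%R.
    by rewrite lead_coef_eq0 -size_poly_eq0 size_XnsubC.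
  by rewrite -(rootZ _ _ p0) -hrs rootE !hornerE chiX // subrr.
have [L LC hL] : fin_mod C ker.
  apply: (@fin_mod_map _ _ _ _ chi rs) => // a b Ca Cb e; split.
    by apply: sgpM => //; exact: sgpV.
  by rewrite chiM ?chiV ?e ?mulVf ?chi_neq0 //; exact: sgpV.
have fCL a : C a -> exists2 t, t \in L & f a = f t.
  move=> Ca; have [t tL kt] := hL a Ca; exists t => //; apply/esym.
  have Gt : G t by apply/CG/LC.
  apply: (shom_eq sG fM) => //; first exact: CG.
  by apply/f1 => //; apply: sgpM => //; [exact: sgpV | exact: CG].
have [||N [sN nN fN hN]] := @residually_finite_seq c K
    ([seq f t | t <- L] ++ [seq (f t)^-1 * f s | t <- L, s <- S]).
- exact: noeth_quot fM fsur nG.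
- apply: (nil_quot sG fM fsur) => x l Gx Gl sl.
  by apply/f1; [have [] := shom_foldR sG fM Gx Gl | exact: nilC].
pose D : set Gam := [set g | G g /\ exists2 a, C a & N ((f a)^-1 * f g)].
have Nf a b : C a -> C b -> N ((f a)^-1 * f b) -> chi a = chi b.
  move=> Ca Cb; have [Ga Gb] := (CG Ca, CG Cb); have CV := sgpV sC Ca.
  rewrite -(shomV sG fM) // -fM //; last exact: sgpV.
  have Cab : C (a^-1 * b) by exact: sgpM.
  have [t tL e] := fCL _ Cab; rewrite e => /hN; rewrite mem_cat map_f // -e => /(_ isT).
  move=> /(f1 _ (CG Cab))[_]; rewrite chiM // chiV //.
  by move/(congr1 (fun k => chi a * k)%R); rewrite mulVKf ?chi_neq0 // mulr1.
pose psi g : R[i] := chi (xget 1 [set a | C a /\ N ((f a)^-1 * f g)]).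
have psiE g a : C a -> N ((f a)^-1 * f g) -> psi g = chi a.
  move=> Ca Nag; have [Cx Nx] : C (xget 1 [set a | C a /\ N ((f a)^-1 * f g)]) /\
      N ((f (xget 1 [set a | C a /\ N ((f a)^-1 * f g)]))^-1 * f g).
    by apply: (@xgetPex _ 1 [set a | C a /\ N ((f a)^-1 * f g)]); exists a.
  apply: Nf => //; move: (xget _ _) Nx => x Nx.
  have -> : (f x)^-1 * f a = ((f x)^-1 * f g) * ((f a)^-1 * f g)^-1.
    by rewrite invgM invgK -mulgA mulVKg.
  by apply: sgpM => //; exact: sgpV.
exists D, psi; split; split.
- split=> [|g h [Gg [a Ca Na]] [Gh [b Cb Nb]]|g [Gg [a Ca Na]]].
  + by split; [exact: sgp1 | exists 1; rewrite ?(shom1 sG fM) ?invg1 ?mulg1; exact: sgp1].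
  + split; first exact: sgpM.
    exists (a * b); first exact: sgpM.
    have [Ga Gb] := (CG Ca, CG Cb).
    rewrite !fM //; have -> : (f a * f b)^-1 * (f g * f h) =
      ((f a)^-1 * f g) ^ f b * ((f b)^-1 * f h).
      by rewrite conjgE invgM; move: (f a)^-1 => fa; rewrite !mulgA mulgK.
    by apply: sgpM => //; exact: nN.
  + split; first exact: sgpV.
    exists a^-1; first exact: sgpV.
    have Ga := CG Ca; rewrite !(shomV sG fM) //.
    have -> : (f a)^-1^-1 * (f g)^-1 = ((f a)^-1 * f g)^-1 ^ (f a)^-1.
      by rewrite conjgE invgM !invgK; rewrite mulgK.
    by apply: nN; exact: sgpV.
- by move=> a Ca; split; [exact: CG | exists a; rewrite // mulVg; exact: sgp1].
- by move=> g [].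
- have [l lG hl] := fin_mod_preim sG fM fsur fN; exists l => // g Gg.
  have [t tl [Gt Nt]] := hl g Gg; exists t => //; split=> //; exists 1; first exact: sgp1.
  by rewrite (shom1 sG fM) invg1 mul1g.
- move=> s sS [Gs [a Ca Na]]; have [t tL e] := fCL _ Ca; rewrite e in Na.
  have Gt := CG (LC _ tL).
  have : (f t)^-1 * f s = 1.
    by apply: hN => //; rewrite mem_cat; apply/orP; right; apply/allpairsP; exists (t, s).
  rewrite -(shomV sG fM) // -fM //; last exact: sgpV.
  have Gts : G (t^-1 * s) by apply: sgpM => //; exact: sgpV.
  move=> /(f1 _ Gts)[Cts _]; rewrite -(mulVKg t s); apply: sgpM => //; exact: LC.
- by move=> d [Gd [a Ca Na]]; rewrite (psiE _ _ Ca Na) cn_chi.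
- move=> g h [Gg [a Ca Na]] [Gh [b Cb Nb]].
  have [Ga Gb] := (CG Ca, CG Cb).
  rewrite (psiE _ _ Ca Na) (psiE _ _ Cb Nb) -chiM //; apply: psiE; first exact: sgpM.
  rewrite !fM //; have -> : (f a * f b)^-1 * (f g * f h) =
    ((f a)^-1 * f g) ^ f b * ((f b)^-1 * f h).
    by rewrite conjgE invgM; move: (f a)^-1 => fa; rewrite !mulgA mulgK.
  by apply: sgpM => //; exact: nN.
- move=> a Ca; apply: psiE => //; rewrite mulVg; exact: sgp1.
Qed.

End ExtendCharacter.

(** * Approximation by roots *)

Section RootsOfUnity.
Variable R : realType.
Implicit Types (l a z w : R[i]) (t : R).

Lemma prod_cn_lower l t (rs : seq R[i]) : 0 < t -> {in rs, forall z, t < cn (z - l)} ->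
  t ^+ size rs <= cn (\prod_(z <- rs) (l - z)).
Proof.
move=> t0; elim: rs => [|z rs IH] h; first by rewrite big_nil cn1 expr0.
rewrite big_cons cnM /= exprS; apply: ler_pM; [exact: ltW | by rewrite exprn_ge0 ?ltW | | ].
  by rewrite cnBC; apply/ltW/h; exact: mem_head.
by apply: IH => w hw; apply: h; rewrite inE hw orbT.
Qed.

(** The distances from l to the m roots of a multiply to |l^m - a|, so they cannot all exceed t. *)
Lemma root_near l a m t : (0 < m)%N -> 0 < t -> cn (l ^+ m - a) <= t ^+ m ->
  exists2 z, z ^+ m = a & cn (z - l) <= t.
Proof.
move=> m0 t0 h; have [rs hrs] := closed_field_poly_normal ('X^m - a%:P : {poly R[i]}).
have lc : lead_coef ('X^m - a%:P : {poly R[i]}) = 1 by rewrite lead_coefXnsubC.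
rewrite lc scale1r in hrs.
have sz : size rs = m.
  by apply: succn_inj; rewrite -(size_prod_XsubC rs id) -hrs size_XnsubC.
apply: contrapT => hn.
have hz z : z \in rs -> t < cn (z - l).
  move=> zrs; rewrite ltNge; apply/negP => hle; apply: hn; exists z => //.
  move: zrs; rewrite -root_prod_XsubC -hrs rootE !hornerE => /eqP/eqP.
  by rewrite subr_eq0 => /eqP.
have : l ^+ m - a = \prod_(z <- rs) (l - z).
  have := congr1 (fun p => p.[l]) hrs; rewrite !hornerE => ->.
  by rewrite horner_prod; apply: eq_bigr => z _; rewrite !hornerE.
move: sz h; case: rs hz {hrs} => [|z rs] hz sz h e; first by rewrite -sz in m0.
move: h; apply/negP; rewrite -ltNge e -sz big_cons cnM /= exprS.
have hl : t ^+ size rs <= cn (\prod_(w <- rs) (l - w)).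
  by apply: prod_cn_lower => // w hw; apply: hz; rewrite inE hw orbT.
apply: lt_le_trans (_ : cn (l - z) * t ^+ size rs <= _); last by rewrite ler_wpM2l ?cn_ge0.
by rewrite ltr_pM2r ?exprn_gt0 // cnBC; apply: hz; exact: mem_head.
Qed.

(** Repeated square roots. If z approximates l^2 and w^2 = z, then |w - l| |w + l| = |z - l^2| and
    the squares of the two factors add up to 4. The larger factor is at least sqrt 2 > 7/5, so the
    better of w and - w improves the error by 7/5. *)
Lemma unity_near l t : cn l = 1 -> 0 < t ->
  exists z n, [/\ (0 < n)%N, z ^+ n = 1 & cn (z - l) <= t].
Proof.
move=> l1 t0.
have main k : forall l, cn l = 1 -> exists2 z, z ^+ (2 ^ k) = 1 & cn (z - l) * (7 / 5) ^+ k <= 2.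
  elim: k => [|k IH] {l1} l l1.
    exists 1; first by rewrite expr1.
    by rewrite expr0 mulr1; have := cnB 1 l; rewrite cn1 l1; lra.
  have [|z z1 hz] := IH (l ^+ 2); first by rewrite cnX l1 expr1n.
  pose w := sqrtc z; have w2 : w ^+ 2 = z by rewrite sqr_sqrtc.
  have cw : cn w = 1.
    have : cn w ^+ (2 * 2 ^ k) = 1 by rewrite -cnX exprM w2 z1 cn1.
    by move/eqP; rewrite pexpr_eq1 ?cn_ge0 ?muln_gt0 ?expn_gt0 // => /eqP.
  have AB : cn (w - l) * cn (w + l) = cn (z - l ^+ 2) by rewrite -cnM -subr_sqr w2.
  have par : cn (w - l) ^+ 2 + cn (w + l) ^+ 2 = 4.
    have := cn_sqr_Re (w - l); have := cn_sqr_Re (w + l).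
    have := cn_sqr_Re w; have := cn_sqr_Re l; rewrite cw l1 !ReD !ImD ReN ImN expr1n.
    by move: (complex.Re w) (complex.Im w) (complex.Re l) (complex.Im l) => a b c d; lra.
  have A0 := cn_ge0 (w - l); have B0 := cn_ge0 (w + l).
  rewrite -AB exprS in hz *.
  have P0 : 0 <= (7 / 5) ^+ k :> R by apply: exprn_ge0; lra.
  have [le|lt] := leP (cn (w - l)) (cn (w + l)).
    exists w; first by rewrite expnS exprM w2.
    apply: le_trans hz; rewrite -[leRHS]mulrA; apply: ler_wpM2l => //.
    apply: ler_wpM2r => //; nra.
  exists (- w); first by rewrite expnS exprM sqrrN w2.
  rewrite -opprD cnN; rewrite (mulrC (cn (w - l))) in hz.
  apply: le_trans hz; rewrite -[leRHS]mulrA; apply: ler_wpM2l => //.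
  apply: ler_wpM2r => //; nra.
pose k := Num.bound (5 / t); have [z z1 hz] := main k l l1.
exists z, (2 ^ k)%N; split=> //; first by rewrite expn_gt0.
have hk : 5 / t < k%:R by apply: archi_boundP; rewrite divr_ge0 // ltW.
have hb : 1 + k%:R * (2 / 5) <= (7 / 5) ^+ k :> R.
  elim: (k) => [|j IHj]; first by rewrite mul0r addr0 expr0.
  rewrite exprS; apply: le_trans (_ : (7 / 5) * (1 + j%:R * (2 / 5)) <= _); last first.
    by apply: ler_wpM2l => //; lra.
  rewrite -natr1; have : 0 <= j%:R :> R by []. by move: (j%:R : R) => x; lra.
rewrite ltr_pdivrMr // in hk; rewrite leNgt; apply/negP => ht.
have y0 : 0 <= (7 / 5) ^+ k :> R by apply: exprn_ge0; lra.
have h1 := ler_wpM2l (ltW t0) hb; have h2 := ler_wpM2r y0 (ltW ht).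
move: (k%:R : R) ((7 / 5) ^+ k : R) hk hb hz ht h1 h2 => x y; lra.
Qed.

End RootsOfUnity.

(** * Near scalars of an abelian group are near a character of finite order *)

Section TorsionCharacters.
Variables (R : realType) (H : hilbertType R) (A : groupType) (q : A -> H -> H) (L : set H).
Hypothesis ab : forall a b : A, commute a b.
Hypothesis qM : forall a b x, L x -> q (a * b)%g x = q a (q b x).
Hypothesis q1 : forall x, L x -> q 1%g x = x.
Hypothesis q_nm : forall a x, L x -> nm (q a x) = nm x.
Implicit Types (B : set A) (X : set H) (chi : A -> R[i]).

Definition nearq X (d : R) (a : A) (l : R[i]) := cn l = 1 /\ forall x, X x -> nm (q a x - l *: x) <= d * nm x.

Definition qinv X := [/\ X `<=` L, forall a x, X x -> X (q a x) & exists2 x, X x & x != 0].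

Lemma nearqM X d e a b l m : qinv X -> nearq X d a l -> nearq X e b m ->
  nearq X (d + e) (a * b)%g (l * m).
Proof.
move=> [XL Xq _] [l1 hl] [m1 hm]; split=> [|x Xx]; first by rewrite cnM l1 m1 mulr1.
rewrite qM; last exact: XL.
apply: le_trans (nm_tri _ (l *: q b x) _) _; rewrite mulrDl; apply: lerD.
  by apply: le_trans (hl _ (Xq b x Xx)) _; rewrite q_nm //; exact: XL.
by rewrite -scalerA -scalerBr nmZ l1 mul1r; exact: hm.
Qed.

Lemma nearqV X d a l : qinv X -> nearq X d a l -> nearq X d (a^-1)%g l^-1.
Proof.
move=> [XL Xq _] [l1 hl]; split=> [|x Xx]; first by rewrite cnV l1 invr1.
have l0 : l != 0 by rewrite -cn_eq0 l1 oner_eq0.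
have Lx := XL _ Xx; have := hl _ (Xq a^-1%g x Xx).
rewrite -qM // mulgV q1 // q_nm // => h; apply: le_trans h.
have -> : x - l *: q a^-1%g x = - l *: (q a^-1%g x - l^-1 *: x).
  by rewrite scalerBr scalerA mulNr divff // !scaleNr scale1r opprK addrC.
by rewrite nmZ cnN l1 mul1r.
Qed.

Lemma nearq_le X d e a l : d <= e -> nearq X d a l -> nearq X e a l.
Proof.
move=> de [l1 hl]; split=> // x Xx; apply: le_trans (hl _ Xx) _.
by apply: ler_wpM2r; rewrite ?nm_ge0.
Qed.

Lemma nearqX X d a l n : qinv X -> nearq X d a l -> nearq X (n%:R * d) (a ^+ n)%g (l ^+ n).
Proof.
move=> iX h; elim: n => [|n IH].
  split=> [|x Xx]; first by rewrite expr0 cn1.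
  by have [XL _ _] := iX; rewrite expr0 scale1r expg0 (q1 (XL _ Xx)) subrr nm0 mul0r mul0r.
by rewrite -natr1 mulrDl mul1r addrC exprS expgS; exact: nearqM.
Qed.

Lemma nearq_move X d e a l m : nearq X d a l -> cn m = 1 -> cn (m - l) <= e -> nearq X (d + e) a m.
Proof.
move=> [l1 hl] m1 lm; split=> // x Xx; apply: le_trans (nm_tri _ (l *: x) _) _.
rewrite mulrDl; apply: lerD; first exact: hl.
by rewrite -scalerBl nmZ cnBC; apply: ler_wpM2r; rewrite ?nm_ge0.
Qed.

Lemma nearq_close X d e a l m : qinv X -> nearq X d a l -> nearq X e a m -> cn (l - m) <= d + e.
Proof.
move=> [_ _ [x Xx x0]] [_ hl] [_ hm]; have xp : 0 < nm x by rewrite nm_gt0.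
rewrite -(ler_pM2r xp) -nmZ scalerBl mulrDl.
apply: le_trans (nm_tri _ (q a x) _) _; apply: lerD; last exact: hm.
by rewrite nmBC; exact: hl.
Qed.

(** A common exponent M is part of the definition because [extend_char] needs a finite image. *)
Definition charB B chi := (forall a b, B a -> B b -> chi (a * b)%g = chi a * chi b) /\ exists2 M, (0 < M)%N & forall a, B a -> chi a ^+ M = 1.

(** [S'] and [d] are fixed before the subspace [X], which can therefore be produced by localising
    the elements of [S'] to precision d. *)
Definition approx_char B := forall (S : seq A) (e : R), 0 < e -> {in S, forall a, B a} ->
  exists (S' : seq A) (d : R), [/\ 0 < d, {in S', forall a, B a} &
   forall X, qinv X -> {in S', forall a, exists l, nearq X d a l} ->
    exists2 chi, charB B chi & {in S, forall a, nearq X e a (chi a)}].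

Lemma approx_char1 : approx_char [set 1%g].
Proof.
move=> S e e0 hS; exists [::], 1; split=> // X [XL _ _] _.
exists (fun=> 1); first by split=> [a b|]; [rewrite mulr1 | exists 1%N].
move=> a /hS /= ->; split=> [|x Xx]; first exact: cn1.
by rewrite scale1r q1 ?subrr ?nm0 ?mulr_ge0 ?nm_ge0 ?ltW //; exact: XL.
Qed.

Definition adj_cyc B (c : A) : set A := [set a | exists b i j, B b /\ a = (b * (c ^+ i * c ^- j))%g].

Lemma adj_cycM (c b b' : A) i j i' j' : (b * (c ^+ i * c ^- j) * (b' * (c ^+ i' * c ^- j')))%g =
  (b * b' * (c ^+ (i + i')%N * c ^- (j + j')%N))%g.
Proof.
rewrite -zpM; move: (c ^+ i * c ^- j)%g (c ^+ i' * c ^- j')%g => z w.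
by rewrite -(mulgA b) [(z * (b' * w))%g]mulgA (ab z b') -!mulgA.
Qed.

Lemma adj_cyc_sgp B c : sgp B -> sgp (adj_cyc B c).
Proof.
move=> sB; split=> [|_ _ [b [i [j [Bb ->]]]] [b' [i' [j' [Bb' ->]]]]|_ [b [i [j [Bb ->]]]]].
- by exists 1%g, 0%N, 0%N; split; [exact: sgp1 | rewrite mulgV mulg1].
- by rewrite adj_cycM; exists (b * b')%g, (i + i')%N, (j + j')%N; split=> //; exact: sgpM.
- exists b^-1%g, j, i; split; first exact: sgpV.
  by rewrite invgM zpV; exact: ab.
Qed.

Lemma adj_cyc_sub B c : B `<=` adj_cyc B c.
Proof. by move=> b Bb; exists b, 0%N, 0%N; split=> //; rewrite mulgV mulg1. Qed.

Lemma adj_cyc_id B c : sgp B -> adj_cyc B c c.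
Proof. by move=> sB; exists 1%g, 1%N, 0%N; split; [exact: sgp1 | rewrite invg1 mulg1 mul1g]. Qed.

Lemma char_facts B chi : sgp B -> charB B chi ->
  [/\ chi 1%g = 1, forall a, B a -> chi a != 0, forall a, B a -> chi a^-1%g = (chi a)^-1 &
   forall a n, B a -> chi (a ^+ n)%g = chi a ^+ n].
Proof.
move=> sB [chiM [M M0 chiX]].
have n0 a : B a -> chi a != 0.
  move=> Ba; apply/eqP => e; have := chiX _ Ba; rewrite e expr0n gtn_eqF //=.
  by move/esym/eqP; rewrite oner_eq0.
have B1 := sgp1 sB; have e1 : chi 1%g = 1.
  by apply: (mulfI (n0 _ B1)); rewrite -chiM // mulg1 mulr1.
split=> // [a Ba|a n Ba].
  by apply: (mulfI (n0 _ Ba)); rewrite -chiM ?mulgV ?mulfV ?n0 //; exact: sgpV.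
elim: n => [|n IH]; first by rewrite expr0.
by rewrite expgS exprS chiM ?IH //; exact: sgpX.
Qed.

(** Agreement with z on the powers of c that lie in [B] makes the value independent of the chosen
    expression b c^i c^-j. *)
Lemma char_extend B chi c z n : sgp B -> charB B chi -> (0 < n)%N -> z ^+ n = 1 ->
  (forall k, B (c ^+ k)%g -> chi (c ^+ k)%g = z ^+ k) ->
  exists2 chi', charB (adj_cyc B c) chi' &
    forall b i j, B b -> chi' (b * (c ^+ i * c ^- j))%g = chi b * (z ^+ i * (z ^+ j)^-1).
Proof.
move=> sB cB n0 zn hc; have [chi1 chi0 chiV chiX] := char_facts sB cB.
have [chiM [M M0 chiXM]] := cB.
have z0 : z != 0.
  by apply/eqP => e; move: zn; rewrite e expr0n gtn_eqF //= => /esym/eqP; rewrite oner_eq0.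
have zz i j : B (c ^+ i * c ^- j)%g -> chi (c ^+ i * c ^- j)%g = z ^+ i * (z ^+ j)^-1.
  move=> Bc; have [[k e1 e2]|[k e1 e2]] := zp_split c i j.
    by rewrite e1 in Bc *; rewrite hc // e2 addnC exprD mulfK // expf_neq0.
  have Bk : B (c ^+ k)%g by rewrite -e1; exact: sgpV.
  rewrite -[(c ^+ i * c ^- j)%g]invgK e1 chiV // hc // e2 exprD invfM mulVKf //.
  exact: expf_neq0.
pose P a (t : A * nat * nat) := B t.1.1 /\ a = (t.1.1 * (c ^+ t.1.2 * c ^- t.2))%g.
pose chi' a := let t := xget (1%g, 0%N, 0%N) [set t | P a t] in
  chi t.1.1 * (z ^+ t.1.2 * (z ^+ t.2)^-1).
have chi'E b i j : B b -> chi' (b * (c ^+ i * c ^- j))%g = chi b * (z ^+ i * (z ^+ j)^-1).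
  move=> Bb; rewrite /chi'; set t := xget _ _.
  have [Bt et] : P (b * (c ^+ i * c ^- j))%g t.
    by apply: (@xgetPex _ (1%g, 0%N, 0%N) [set t | P (b * (c ^+ i * c ^- j))%g t]); exists (b, i, j).
  have e : (t.1.1^-1 * b)%g = (c ^+ (t.1.2 + j)%N * c ^- (t.2 + i)%N)%g.
    rewrite -zpM -(zpV c i j); move: et => /(congr1 (fun g => t.1.1^-1 * g * (c ^+ i * c ^- j)^-1)%g).
    by rewrite (mulgA _ b) mulgK mulKg => ->.
  have Be : B (t.1.1^-1 * b)%g by apply: sgpM => //; exact: sgpV.
  have := zz (t.1.2 + j)%N (t.2 + i)%N; rewrite -e => /(_ Be).
  rewrite chiM ?chiV //; last exact: sgpV.
  have := chi0 _ Bt; move: (chi t.1.1) (chi b) => x y x0 /(congr1 (fun k => x * k)).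
  rewrite mulVKf // => ->; rewrite !exprD.
  by field; rewrite ?expf_neq0.
exists chi' => //; split=> [_ _ [b [i [j [Bb ->]]]] [b' [i' [j' [Bb' ->]]]]|].
  rewrite adj_cycM !chi'E ?chiM //; last exact: sgpM.
  by rewrite !exprD; field; rewrite ?expf_neq0.
exists (M * n)%N; first by rewrite muln_gt0 M0.
move=> _ [b [i [j [Bb ->]]]]; rewrite chi'E // !exprMn exprVn [chi b ^+ _]exprM chiXM // expr1n.
have zk k : (z ^+ k) ^+ (M * n) = 1 by rewrite exprAC mulnC exprM zn !expr1n.
by rewrite !zk invr1 !mulr1.
Qed.

(** Let l be the near eigenvalue of c. If some positive power of c lies in [B], and c^m is the
    first, then z is an m-th root of chi (c^m) close to l; otherwise any root of unity close to l is
    admissible. *)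
Lemma approx_char_step B c : sgp B -> approx_char B -> approx_char (adj_cyc B c).
Proof.
move=> sB hB S e e0 hS.
have ex s : exists t : A * nat * nat, s \in S -> B t.1.1 /\ s = (t.1.1 * (c ^+ t.1.2 * c ^- t.2))%g.
  have [/hS[b [i [j [Bb ->]]]]|] := boolP (s \in S); first by exists (b, i, j).
  by exists (1%g, 0%N, 0%N).
pose T s := sval (cid (ex s)); have TP s := svalP (cid (ex s)); rewrite -/(T _) in TP.
pose K := (\sum_(s <- S) ((T s).1.2 + (T s).2))%N.
have TK s : s \in S -> ((T s).1.2 + (T s).2 <= K)%N.
  by move=> sS; rewrite /K (big_rem s) //= leq_addr.
have K1 : 0 < K%:R + 1 :> R by rewrite ltr_wpDl.
(* [K] bounds the exponents of c occurring in [S], so an error of 2 t at c grows to at most e/2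
   there; the other e/2 is left for [B]. *)
pose t := e / (4 * (K%:R + 1)).
have t0 : 0 < t by rewrite divr_gt0 // mulr_gt0.
have Kt : K%:R * (t + t) <= e / 2.
  have : t * (4 * (K%:R + 1)) = e by rewrite /t mulfVK // gt_eqF // mulr_gt0.
  by move: (K%:R : R) t0 => k; nra.
have e20 : 0 < e / 2 by rewrite divr_gt0.
have final X chi z n : qinv X -> charB B chi -> {in S, forall s, nearq X (e / 2) (T s).1.1 (chi (T s).1.1)} ->
   (0 < n)%N -> z ^+ n = 1 -> nearq X (t + t) c z ->
   (forall k, B (c ^+ k)%g -> chi (c ^+ k)%g = z ^+ k) ->
   exists2 chi, charB (adj_cyc B c) chi & {in S, forall a, nearq X e a (chi a)}.
  move=> iX cB hS2 n0 zn hc hck; have [chi' c' chi'E] := char_extend sB cB n0 zn hck.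
  exists chi' => // s sS; have [Bt es] := TP s sS; rewrite {1 2}es chi'E //.
  apply: nearq_le (nearqM iX (hS2 s sS) (nearqM iX (nearqX _ iX hc) (nearqV iX (nearqX _ iX hc)))).
  rewrite -mulrDl -natrD; have : ((T s).1.2 + (T s).2)%:R * (t + t) <= K%:R * (t + t).
    by apply: ler_wpM2r; [lra | rewrite ler_nat; exact: TK].
  by lra.
have [[m [m0 Bm]]|none] := pselect (exists m, (0 < m)%N /\ B (c ^+ m)%g).
  pose Pm k := (0 < k)%N && `[< B (c ^+ k)%g >].
  have exP : exists k, Pm k by exists m; apply/andP; split=> //; exact/asboolP.
  case: (ex_minnP exP) => {m m0 Bm} m /andP[m0 /asboolP Bm] mmin.
  have m0R : 0 < m%:R :> R by rewrite ltr0n.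
  have tm : 0 < t ^+ m / 2 by rewrite divr_gt0 // exprn_gt0.
  (* [root_near] needs l^m within t^m of chi (c^m): one half is granted to the character on [B], the
     other to the m-th power of the near scalar, through d1. *)
  pose eB := Num.min (e / 2) (t ^+ m / 2).
  have [||S' [d [d0 hS' hX]]] := hB ((c ^+ m)%g :: [seq (T s).1.1 | s <- S]) eB.
  - by rewrite lt_min e20.
  - move=> a; rewrite inE => /orP[/eqP->//|/mapP[s sS ->]]; by have [] := TP s sS.
  pose d1 := Num.min d (Num.min t (t ^+ m / 2 / m%:R)).
  have d1d : d1 <= d by rewrite ge_min lexx.
  have d1t : d1 <= t by rewrite !ge_min lexx orbT.
  have d1m : d1 <= t ^+ m / 2 / m%:R by rewrite !ge_min lexx !orbT.
  exists (c :: S'), d1; split.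
  - by rewrite !lt_min d0 t0 divr_gt0.
  - move=> a; rewrite inE => /orP[/eqP->|/hS' Ba]; [exact: adj_cyc_id | exact: adj_cyc_sub].
  move=> X iX hl; have [l hcl] := hl c (mem_head _ _).
  have [|chi cB hchi] := hX X iX.
    by move=> a aS'; have [|l' h'] := hl a; rewrite ?inE ?aS' ?orbT //; exists l'; exact: nearq_le h'.
  have [chi1 chi0 chiV chiX] := char_facts sB cB.
  have hcm := hchi (c ^+ m)%g (mem_head _ _).
  have [z zm zl] : exists2 z, z ^+ m = chi (c ^+ m)%g & cn (z - l) <= t.
    apply: root_near => //; apply: le_trans (nearq_close iX (nearqX m iX hcl) hcm) _.
    have : m%:R * d1 <= t ^+ m / 2 by rewrite mulrC -ler_pdivlMr.
    have : eB <= t ^+ m / 2 by rewrite ge_min lexx orbT.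
    lra.
  have [_ [M M0 chiXM]] := cB.
  have zMm : z ^+ (m * M) = 1 by rewrite exprM zm chiXM.
  have z1 : cn z = 1.
    have : cn z ^+ (m * M) = 1 by rewrite -cnX zMm cn1.
    by move/eqP; rewrite pexpr_eq1 ?cn_ge0 ?muln_gt0 ?m0 // => /eqP.
  apply: (final X chi z (m * M)%N) => //.
  - move=> s sS; apply: nearq_le (hchi _ _); first by rewrite ge_min lexx.
    by rewrite inE; apply/orP; right; exact: map_f.
  - by rewrite muln_gt0 m0.
  - exact: nearq_move (nearq_le d1t hcl) z1 zl.
  - move=> k Bk; have : (k %% m = 0)%N.
      apply/eqP; rewrite -leqn0 leqNgt; apply/negP => r0.
      have : Pm (k %% m)%N.
        rewrite /Pm r0; apply/asboolP; have -> : (c ^+ (k %% m) = c ^+ k * (c ^+ m ^+ (k %/ m))^-1)%g.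
          have -> : (c ^+ k = c ^+ (k %% m) * c ^+ m ^+ (k %/ m))%g.
            by rewrite -expgnA -expgnDr mulnC addnC -divn_eq.
          by rewrite mulgK.
        by apply: sgpM => //; apply: sgpV => //; exact: sgpX.
      by move/mmin; rewrite leqNgt ltn_mod m0.
    move=> r; rewrite (divn_eq k m) r addn0 mulnC expgnA chiX // -zm -exprM //.
have [|S' [d [d0 hS' hX]]] := hB [seq (T s).1.1 | s <- S] (e / 2) e20.
  by move=> a /mapP[s sS ->]; have [] := TP s sS.
exists (c :: S'), (Num.min d t); split.
- by rewrite lt_min d0.
- move=> a; rewrite inE => /orP[/eqP->|/hS' Ba]; [exact: adj_cyc_id | exact: adj_cyc_sub].
move=> X iX hl; have [l hcl] := hl c (mem_head _ _).
have [|chi cB hchi] := hX X iX.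
  move=> a aS'; have [|l' h'] := hl a; rewrite ?inE ?aS' ?orbT //; exists l'.
  by apply: nearq_le h'; rewrite ge_min lexx.
have [chi1 _ _ _] := char_facts sB cB.
have [z [n [n0 zn zl]]] := unity_near hcl.1 t0.
have z1 : cn z = 1.
  have : cn z ^+ n = 1 by rewrite -cnX zn cn1.
  by move/eqP; rewrite pexpr_eq1 ?cn_ge0 // => /eqP.
apply: (final X chi z n) => //.
- by move=> s sS; apply: hchi; exact: map_f.
- by apply: nearq_move z1 zl; apply: nearq_le hcl; rewrite ge_min lexx orbT.
- move=> [|k] Bk; first by rewrite expg0 chi1 expr0.
  by case: none; exists k.+1.
Qed.

Lemma approx_char_all (l : seq A) : (forall T, sgp T -> {in l, forall a, T a} -> forall a, T a) ->
  approx_char setT.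
Proof.
move=> gen.
have [B [sB aB hB]] : exists B, [/\ sgp B, approx_char B & {in l, forall a, B a}].
  elim: l {gen} => [|c l [B [sB aB hB]]].
    exists [set 1%g]; split=> //; last exact: approx_char1.
    by split=> [//|_ _ -> ->|_ ->] /=; rewrite ?mulg1 ?invg1.
  exists (adj_cyc B c); split; [exact: adj_cyc_sgp | exact: approx_char_step | ].
  move=> a; rewrite inE => /orP[/eqP->|/hB Ba]; [exact: adj_cyc_id | exact: adj_cyc_sub].
by have <- : B = setT by apply/seteqP; split=> // a _; exact: gen.
Qed.

End TorsionCharacters.

(** The transversal is drawn from the given list, so its elements inherit what was arranged for the
    list in advance. *)
Lemma reps_in_list (Gam : groupType) (G D : set Gam) (l : seq Gam) : sgp G -> sgp D -> D `<=` G ->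
  {in l, forall t, G t} -> (forall g, G g -> exists2 t, t \in l & D (t^-1 * g)%g) ->
  exists (q : nat) (r : 'I_q -> Gam) (ix : Gam -> 'I_q), [/\ forall i, r i \in l,
    forall g, G g -> D ((r (ix g))^-1 * g)%g & forall i j, D ((r i)^-1 * r j)%g -> i = j].
Proof.
move=> sG sD DG lG hl.
pose P g t := `[< D (t^-1 * g)%g >]; pose rep g := nth 1%g l (find (P g) l).
have eqP_ g h : D (g^-1 * h)%g -> rep g = rep h.
  move=> Dgh; rewrite /rep; congr nth; apply: eq_find => t; apply/asboolP/asboolP => h1.
    by rewrite -(mulVKg g h) mulgA; exact: sgpM.
  rewrite -(mulVKg h g) mulgA; apply: sgpM => //.
  by rewrite -[g in (_ * g)%g]invgK -invgM; exact: sgpV.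
have has_ g : G g -> has (P g) l.
  by move=> Gg; have [t tl Dt] := hl g Gg; apply/hasP; exists t => //; exact/asboolP.
have repl g : G g -> rep g \in l by move=> Gg; rewrite mem_nth // -has_find has_.
have repD g : G g -> D ((rep g)^-1 * g)%g by move=> Gg; apply/asboolP; exact: nth_find (has_ g Gg).
pose l' := undup [seq rep t | t <- l].
have repl' g : G g -> rep g \in l'.
  move=> Gg; rewrite mem_undup; apply/mapP; exists (rep g); first exact: repl.
  by apply/esym/eqP_; exact: repD.
have q0 : (0 < size l')%N by rewrite lt0n size_eq0; apply/eqP => e0; have := repl' 1%g (sgp1 sG); rewrite e0.
have l'G t : t \in l' -> exists2 u, G u & t = rep u.
  by rewrite mem_undup => /mapP[u ul ->]; exists u => //; exact: lG.
have ixP g : G g -> val (insubd (Ordinal q0) (index (rep g) l') : 'I_(size l')) = index (rep g) l'.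
  by move=> Gg; rewrite val_insubd index_mem repl'.
exists (size l'), (fun i => nth 1%g l' i), (fun g => insubd (Ordinal q0) (index (rep g) l')).
split=> [i|g Gg|i j Dij].
- by have [u Gu ->] := l'G _ (mem_nth 1%g (ltn_ord i)); exact: repl.
- by rewrite ixP // nth_index ?repl' //; exact: repD.
- apply/val_inj/eqP; rewrite -(nth_uniq 1%g (ltn_ord i) (ltn_ord j)) ?undup_uniq //.
  move: Dij; have [u Gu ->] := l'G _ (mem_nth 1%g (ltn_ord i)).
  have [w Gw ->] := l'G _ (mem_nth 1%g (ltn_ord j)) => Duw; apply/eqP/eqP_.
  have -> : (u^-1 * w = ((rep u)^-1 * u)^-1 * ((rep u)^-1 * rep w) * ((rep w)^-1 * w))%g.
    by rewrite invgM invgK -!mulgA !mulVKg.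
  by apply: sgpM; [|apply: sgpM => //; apply: sgpV => //|]; by try exact: repD.
Qed.

Lemma fin_mod_reps (Gam : groupType) (G D : set Gam) : sgp G -> sgp D -> D `<=` G -> fin_mod G D ->
  exists (q : nat) (r : 'I_q -> Gam) (ix : Gam -> 'I_q), [/\ forall i, G (r i),
    forall g, G g -> D ((r (ix g))^-1 * g)%g & forall i j, D ((r i)^-1 * r j)%g -> i = j].
Proof.
move=> sG sD DG [l lG hl]; have [q [r [ix [h1 h2 h3]]]] := reps_in_list sG sD DG lG hl.
by exists q, r, ix; split=> // i; exact/lG/h1.
Qed.

(** * From a Folner set and free vectors to projections *)

Section Endgame.
Variables (R : realType) (H : hilbertType R) (Gam : groupType) (p : Gam -> H -> H).
Hypothesis hp : urep p.

(** If no nonzero vector of [L] is orthogonal to [E], the projections of [E] span [L]; the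
    projection onto this finite dimensional invariant space commutes exactly. *)
Lemma qd_finite (G : set Gam) (L : set H) (F : seq Gam) (e : R) : sgp G -> csub p G L ->
  {in F, forall h, G h} -> 0 <= e -> ~ infdim L -> qd p F e L.
Proof.
move=> sG [sL cL iL _] FG e0 /existsNP[E hE] xs Lxs.
have ex y : exists z, L z /\ forall w, L w -> dot (y - z) w = 0.
  by have [z Lz hz] := projection_theorem y sL cL; exists z.
pose pr y := sval (cid (ex y)); have prP y : L (pr y) /\ forall w, L w -> dot (y - pr y) w = 0.
  exact: svalP (cid (ex y)).
have [|J [u [ou Lu uK]]] := gram_schmidt (X := L) (xs := map pr E) sL.
  by move=> _ /mapP[y _ ->]; have [] := prP y.
have lu := pj_lin u.
have uL x : L x -> pj u x = x.
  move=> Lx; apply/esym/eqP; rewrite -subr_eq0; apply/eqP; apply: contrapT => /eqP ne; apply: hE.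
  have Lr : L (x - pj u x) by apply: lsubB => //; exact: pj_in.
  exists (x - pj u x); split=> // y yE; have [Ly hy] := prP y.
  rewrite -[y](subrK (pr y)) dotDr [dot _ (y - _)]dotC hy // conjc0 add0r.
  by rewrite -(uK (pr y)) ?map_f // -pj_adj (linB _ _ lu) pj_idem // subrr dot0l.
exists J, u; split=> // [x /Lxs Lx|h hF x]; first exact: uL.
have Gh := FG h hF; have lh := urep_lin hp h.
have Lpx : L (pj u x) by exact: pj_in.
have d0 : pj u (p h (x - pj u x)) = 0.
  rewrite /pj big1 // => i _; rewrite (urep_adj hp).
  have Lw : L (p h^-1%g (u i)) by apply: iL => //; exact: sgpV.
  by rewrite -(uL _ Lw) -pj_adj (linB _ _ lu) pj_idem // subrr dot0l scale0r.
have : pj u (p h x) = p h (pj u x).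
  apply/eqP; rewrite -subr_eq0 -(uL (p h (pj u x))); last exact: iL.
  by rewrite -(linB _ _ lu) -(linB _ _ lh) d0.
by move=> ->; rewrite subrr nm0 mulr_ge0 ?nm_ge0.
Qed.

(** [C] acts on [L] through the abelian group C/N, where N acts trivially. A character of finite
    order found there is automatically trivial on commutators of [C] with [G]. Extended to finite
    index, it supplies the data of [main_lemma]; the finite dimensional case is split off because
    free vectors need infinite dimension. *)
Lemma endgame (G C : set Gam) (L : set H) (F : seq Gam) (e : R) (n : nat) (s : 'I_n -> Gam) :
  noeth Gam -> sgp G -> csub p G L -> {in F, forall h, G h} -> {in F, forall h, h^-1%g \in F} ->
  0 < e -> sgp C -> C `<=` G -> (forall c g, C c -> G g -> C (c ^ g)%g) ->
  (forall c, C c -> cen p G L c) -> (forall a b c, G a -> G b -> G c -> C [~ [~ a, b], c]%g) ->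
  (0 < n)%N -> (forall j, G (s j)) -> (forall i j, C ((s i)^-1 * s j)%g -> i = j) ->
  {in F, forall h, #|Bad C s h|%:R <= (e / 896) ^+ 2 * n%:R} ->
  (forall L', csub p G L' -> L' `<=` L -> infdim L' ->
    free_vectors p L' [seq ((s ij.2)^-1 * s ij.1)%g | ij <- enum {: 'I_n * 'I_n} & ij.1 != ij.2]) ->
  exists L', [/\ csub p G L', L' `<=` L & qd p F e L'].
Proof.
move=> nG sG csL FG FV e0 sC CG nC cenC cl n0 Gs s_inj Fol free.
have [[L' [cs' L'L inf]]|hinf] := pselect (exists L', [/\ csub p G L', L' `<=` L & ~ infdim L']).
  by exists L'; split=> //; exact: qd_finite sG cs' FG (ltW e0) inf.
pose N := [set c | C c /\ forall x, L x -> p c x = x].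
have [sL cL iL nL] := csL.
have trivR c g x : C c -> G g -> L x -> p [~ c, g]%g x = x.
  move=> Cc Gg Lx; have [_ hc] := cenC c Cc.
  by rewrite commgEl conjgE !(urepM hp) hc // !(urepK hp).
have CR c g : C c -> G g -> C [~ c, g]%g.
  by move=> Cc Gg; rewrite commgEl; apply: sgpM => //; [exact: sgpV | exact: nC].
have sN : sgp N.
  split=> [|a b [Ca ha] [Cb hb]|a [Ca ha]]; split; try by [exact: sgp1 | exact: sgpM | exact: sgpV].
  - by move=> x Lx; rewrite (urep1 hp).
  - by move=> x Lx; rewrite (urepM hp) hb // ha.
  - by move=> x Lx; rewrite -{1}(ha x Lx) (urepK hp).
have nN a c : N a -> C c -> N (a ^ c)%g.
  move=> [Ca ha] Cc; split=> [|x Lx]; first by apply: sgpJ.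
  have Gc := CG _ Cc; rewrite conjgE !(urepM hp) ha ?(urepK hp) //; exact: iL.
have [K [f [fM f1 fsur]]] := quotient_by_sets sC sN nN.
pose sv k := s2val (cid2 (fsur k)).
have svC k : C (sv k) by exact: s2valP (cid2 (fsur k)).
have fsv k : f (sv k) = k by exact: s2valP' (cid2 (fsur k)).
have pf a b x : C a -> C b -> f a = f b -> L x -> p a x = p b x.
  move=> Ca Cb efe Lx; have Cab : C (a^-1 * b)%g by apply: sgpM => //; exact: sgpV.
  have [_ h] := (f1 _ Cab).1 (eq_shom sC fM Ca Cb efe).
  by rewrite -{1}(h x Lx) -(urepM hp) mulVKg.
pose q k := p (sv k).
have qM a b x : L x -> q (a * b)%g x = q a (q b x).
  by move=> Lx; rewrite /q -(urepM hp); apply: pf => //; rewrite ?fM ?fsv //; exact: sgpM.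
have q1 x : L x -> q 1%g x = x.
  move=> Lx; rewrite /q -[RHS](urep1 hp); apply: pf => //; first exact: sgp1.
  by rewrite fsv (shom1 sC fM).
have q_nm a x : L x -> nm (q a x) = nm x by rewrite /q (urep_nm hp).
have ab (a b : K) : commute a b.
  apply/commgP/eqP; rewrite -(fsv a) -(fsv b) -(shomR sC fM) //.
  apply/(f1 _ (sgpR sC (svC a) (svC b))); split; first exact: sgpR.
  by move=> x Lx; apply: trivR => //; exact/CG/svC.
have [l lC hl] := nG _ sC.
have gen T : sgp T -> {in map f l, forall a, T a} -> forall a : K, T a.
  move=> sT hT a; rewrite -(fsv a).
  have [|//] := hl _ (sgp_preim sC fM sT) _ _ (svC a).
  by move=> g gl; split; [exact: lC | apply: hT; exact: map_f].
have sn0 : 0 < Num.sqrt n%:R :> R by rewrite sqrtr_gt0 ltr0n.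
(* With b = (e / 896) sqrt n, the hypothesis [small] becomes 112 * 4 * (e / 896) <= e / 2, which
   holds with equality. *)
pose d := e / (896 * Num.sqrt n%:R).
have h896 : 0 < 896 :> R by rewrite ltr0n.
have d0 : 0 < d by exact: (divr_gt0 e0 (mulr_gt0 h896 sn0)).
pose S0 := [seq f ((s hjj.2.2)^-1 * hjj.1 * s hjj.2.1)%g | hjj <- [seq (h, jj) | h <- F, jj <- enum {: 'I_n * 'I_n}]].
have [|S' [d' [d'0 _ hchar]]] := approx_char_all ab qM q1 q_nm gen (S := S0) d0; first by [].
have [|L1 [cs1 L1L near1]] := localise_seq hp sG (cs := map sv S') csL _ d'0.
  by move=> _ /mapP[k _ ->]; exact: cenC.
have [sL1 cL1 iL1 nL1] := cs1.
have qi : qinv q L L1 by split=> // a x L1x; apply: iL1 => //; exact/CG/svC.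
have [|chi [chiM [M M0 chiX]] hchi] := hchar L1 qi.
  by move=> a aS'; have [|c hc] := near1 (sv a); [exact: map_f | exists c].
have sK : sgp [set: K] by [].
have [chi1 _ _ _] := char_facts sK (conj chiM (ex_intro2 _ _ M M0 chiX)).
have triv1 c : C c -> (forall x, L x -> p c x = x) -> chi (f c) = 1.
  by move=> Cc hc; have -> : f c = 1%g by apply/f1.
pose Sd := [seq ((s ij.1)^-1 * s ij.2)%g | ij <- enum {: 'I_n * 'I_n}].
(* Weight three in the sense of [nil]: [[x, a], b] lies in [C] by [cl], and one more commutator acts
   trivially on [L], so the character is 1 on it. Feeding the differences of the s i as [Sd] keeps
   them distinct modulo [D]. *)
have [|||||D [psi [[sD CD DG fD DS] [psi1 psiM psiC]]]] :=
    @extend_char R Gam G C (fun c => chi (f c)) M 3 nG sG sC CG M0 _ _ _ _ Sd.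
- by move=> a b Ca Cb; rewrite fM // chiM.
- by move=> a Ca; exact: chiX.
- move=> a g Ca Gg; split; first exact: CR.
  by apply: triv1 => [|x Lx]; [exact: CR | exact: trivR].
- move=> x [|a [|b [|c [|? ?]]]] // Gx Gl _.
  have [Ga Gb Gc] : [/\ G a, G b & G c] by split; apply: Gl; rewrite !inE eqxx ?orbT.
  have C3 := cl _ _ _ Gx Ga Gb; split; first exact: CR.
  by apply: triv1 => [|y Ly]; [exact: CR | exact: trivR].
- by move=> _ /mapP[ij _ ->]; apply: sgpM => //; exact: sgpV.
have [qn [r [ix [Gr ixP r_inj]]]] := fin_mod_reps sG sD DG fD.
exists L1; split=> //.
have CJ c g : C c -> G g -> D (c ^ g)%g /\ psi (c ^ g)%g = psi c.
  move=> Cc Gg; have Ccg := nC _ _ Cc Gg; split; first exact: CD.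
  rewrite !psiC //; have -> : (c ^ g = c * [~ c, g])%g by rewrite commgEl mulVKg.
  by rewrite fM ?chiM ?(triv1 [~ c, g]%g) ?mulr1 //; [exact: CR | move=> x Lx; exact: trivR | exact: CR].
refine (main_lemma (b := e / 896 * Num.sqrt n%:R) (d := d) hp sG sL1 iL1 sC sD DG CD psi1 psiM
  CJ Gr ixP r_inj n0 Gs _ FG FV _ (ltW d0) e0 _ _ _ _).
- move=> i j Dij; apply: s_inj; apply: DS => //; apply/mapP; exists (i, j) => //.
  by rewrite mem_enum.
- exact: (ltW (mulr_gt0 (divr_gt0 e0 h896) sn0)).
- by move=> h hF; rewrite exprMn sqr_sqrtr ?ler0n //; exact: Fol.
- move=> h j j' x hF Cc L1x; rewrite psiC //; have Lx := L1L _ L1x.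
  have [|_ hq] := hchi (f ((s j')^-1 * h * s j)%g).
    apply/mapP; exists (h, (j, j')) => //; apply/allpairsP; exists (h, (j, j')).
    by rewrite mem_enum.
  by have := hq x L1x; rewrite /q (pf (sv _) ((s j')^-1 * h * s j)%g) // fsv.
- rewrite /d; move: (n%:R : R) (Num.sqrt n%:R : R) sn0 (sqr_sqrtr (ler0n R n)) => N' sn sn1 eN.
  rewrite -eN; have -> : sn^-1 * (sn ^+ 2 * (2 * (e / (896 * sn))) + 2 * (e / 896 * sn)) = 4 * (e / 896).
    by field; rewrite gt_eqF //= gt_eqF.
  by lra.
- move=> E d1 d10; have [|x [h1 h2 h3 h4]] := free L1 cs1 L1L _ E d1 d10.
    by apply: contrapT => ninf; apply: hinf; exists L1.
  exists x; split=> // i j ij; apply: h4; apply/mapP; exists (i, j) => //.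
  by rewrite mem_filter ij mem_enum.
Qed.

End Endgame.

(** * Orthogonal translates and induction from finite index *)

Section Induction.
Variables (R : realType) (H : hilbertType R) (Gam : groupType) (p : Gam -> H -> H).
Hypothesis hp : urep p.

Lemma gapV (L : set H) k w : invariant p setT L -> gap p L k w -> gap p L k w^-1%g.
Proof.
move=> iL hg x Lx; have := hg (p w^-1%g x) (iL w^-1%g x I Lx).
by rewrite (urep_nm hp) (urepKV hp) nmBC.
Qed.

Lemma small_powers (a B : R) : (forall k, a <= (5 / 7) ^+ k * B) -> a <= 0.
Proof.
move=> h; rewrite leNgt; apply/negP => a0.
have B0 : 0 < B by have := h 0%N; rewrite expr0 mul1r; exact: lt_le_trans a0.
have [N hN] : exists N : nat, 3 * B / a < N%:R.
  by exists (Num.bound (3 * B / a)); apply: archi_boundP; rewrite divr_ge0 ?mulr_ge0 ?ltW.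
rewrite ltr_pdivrMr // in hN.
have b1 : 1 + N%:R * (2 / 5) <= (1 + 2 / 5) ^+ N :> R by apply: bernoulli_le; lra.
have P0 : 0 <= (5 / 7) ^+ N :> R by apply: exprn_ge0; lra.
have k1 : (5 / 7) ^+ N * (1 + 2 / 5) ^+ N = 1 :> R.
  by rewrite -exprMn (_ : 5 / 7 * (1 + 2 / 5) = 1) ?expr1n //; field.
have h3 : (5 / 7) ^+ N * (1 + N%:R * (2 / 5)) <= 1 :> R by apply: le_trans (ler_wpM2l P0 b1) _; rewrite k1.
have X0 : 0 <= 1 + N%:R * (2 / 5) :> R by rewrite addr_ge0 // mulr_ge0 //; lra.
have h4 := ler_wpM2r X0 (h N); have h5 := ler_wpM2r (ltW B0) h3.
move: (N%:R : R) ((5 / 7) ^+ N : R) hN h4 h5 => n P; lra.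
Qed.

(* The operator [p z] acts almost as [l] on [L1] and almost as [l * mu] on [p t] [L1]. *)
Lemma translate_orth (L1 : set H) (G : set Gam) (z t : Gam) (d kap : R) (l mu : R[i]) :
  sgp G -> lsub L1 -> invariant p G L1 -> G z -> G [~ z, t]%g -> 0 < d -> d <= 1 -> 8 * d <= kap ->
  near_scalar p L1 d z l -> near_scalar p L1 d [~ z, t]%g mu -> gap p L1 kap [~ z, t]%g ->
  forall x y, L1 x -> L1 y -> dot (p t x) y = 0.
Proof.
move=> sG sL iL Gz Gw d0 d1 dk [l1 hl] [mu1 hmu] hgap; set w := [~ z, t]%g in Gw hmu hgap *.
(* The bound improves by 5/7 in each round. In [key] the remainders x' and y' stay in [L1] and are
   smaller by 2 d and d, which gives 2 d + d + 2 d^2 <= 5 d on the right; on the left |1 - mu| >= 8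
   d - d = 7 d. *)
suff main k x y : L1 x -> L1 y -> cn (dot (p t x) y) <= (5 / 7) ^+ k * (nm x * nm y).
  move=> x y Lx Ly; apply/eqP; rewrite -cn_eq0 eq_le cn_ge0 andbT.
  by apply: small_powers => k; exact: main.
elim: k x y => [|k IH] x y Lx Ly.
  by rewrite expr0 mul1r; apply: le_trans (CS _ _) _; rewrite (urep_nm hp).
have [x00|xn0] := eqVneq x 0; first by rewrite x00 (lin0 (urep_lin hp t)) dot0l cn0 nm0 mul0r mulr0.
have xp : 0 < nm x by rewrite nm_gt0.
pose x' := p z (p w x) - (l * mu) *: x; pose y' := p z y - l *: y.
have Lwx : L1 (p w x) by exact: iL.
have Lx' : L1 x' by apply: lsubB => //; [exact: iL | exact: lsubZ].
have Ly' : L1 y' by apply: lsubB => //; [exact: iL | exact: lsubZ].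
have nx' : nm x' <= 2 * d * nm x.
  apply: le_trans (nm_tri _ (l *: p w x) _) _.
  have h1 := hl _ Lwx; rewrite (urep_nm hp) in h1.
  have : nm (l *: p w x - (l * mu) *: x) <= d * nm x.
    by rewrite -scalerA -scalerBr nmZ l1 mul1r; exact: hmu.
  by move: h1; lra.
have ny' : nm y' <= d * nm y by exact: hl.
have mu_far : 7 * d <= cn (1 - mu).
  have h1 := hgap _ Lx; have h2 := hmu _ Lx.
  have h3 : nm (mu *: x - x) = cn (1 - mu) * nm x.
    by rewrite -[X in _ - X]scale1r -scalerBl nmZ cnBC.
  have h4 := nm_tri (p w x) (mu *: x) x; rewrite h3 in h4.
  rewrite -(ler_pM2r xp); have := ler_wpM2r (ltW xp) dk; lra.
have ll : l * conjc l = 1 by rewrite -cn_sqr l1 expr1n.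
have lt_ := urep_lin hp t.
have key : (1 - mu) * dot (p t x) y =
    l * mu * dot (p t x) y' + conjc l * dot (p t x') y + dot (p t x') y'.
  have e1 : dot (p t x) y = dot (p t (p z (p w x))) (p z y).
    have ezt : (z * t = t * z * w)%g by exact: commgC.
    by rewrite -!(urepM hp t) -(urepM hp (t * z)%g) -ezt (urepM hp) (urep_dot hp).
  have ex : p z (p w x) = (l * mu) *: x + x' by rewrite /x' addrC subrK.
  have ey : p z y = l *: y + y' by rewrite /y' addrC subrK.
  rewrite mulrBl mul1r {1}e1 ex ey (linD _ _ lt_) (linZ _ _ lt_).
  rewrite !dotDl !dotDr !dotZl !dotZr.
  have -> : l * mu * (conjc l * dot (p t x) y) = mu * dot (p t x) y.
    by rewrite mulrCA !mulrA (mulrC (conjc l)) ll mul1r.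
  by move: (dot _ _) (dot _ _) (dot _ _) (dot _ _) => a1 a2 a3 a4; ring.
have P0 : 0 <= (5 / 7) ^+ k :> R by apply: exprn_ge0; lra.
have i1 := IH x y' Lx Ly'; have i2 := IH x' y Lx' Ly; have i3 := IH x' y' Lx' Ly'.
have hc : cn (1 - mu) * cn (dot (p t x) y) <= (5 / 7) ^+ k * (5 * d * (nm x * nm y)).
  rewrite -cnM key; apply: le_trans (cnD _ _) _.
  have a1 : cn (l * mu * dot (p t x) y' + conjc l * dot (p t x') y) <= cn (dot (p t x) y') + cn (dot (p t x') y).
    by apply: le_trans (cnD _ _) _; rewrite !cnM cnJ l1 mu1 !mul1r.
  apply: le_trans (lerD a1 i3) _; apply: le_trans (lerD (lerD i1 i2) (lexx _)) _.
  rewrite -!mulrDr; apply: ler_wpM2l => //.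
  have X0 := nm_ge0 x; have Y0 := nm_ge0 y; have XY := mulr_ge0 X0 Y0.
  have b1 := ler_wpM2l X0 ny'; have b2 := ler_wpM2r Y0 nx'.
  have b3 : nm x' * nm y' <= (2 * d * nm x) * (d * nm y) by apply: ler_pM; rewrite ?nm_ge0.
  have b4 : d * d * (nm x * nm y) <= d * (nm x * nm y).
    by apply: ler_wpM2r => //; rewrite ler_piMl // ltW.
  by move: b1 b2 b3 b4; move: (nm x) (nm y) (nm x') (nm y') => a b a' b'; lra.
have c0 := cn_ge0 (dot (p t x) y).
have := le_trans (ler_wpM2r c0 mu_far) hc; rewrite exprS.
move: (cn _) ((5 / 7) ^+ k : R) (nm x * nm y) => a P B h.
rewrite -(ler_pM2l d0); move: h; lra.
Qed.

(** The projection is the sum of the conjugates of one projection by the r i. An element h permutes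
    the cosets, and between two of them it acts through an element of [F1]; the q errors are simply
    added. *)
Lemma qd_induced (G : set Gam) (L : set H) (F F1 : seq Gam) (e : R) (q : nat) (r : 'I_q -> Gam)
    (ix : Gam -> 'I_q) : sgp G -> lsub L -> 0 <= e ->
  (forall g, G ((r (ix g))^-1 * g)%g) -> (forall i j, G ((r i)^-1 * r j)%g -> i = j) ->
  (forall i j x y, i != j -> L x -> L y -> dot (p (r i) x) (p (r j) y) = 0) ->
  (forall h i, h \in F -> ((r (ix (h * r i)))^-1 * (h * r i))%g \in F1) -> qd p F1 e L ->
  qd p F (q%:R * e) [set y | exists2 x : 'I_q -> H, (forall i, L (x i)) & y = \sum_i p (r i) (x i)].
Proof.
move=> sG sL e0 ixP r_inj orth FF1 hqd xs hxs.
have ex y : exists x : 'I_q -> H, y \in xs -> (forall i, L (x i)) /\ y = \sum_i p (r i) (x i).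
  by have [/hxs[x h1 h2]|] := boolP (y \in xs); [exists x | exists (fun=> 0)].
pose c y := sval (cid (ex y)).
have cP y : y \in xs -> (forall i, L (c y i)) /\ y = \sum_i p (r i) (c y i) by exact: svalP (cid (ex y)).
have [|J [u [ou Lu uK uF]]] := hqd [seq c y i | y <- xs, i <- enum 'I_q].
  by move=> _ /allpairsP[[y i] [/= yxs _ ->]]; have [] := cP y yxs.
pose v (ij : 'I_q * J) := p (r ij.1) (u ij.2).
have ov : onf v.
  move=> [i j] [i' j']; rewrite /v /= xpair_eqE; have [<-|ne] := eqVneq i i'.
    by rewrite (urep_dot hp) ou.
  exact: orth.
have pjv y : pj v y = \sum_i p (r i) (pj u (p (r i)^-1%g y)).
  rewrite /pj; under [RHS]eq_bigr => i _ do rewrite (lin_sum _ _ _ (urep_lin hp _)).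
  rewrite pair_bigA /=; apply: eq_bigr => -[i j] _ /=.
  by rewrite (linZ _ _ (urep_lin hp _)) (urep_adj hp) invgK.
exists ('I_q * J)%type, v; split=> //.
- move=> [i j]; exists (fun k => if k == i then u j else 0).
    by move=> k; case: ifP => _ //; exact: (lsub0 sL).
  rewrite (bigD1 i) //= eqxx big1 ?addr0 // => k ki.
  by rewrite (negPf ki) (lin0 (urep_lin hp _)).
- move=> y yxs; have [Lc ey] := cP y yxs.
  have e1 i : pj u (p (r i)^-1%g y) = pj u (c y i).
    apply: eq_bigr => j _; congr (_ *: _); rewrite -(urep_dot hp (r i)) (urepKV hp).
    rewrite {1}ey dot_suml (bigD1 i) //= big1 ?addr0 ?(urep_dot hp) // => k ki.
    exact: orth.
  rewrite pjv [RHS]ey; apply: eq_bigr => i _; rewrite e1; congr (p _ _); apply: uK.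
  by apply/allpairsP; exists (y, i); rewrite mem_enum.
- move=> h hF y; pose pi i := ix (h * r i)%g.
  have pinj : injective pi.
    move=> i j eij; apply: r_inj; have h1 := ixP (h * r i)%g; have h2 := ixP (h * r j)%g.
    rewrite -/(pi i) -/(pi j) -eij in h1 h2.
    have := sgpM sG (sgpV sG h1) h2.
    by rewrite !invgM invgK -!mulgA !(mulKg, mulVKg).
  rewrite !pjv (lin_sum _ _ _ (urep_lin hp _)) [X in _ - X](reindex_inj pinj) /= -sumrB.
  apply: le_trans (nm_sum _ _ _) _; rewrite -mulrA -[leRHS]sum_cst.
  apply: ler_sum => i _; pose g := ((r (pi i))^-1 * (h * r i))%g.
  have gF : g \in F1 by exact: FF1.
  have e1 : (r (pi i) * g = h * r i)%g by exact: mulVKg.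
  have e2 : (g * (r i)^-1 = (r (pi i))^-1 * h)%g by rewrite /g mulgA mulgK.
  have -> : p h (p (r i) (pj u (p (r i)^-1%g y))) - p (r (pi i)) (pj u (p (r (pi i))^-1%g (p h y))) =
      p (r (pi i)) (p g (pj u (p (r i)^-1%g y)) - pj u (p g (p (r i)^-1%g y))).
    rewrite (linB _ _ (urep_lin hp _)) -(urepM hp h) -(urepM hp _ g) e1 -(urepM hp g) e2.
    by rewrite (urepM hp _ h).
  rewrite (urep_nm hp); have := uF g gF (p (r i)^-1%g y); by rewrite (urep_nm hp).
Qed.

End Induction.

Lemma common_lower (R : realType) (T : eqType) (l : seq T) (P : T -> R -> Prop) :
  (forall t k k', P t k -> k' <= k -> P t k') ->
  {in l, forall t, exists2 k, 0 < k & P t k} -> exists2 k : R, 0 < k & {in l, forall t, P t k}.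
Proof.
move=> mono; elim: l => [|t l IH] h; first by exists 1.
have [|k k0 hk] := IH; first by move=> u ul; apply: h; rewrite inE ul orbT.
have [k' k'0 hk'] := h t (mem_head _ _); exists (Num.min k k'); first by rewrite lt_min k0.
move=> u; rewrite inE => /orP[/eqP->|/hk hu]; first by apply: mono hk' _; rewrite ge_min lexx orbT.
by apply: mono hu _; rewrite ge_min lexx.
Qed.

(** * The two regimes over the centre of the quotient *)

Section Local.
Variables (R : realType) (H : hilbertType R) (Gam : groupType) (p : Gam -> H -> H).
Hypothesis hp : urep p.
Variables (Dl : set Gam) (K : groupType) (f : Gam -> K) (z : Gam) (xs : seq Gam).
Hypotheses (nG : noeth Gam) (sDl : sgp Dl) (cD : forall d g, Dl d -> commute d g).
Hypothesis cl : forall x y w, Dl [~ [~ x, y], w]%g.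
Hypotheses (fM : shom setT f) (f1 : forall g, f g = 1%g <-> Dl g).
Hypothesis fsur : forall k, exists g, f g = k.
Hypothesis gen : forall T, sgp T -> {in xs, forall x, T x} -> forall g, T g.

(** The preimage of the centre of the quotient by [Dl] ([ztP]); modulo [Dl] it consists of powers of
    z. *)
Definition zt : set Gam := [set s | forall g, Dl [~ s, g]%g].
Hypothesis zZ : zt z.
Hypothesis zt_cyc : forall s, zt s -> cyc (f z) (f s).
Hypothesis z_inf : forall n, (0 < n)%N -> ~ Dl (z ^+ n)%g.

Let sT : sgp [set: Gam]. Proof. by []. Qed.

Let f_eq g h : f g = f h -> exists2 d, Dl d & h = (g * d)%g.
Proof.
move=> e; exists (g^-1 * h)%g; last by rewrite mulVKg.
by apply/f1; exact: (eq_shom sT fM).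
Qed.

Lemma Dl_R d g : Dl d -> [~ d, g]%g = 1%g.
Proof. by move=> Dd; apply/eqP/commgP; exact: cD. Qed.

Lemma Dl_R' d g : Dl d -> [~ g, d]%g = 1%g.
Proof. by move=> Dd; rewrite -invgR Dl_R // invg1. Qed.

Lemma zR_mul g h : [~ z, g * h]%g = ([~ z, g] * [~ z, h])%g.
Proof.
have -> : ([~ z, g * h] = [~ z, h] * [~ z, g] ^ h)%g.
  by rewrite !commgEl conjgM (conjMg z^-1%g) conjVg; move: (z ^ g ^ h)%g (z ^ h)%g => a b; rewrite !mulgA mulgK.
have -> : ([~ z, g] ^ h = [~ z, g])%g by apply/conjg_fixP; rewrite Dl_R.
exact/esym/cD.
Qed.

Lemma cen_Dl G L c : Dl c -> G c -> cen p G L c.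
Proof. by move=> Dc Gc; split=> // g x Gg Lx; rewrite -!(urepM hp) cD. Qed.

(** The kernel on [L] of the homomorphism g -> [z, g] into [Dl]. On a subspace invariant under it, z
    and with it all of [zt] become central ([cen_zt]). *)
Definition ztriv (L : set H) : set Gam := [set g | forall v, L v -> p [~ z, g]%g v = v].

Lemma ztriv_sgp L : sgp (ztriv L).
Proof.
split=> [v Lv|g h hg hh v Lv|g hg v Lv] /=.
- by rewrite commg1 (urep1 hp).
- by rewrite zR_mul (urepM hp) hh ?hg.
- have -> : [~ z, g^-1]%g = ([~ z, g]^-1)%g.
    by apply/esym/mulg1_eq; rewrite -zR_mul mulgV commg1.
  by rewrite -{1}(hg v Lv) (urepK hp).
Qed.

Lemma zt_R u : zt u -> [~ z, u]%g = 1%g.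
Proof.
move=> /zt_cyc[i [j e]].
have [|d Dd ->] := @f_eq (z ^+ i * z ^- j)%g u.
  by rewrite fM // (shomV sT fM) // !(shomX sT fM) // e.
rewrite (zR_mul _ d) (Dl_R' z Dd) mulg1; apply/eqP/commgP.
by apply: commuteM; [|apply: commuteV]; apply: commuteX; exact: commute_refl.
Qed.

Lemma zt_ztriv L u : zt u -> ztriv L u.
Proof. by move=> hu v Lv; rewrite zt_R // (urep1 hp). Qed.

Lemma cen_zt L u : lsub L -> invariant p (ztriv L) L -> zt u -> cen p (ztriv L) L u.
Proof.
move=> sL iL hu; have sG := ztriv_sgp L; have [i [j e]] := zt_cyc hu.
have [|d Dd ->] := @f_eq (z ^+ i * z ^- j)%g u.
  by rewrite fM // (shomV sT fM) // !(shomX sT fM) // e.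
have cz : cen p (ztriv L) L z.
  split=> [v Lv|g x Gg Lx]; first by rewrite commgg (urep1 hp).
  by rewrite -!(urepM hp) commgC (urepM hp) Gg.
apply: (cenM hp sG iL); last first.
  apply: cen_Dl => // v Lv; by rewrite Dl_R' // (urep1 hp).
by apply: (cenM hp sG iL); [|apply: (cenV hp sG iL)]; apply: cenX.
Qed.

(** The Folner list is known before [C], so the commutators of its differences with generators of
    [G] can be stabilised first; [C] is then the full centre of the action on the resulting
    subspace. A difference outside [C] fails to commute with some generator, and stabilisation has
    turned this failure into the gap that [stage_gap] needs. *)
Lemma two_step_local (G : set Gam) (L : set H) (F : seq Gam) (e : R) : sgp G -> csub p G L ->
  (forall u, zt u -> cen p G L u) ->
  {in F, forall h, G h} -> {in F, forall h, h^-1%g \in F} -> 1%g \in F -> 0 < e ->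
  exists L', [/\ csub p G L', L' `<=` L & qd p F e L'].
Proof.
move=> sG csL cenZ FG FV F1 e0.
have ztR g y : zt [~ g, y]%g by move=> h; exact: cl.
have e2 : 0 < (e / 896) ^+ 2 by apply: exprn_gt0; apply: (divr_gt0 e0); rewrite ltr0n.
have [S [SG hS]] := folner e2 F1.
have SG' := SG G sG FG.
have [ys ysG hys] := nG sG.
have [|L2 [cs2 L2L st]] := stabilise hp sG (L := L)
    (W := [seq [~ s, y]%g | s <- [seq (s'.2^-1 * s'.1)%g | s' <- [seq (a, b) | a <- S, b <- S]], y <- ys]) csL.
  by move=> _ /allpairsP[[s y] [_ _ ->]]; exact: cenZ.
have [sL2 cL2 iL2 nL2] := cs2.
pose C := [set c | cen p G L2 c].
have CG : C `<=` G by move=> c [].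
have sC : sgp C.
  split=> [|c d hc hd|c hc]; [exact: cen1 | exact: cenM | exact: (cenV hp sG iL2)].
have cenZ2 u : zt u -> C u by move=> hu; exact: cen_sub (cenZ u hu).
have nC c g : C c -> G g -> C (c ^ g)%g.
  move=> hc Gg; split=> [|h x Gh Lx]; first exact: sgpJ (CG _ hc) Gg.
  by rewrite !(cenJ hp hc Gg) //; [have [_ ->] := hc | exact: iL2].
have clC a b c : G a -> G b -> G c -> C [~ [~ a, b], c]%g by move=> _ _ _; apply: cenZ2; exact: ztR.
have [n [s [n0 sS s_inj Fol]]] := hS G C sG sC CG nC FG clC.
have Gs j : G (s j) by apply: SG'.
have [L3 [cs3 L32 q3]] : exists L', [/\ csub p G L', L' `<=` L2 & qd p F e L'].
  apply: (endgame hp nG sG cs2 FG FV e0 sC CG nC _ clC n0 Gs s_inj Fol) => // L' cs' L'2 inf.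
  have [sL' cL' iL' nL'] := cs'.
  apply: free_of_states => d d0; have [phi nphi] := null_state_ex hp sL' inf.
  have [|psi [npsi hpsi]] := stage_gap hp sG sL' iL'
      (S := [seq ((s ij.2)^-1 * s ij.1)%g | ij <- enum {: 'I_n * 'I_n} & ij.1 != ij.2]) d0 nphi.
    move=> t /mapP[[i j]]; rewrite mem_filter /= => /andP[ij _] et.
    have Gt : G t by rewrite et; apply: sgpM => //; exact: sgpV.
    split=> // [h Gh|]; first exact: cen_sub L'2 (cenZ2 _ (ztR t h)).
    have [[y yys [k k0 hk]]|none] := pselect (exists2 y, y \in ys & exists2 k, 0 < k & gap p L2 k [~ t, y]%g).
      by exists y, k; split=> //; [exact: ysG | exact: gap_sub hk].
    exfalso; move/eqP: ij; apply; apply/esym/s_inj; rewrite -et; split=> // g x Gg Lx.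
    have sX : sgp [set g | G g /\ forall x, L2 x -> p t (p g x) = p g (p t x)].
      split=> [|g1 g2 [G1 h1] [G2 h2]|g1 [G1 h1]] /=.
      - by split=> [|y Ly]; [exact: sgp1 | rewrite !(urep1 hp)].
      - split=> [|y Ly]; first exact: sgpM.
        by rewrite !(urepM hp) h1 ?h2 //; exact: iL2.
      - split=> [|y Ly]; first exact: sgpV.
        have Ly' : L2 (p g1^-1%g y) by apply: iL2 => //; exact: sgpV.
        by have := h1 _ Ly'; rewrite (urepKV hp) => ->; rewrite (urepK hp).
    have [|_ h] := hys _ sX _ g Gg; last exact: h.
    move=> y yys; have Gy := ysG _ yys; split=> // x' Lx'.
    have [|h1|[k k0 hk]] := st [~ t, y]%g; last by case: none; exists y => //; exists k.
      apply/allpairsP; exists (t, y); split=> //; apply/mapP; exists (s i, s j) => //.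
      by apply/allpairsP; exists (s i, s j); rewrite /= !sS.
    by rewrite -!(urepM hp) commgC (urepM hp) h1.
  exists psi => // t tS; have := hpsi t tS 1%g (cen1 hp L' sG); by rewrite mulg1.
by exists L3; split=> //; exact: subset_trans L32 L2L.
Qed.

(** Modulo [ztriv] the group is abelian, finitely generated and torsion, hence finite. After
    localising z, translates of the subspace by distinct coset representatives have separated near
    eigenvalues of z, so they are orthogonal by [translate_orth]. The problem reduces to the finite
    index subgroup, where [zt] is central, and is induced back. *)
Lemma torsion_case (L : set H) (F : seq Gam) (e : R) : csub p setT L -> 0 < e ->
  {in xs, forall x, exists2 l, (0 < l)%N & forall v, L v -> p ([~ z, x] ^+ l)%g v = v} ->
  exists X, [/\ lsub X, invariant p setT X, X `<=` L, exists2 x, X x & x != 0 & qd p F e X].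
Proof.
move=> csL e0 tor; have [sL cL iL nL] := csL.
have sG0 := ztriv_sgp L.
have zX g n : [~ z, g ^+ n]%g = ([~ z, g] ^+ n)%g.
  by elim: n => [|n IH]; [rewrite commg1 | rewrite !expgS zR_mul IH].
have torG s : exists2 n, (0 < n)%N & ztriv L (s ^+ n)%g.
  pose T := [set s | exists2 n, (0 < n)%N & ztriv L (s ^+ n)%g].
  have comm a b : ([~ z, a] * [~ z, b] = [~ z, b] * [~ z, a])%g by apply: cD; exact: zZ.
  suff : T s by [].
  have triv_pow a n m v : L v -> ztriv L (a ^+ n)%g -> p ([~ z, a] ^+ (n * m))%g v = v.
    by move=> Lv h; rewrite -zX expgnA; apply: (sgpX m sG0 h).
  apply: gen => [|x xxs]; last first.
    by have [l l0 hl] := tor x xxs; exists l => // v Lv; rewrite zX; exact: hl.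
  split=> [|a b [n n0 hn] [m m0 hm]|a [n n0 hn]].
  - by exists 1%N => //; exact: sgp1.
  - exists (n * m)%N; first by rewrite muln_gt0 n0.
    move=> v Lv; rewrite zX zR_mul expgMn; last exact: comm.
    by rewrite (urepM hp) (mulnC n) (triv_pow b) // mulnC (triv_pow a).
  - exists n => // v Lv; rewrite zX -(_ : [~ z, a]^-1 = [~ z, a^-1])%g; last first.
      by apply: mulg1_eq; rewrite -zR_mul mulgV commg1.
    have := hn; rewrite /ztriv /= zX => h.
    have -> : ([~ z, a]^-1 ^+ n = ([~ z, a] ^+ n)^-1)%g.
      move: [~ z, a]%g => w; elim: (n) => [|k IHk]; first by rewrite invg1.
      by rewrite expgS expgSr invgM IHk.
    by rewrite -{1}(h v Lv) (urepK hp).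
have [[l _ hl] _] : fin_mod setT (ztriv L) /\ exists2 n, (0 < n)%N & forall s, setT s -> ztriv L (s ^+ n)%g.
  apply: fg_torsion => // [b s hb _ v Lv|s t _ _ v Lv|].
  - have -> : (b ^ s = b * [~ b, s])%g by rewrite commgEl mulVKg.
    by rewrite zR_mul (zt_R (cl b s)) mulg1; exact: hb.
  - exact: zt_ztriv (cl s t) v Lv.
  - exact: nG.
have [|L1 [cs1 L1L st]] := stabilise hp sT (L := L)
    (W := [seq [~ z, a^-1 * b]%g | a <- l, b <- l]) csL.
  by move=> _ /allpairsP[[a b] [_ _ ->]]; apply: cen_Dl => //; exact: zZ.
have [sL1 cL1 iL1 nL1] := cs1.
(* The subgroup is taken anew on [L1], where it may have grown: now a commutator of z with a
   difference of distinct coset representatives is nontrivial on [L1], and stabilisation gives it a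
   gap. *)
pose G := ztriv L1; have sG : sgp G := ztriv_sgp L1.
have GG : ztriv L `<=` G by move=> g hg v /L1L; exact: hg.
have [//|//|g _|q [r [ix [rl ixP r_inj]]]] := @reps_in_list Gam setT G l sT sG.
  by have [t tl ht] := hl g I; exists t => //; exact: GG.
have iG L' : invariant p setT L' -> invariant p G L' by move=> h g x _; exact: h.
have csG : csub p G L1 by split=> //; exact: iG.
have cenZ u : zt u -> cen p G L1 u by move=> hu; apply: cen_zt => //; exact: iG.
have gaps : {in enum {: 'I_q * 'I_q}, forall ij, exists2 k, 0 < k &
    ij.1 != ij.2 -> gap p L1 k [~ z, (r ij.2)^-1 * r ij.1]%g}.
  move=> [i j] _ /=; have [->|ij] := eqVneq i j; first by exists 1.
  have [|h|[k k0 hk]] := st [~ z, (r j)^-1 * r i]%g; last by exists k.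
    by apply/allpairsP; exists (r j, r i); rewrite !rl.
  by move/eqP: ij; case; apply/esym/r_inj => v; exact: h.
have [|kap kap0 hkap] := common_lower (P := fun ij k => ij.1 != ij.2 ->
    gap p L1 k [~ z, (r ij.2)^-1 * r ij.1]%g) _ gaps.
  move=> t k k' h k'k ne x Lx; apply: le_trans (h ne x Lx).
  by apply: ler_wpM2r => //; exact: nm_ge0.
pose d := Num.min (kap / 8) 1.
have d0 : 0 < d by rewrite lt_min ltr01 divr_gt0.
have d1 : d <= 1 by rewrite ge_min lexx orbT.
have dk : 8 * d <= kap.
  by have : d <= kap / 8 by [rewrite ge_min lexx]; move: (d) => y; lra.
have Dz u : Dl u -> zt u by move=> Du g; rewrite Dl_R //; exact: sgp1.
have [|L2 [cs2 L21 near]] := localise_seq hp sG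
    (cs := z :: [seq [~ z, (r ij.2)^-1 * r ij.1]%g | ij <- enum {: 'I_q * 'I_q}]) csG _ d0.
  by move=> c; rewrite inE => /orP[/eqP->|/mapP[ij _ ->]]; apply: cenZ => //; apply: Dz; exact: zZ.
have [sL2 cL2 iL2 nL2] := cs2.
have orth i j x y : i != j -> L2 x -> L2 y -> dot (p (r i) x) (p (r j) y) = 0.
  move=> ij Lx Ly; rewrite -(invgK (r j)) -(urep_adj hp) -(urepM hp).
  have [lz hz] := near z (mem_head _ _).
  have [|mu hmu] := near [~ z, (r j)^-1 * r i]%g.
    by rewrite inE; apply/orP; right; apply/mapP; exists (i, j) => //; rewrite mem_enum.
  apply: (translate_orth hp sG sL2 iL2 _ _ d0 d1 dk hz hmu) => //.
  - exact: (cenZ z zZ).1.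
  - by have [] := cenZ _ (Dz _ (zZ ((r j)^-1 * r i)%g)).
  - by apply: gap_sub L21 _; apply: (hkap (i, j)); rewrite ?mem_enum.
pose F0 := [seq ((r (ix (h * r i)))^-1 * (h * r i))%g | h <- F, i <- enum 'I_q].
pose F1 := 1%g :: F0 ++ [seq h^-1%g | h <- F0].
pose e' := e / (q%:R + 1).
have q1 : 0 < q%:R + 1 :> R by rewrite ltr_wpDl.
have e'0 : 0 < e' by apply: divr_gt0.
have F0G : {in F0, forall h, G h} by move=> _ /allpairsP[[h i] [_ _ ->]]; exact: ixP.
have [||||L3 [cs3 L32 q3]] := @two_step_local G L2 F1 e' sG cs2 _ _ _ _ e'0.
- by move=> u hu; exact: cen_sub L21 (cenZ u hu).
- move=> h; rewrite inE mem_cat => /or3P[/eqP->|/F0G//|/mapP[k /F0G Gk ->]]; first exact: (sgp1 sG).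
  exact: (sgpV sG Gk).
- move=> h; rewrite !inE !mem_cat => /or3P[/eqP->|hF|/mapP[k kF ->]].
  + by rewrite invg1 eqxx.
  + by rewrite map_f ?orbT.
  + by rewrite invgK kF /= orbT.
- exact: mem_head.
have [sL3 cL3 iL3 [x0 Lx0 x00]] := cs3.
exists [set y | exists2 x : 'I_q -> H, (forall i, L3 (x i)) & y = \sum_i p (r i) (x i)]; split.
- split=> [|k _ _ [x Lx ->] [y Ly ->]].
    by exists (fun=> 0) => [i|]; [exact: (lsub0 sL3) | rewrite big1 // => i _; rewrite (lin0 (urep_lin hp _))].
  exists (fun i => k *: x i + y i) => [i|]; first exact: sL3.2.
  by rewrite scaler_sumr -big_split /=; apply: eq_bigr => i _; rewrite (urep_lin hp).
- move=> h _ _ [x Lx ->]; pose pi i := ix (h * r i)%g.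
  have pinj : injective pi.
    move=> i j eij; apply: r_inj; have h1 := ixP (h * r i)%g I; have h2 := ixP (h * r j)%g I.
    rewrite -/(pi i) -/(pi j) -eij in h1 h2.
    have := sgpM sG (sgpV sG h1) h2.
    by rewrite !invgM invgK -!mulgA !(mulKg, mulVKg).
  have [pV piV Vpi] : bijective pi by exact: injF_bij.
  exists (fun k => p ((r k)^-1 * (h * r (pV k)))%g (x (pV k))) => [k|].
    apply: iL3 => //; rewrite -{1}(Vpi k); exact: ixP.
  rewrite (lin_sum _ _ _ (urep_lin hp _)) [RHS](reindex_inj pinj) /=.
  by apply: eq_bigr => i _; rewrite piV -!(urepM hp) mulVKg.
- move=> _ [x Lx ->]; apply: lsub_sum => // i _; apply: iL => //; exact/L1L/L21/L32.
- exists (p (r (ix 1%g)) x0); last by rewrite -nm_eq0 (urep_nm hp) nm_eq0.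
  exists (fun k => if k == ix 1%g then x0 else 0) => [k|]; first by case: ifP => _ //; exact: (lsub0 sL3).
  rewrite (bigD1 (ix 1%g)) //= eqxx big1 ?addr0 // => k /negPf->; exact: (lin0 (urep_lin hp _)).
- have := @qd_induced _ _ _ _ hp G L3 F F1 e' q r ix sG sL3 (ltW e'0) (fun g => ixP g I) r_inj _ _ q3.
  move=> hqd zs hzs; have [||J [v [h1 h2 h3 h4]]] := hqd _ _ zs hzs.
  + by move=> i j x y ij /L32 Lx /L32 Ly; exact: orth.
  + move=> h i hF; rewrite inE mem_cat; apply/or3P; constructor 2.
    by apply/allpairsP; exists (h, i); rewrite mem_enum.
  have le_ : q%:R * e' <= e by rewrite /e' mulrA ler_pdivrMr // mulrC ler_wpM2l ?ltW // ltrDl.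
  exists J, v; split=> // h hF.
  by apply: acm_le le_ _; exact: h4.
Qed.

Lemma ztP u : zt u <-> forall k, commute (f u) k.
Proof.
split=> [hu k|h g].
  have [g <-] := fsur k; apply/commgP/eqP; rewrite -(shomR sT fM) //.
  by apply/f1.
by apply/f1; rewrite (shomR sT fM) //; apply/eqP/commgP; exact: h.
Qed.

Lemma common_upper (T : eqType) (l : seq T) (P : T -> nat -> Prop) :
  {in l, forall t, exists k, P t k} -> exists N, {in l, forall t, exists2 k, (k <= N)%N & P t k}.
Proof.
elim: l => [|t l IH] h; first by exists 0%N.
have [|N hN] := IH; first by move=> u ul; apply: h; rewrite inE ul orbT.
have [k hk] := h t (mem_head _ _); exists (N + k)%N => u.
rewrite inE => /orP[/eqP->|/hN[j jN hj]]; first by exists k; rewrite ?leq_addl.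
by exists j => //; rewrite (leq_trans jN) // leq_addr.
Qed.

Definition zpow (t : Gam) (k : nat) := (0 < k)%N /\ (f t = f z ^+ k \/ f t = f z ^- k)%g.

Lemma zpow_ex t : zt t -> ~ Dl t -> exists k, zpow t k.
Proof.
move=> /zt_cyc[i [j e]] nD; have n1 : f t <> 1%g by move/f1.
have [[k e1 _]|[k e1 _]] := zp_split (f z) i j; rewrite -e in e1; exists k; split.
- by case: k e1 => // e1; case: n1.
- by left.
- by case: k e1 => // /(congr1 inv); rewrite invgK invg1.
- by right; rewrite -e1 invgK.
Qed.

(** Modulo [Dl], conjugation by y^i multiplies s n by [s, y]^i, so the quotient lies over the power
    i - j of [s, y]. The sum of the two truncated differences is |i - j|. *)
Lemma zpow_quot a s y n k i j : zt n -> zpow [~ s, y]%g k -> i != j -> a = (s * n)%g ->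
  zpow ((a ^ (y ^+ j))^-1 * a ^ (y ^+ i))%g (k * ((i - j) + (j - i)))%N.
Proof.
move=> hn [k0 hk] ij ->.
have cz := (ztP z).1 zZ.
have cw c : commute (f [~ s, y]%g) c.
  case: hk => ->; first by apply/commute_sym/commuteX/commute_sym/cz.
  by apply/commute_sym/commuteV/commuteX/commute_sym/cz.
have cwX m c : commute (f [~ s, y]%g ^+ m)%g c by apply/commute_sym/commuteX/commute_sym/cw.
have cn_ := (ztP n).1 hn.
have e m : f ((s * n) ^ (y ^+ m))%g = (f s * f n * f [~ s, y] ^+ m)%g.
  elim: m => [|m IH]; first by rewrite conjg1 fM // mulg1.
  rewrite expgSr conjgM (shomJ sT fM) // IH (conjMg (f s * f n)%g) (conjMg (f s)).
  have -> : (f n ^ f y = f n)%g by apply/conjg_fixP/commgP; exact: cn_.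
  have -> : ((f [~ s, y] ^+ m) ^ f y = f [~ s, y] ^+ m)%g by apply/conjg_fixP/commgP; exact: cwX.
  have -> : (f s ^ f y = f s * f [~ s, y])%g by rewrite (shomR sT fM) // commgEl mulVKg.
  by rewrite expgS -!mulgA; congr (_ * _)%g; rewrite !mulgA (cw (f n)).
have er : f ((((s * n) ^ (y ^+ j))^-1 * (s * n) ^ (y ^+ i)))%g = (f [~ s, y] ^- j * f [~ s, y] ^+ i)%g.
  by rewrite fM // (shomV sT fM) // !e invgM -mulgA mulKg.
split; first by rewrite muln_gt0 k0 addn_gt0 !subn_gt0 -neq_ltn eq_sym.
have main m c : (c = f z ^+ k \/ c = f z ^- k)%g -> (c ^+ m = f z ^+ (k * m) \/ c ^+ m = f z ^- (k * m))%g.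
  case=> ->; [left | right]; first by rewrite expgnA.
  rewrite expgnA; move: (f z ^+ k)%g => w; elim: m => [|m IHm]; first by rewrite invg1.
  by rewrite expgS expgSr invgM IHm.
rewrite er; move: (f [~ s, y]%g) hk => w hk; have [lt|le] := ltnP j i.
  have -> : (i - j + (j - i) = i - j)%N by lia.
  have -> : (w ^- j * w ^+ i = w ^+ (i - j))%g by rewrite -{1}(subnKC (ltnW lt)) expgnDr mulKg.
  exact: main hk.
have -> : (i - j + (j - i) = j - i)%N by lia.
have -> : (w ^- j * w ^+ i = w ^- (j - i))%g.
  by rewrite -{1}(subnKC le) expgnDr invgM -mulgA mulVg mulg1.
by have [->|->] := main (j - i)%N _ hk; [right | left; rewrite invgK].
Qed.

(** Here [Dl] itself serves as [C]. A Folner difference t lies over some z^k or z^-k, or else some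
    commutator [t, y] does. The first kind is treated by the gaps of [z^l, x] = [z, x]^l; the second
    by [stage_orth], as the conjugates of t by powers of y differ by powers of z on which the state
    is already small. *)
Lemma gap_case (L : set H) (F : seq Gam) (e : R) : csub p setT L -> 0 < e ->
  {in F, forall h, h^-1%g \in F} -> 1%g \in F ->
  (forall L', csub p setT L' -> L' `<=` L ->
    exists2 x, x \in xs & forall l, (0 < l)%N -> ~ (forall v, L' v -> p ([~ z, x] ^+ l)%g v = v)) ->
  exists L', [/\ csub p setT L', L' `<=` L & qd p F e L'].
Proof.
move=> csL e0 FV F1 hB; have FG : {in F, forall h, [set: Gam] h} by [].
have [[L' [cs' L'L inf]]|hinf] := pselect (exists L', [/\ csub p setT L', L' `<=` L & ~ infdim L']).
  by exists L'; split=> //; exact: qd_finite sT cs' FG (ltW e0) inf.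
have e2 : 0 < (e / 896) ^+ 2 by apply: exprn_gt0; apply: (divr_gt0 e0); rewrite ltr0n.
have [S [_ hS]] := folner e2 F1.
have nD c g : Dl c -> setT g -> Dl (c ^ g)%g.
  by move=> Dc _; have /conjg_fixP-> : [~ c, g]%g == 1%g by rewrite Dl_R.
have DT : Dl `<=` setT by [].
have [n [s [n0 sS s_inj Fol]]] := hS setT Dl sT sDl DT nD FG (fun a b c _ _ _ => cl a b c).
apply: (endgame hp nG sT csL FG FV e0 sDl DT nD (fun c Dc => cen_Dl L Dc I)
  (fun a b c _ _ _ => cl a b c) n0 (fun j => I) s_inj Fol) => L1 cs1 L1L inf1 E d d0.
have [sL1 cL1 iL1 nL1] := cs1.
have d20 : 0 < d / 2 by rewrite divr_gt0.
have [M [d1 [b [M0 d10 b0 hb1 hb2]]]] := stage_params d20.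
have M0R : 0 < M%:R :> R by rewrite ltr0n.
have d1d : d1 <= d / 2 by rewrite -(ler_pM2l M0R); move: b0 hb2; lra.
set T := [seq _ | ij <- _ & _].
have TD t : t \in T -> ~ Dl t.
  move=> /mapP[[i j]]; rewrite mem_filter /= => /andP[ij _] -> Dt.
  by move/eqP: ij; apply; apply/esym/s_inj.
have [N hN] : exists N, {in T, forall t, exists2 k, (k <= N)%N &
    (zt t /\ zpow t k) \/ (~ zt t /\ exists y, zpow [~ t, y]%g k)}.
  apply: common_upper => t tT; have [ht|ht] := pselect (zt t).
    by have [k hk] := zpow_ex ht (TD t tT); exists k; left.
  have [y hy] : exists y, ~ Dl [~ t, y]%g by apply/existsNP.
  by have [k hk] := zpow_ex (cl t y) hy; exists k; right; split=> //; exists y.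
(* The exponents k |i - j| from [zpow_quot] have k <= N and i, j < M. *)
pose lm := (N * M)%N.
have [|L2 [cs2 L21 st]] := stabilise hp sT (L := L1)
    (W := [seq ([~ z, x] ^+ l)%g | x <- xs, l <- iota 1 lm]) cs1.
  by move=> _ /allpairsP[[x l] [_ _ ->]]; apply: cen_Dl => //; apply: sgpX => //; exact: zZ.
have [sL2 cL2 iL2 nL2] := cs2.
have L2L : L2 `<=` L by exact: subset_trans L21 L1L.
have [x xxs hx] := hB L2 cs2 L2L.
have gapx l : (0 < l <= lm)%N -> exists2 k, 0 < k & gap p L2 k ([~ z, x] ^+ l)%g.
  move=> /andP[l0 llm]; have [|h|//] := st ([~ z, x] ^+ l)%g.
    by apply/allpairsP; exists (x, l); split=> //; rewrite mem_iota l0 add1n ltnS.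
  by case: (hx l l0).
have inf2 : infdim L2 by apply: contrapT => ninf; apply: hinf; exists L2.
have [phi nphi] := null_state_ex hp sL2 inf2.
have zXR l g : [~ z ^+ l, g]%g = ([~ z, g] ^+ l)%g by apply: commX_central => h; apply: cD; exact: zZ.
have zVR l g : [~ z ^- l, g]%g = ([~ z, g] ^- l)%g.
  have Dw : Dl ([~ z, g] ^+ l)%g by apply: sgpX => //; exact: zZ.
  rewrite commgEl conjVg invgK.
  have -> : ((z ^+ l) ^ g = z ^+ l * [~ z, g] ^+ l)%g by rewrite -zXR commgEl mulVKg.
  by rewrite -(cD _ Dw) invgM mulgA mulgV mul1g.
have [|psi1 [npsi1 hpsi1]] := stage_gap hp sT sL2 iL2
    (S := [seq z ^+ l | l <- iota 1 lm]%g ++ [seq z ^- l | l <- iota 1 lm]%g) d10 nphi.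
  move=> t; rewrite mem_cat => /orP[] /mapP[l]; rewrite mem_iota add1n ltnS => hl ->.
    split=> // [h _|]; first by rewrite zXR; apply: cen_Dl => //; apply: sgpX => //; exact: zZ.
    by have [k k0 hk] := gapx l hl; exists x, k; rewrite zXR.
  split=> // [h _|]; first by rewrite zVR; apply: cen_Dl => //; apply: (sgpV sDl); apply: (sgpX _ sDl); exact: zZ.
  by have [k k0 hk] := gapx l hl; exists x, k; rewrite zVR; split=> //; exact: gapV.
(* Elements of [Q] are determined only up to [Dl]; this is where the uniformity of [stage_gap] in
   the central factor is used. *)
pose Q : set Gam := [set t | exists2 l, (l <= lm)%N & zpow t l].
have hQ t : Q t -> cn (psi1 t) <= d1.
  move=> [l llm [l0 hl]]; case: hl => hl.
    have [|c Dc ->] := @f_eq (z ^+ l)%g t; first by rewrite (shomX sT fM).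
    apply: hpsi1; last exact: cen_Dl.
    by rewrite mem_cat; apply/orP; left; apply/mapP; exists l; rewrite // mem_iota l0 add1n ltnS.
  have [|c Dc ->] := @f_eq (z ^- l)%g t; first by rewrite (shomV sT fM) // (shomX sT fM).
  apply: hpsi1; last exact: cen_Dl.
  by rewrite mem_cat; apply/orP; right; apply/mapP; exists l; rewrite // mem_iota l0 add1n ltnS.
have [||psi [npsi hpQ hpS]] := @stage_orth _ _ _ p hp setT L2 sT sL2 iL2 Q zt
    [seq t <- T | ~~ `[< zt t >]] M d1 b (d / 2) psi1 M0 d10 b0 hb1 hb2 npsi1 hQ.
- move=> t h [l llm [l0 hl]] _; exists l => //; split=> //.
  rewrite (shomJ sT fM) //; have -> // : (f t ^ f h = f t)%g.
  have cz := (ztP z).1 zZ.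
  apply/conjg_fixP/commgP; case: hl => ->; first by apply/commute_sym/commuteX/commute_sym/cz.
  by apply/commute_sym/commuteV/commuteX/commute_sym/cz.
- move=> t; rewrite mem_filter => /andP[/asboolPn nt tT]; split.
    move=> m h hm _; exists (t^-1 * (t * m) ^ h)%g; last by rewrite mulVKg.
    apply/ztP => c; have -> : (t^-1 * (t * m) ^ h = [~ t, h] * m ^ h)%g.
      by rewrite (conjMg t) mulgA commgEl.
    rewrite fM // (shomJ sT fM) //.
    have -> : (f m ^ f h = f m)%g by apply/conjg_fixP/commgP; exact: (ztP m).1 hm _.
    apply/commute_sym/commuteM; apply/commute_sym.
      exact: (ztP [~ t, h]%g).1 (cl t h) c.
    exact: (ztP m).1 hm c.
  have [k kN [[//]|[_ [y hy]]]] := hN t tT.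
  exists y => // m i j hm iM jM ij; exists (k * ((i - j) + (j - i)))%N.
    by apply: (leq_mul kN); move: iM jM; clear; lia.
  exact: zpow_quot hm hy ij erefl.
have hT t : t \in T -> cn (psi t) <= d / 2.
  move=> tT; have [ht|nt] := pselect (zt t).
    apply: le_trans d1d; apply: hpQ; have [k kN [[_ hk]|[nz _]]] := hN t tT; last by case: nz.
    exact: (ex_intro2 _ _ k (leq_trans kN (leq_pmulr N M0)) hk).
  rewrite -[t]mulg1; apply: hpS; first by rewrite mem_filter tT andbT; exact/asboolPn.
  by move=> g; rewrite comm1g; exact: sgp1.
have [y [Ly ny hE hy]] := npsi E T _ d20.
exists y; split=> // [|w /hE he|t tT]; [exact: L21 | by move: d0; lra |].
have := hy t tT; have := hT t tT.
have := cnD (dot (p t y) y - psi t) (psi t); rewrite subrK; lra.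
Qed.

Lemma local_qd (L : set H) (F : seq Gam) (e : R) : csub p setT L -> 0 < e ->
  {in F, forall h, h^-1%g \in F} -> 1%g \in F ->
  exists X, [/\ lsub X, invariant p setT X, X `<=` L, exists2 x, X x & x != 0 & qd p F e X].
Proof.
move=> csL e0 FV F1.
have [[L' [cs' L'L tor]]|none] := pselect (exists L', [/\ csub p setT L', L' `<=` L &
    {in xs, forall x, exists2 l, (0 < l)%N & forall v, L' v -> p ([~ z, x] ^+ l)%g v = v}]).
  have [X [h1 h2 h3 h4 h5]] := torsion_case F cs' e0 tor.
  by exists X; split=> //; exact: subset_trans h3 L'L.
have [|L' [[h1 h2 h3 h4] h5 h6]] := gap_case csL e0 FV F1.
  move=> L' cs' L'L; apply: contrapT => h; apply: none; exists L'; split=> // x xxs.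
  apply: contrapT => h'; apply: h; exists x => // l l0 hl; apply: h'; by exists l.
by exists L'; split.
Qed.

End Local.

(** * Exhausting a representation by orthogonal pieces *)

Section Exhaustion.
Variables (R : realType) (H : hilbertType R) (Gam : groupType) (p : Gam -> H -> H).
Hypothesis hp : urep p.
Variables (F : seq Gam) (e : R).
Hypothesis e0 : 0 < e.

Definition sumf (I J : finType) (v : I -> H) (w : J -> H) (s : I + J) : H :=
  match s with inl i => v i | inr j => w j end.

Lemma pj_sumf (I J : finType) (v : I -> H) (w : J -> H) x : pj (sumf v w) x = pj v x + pj w x.
Proof. by rewrite /pj big_sumType. Qed.

Lemma onf_sumf (I J : finType) (v : I -> H) (w : J -> H) : onf v -> onf w ->
  (forall i j, dot (v i) (w j) = 0) -> onf (sumf v w).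
Proof.
move=> ov ow vw [i|j] [i'|j'] /=; [exact: ov | exact: vw | | exact: ow].
by rewrite dotC vw conjc0.
Qed.

(** The tolerance does not grow: the two commutators land in orthogonal subspaces and depend on
    orthogonal components of the vector, so their squares are added by Pythagoras. *)
Lemma qd_orth_sum (X Y : set H) : lsub X -> lsub Y -> invariant p setT X -> invariant p setT Y ->
  (forall x y, X x -> Y y -> dot x y = 0) -> qd p F e X -> qd p F e Y ->
  qd p F e [set z | exists x y, [/\ X x, Y y & z = x + y]].
Proof.
move=> sX sY iX iY XY qX qY xs hxs.
have ex z : exists ab : H * H, z \in xs -> [/\ X ab.1, Y ab.2 & z = ab.1 + ab.2].
  by have [/hxs[a [b h]]|] := boolP (z \in xs); [exists (a, b) | exists (0, 0)].
pose ab z := sval (cid (ex z)).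
have abP z : z \in xs -> [/\ X (ab z).1, Y (ab z).2 & z = (ab z).1 + (ab z).2] by exact: svalP (cid (ex z)).
have [|I [v [ov Xv vK vF]]] := qX [seq (ab z).1 | z <- xs].
  by move=> _ /mapP[z zs ->]; have [] := abP z zs.
have [|J [w [ow Yw wK wF]]] := qY [seq (ab z).2 | z <- xs].
  by move=> _ /mapP[z zs ->]; have [] := abP z zs.
exists (I + J)%type, (sumf v w); split.
- by apply: onf_sumf => // i j; exact: XY.
- move=> [i|j] /=; [exists (v i), 0 | exists 0, (w j)]; split=> //; rewrite ?addr0 ?add0r //.
    exact: (lsub0 sY).
  exact: (lsub0 sX).
- move=> z zs; have [Xa Yb ez] := abP z zs.
  have vb : pj v (ab z).2 = 0 by rewrite /pj big1 // => i _; rewrite dotC XY ?conjc0 ?scale0r.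
  have wa : pj w (ab z).1 = 0 by rewrite /pj big1 // => j _; rewrite XY ?scale0r.
  have va : pj v (ab z).1 = (ab z).1 by apply: vK; apply/mapP; exists z.
  have wb : pj w (ab z).2 = (ab z).2 by apply: wK; apply/mapP; exists z.
  have ev : pj v z = (ab z).1 by rewrite {1}ez (linD _ _ (pj_lin v)) va vb addr0.
  have ew : pj w z = (ab z).2 by rewrite {1}ez (linD _ _ (pj_lin w)) wa wb add0r.
  by rewrite pj_sumf ev ew -ez.
- move=> h hF y.
  (* [Z] need not be closed, so there is no projection onto it. The component of y along the
     finitely many vectors that enter the commutator takes its place. *)
  have red (Z : set H) (K : finType) (u : K -> H) : lsub Z -> invariant p setT Z -> (forall k, Z (u k)) ->
      exists (J' : finType) (a : J' -> H), [/\ onf a, forall j, Z (a j) &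
        p h (pj u y) - pj u (p h y) = p h (pj u (pj a y)) - pj u (p h (pj a y))].
    move=> sZ iZ Zu.
    have [|J' [a [oa Za aK]]] := gram_schmidt (X := Z)
        (xs := [seq u k | k <- enum K] ++ [seq p h^-1%g (u k) | k <- enum K]) sZ.
      by move=> t; rewrite mem_cat => /orP[] /mapP[k _ ->] //; exact: iZ.
    exists J', a; split=> //; congr (p h _ - _); apply: eq_bigr => k _; congr (_ *: _).
      by rewrite pj_adj aK // mem_cat map_f // mem_enum.
    by rewrite !(urep_adj hp) pj_adj aK // mem_cat orbC map_f // mem_enum.
  have [I' [a [oa Xa e1]]] := red X I v sX iX Xv.
  have [J' [b [ob Yb e2]]] := red Y J w sY iY Yw.
  have Xd : X (p h (pj v (pj a y)) - pj v (p h (pj a y))).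
    by apply: lsubB => //; [apply: iX => //|]; exact: pj_in.
  have Yd : Y (p h (pj w (pj b y)) - pj w (p h (pj b y))).
    by apply: lsubB => //; [apply: iY => //|]; exact: pj_in.
  rewrite !pj_sumf (linD _ _ (urep_lin hp h)) opprD addrACA e1 e2.
  rewrite -(ler_pXn2r (n := 2)) ?nnegrE ?nm_ge0 ?mulr_ge0 ?nm_ge0 ?(ltW e0) //.
  rewrite pythag; last exact: XY.
  have h1 := vF h hF (pj a y); have h2 := wF h hF (pj b y).
  have le2 (s t : R) : 0 <= s -> s <= t -> s ^+ 2 <= t ^+ 2.
    by move=> s0 st; rewrite ler_pXn2r ?nnegrE // (le_trans s0).
  have k1 := le2 _ _ (nm_ge0 _) h1; have k2 := le2 _ _ (nm_ge0 _) h2.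
  have oab : onf (sumf a b) by apply: onf_sumf => // i j; exact: XY.
  have k3 := le2 _ _ (nm_ge0 _) (pj_nm oab y); rewrite pj_sumf pythag in k3; last first.
    by apply: XY; exact: pj_in.
  rewrite exprMn; rewrite exprMn in k1; rewrite exprMn in k2.
  have E0 : 0 <= e ^+ 2 by rewrite exprn_ge0 // ltW.
  have k4 := ler_wpM2l E0 k3; rewrite mulrDr in k4; lra.
Qed.

Hypothesis loc : forall L, csub p setT L ->
  exists X, [/\ lsub X, invariant p setT X, X `<=` L, exists2 x, X x & x != 0 & qd p F e X].

(** If a maximal subspace with [qd] were not dense, the part of [L] orthogonal to it would be a
    nonzero closed invariant subspace; [loc] finds a further piece there, and [qd_orth_sum]
    contradicts maximality. *)
Lemma qd_dense (L : set H) : lsub L -> aclosed L -> invariant p setT L ->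
  exists A, [/\ lsub A, invariant p setT A, A `<=` L, qd p F e A &
    forall x d, L x -> 0 < d -> exists2 a, A a & nm (x - a) < d].
Proof.
move=> sL cL iL.
pose good (A : set H) := [/\ lsub A, invariant p setT A, A `<=` L & qd p F e A].
have [Fm FmP tot|A [[A0|[sA iA AL qA]] maxA]] := @Zorn_bigcup H [set A | A = set0 \/ good A].
- have [[A0 FA0 [x0 A0x0]]|none] := pselect (exists2 A, Fm A & exists x, A x); last first.
    left; apply/seteqP; split=> // x [A FA Ax]; by case: none; exists A => //; exists x.
  right.
  have gd A x : Fm A -> A x -> good A by move=> /FmP[->|].
  have two x y : (\bigcup_(A in Fm) A) x -> (\bigcup_(A in Fm) A) y ->
      exists A, [/\ Fm A, A x & A y].
    move=> [A FA Ax] [B FB By]; have [AB|BA] := tot _ _ FA FB; first by exists B; split=> //; exact: AB.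
    by exists A; split=> //; exact: BA.
  split.
  + split=> [|k x y hx hy]; first by exists A0 => //; have [sA0 _ _ _] := gd _ _ FA0 A0x0; exact: (lsub0 sA0).
    by have [A [FA Ax Ay]] := two x y hx hy; exists A => //; have [sA _ _ _] := gd _ _ FA Ax; exact: sA.2.
  + by move=> g x Tg [A FA Ax]; exists A => //; have [_ iA _ _] := gd _ _ FA Ax; exact: iA.
  + by move=> x [A FA Ax]; have [_ _ h _] := gd _ _ FA Ax; exact: h.
  + move=> xs hxs.
    have [A [FA Ax0 Axs]] : exists A, [/\ Fm A, exists x, A x & {in xs, forall x, A x}].
      elim: xs hxs => [|x xs IH] hxs; first by exists A0; split=> //; exists x0.
      have [|A [FA _ Axs]] := IH; first by move=> y hy; apply: hxs; rewrite inE hy orbT.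
      have [B FB Bx] := hxs x (mem_head _ _).
      have [AB|BA] := tot _ _ FA FB.
        exists B; split=> //; first by exists x.
        by move=> y; rewrite inE => /orP[/eqP->//|/Axs]; exact: AB.
      exists A; split=> //; first by exists x; exact: BA.
      by move=> y; rewrite inE => /orP[/eqP->|/Axs//]; exact: BA.
    have [x1 Ax1] := Ax0; have [_ _ _ qA] := gd _ _ FA Ax1.
    have [I [v [h1 h2 h3 h4]]] := qA xs Axs; exists I, v; split=> // i; by exists A.
- exfalso; apply: (maxA [set 0]).
    by rewrite A0; split=> // h; exact: (h 0 erefl).
  right; split.
  + by split=> // k x y /= -> ->; rewrite scaler0 addr0.
  + by move=> g x _ /= ->; rewrite (lin0 (urep_lin hp g)).
  + by move=> x /= ->; exact: (lsub0 sL).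
  + move=> xs hxs; exists 'I_0, (fun=> 0); split=> [[]//|[]//|x /hxs /= ->|h hF x].
      by rewrite /pj big_ord0.
    by rewrite /pj !big_ord0 (lin0 (urep_lin hp h)) subrr nm0 mulr_ge0 ?nm_ge0 // ltW.
exists A; split=> // x d Lx d0.
pose cA := [set x | forall d, 0 < d -> exists2 a, A a & nm (x - a) < d].
have AcA : A `<=` cA by move=> a Aa r r0; exists a; rewrite // subrr nm0.
have ccA : aclosed cA.
  move=> y hy r r0; have r20 : 0 < r / 2 by rewrite divr_gt0.
  have [w cw hw] := hy _ r20; have [a Aa ha] := cw _ r20; exists a => //.
  by have := nm_tri y w a; lra.
have scA : lsub cA.
  split=> [|k y w hy hw r r0]; first by apply: AcA; exact: (lsub0 sA).
  have k1 : 0 < cn k + 1 by rewrite ltr_wpDl // cn_ge0.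
  have r1 : 0 < r / 2 / (cn k + 1) by rewrite divr_gt0 // divr_gt0.
  have r20 : 0 < r / 2 by rewrite divr_gt0.
  have [a Aa ha] := hy _ r1; have [b Ab hb] := hw _ r20.
  exists (k *: a + b); first exact: sA.2.
  rewrite opprD addrACA -scalerBr; have := nmD (k *: (y - a)) (w - b); rewrite nmZ.
  have : cn k * nm (y - a) <= r / 2.
    apply: le_trans (_ : (cn k + 1) * nm (y - a) <= _); last by rewrite mulrC -ler_pdivlMr // ltW.
    by apply: ler_wpM2r; rewrite ?nm_ge0 // lerDl.
  lra.
have cAL : cA `<=` L by move=> y hy; apply: cL => r /hy[a Aa ha]; exists a => //; exact: AL.
have [y cy hy] := projection_theorem x scA ccA.
suff xy : x = y by rewrite xy; exact: cy.
apply/eqP; rewrite -subr_eq0; apply: contrapT => /negP ne.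
pose L1 : set H := [set w | L w /\ forall a, A a -> dot w a = 0].
have [X [sX iX XL1 [x0 Xx0 x00] qX]] : exists X, [/\ lsub X, invariant p setT X, X `<=` L1,
    exists2 x, X x & x != 0 & qd p F e X].
  apply: loc; split.
  - split=> [|k u w [Lu hu] [Lw hw]]; first by split=> [|a _]; [exact: (lsub0 sL) | rewrite dot0l].
    by split=> [|a Aa]; [exact: sL.2 | rewrite dotDl dotZl hu // hw // mulr0 addr0].
  - move=> u hu; split=> [|a Aa]; first by apply: cL => r /hu[w [Lw _] hw]; exists w.
    apply/eqP; rewrite -cn_eq0 eq_le cn_ge0 andbT; apply/ler_addgt0Pr => r r0; rewrite add0r.
    have a1 : 0 < nm a + 1 by rewrite ltr_wpDl // nm_ge0.
    have [w [_ hw] huw] := hu (r / (nm a + 1)) (divr_gt0 r0 a1).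
    rewrite -[u](subrK w) dotDl hw // addr0; apply: le_trans (CS _ _) _.
    apply: le_trans (_ : nm (u - w) * (nm a + 1) <= _); last by rewrite -ler_pdivlMr // ltW.
    by apply: ler_wpM2l; rewrite ?nm_ge0 // lerDl.
  - move=> g u _ [Lu hu]; split=> [|a Aa]; first exact: iL.
    by rewrite (urep_adj hp) hu //; exact: iA.
  - exists (x - y) => //; split=> [|a Aa]; first by apply: lsubB => //; exact: cAL.
    by apply: hy; exact: AcA.
have AX a x' : A a -> X x' -> dot a x' = 0.
  by move=> Aa /XL1[_ h]; rewrite dotC h // conjc0.
apply: (maxA [set w | exists a b, [/\ A a, X b & w = a + b]]).
  split=> [a Aa|h]; first by exists a, 0; split=> //; [exact: (lsub0 sX) | rewrite addr0].
  have Ax0 : A x0 by apply: h; exists 0, x0; split=> //; [exact: (lsub0 sA) | rewrite add0r].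
  by move: x00; rewrite -nm_eq0 -sqrf_eq0 -Re_dotxx AX // eqxx.
right; split.
- split=> [|k _ _ [a [b [Aa Xb ->]]] [a' [b' [Aa' Xb' ->]]]].
    by exists 0, 0; split; [exact: (lsub0 sA) | exact: (lsub0 sX) | rewrite addr0].
  exists (k *: a + a'), (k *: b + b'); split; [exact: sA.2 | exact: sX.2 |].
  by rewrite scalerDr addrACA.
- move=> g _ _ [a [b [Aa Xb ->]]]; exists (p g a), (p g b); split; [exact: iA | exact: iX |].
  exact: (linD _ _ (urep_lin hp g)).
- move=> _ [a [b [Aa Xb ->]]]; apply: lsubD => //; first exact: AL.
  by have [] := XL1 _ Xb.
- exact: qd_orth_sum.
Qed.

End Exhaustion.

(** * Increasing sequences of almost commuting projections *)

Section Growing.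
Variables (R : realType) (H : hilbertType R).

Lemma spn_range_comb (I : finType) (y : I -> H) s : spn (range y) s -> exists c : I -> R[i], s = \sum_i c i *: y i.
Proof.
move=> h; apply: (h [set s | exists c : I -> R[i], s = \sum_i c i *: y i]) => [|_ [i _ <-]].
  split=> [|k _ _ [c ->] [d ->]]; first by exists (fun=> 0); rewrite big1 // => i _; rewrite scale0r.
  exists (fun i => k * c i + d i); rewrite scaler_sumr -big_split /=.
  by apply: eq_bigr => i _; rewrite scalerDl scalerA.
exists (fun j => (j == i)%:R); rewrite (bigD1 i) //= eqxx scale1r big1 ?addr0 // => j /negPf->.
by rewrite scale0r.
Qed.

(* [u] spans [v] together with the part of the range of [pj q] orthogonal to [v]. *)
Lemma grow (I : finType) (v : I -> H) (t : R) : onf v -> 0 < t -> exists2 d : R, 0 < d &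
  forall (K : finType) (q : K -> H), onf q -> (forall i, nm (v i - pj q (v i)) <= d) ->
  exists (J : finType) (u : J -> H), [/\ onf u, forall i, pj u (v i) = v i &
    forall x, nm (pj u x - pj q x) <= t * nm x].
Proof.
move=> ov t0; pose k : R := #|I|%:R; have k0 : 0 <= k by [].
have k1 : 0 < k + 1 by rewrite ltr_wpDl.
(* The bound k d <= 1/2 makes [pj q] bounded below by 1/2 on the span of [v]; the two parts of the
   final error are k d and 2 k d, hence the 3. *)
pose d := Num.min (2^-1 / (k + 1)) (t / 3 / (k + 1)).
have d0 : 0 < d by rewrite lt_min !divr_gt0 // invr_gt0.
have kd2 : k * d <= 1 / 2.
  have : (k + 1) * d <= 2^-1 by rewrite mulrC -ler_pdivlMr // ge_min lexx.
  by rewrite mulrDl mul1r; have := ltW d0; lra.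
have kdt : 3 * (k * d) <= t.
  have : (k + 1) * d <= t / 3 by rewrite mulrC -ler_pdivlMr // ge_min lexx orbT.
  by rewrite mulrDl mul1r; have := ltW d0; lra.
exists d => // K q oq hq; pose y i := pj q (v i).
have [|J1 [a [oa ya aK]]] := gram_schmidt (X := spn (range y)) (xs := [seq y i | i <- enum I]) (spn_lsub _).
  by move=> _ /mapP[i _ ->]; apply: spn_sub; exists i.
have ay i : pj a (y i) = y i by apply: aK; rewrite map_f // mem_enum.
have lq := pj_lin q; have la := pj_lin a.
have qa j : pj q (a j) = a j.
  apply: (ya j [set x | pj q x = x]) => [|_ [i _ <-]]; last exact: pj_idem.
  by split=> [|c x x' /= hx hx']; [exact: (lin0 lq) | rewrite /= lq hx hx'].
have qpa x : pj q (pj a x) = pj a x.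
  rewrite {2 3}/pj (lin_sum _ _ _ lq); apply: eq_bigr => j _.
  by rewrite (linZ _ _ lq) qa.
have paq x : pj a (pj q x) = pj a x.
  by apply: eq_bigr => j _; rewrite pj_adj qa.
pose Rr x := pj q x - pj a x.
have sX : lsub [set x | pj q x = x /\ pj a x = 0].
  split=> [|c x x' [h1 h2] [h3 h4]] /=; first by rewrite (lin0 lq) (lin0 la).
  by rewrite lq la h1 h2 h3 h4 scaler0 addr0.
have RX x : pj q (Rr x) = Rr x /\ pj a (Rr x) = 0.
  by rewrite /Rr (linB _ _ lq) (linB _ _ la) pj_idem // qpa paq pj_idem // subrr.
have [|J2 [w [ow wX wK]]] := gram_schmidt (xs := [seq Rr (q j) | j <- enum K]) sX.
  by move=> _ /mapP[j _ ->]; exact: RX.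
have lw := pj_lin w.
have wR x : pj w x = Rr x.
  have -> : pj w x = pj w (Rr x).
    apply: eq_bigr => j _; have [h1 h2] := wX j; congr (_ *: _).
    by rewrite /Rr dotBl !pj_adj h1 h2 dot0r subr0.
  have -> : Rr x = \sum_j dot x (q j) *: Rr (q j).
    have lR : lin Rr by move=> c x1 x2; rewrite /Rr lq la opprD addrACA -scalerBr.
    have -> : Rr x = Rr (pj q x) by rewrite /Rr pj_idem // paq.
    rewrite {1}/pj (lin_sum _ _ _ lR); apply: eq_bigr => j _.
    by rewrite (linZ _ _ lR).
  rewrite (lin_sum _ _ _ lw); apply: eq_bigr => j _.
  by rewrite (linZ _ _ lw) wK //; apply/mapP; exists j; rewrite ?mem_enum.
have vw i j : dot (v i) (w j) = 0.
  have [h1 h2] := wX j.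
  by rewrite -h1 -pj_adj -/(y i) -ay pj_adj h2 dot0r.
have lv := pj_lin v.
exists (I + J2)%type, (sumf v w); split.
- exact: onf_sumf.
- move=> i; rewrite pj_sumf pj_v // [pj w _]/pj big1 ?addr0 // => j _.
  by rewrite vw scale0r.
move=> x; rewrite pj_sumf wR /Rr.
rewrite (_ : _ - _ = pj v x - pj a x); last by rewrite addrCA [pj q x + _]addrC addrK.
have small (V : H) (T : H -> H) : lin T -> (forall i, nm (v i - T (v i)) <= d) -> pj v V = V ->
    nm (V - T V) <= k * d * nm V.
  move=> lT hT hV; rewrite -{1 2}hV /pj (lin_sum _ _ _ lT) -sumrB.
  apply: le_trans (nm_sum _ _ _) _.
  apply: le_trans (_ : \sum_(i : I) d * nm V <= _); last by rewrite sumr_const -mulr_natl mulrA.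
  apply: ler_sum => i _; rewrite (linZ _ _ lT) -scalerBr nmZ mulrC; apply: ler_pM; rewrite ?nm_ge0 ?cn_ge0 //.
  by apply: le_trans (CS _ _) _; rewrite (onf_nm i ov) mulr1.
have b1 : nm (pj v x - pj a (pj v x)) <= k * d * nm x.
  apply: le_trans (small (pj v x) (pj a) la _ _) _; last 1 first.
  - by apply: ler_wpM2l; [rewrite mulr_ge0 // ltW | exact: pj_nm].
  - by move=> i; apply: le_trans (hq i); exact: (@pj_best _ _ _ a oa (v i) (y i) (ay i)).
  - exact: pj_idem.
have b2 s : spn (range y) s -> nm (s - pj v s) <= 2 * (k * d) * nm s.
  move=> /spn_range_comb[c es]; pose V := \sum_i c i *: v i.
  have hV : pj v V = V by exact: pj_comb.
  have sV : s = pj q V.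
    rewrite es /V (lin_sum _ _ _ lq); apply: eq_bigr => i _.
    by rewrite (linZ _ _ lq).
  have h1 := small V (pj q) lq hq hV; rewrite -sV in h1.
  have h2 : nm V <= 2 * nm s.
    have := nm_tri V s 0; rewrite !subr0 => h3.
    have := ler_wpM2r (nm_ge0 V) kd2; lra.
  apply: le_trans (@pj_best _ _ _ v ov s V hV) _; rewrite nmBC; apply: le_trans h1 _.
  have kd0 : 0 <= k * d by rewrite mulr_ge0 // ltW.
  by have := ler_wpM2l kd0 h2; lra.
pose tt := pj a (x - pj v x).
have stt : spn (range y) tt by apply: pj_in => //; exact: spn_lsub.
have b3 : nm tt <= 2 * (k * d) * nm x.
  have : nm tt ^+ 2 <= nm tt * (2 * (k * d) * nm x).
    rewrite -Re_dotxx {1}/tt pj_adj /tt pj_idem // -/tt.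
    have -> : dot (x - pj v x) tt = dot x (tt - pj v tt) by rewrite dotBl dotBr pj_adj.
    apply: le_trans (Re_le_cn _) _; apply: le_trans (CS _ _) _.
    by have := ler_wpM2l (nm_ge0 x) (b2 _ stt); lra.
  have [->|n0] := eqVneq tt 0.
    by rewrite nm0 => _; rewrite !mulr_ge0 ?nm_ge0 // ltW.
  by rewrite expr2 ler_pM2l // nm_gt0.
have -> : pj v x - pj a x = (pj v x - pj a (pj v x)) - tt.
  by rewrite /tt (linB _ _ la) opprB addrA subrK.
apply: le_trans (nmB _ _) _; have := ler_wpM2r (nm_ge0 x) kdt; lra.
Qed.

Variables (Gam : Type) (U : Gam -> H -> H) (gs : nat -> Gam) (ys : nat -> H).
Hypothesis U1 : forall g x, nm (U g x) <= nm x.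
Hypothesis Ul : forall g, lin (U g).
Hypothesis app : forall (n : nat) (zs : seq H) (e : R), 0 < e ->
  exists (J : finType) (q : J -> H), [/\ onf q, {in zs, forall x, nm (x - pj q x) <= e} &
    forall k, (k < n)%N -> acm (U (gs k)) e (pj q)].

(** The factor 3: one share for the commutator of the approximating projection, and one for
    replacing it by [u] on each side of the operator. *)
Lemma growing_step (n : nat) (I : finType) (v : I -> H) : onf v ->
  exists (J : finType) (u : J -> H), [/\ onf u, forall i, pj u (v i) = v i,
    forall k, (k < n)%N -> nm (ys k - pj u (ys k)) <= n.+1%:R^-1 * (1 + nm (ys k)) &
    forall k, (k < n)%N -> acm (U (gs k)) (3 * n.+1%:R^-1) (pj u)].
Proof.
move=> ov; have n0 : 0 < n.+1%:R^-1 :> R by rewrite invr_gt0.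
move: (n.+1%:R^-1 : R) n0 => t t0.
have [d d0 hd] := grow ov t0.
have e0 : 0 < Num.min d t by rewrite lt_min d0.
have [K [q [oq hq1 hq2]]] := app n ([seq v i | i <- enum I] ++ [seq ys k | k <- iota 0 n]) e0.
have [|J [u [ou uv uq]]] := hd K q oq.
  move=> i; apply: le_trans (hq1 _ _) _; last by rewrite ge_min lexx.
  by rewrite mem_cat map_f // mem_enum.
exists J, u; split=> // k kn => [|x].
  have h1 : nm (ys k - pj q (ys k)) <= t.
    apply: le_trans (hq1 _ _) _; last by rewrite ge_min lexx orbT.
    by rewrite mem_cat orbC map_f // mem_iota.
  by have := nm_tri (ys k) (pj q (ys k)) (pj u (ys k)); rewrite [nm (pj q _ - _)]nmBC; have := uq (ys k); lra.
have h1 : nm (U (gs k) (pj q x) - pj q (U (gs k) x)) <= t * nm x.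
  apply: le_trans (hq2 k kn x) _; apply: ler_wpM2r; first exact: nm_ge0.
  by rewrite ge_min lexx orbT.
have h2 := uq (U (gs k) x); have h3 := le_trans (U1 (gs k) _) (uq x).
rewrite (linB _ _ (Ul _)) in h3.
have h4 := nm_tri (U (gs k) (pj u x)) (U (gs k) (pj q x)) (pj u (U (gs k) x)).
have h5 := nm_tri (U (gs k) (pj q x)) (pj q (U (gs k) x)) (pj u (U (gs k) x)).
rewrite [nm (pj q _ - pj u _)]nmBC in h5.
by have := ler_wpM2l (ltW t0) (U1 (gs k) x); lra.
Qed.

Lemma growing_sequence : exists (J : nat -> finType) (v : forall n, J n -> H),
  [/\ forall n, onf (v n), forall n i, pj (v n.+1) (v n i) = v n i,
    forall n k, (k < n)%N -> nm (ys k - pj (v n.+1) (ys k)) <= n.+1%:R^-1 * (1 + nm (ys k)) &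
    forall n k, (k < n)%N -> acm (U (gs k)) (3 * n.+1%:R^-1) (pj (v n.+1))].
Proof.
(* Index type and family vary together along the recursion, so they are packed into one state; the
   sequence starts from the empty family. *)
pose St := {J : finType & {v : J -> H | onf v}}.
have stp n (s : St) : {s' : St | [/\ forall i, pj (sval (projT2 s')) (sval (projT2 s) i) = sval (projT2 s) i,
    forall k, (k < n)%N -> nm (ys k - pj (sval (projT2 s')) (ys k)) <= n.+1%:R^-1 * (1 + nm (ys k)) &
    forall k, (k < n)%N -> acm (U (gs k)) (3 * n.+1%:R^-1) (pj (sval (projT2 s')))]}.
  apply: cid; case: s => I [v ov]; have [J [u [ou h1 h2 h3]]] := growing_step n ov.
  by exists (existT _ J (exist _ u ou)).
have o0 : onf (fun i : 'I_0 => 0 : H) by case.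
pose fix sq n : St := if n is n'.+1 then sval (stp n' (sq n')) else existT _ ('I_0 : finType) (exist _ _ o0).
exists (fun n => projT1 (sq n)), (fun n => sval (projT2 (sq n))); split=> n.
- exact: (svalP (projT2 (sq n))).
- by have [h _ _] := svalP (stp n (sq n)).
- by have [_ h _] := svalP (stp n (sq n)).
- by have [_ _ h] := svalP (stp n (sq n)).
Qed.

End Growing.

(** * Star representations are contractive *)

Section Contractive.
Variables (R : realType) (A : cstarAlgType R) (H : hilbertType R) (s : A -> H -> H).
Hypothesis hs : star_representation s.

Definition na (a : A) : R := complex.Re `|a|.

Lemma naE a : `|a| = (na a)%:C.
Proof. by have := normr_ge0 a; rewrite lecE /= => /andP[/eqP e _]; rewrite /na; case: `|a| e => x y /= ->. Qed.

Lemma na_ge0 a : 0 <= na a.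
Proof. by have := normr_ge0 a; rewrite naE lecR. Qed.

Lemma naD a b : na (a + b) <= na a + na b.
Proof. by have := ler_normD a b; rewrite !naE -rmorphD lecR. Qed.

Lemma naM a b : na (cmul a b) <= na a * na b.
Proof. by have := cmul_norm a b; rewrite !naE -rmorphM lecR. Qed.

Lemma naZ k a : na (k *: a) = cn k * na a.
Proof. by have := normrZ k a; rewrite !naE cnE -rmorphM => /complexI. Qed.

Lemma naN a : na (- a) = na a. Proof. by rewrite /na normrN. Qed.

Lemma na0 : na 0 = 0. Proof. by rewrite /na normr0. Qed.

Lemma na_eq0 a : na a = 0 -> a = 0.
Proof. by move=> h; apply/eqP; rewrite -normr_eq0 naE h. Qed.

Lemma naBC a b : na (a - b) = na (b - a). Proof. by rewrite -opprB naN. Qed.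

Lemma naC a : na (cmul (star a) a) = na a ^+ 2.
Proof. by have := cstar_norm a; rewrite !naE -rmorphXn => /complexI. Qed.

Lemma na_star a : na (star a) = na a.
Proof.
have h b : na b <= na (star b).
  have [->|b0] := eqVneq (na b) 0; first exact: na_ge0.
  have bp : 0 < na b by rewrite lt_def b0 na_ge0.
  by rewrite -(ler_pM2r bp) -expr2 -naC; exact: naM.
by apply/eqP; rewrite eq_le h -{2}(starK a) h.
Qed.

Lemma na_complete (u : nat -> A) :
  (forall e : R, 0 < e -> exists N, forall m n, (N <= m)%N -> (N <= n)%N -> na (u m - u n) < e) ->
  exists l, forall e : R, 0 < e -> exists N, forall n, (N <= n)%N -> na (u n - l) < e.
Proof.
move=> h; have /cvg_ex[l hl] : cvg (u n @[n --> \oo]).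
  apply: cauchy_cvg; apply/cauchy_ballP => e /gt0_complex[-> e0].
  have [N hN] := h _ e0; rewrite near_simpl; near=> p.
  rewrite -ball_normE /= naE ltcR; apply: hN; near: p.
    exists ([set n | (N <= n)%N], setT) => //=; last by move=> [a b] [].
    by split; [exists N | exact: filterT].
  exists (setT, [set n | (N <= n)%N]) => //=; last by move=> [a b] [].
  by split; [exact: filterT | exists N].
exists l => e e0; move/cvgrPdist_lt : hl => /(_ e%:C); rewrite ltcR => /(_ e0)[N _ hN].
by exists N => n /hN /=; rewrite naE ltcR naBC.
Unshelve. all: by end_near. Qed.

Lemma cmulBl (a b c : A) : cmul (a - b) c = cmul a c - cmul b c.
Proof. by rewrite cmulDl -scaleN1r cmulZl scaleN1r. Qed.

Lemma cmulBr (a b c : A) : cmul a (b - c) = cmul a b - cmul a c.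
Proof. by rewrite cmulDr -scaleN1r cmulZr scaleN1r. Qed.

(** The fixed point equation Y = (T + Y^2) / 2 again, now in the algebra. Strictness of the bound on
    T makes the iteration contract on the ball of radius rho, so convergence is geometric. *)
Lemma sqrt_one_sub (T : A) : star T = T -> na T < 1 ->
  exists z : A, star z = z /\ cmul z z = cone - T.
Proof.
(* The midpoint between the norm of T and 1 satisfies (na T + rho^2) / 2 <= rho, so the ball of this
   radius is mapped to itself. *)
move=> sT T1; pose rho := (1 + na T) / 2; have T0 := na_ge0 T.
have h0 : 0 <= rho by rewrite /rho; lra.
have h1 : rho < 1 by rewrite /rho; lra.
have h2 : (na T + rho * rho) / 2 <= rho by rewrite /rho; nra.
pose c : R[i] := 2^-1%:C.
have cc : cn c = 2^-1 by rewrite cn_real ger0_norm // invr_ge0.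
pose fix Y n : A := if n is n'.+1 then c *: (T + cmul (Y n') (Y n')) else 0.
have Yr n : na (Y n) <= rho.
  elim: n => [|n IH] /=; first by rewrite na0.
  rewrite naZ cc; apply: le_trans h2; rewrite mulrC; apply: ler_wpM2r; first by rewrite invr_ge0.
  apply: le_trans (naD _ _) _; rewrite lerD2l; apply: le_trans (naM _ _) _.
  by apply: ler_pM; rewrite ?na_ge0.
have dif a b : na a <= rho -> na b <= rho -> na (c *: (T + cmul a a) - c *: (T + cmul b b)) <= rho * na (a - b).
  move=> ha hb; rewrite -scalerBr naZ cc opprD addrACA subrr add0r.
  have -> : cmul a a - cmul b b = cmul a (a - b) + cmul (a - b) b.
    by rewrite cmulBr cmulBl addrA subrK.
  have := naD (cmul a (a - b)) (cmul (a - b) b).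
  have := naM a (a - b); have := naM (a - b) b; have X := na_ge0 (a - b).
  have := ler_wpM2r X ha; have := ler_wpM2l X hb; lra.
have stepY n : na (Y n.+1 - Y n) <= rho ^+ n.
  elim: n => [|n IH]; first by rewrite expr0 subr0 (le_trans (Yr 1%N)) // ltW.
  apply: (le_trans (y := rho * na (Y n.+1 - Y n))); first exact: (dif (Y n.+1) (Y n) (Yr _) (Yr _)).
  by rewrite exprS; apply: ler_wpM2l.
have tail n m : na (Y (n + m)%N - Y n) * (1 - rho) <= rho ^+ n * (1 - rho ^+ m).
  elim: m => [|m IH]; first by rewrite addn0 subrr na0 mul0r expr0 subrr mulr0.
  have := naD (Y (n + m).+1 - Y (n + m)%N) (Y (n + m)%N - Y n); rewrite subrKA => h3.
  have h4 := stepY (n + m)%N; rewrite exprD in h4; rewrite addnS exprS.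
  have r1 : 0 <= 1 - rho by lra.
  have h5 := ler_wpM2r r1 (le_trans h3 (lerD h4 (lexx _))).
  move: IH h5; rewrite mulrDl; lra.
have [l hl] : exists l, forall e : R, 0 < e -> exists N, forall n, (N <= n)%N -> na (Y n - l) < e.
  apply: na_complete => e e0; have r1 : 0 < 1 - rho by lra.
  have /cvgrPdist_lt hc : (rho ^+ n @[n --> \oo] --> (0 : R)) by apply: cvg_expr; rewrite ger0_norm.
  have e1 : 0 < e * (1 - rho) / 2 by rewrite divr_gt0 // mulr_gt0.
  have [N _ hN] := hc _ e1; exists N => m n Nm Nn.
  have t0 k : (N <= k)%N -> na (Y k - Y N) < e / 2.
    move=> Nk; have := tail N (k - N)%N; rewrite subnKC // => h3.
    have := hN N (leqnn N); rewrite /= sub0r normrN ger0_norm ?exprn_ge0 // => h4.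
    have P : 0 <= rho ^+ N * rho ^+ (k - N) by rewrite mulr_ge0 ?exprn_ge0.
    rewrite -(ltr_pM2r r1); move: h3; rewrite mulrBr mulr1; lra.
  have := naD (Y m - Y N) (Y N - Y n); rewrite subrKA [na (Y N - _)]naBC.
  have := t0 m Nm; have := t0 n Nn; lra.
have sY n : star (Y n) = Y n.
  elim: n => [|n IH] /=; first by have := starD (0 : A) 0; rewrite addr0 => /eqP; rewrite -subr_eq0 opprD addNKr oppr_eq0 => /eqP.
  rewrite starZ starD starM IH sT; congr (_ *: _); exact: conjc_real.
have lr : na l <= rho.
  apply/ler_addgt0Pr => e e0; have [N hN] := hl e e0; have := hN N (leqnn N).
  have := naD (l - Y N) (Y N); rewrite subrK naBC; have := Yr N; lra.
have eps a : (forall e : R, 0 < e -> na a <= e) -> a = 0.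
  move=> h; apply: na_eq0; apply/eqP; rewrite eq_le na_ge0 andbT.
  by apply/ler_addgt0Pr => e e0; rewrite add0r; exact: h.
have sl : star l = l.
  apply/eqP; rewrite -subr_eq0; apply/eqP; apply: eps => e e0.
  have e20 : 0 < e / 2 by rewrite divr_gt0.
  have [N hN] := hl _ e20; have h3 := hN N (leqnn N).
  have h4 : na (star l - Y N) = na (Y N - l).
    rewrite -na_star -{1}(sY N) -[in RHS]naN opprB; congr na.
    have -> : star l - star (Y N) = star (l - Y N).
      by rewrite starD -scaleN1r -[- Y N]scaleN1r starZ rmorphN rmorph1.
    by rewrite starK.
  have := naD (star l - Y N) (Y N - l); rewrite subrKA h4; lra.
have el : l = c *: (T + cmul l l).
  apply/eqP; rewrite -subr_eq0; apply/eqP; apply: eps => e e0.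
  have e20 : 0 < e / 2 by rewrite divr_gt0.
  have [N hN] := hl _ e20.
  have h3 := hN N (leqnn N); have h4 := hN N.+1 (leqW (leqnn N)).
  have h5 := dif _ _ (Yr N) lr; rewrite -/(Y N.+1) in h5.
  have := naD (l - Y N.+1) (Y N.+1 - c *: (T + cmul l l)); rewrite subrKA [na (l - _)]naBC.
  have := ler_wpM2r (na_ge0 (Y N - l)) (ltW h1); rewrite /= in h5; move: h4; rewrite /=; lra.
exists (cone - l); split.
  have s1 : star (cone : A) = cone.
    have := starM (star cone : A) cone; rewrite cmulr1 starK => h.
    by rewrite -[LHS]cmulr1 -h.
  by rewrite starD -scaleN1r starZ rmorphN rmorph1 sl s1.
rewrite cmulBl cmul1 cmulBr cmulr1.
have c2 : c + c = 1.
  have -> : c = 2^-1 by rewrite /c (fmorphV (real_complex R)) (rmorph_nat (real_complex R)).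
  by rewrite -[RHS](@divff _ (2 : R[i])) ?pnatr_eq0 // -[X in _ = X * _]/(1 + 1 : R[i]) mulrDl mul1r.
have e2 : l + l = T + cmul l l by rewrite {1 2}el -scalerDl c2 scale1r.
have -> : T = l + l - cmul l l by rewrite e2 addrK.
by rewrite !opprB opprD !addrA (addrAC cone).
Qed.

Lemma srepM a b x : s (cmul a b) x = s a (s b x). Proof. by have [_ _ h _] := hs. Qed.
Lemma srep_adj a x y : dot (s (star a) x) y = dot x (s a y).
Proof. by have [_ _ _ h] := hs; exact: h. Qed.
Lemma srep_lin a : lin (s a). Proof. by have [h _ _ _] := hs; have [l _] := h a. Qed.
Lemma srepD a b x : s (a + b) x = s a x + s b x.
Proof. by have [_ h _ _] := hs; have := h 1 a b x; rewrite !scale1r. Qed.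
Lemma srep0 x : s 0 x = 0.
Proof. by have := srepD 0 0 x; rewrite addr0 => /eqP; rewrite -subr_eq0 opprD addNKr oppr_eq0 => /eqP. Qed.
Lemma srepZ k a x : s (k *: a) x = k *: s a x.
Proof. by have [_ h _ _] := hs; have := h k a 0 x; rewrite !addr0 srep0 addr0. Qed.
Lemma srepB a b x : s (a - b) x = s a x - s b x.
Proof. by rewrite srepD -scaleN1r srepZ scaleN1r. Qed.

Lemma star1 : star (cone : A) = cone.
Proof. by have := starM (star cone : A) cone; rewrite cmulr1 starK => h; rewrite -[LHS]cmulr1 -h. Qed.

Lemma srep1_adj x y : dot (s cone x) y = dot x (s cone y).
Proof. by rewrite -{1}star1 srep_adj. Qed.

Lemma srep1_idem x : s cone (s cone x) = s cone x.
Proof. by rewrite -srepM cmul1. Qed.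

Lemma srep1_nm x : nm (s cone x) <= nm x.
Proof.
have : nm (s cone x) ^+ 2 <= nm (s cone x) * nm x.
  rewrite -Re_dotxx srep1_adj srep1_idem -srep1_adj.
  by apply: le_trans (Re_le_cn _) _; exact: CS.
have [->|n0] := eqVneq (s cone x) 0; first by rewrite nm0 nm_ge0.
by rewrite expr2 ler_pM2l // nm_gt0.
Qed.

(** For b of norm below 1, write 1 - b^* b = z^2 with z self-adjoint. Then |s b y|^2 = (s 1 y, y) -
    |s z y|^2 <= |y|^2, where s 1 is only a projection. The general case follows by scaling. *)
Lemma srep_contractive a x : nm (s a x) <= na a * nm x.
Proof.
have small b y : na b < 1 -> nm (s b y) <= nm y.
  move=> b1; have sT : star (cmul (star b) b) = cmul (star b) b by rewrite starM starK.
  have [|z [sz ez]] := sqrt_one_sub sT.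
    by rewrite naC expr2; have := na_ge0 b; nra.
  rewrite -(ler_pXn2r (n := 2)) ?nnegrE ?nm_ge0 // -Re_dotxx -srep_adj -srepM.
  have -> : cmul (star b) b = cone - cmul z z by rewrite ez opprB addrC subrK.
  rewrite srepB srepM dotBl -{1}sz srep_adj ReD ReN Re_dotxx.
  have h1 : complex.Re (dot (s cone y) y) <= nm y ^+ 2.
    apply: le_trans (Re_le_cn _) _; apply: le_trans (CS _ _) _.
    by rewrite expr2; apply: ler_wpM2r; [exact: nm_ge0 | exact: srep1_nm].
  by have := sqr_ge0 (nm (s z y)); lra.
apply/ler_addgt0Pr => e e0.
have x1 : 0 < nm x + 1 by rewrite ltr_wpDl // nm_ge0.
pose r := na a + e / (nm x + 1).
have r0 : 0 < r by rewrite ltr_wpDl ?na_ge0 // divr_gt0.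
have h : nm (s (r^-1%:C *: a) x) <= nm x.
  apply: small; rewrite naZ cn_real ger0_norm ?invr_ge0 ?ltW // mulrC ltr_pdivrMr // mul1r.
  by rewrite ltrDl divr_gt0.
move: h; rewrite (srepZ) nmZ cn_real ger0_norm ?invr_ge0 ?(ltW r0) // ler_pdivrMl // => h.
apply: le_trans h _; rewrite /r mulrDl lerD2l -mulrA.
apply: ler_piMr; first exact: ltW.
by rewrite mulrC ler_pdivrMr // mul1r lerDl.
Qed.

End Contractive.

(** * Density, operator norm and compactness in terms of real norms *)

Section Distance.
Variables (R : realType) (V : normedModType R[i]).

Lemma nbhs_dist (x : V) (e : R) : 0 < e -> nbhs x [set y | `|x - y| < e%:C].
Proof.
move=> e0; apply/nbhs_ballP; exists e%:C => [|y]; first by rewrite /= ltcR.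
by rewrite -ball_normE.
Qed.

Lemma dense_dist (D : set V) (x : V) (e : R) : dense D -> 0 < e ->
  exists2 y, D y & `|x - y| < e%:C.
Proof.
move=> dD e0; have [||y [hy Dy]] := dD (interior [set y | `|x - y| < e%:C]).
- by exists x; exact: nbhs_dist.
- exact: open_interior.
- by exists y => //; exact: (interior_subset hy).
Qed.

End Distance.

Section Operators.
Variables (R : realType) (H : hilbertType R).

Lemma lip_continuous (T : H -> H) (c : R) :
  (forall x y, nm (T x - T y) <= c * nm (x - y)) -> continuous T.
Proof.
move=> h x; apply/cvgrPdist_lt => e /gt0_complex[-> e0].
have c1 : 0 < `|c| + 1 by rewrite ltr_wpDl.
apply/nbhs_ballP; exists (complex.Re e / (`|c| + 1))%:C => /=; first by rewrite ltcR divr_gt0.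
move=> y; rewrite -ball_normE /= !nmE !ltcR => hy; apply: le_lt_trans (h _ _) _.
apply: le_lt_trans (_ : (`|c| + 1) * nm (x - y) < _); last by rewrite mulrC -ltr_pdivlMr.
apply: ler_wpM2r; first exact: nm_ge0.
by apply: le_trans (ler_norm c) _; rewrite lerDl.
Qed.

Lemma opnorm_bounds (T : H -> H) (c : R) : 0 <= c -> (forall x, nm (T x) <= c * nm x) ->
  0 <= opnorm T <= c.
Proof.
move=> c0 hT; have T0 : nm (T 0) = 0.
  by apply/eqP; rewrite eq_le nm_ge0 andbT; have := hT 0; rewrite nm0 mulr0.
pose S := [set complex.Re `|T x| | x in @unit_ball R H].
have S0 : S 0 by exists 0; rewrite /unit_ball /= ?normr0 //; exact: T0.
have Sc : ubound S c.
  move=> _ [x + <-]; rewrite /unit_ball /= nmE lecR => x1; apply: le_trans (hT x) _.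
  by rewrite ler_piMr.
apply/andP; split.
  by apply: sup_upper_bound => //; split; [exists 0 | exists c].
by apply: ge_sup => //; exists 0.
Qed.

Lemma pj_projection (I : finType) (v : I -> H) : onf v -> projection (pj v).
Proof.
move=> ov; have lv := pj_lin v; split=> [|x|x y]; [|exact: pj_idem|exact: pj_adj].
split; first exact: lv.
by apply: (@lip_continuous _ 1) => x y; rewrite -(linB _ _ lv) mul1r; exact: pj_nm.
Qed.

(** Along an ultrafilter the finitely many coordinates of a bounded vector converge; vectors in the
    closure of the image are fixed by [pj v], so they converge with their coordinates. *)
Lemma pj_compact (I : finType) (v : I -> H) : onf v -> compact_operator (pj v).
Proof.
move=> ov; rewrite /compact_operator compact_ultra => F uF FC.
set C := closure _ in FC *.
have lv := pj_lin v.
have hC y : C y -> pj v y = y /\ nm y <= 1.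
  move=> Cy; have ap (e : R) : 0 < e -> exists2 w, pj v w = w /\ nm w <= 1 & nm (y - w) < e.
    move=> e0; have [|w [[x x1 <-] hw]] := Cy [set w | `|y - w| < e%:C].
      exact: nbhs_dist.
    exists (pj v x); last by move: hw; rewrite /= nmE ltcR.
    split; first exact: pj_idem.
    by apply: le_trans (pj_nm ov x) _; move: x1; rewrite /unit_ball /= nmE lecR.
  split.
    apply/eqP; rewrite -subr_eq0 -nm_eq0 eq_le nm_ge0 andbT; apply/ler_addgt0Pr => e e0; rewrite add0r.
    have [|w [hw _] yw] := ap (e / 2); first by rewrite divr_gt0.
    have := nm_tri (pj v y) w y; rewrite -{1}hw -(linB _ _ lv) [nm (w - y)]nmBC.
    have := pj_nm ov (y - w); lra.
  apply/ler_addgt0Pr => e e0; have [w [_ w1] yw] := ap _ e0.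
  by have := nm_tri y w 0; rewrite !subr0; lra.
have bd (g : R[i] -> R) i : (forall z, `|g z| <= cn z) -> exists r, forall e, 0 < e -> F [set y | `|g (dot y (v i)) - r| < e].
  move=> hg; apply: (@ultra_limit R H F uF (fun y => g (dot y (v i))) 1).
  apply: filterS FC => y /hC[_ y1]; rewrite /=; apply: le_trans (hg _) _.
  by apply: le_trans (CS _ _) _; rewrite (onf_nm i ov) mulr1.
have hr i : exists c : R[i], forall e : R, 0 < e -> F [set y | cn (dot y (v i) - c) < e].
  have [a ha] := bd (@complex.Re R) i (@absRe_le_cn R); have [b hb] := bd (@complex.Im R) i (@absIm_le_cn R).
  exists (Complex a b) => e e0; have e2 : 0 < e / 2 by rewrite divr_gt0.
  apply: filterS (filterI (ha _ e2) (hb _ e2)) => y [/= h1 h2].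
  apply: le_lt_trans (cn_le_ReIm _) _; rewrite ReD ImD ReN ImN /=; lra.
pose c i := sval (cid (hr i)); have cP i := svalP (cid (hr i)); rewrite -/(c _) in cP.
pose l := \sum_i c i *: v i.
have Fl : F --> l.
  move=> B /nbhs_ballP[r /= /gt0_complex[er e0] hB]; rewrite er in hB; set e := complex.Re r in e0 hB.
  have k1 : 0 < #|I|%:R + 1 :> R by rewrite ltr_wpDl.
  have d0 : 0 < e / (#|I|%:R + 1) by rewrite divr_gt0.
  have FI : F [set y | forall i, cn (dot y (v i) - c i) < e / (#|I|%:R + 1)].
    by apply: filter_forall => i; exact: cP.
  apply: filterS (filterI FC FI) => y [/hC[hy _] hd]; apply: hB.
  rewrite -ball_normE /= nmE ltcR nmBC -hy /l /pj -sumrB.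
  apply: le_lt_trans (nm_sum _ _ _) _; apply: le_lt_trans (_ : \sum_(i : I) e / (#|I|%:R + 1) < _).
    apply: ler_sum => i _; rewrite -scalerBl nmZ (onf_nm i ov) mulr1; apply: ltW; exact: (hd i).
  by rewrite sumr_const -[ltLHS]mulr_natl mulrA ltr_pdivrMr // mulrC ltr_pM2l // ltrDl.
exists l; split=> //; rewrite /C; apply: closed_closure => B /Fl FB.
by have [y [Cy By]] := filter_ex (filterI FC FB); exists y.
Qed.

End Operators.

(** * From the group to star representations of its algebra *)

Section StarRepresentation.
Variables (R : realType) (Gam : groupType) (A : cstarAlgType R) (u : Gam -> A).
Hypothesis hA : full_group_cstar u.
Variable gs : nat -> Gam.
Hypothesis gs_sur : forall g, exists n, gs n = g.
Hypothesis loc : forall (H : hilbertType R) (p : Gam -> H -> H), urep p ->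
  forall (F : seq Gam) (e : R), 0 < e -> {in F, forall h, h^-1%g \in F} -> 1%g \in F ->
  forall L, csub p setT L ->
  exists X, [/\ lsub X, invariant p setT X, X `<=` L, exists2 x, X x & x != 0 & qd p F e X].

Let u1 : u 1%g = cone. Proof. by have [[]] := hA. Qed.
Let uM g h : u (g * h)%g = cmul (u g) (u h). Proof. by have [[_ h1]] := hA. Qed.
Let uS g : star (u g) = u g^-1%g. Proof. by have [_ h _ _] := hA. Qed.

Lemma na_u g : na (u g) <= 1.
Proof.
have h : na (u g) ^+ 2 = na (cone : A) by rewrite -naC uS -uM mulVg u1.
have h1 : na (cone : A) ^+ 2 = na (cone : A) by rewrite -naC star1 cmul1.
have y1 : na (cone : A) <= 1 by rewrite leNgt; apply/negP => y1; nra.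
by rewrite leNgt; apply/negP => x1; nra.
Qed.

Definition ratc (ab : rat * rat) : R[i] := Complex (ratr ab.1) (ratr ab.2).

Lemma ratc_dense (z : R[i]) (e : R) : 0 < e -> exists ab, cn (z - ratc ab) <= e.
Proof.
move=> e0; have e2 : 0 < e / 2 by rewrite divr_gt0.
have q (x : R) : exists a : rat, `|x - ratr a| <= e / 2.
  have [|a] := @rat_in_itvoo R x (x + e / 2); first by rewrite ltrDl.
  by rewrite in_itv /= => /andP[h1 h2]; exists a; rewrite ler_norml; lra.
have [a ha] := q (complex.Re z); have [b hb] := q (complex.Im z); exists (a, b).
apply: le_trans (cn_le_ReIm _) _; rewrite ReD ImD ReN ImN /=; lra.
Qed.

Definition ratsum (l : seq (nat * (rat * rat))) : A := \sum_(t <- l) ratc t.2 *: u (gs t.1).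

Lemma ratsum_approx (a : A) (e : R) : 0 < e -> exists l, na (a - ratsum l) < e.
Proof.
move=> e0; have e2 : 0 < e / 2 by rewrite divr_gt0.
have [_ _ _ dA] := hA.
have [b [ab [n [c [g eb]]]]] : exists b, na (a - b) < e / 2 /\
    exists n (c : 'I_n -> R[i]) (g : 'I_n -> Gam), b = \sum_(i < n) c i *: u (g i).
  by have [b hb' hb] := dense_dist a dA e2; exists b; split=> //; move: hb; rewrite naE ltcR.
have n1 : 0 < n.+1%:R :> R by [].
have e3 : 0 < e / 2 / n.+1%:R by rewrite !divr_gt0.
pose rc i := sval (cid (ratc_dense (c i) e3)).
have rcP i : cn (c i - ratc (rc i)) <= e / 2 / n.+1%:R by exact: (svalP (cid (ratc_dense (c i) e3))).
pose ix i := sval (cid (gs_sur (g i))); have ixP i : gs (ix i) = g i by exact: (svalP (cid (gs_sur (g i)))).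
exists [seq (ix i, rc i) | i <- enum 'I_n].
have -> : ratsum [seq (ix i, rc i) | i <- enum 'I_n] = \sum_(i < n) ratc (rc i) *: u (g i).
  by rewrite /ratsum big_map big_enum /=; apply: eq_bigr => i _; rewrite ixP.
have := naD (a - b) (b - \sum_(i < n) ratc (rc i) *: u (g i)); rewrite subrKA.
have : na (b - \sum_(i < n) ratc (rc i) *: u (g i)) <= e / 2.
  rewrite eb -sumrB; apply: le_trans (_ : \sum_(i < n) e / 2 / n.+1%:R <= _).
    elim/big_ind2: _ => [|x1 x2 y1 y2 h1 h2|i _]; first by rewrite na0.
      exact: le_trans (naD _ _) (lerD h1 h2).
    rewrite -scalerBl naZ -[leRHS]mulr1; apply: ler_pM; rewrite ?cn_ge0 ?na_ge0 //.
    exact: na_u.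
  rewrite sumr_const card_ord -[leLHS]mulr_natl mulrA ler_pdivrMr // mulrC.
  by apply: ler_wpM2l; [exact: ltW | rewrite ler_nat].
lra.
Qed.

Lemma full_group_cstar_separable : separable_space A.
Proof.
exists (range ratsum).
  exact: card_le_trans (card_image_le _ _) (countableP _).
move=> O [a Oa] oO; have := open_nbhs_nbhs (conj oO Oa) => /nbhs_ballP[r /= /gt0_complex[er e0] hO]; rewrite er in hO.
have [l hl] := ratsum_approx a e0; exists (ratsum l); split; last by exists l.
by apply: hO; rewrite -ball_normE /= naE ltcR.
Qed.

Variables (H : hilbertType R) (s : A -> H -> H).
Hypotheses (sepH : separable_space H) (hs : star_representation s).

Let E := s cone.
Let E_lin : lin E := srep_lin hs cone.
Let E_idem x : E (E x) = E x := srep1_idem hs x.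
Let E_adj x y : dot (E x) y = dot x (E y) := srep1_adj hs x y.
Let U g := s (u g).
Let UE g x : U g (E x) = U g x. Proof. by rewrite /U /E -(srepM hs) cmulr1. Qed.
Let EU g x : E (U g x) = U g x. Proof. by rewrite /U /E -(srepM hs) cmul1. Qed.
(** The representation may be degenerate. Letting the group act as the identity on the complement of
    the range of [E] gives a unitary representation on all of [H]. *)
Let p g x := U g x + (x - E x).

Lemma star_urep : urep p.
Proof.
have pl g : lin (p g).
  move=> k x y; rewrite /p /U (srep_lin hs) E_lin scalerDr scalerBr opprD.
  have ac (a b c d a' b' : H) : a + b + (c + d + (- a' - b')) = a + (c - a') + (b + (d - b')).
    rewrite -!addrA; congr (_ + _); rewrite addrCA; congr (_ + _).
    by rewrite [RHS]addrCA; congr (_ + _); rewrite addrCA.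
  exact: ac.
have padj g x y : dot (p g x) y = dot x (p g^-1%g y).
  rewrite /p !dotDl !dotDr !dotNl !dotNr E_adj; congr (_ + _).
  by have := srep_adj hs (u g^-1%g) x y; rewrite uS invgK.
have pM g h x : p (g * h)%g x = p g (p h x).
  rewrite /p; have e1 : E (U h x + (x - E x)) = U h x.
    by rewrite (linD _ _ E_lin) EU (linB _ _ E_lin) E_idem subrr addr0.
  rewrite e1 [_ + _ - U h x]addrC addKr; congr (_ + _).
  have lU := srep_lin hs (u g); rewrite /U uM (srepM hs) (linD _ _ lU) (linB _ _ lU).
  by rewrite -/(U g (E x)) UE /U subrr addr0.
have p1 x : p 1%g x = x by rewrite /p /U u1 addrC subrK.
split=> // g x y; by rewrite padj -pM mulVg p1.
Qed.

(** On the range of [E] the vectors are approximated from the dense subspace of [qd_dense]. The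
    operators [U g] kill the complement, so there any finite orthonormal family commutes with
    them. *)
Lemma star_approx (n : nat) (zs : seq H) (e : R) : 0 < e ->
  exists (J : finType) (q : J -> H), [/\ onf q, {in zs, forall x, nm (x - pj q x) <= e} &
    forall k, (k < n)%N -> acm (U (gs k)) e (pj q)].
Proof.
move=> e0; have hp := star_urep.
pose F0 := [seq gs k | k <- iota 0 n]; pose F := 1%g :: F0 ++ [seq h^-1%g | h <- F0].
have FV : {in F, forall h, h^-1%g \in F}.
  move=> h; rewrite !inE !mem_cat => /or3P[/eqP->|hF|/mapP[k kF ->]].
  - by rewrite invg1 eqxx.
  - by rewrite map_f ?orbT.
  - by rewrite invgK kF /= orbT.
pose L := [set x | E x = x].
have sL : lsub L.
  by split=> [|k x y /= hx hy]; [exact: (lin0 E_lin) | rewrite /L /= E_lin hx hy].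
have cL : aclosed L.
  move=> x hx; apply/eqP; rewrite -subr_eq0 -nm_eq0 eq_le nm_ge0 andbT.
  apply/ler_addgt0Pr => r r0; rewrite add0r; have [|y Ly xy] := hx (r / 2); first by rewrite divr_gt0.
  have := nm_tri (E x) y x; rewrite -{1}Ly -(linB _ _ E_lin) [nm (y - x)]nmBC.
  have := srep1_nm hs (x - y); rewrite -/E; lra.
have pE g x : L x -> p g x = U g x by move=> Lx; rewrite /p Lx subrr addr0.
have iL : invariant p setT L by move=> g x _ Lx; rewrite /L /= pE // EU.
have [X [sX iX XL qX dX]] := qd_dense hp e0 (loc hp e0 FV (mem_head _ _)) sL cL iL.
pose ap x := s2val (cid2 (dX (E x) e (E_idem x) e0)).
have apX x : X (ap x) by exact: s2valP (cid2 _).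
have apn x : nm (E x - ap x) < e by exact: s2valP' (cid2 (dX (E x) e (E_idem x) e0)).
have [|I [v [ov Xv vK vF]]] := qX [seq ap x | x <- zs]; first by move=> _ /mapP[x _ ->].
have sN : lsub [set x | E x = 0].
  by split=> [|k x y /= hx hy]; [exact: (lin0 E_lin) | rewrite /= E_lin hx hy scaler0 addr0].
have [|J [w [ow Nw wK]]] := gram_schmidt (xs := [seq x - E x | x <- zs]) sN.
  by move=> _ /mapP[x _ ->]; rewrite /= (linB _ _ E_lin) E_idem subrr.
have Lv i : E (v i) = v i by exact: XL.
have pv0 x : E x = 0 -> pj v x = 0.
  by move=> Ex; rewrite /pj big1 // => i _; rewrite -Lv -E_adj Ex dot0l scale0r.
have pw0 x : E x = x -> pj w x = 0.
  by move=> Ex; rewrite /pj big1 // => i _; rewrite -Ex E_adj Nw dot0r scale0r.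
have oq : onf (sumf v w).
  by apply: onf_sumf => // i j; rewrite -Lv E_adj Nw dot0r.
exists (I + J)%type, (sumf v w); split=> // [x xz|k kn y].
  have fixx : pj (sumf v w) (ap x + (x - E x)) = ap x + (x - E x).
    rewrite pj_sumf (linD _ _ (pj_lin v)) (linD _ _ (pj_lin w)).
    rewrite (vK (ap x)); last by apply/mapP; exists x.
    rewrite (wK (x - E x)); last by apply/mapP; exists x.
    rewrite pv0 ?pw0 ?addr0 ?add0r //; first exact: XL.
    by rewrite (linB _ _ E_lin) E_idem subrr.
  apply: le_trans (@pj_best _ _ _ _ oq x _ fixx) _.
  have -> : x - (ap x + (x - E x)) = E x - ap x; last by rewrite ltW.
  by rewrite opprD opprB addrCA [x + _]addrC subrK addrC.
have lU := srep_lin hs (u (gs k)); rewrite -/(U (gs k)) in lU.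
have e1 : U (gs k) (pj (sumf v w) y) = p (gs k) (pj v y).
  rewrite pj_sumf (linD _ _ lU) pE; last by apply: pj_in => // i; exact: Lv.
  have -> : U (gs k) (pj w y) = 0; last by rewrite addr0.
  by rewrite -UE (_ : E (pj w y) = 0) ?(lin0 lU) //; apply: (pj_in _ sN).
have e2 : pj (sumf v w) (U (gs k) y) = pj v (p (gs k) y).
  rewrite pj_sumf (pw0 (U (gs k) y)) ?EU // addr0 /p (linD _ _ (pj_lin v)) (pv0 (y - E y)) ?addr0 //.
  by rewrite (linB _ _ E_lin) E_idem subrr.
rewrite e1 e2; apply: vF; rewrite inE mem_cat; apply/or3P; constructor 2.
by apply/mapP; exists k; rewrite // mem_iota.
Qed.

Lemma star_quasidiagonal : quasidiagonal_set (range s).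
Proof.
have U1 g x : nm (U g x) <= nm x.
  apply: le_trans (srep_contractive hs _ _) _; rewrite -[leRHS]mul1r.
  by apply: ler_wpM2r; [exact: nm_ge0 | exact: na_u].
split.
- by move=> _ [a _ <-]; have [h _ _ _] := hs; exact: h.
- have [D cD dD] := full_group_cstar_separable.
  exists (s @` D); first split.
  + by move=> _ [a _ <-]; exists a.
  + exact: card_le_trans (card_image_le _ _) cD.
  move=> _ [a _ <-] e e0; have e2 : 0 < e / 2 by rewrite divr_gt0.
  have [b Db hb] := dense_dist a dD e2.
  move: hb; rewrite /= naE ltcR => hb.
  exists (s b); first by exists b.
  have /andP[_] : 0 <= opnorm (s a \- s b) <= e / 2.
    apply: opnorm_bounds => [|x]; first exact: ltW.
    rewrite /= -(srepB hs); apply: le_trans (srep_contractive hs _ _) _.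
    by apply: ler_wpM2r; [exact: nm_ge0 | exact: ltW].
  by move=> h; lra.
have [D cD dD] := sepH.
have [ys hys] : exists ys : nat -> H, forall x (e : R), 0 < e -> exists k, nm (x - ys k) < e.
  have [y0 Dy0] : exists y, D y.
    by have [|y [_ Dy]] := dD setT _ openT; [exists 0 | exists y].
  have [f hf] : exists f : nat -> H, D `<=` range f.
    have /countable_injP[f fi] := cD; exists (fun k => xget y0 [set t | D t /\ f t = k]) => y Dy.
    exists (f y) => //; have [|Dx fx] := @xgetPex _ y0 [set t | D t /\ f t = f y]; first by exists y.
    by apply: fi; rewrite ?inE.
  exists f => x e e0; have [y Dy hy] := dense_dist x dD e0.
  have [k _ ek] := hf _ Dy; exists k; rewrite ek.
  by move: hy; rewrite /= nmE ltcR.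
have [J [v [ov vv vy vU]]] := growing_sequence (U := U) (gs := gs) ys U1 (fun g => srep_lin hs (u g)) star_approx.
exists (fun n => pj (v n)); split.
- by move=> n; split; [exact: pj_projection | exact: pj_compact].
- move=> n x; have e1 : pj (v n) x = pj (v n) (pj (v n.+1) x).
    by apply: eq_bigr => i _; rewrite pj_adj vv.
  have dE m : hdot (pj (v m) x) x = (nm (pj (v m) x) ^+ 2)%:C.
    by rewrite -dotxx pj_adj pj_idem // -pj_adj.
  rewrite !dE lecR ler_pXn2r ?nnegrE ?nm_ge0 // e1; exact: pj_nm.
- move=> x; apply/nm_cvgP => e e0; have e4 : 0 < e / 4 by rewrite divr_gt0.
  have [k hk] := hys x _ e4.
  have [N hN] := harmonic_small (1 + nm (ys k)) e4.
  (* Two successors, since the estimates at index n + 1 concern only the approximants k < n. *)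
  exists (maxn N k).+2 => -[//|n]; rewrite ltnS => hn.
  have h1 := vy n k (leq_ltn_trans (leq_maxr N k) hn).
  have h2 := hN n (leq_trans (leq_maxl N k) (ltnW hn)).
  have h3 := pjc_nm (ov n.+1) (x - ys k).
  have lv := pj_lin (v n.+1); rewrite (linB _ _ lv) in h3.
  have h4 := nmD (x - ys k - (pj (v n.+1) x - pj (v n.+1) (ys k))) (ys k - pj (v n.+1) (ys k)).
  have ac (p1 p2 p3 p4 : H) : p1 - p3 = p1 - p2 - (p3 - p4) + (p2 - p4).
    by rewrite opprB addrAC !subrKA.
  rewrite nmBC (ac x (ys k) (pj (v n.+1) x) (pj (v n.+1) (ys k))).
  have h5 : nm (ys k - pj (v n.+1) (ys k)) < e / 4.
    by apply: le_lt_trans h1 _; apply: le_lt_trans h2; rewrite mulrC.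
  by apply: le_lt_trans h4 _; lra.
- move=> _ [a _ <-]; apply/cvgrPdist_lt => e e0; have e8 : 0 < e / 8 by rewrite divr_gt0.
  have [l hl] := ratsum_approx a e8.
  have [c [c0 hc]] : exists c : R, 0 <= c /\ forall n t, (forall k, k \in map fst l -> acm (U (gs k)) t (pj (v n))) -> 0 <= t ->
      acm (s (ratsum l)) (c * t) (pj (v n)).
    rewrite /ratsum; elim: (l) => [|[k ab] l' [c [c0 IH]]].
      exists 0; split=> // n t _ _ x; rewrite big_nil !(srep0 hs) (lin0 (pj_lin _)) subrr nm0.
      by rewrite !mul0r.
    exists (cn (ratc ab) + c); split=> [|n t h t0 x]; first by rewrite addr_ge0 // cn_ge0.
    rewrite big_cons !(srepD hs) !(srepZ hs) (linD _ _ (pj_lin _)) (linZ _ _ (pj_lin _)) opprD addrACA -scalerBr.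
    apply: le_trans (nmD _ _) _; rewrite nmZ !mulrDl; apply: lerD.
      by rewrite -!mulrA; apply: ler_wpM2l; [exact: cn_ge0 | apply: h; exact: mem_head].
    by apply: IH => // k' hk'; apply: h; rewrite inE hk' orbT.
  have [N hN] := harmonic_small (3 * c) e8.
  pose M := \max_(k <- map fst l) k.
  exists (maxn N M).+2 => // -[//|n]; rewrite /= ltnS => hn.
  have h1 : acm (s (ratsum l)) (c * (3 * n.+1%:R^-1)) (pj (v n.+1)).
    apply: hc => [k kl|]; last by rewrite mulr_ge0 // invr_ge0.
    apply: vU; apply: leq_ltn_trans hn; apply: leq_trans (leq_maxr N M).
    by rewrite /M (big_rem k) //= leq_maxl.
  have h2 := hN n (leq_trans (leq_maxl N M) (ltnW hn)).
  have /andP[b0 b1] : 0 <= opnorm ((pj (v n.+1) \o s a) \- (s a \o pj (v n.+1))) <= e / 2.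
    apply: opnorm_bounds => [|x]; first by apply: ltW; rewrite divr_gt0.
    have lv := pj_lin (v n.+1); rewrite /=; set P := pj (v n.+1) in h1 lv *.
    have eq_ : P (s a x) - s a (P x) = (P (s (a - ratsum l) x) - s (a - ratsum l) (P x)) - (s (ratsum l) (P x) - P (s (ratsum l) x)).
      have ac (p1 p2 p3 p4 : H) : p1 - p2 = p1 - p3 - (p2 - p4) - (p4 - p3).
        by rewrite !opprB addrAC !subrKA.
      by rewrite !(srepB hs) (linB _ _ lv); exact: ac.
    rewrite eq_; apply: le_trans (nmB _ _) _.
    have k1 := nmB (P (s (a - ratsum l) x)) (s (a - ratsum l) (P x)).
    have k2 := pj_nm (ov n.+1) (s (a - ratsum l) x); rewrite -/P in k2.
    have k3 := srep_contractive hs (a - ratsum l) x.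
    have k4 := srep_contractive hs (a - ratsum l) (P x).
    have k5 := pj_nm (ov n.+1) x; rewrite -/P in k5.
    have k6 := ler_wpM2l (na_ge0 (a - ratsum l)) k5.
    have k7 := ler_wpM2r (nm_ge0 x) (ltW hl).
    have k8 : c * (3 * n.+1%:R^-1) * nm x <= e / 8 * nm x.
      by apply: ler_wpM2r; [exact: nm_ge0 | rewrite mulrA [c * 3]mulrC; exact: ltW].
    have k9 := h1 x; have X0 := mulr_ge0 (ltW e8) (nm_ge0 x).
    have q1 := le_trans k2 (le_trans k3 k7); have q2 := le_trans k4 (le_trans k6 k7).
    have q3 : nm (s (ratsum l) (P x) - P (s (ratsum l) x)) <= e / 8 * nm x.
      by first [exact: le_trans k9 k8 | rewrite nmBC; exact: le_trans k9 k8].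
    apply: le_trans (lerD (le_trans k1 (lerD q1 q2)) q3) _.
    have -> : e / 2 * nm x = e / 8 * nm x + e / 8 * nm x + (e / 8 * nm x + e / 8 * nm x) by field.
    by rewrite lerD2l lerDl.
  have b2 : `|0 - opnorm ((pj (v n.+1) \o s a) \- (s a \o pj (v n.+1)))| < e.
    by rewrite sub0r normrN (ger0_norm b0); apply: le_lt_trans b1 _; lra.
  exact: b2.
Qed.

End StarRepresentation.
Local Open Scope quotient_scope.

(** * Translating the group notions of the statement *)

Section GroupClosedOfSgp.
Variables (G : groupType) (T : set G).
Hypothesis sT : sgp T.

Definition sgp_pred : {pred G} := fun x => `[<T x>].

Let sgp_predP x : (x \in sgp_pred) <-> T x.
Proof. by split=> [/asboolP//|h]; apply/asboolP. Qed.

Let predM : mulg_closed sgp_pred.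
Proof. by move=> x y /sgp_predP hx /sgp_predP hy; apply/sgp_predP; have [_ h _] := sT; exact: h. Qed.

Let pred1 : (1 : G)%g \in sgp_pred.
Proof. by apply/sgp_predP; have [] := sT. Qed.

Let predV : invg_closed sgp_pred.
Proof. by move=> x /sgp_predP hx; apply/sgp_predP; have [_ _ h] := sT; exact: h. Qed.

HB.instance Definition _ := isMulClosed.Build G sgp_pred predM.
HB.instance Definition _ := isMul1Closed.Build G sgp_pred pred1.
HB.instance Definition _ := isInvClosed.Build G sgp_pred predV.

Lemma sgp_groupClosed : exists T' : groupClosed G, forall x, (x \in T') <-> T x.
Proof. by exists (sgp_pred : groupClosed G) => x; exact: sgp_predP. Qed.

End GroupClosedOfSgp.

Lemma finitely_generated_fgen (G : groupType) (S : {pred G}) :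
  finitely_generated S -> fgen [set x | x \in S].
Proof.
move=> [s sS h]; exists s => // T sT sT' x xS.
have [T' hT'] := sgp_groupClosed sT.
by apply/hT'; apply: (h T') xS => y ys; apply/hT'; exact: sT'.
Qed.

Section QuotientProjection.
Variables (G : groupType) (N : normalClosed G).
Local Notation Q := (quotient_group N).

Definition qproj (g : G) : Q := \pi_Q g.

Lemma qprojM g h : qproj (g * h)%g = (qproj g * qproj h)%g.
Proof. exact: esym (pi_qmul N g h). Qed.

Lemma qprojV g : qproj g^-1%g = (qproj g)^-1%g.
Proof. exact: esym (pi_qinv N g). Qed.

Lemma qprojR g h : qproj [~ g, h]%g = [~ qproj g, qproj h]%g.
Proof. by rewrite !commgEl /conjg !(qprojM, qprojV). Qed.

Lemma qproj1 g : qproj g = 1%g <-> g \in N.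
Proof.
have e : coset_eq N 1%g g = (g \in N) by rewrite /coset_eq invg1 mul1g.
rewrite -e; split=> [h|/(coset_eqP N) h]; last exact: esym h.
by apply/(coset_eqP N); exact: esym h.
Qed.

Lemma qproj_sur k : exists g, qproj g = k.
Proof. by exists (repr k); exact: reprK. Qed.

End QuotientProjection.

(** * A torsion-free centre of rank one is cyclic *)

Section RankOneCenter.
Variable Q : groupType.
Local Open Scope group_scope.

Lemma commg1_commute (x y : Q) : [~ x, y] = 1 <-> commute x y.
Proof.
rewrite commgEl /conjg /commute; split=> [h|->]; last by rewrite mulKg mulVg.
have e : x * y = y * (x * (x^-1 * (y^-1 * (x * y)))) by rewrite !mulVKg.
by rewrite e h mulg1.
Qed.

Definition ctr : set Q := [set x | forall y, commute x y].

Lemma center_predP x : (x \in center_pred Q) <-> ctr x.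
Proof.
split=> h.
  have h' : `[< forall y, commute x y >] by exact: h.
  by move=> y; have /asboolP/(_ y) := h'.
have h' : `[< forall y, commute x y >] by apply/asboolP => y; exact: (h y).
exact: h'.
Qed.

Lemma sgp_ctr : sgp ctr.
Proof.
split=> [y|x y cx cy t|x cx y]; rewrite /commute.
- by rewrite mul1g mulg1.
- by rewrite -mulgA (cy t) mulgA (cx t) -mulgA.
- by rewrite -[in LHS](mulgK x y) -[(y * x)](cx y) mulgA mulKg.
Qed.

Lemma sgp_cycle (z : Q) : sgp (cyc z).
Proof.
have cX i j : commute (z ^+ i) (z ^- j).
  by apply: commuteV; apply: commuteX2; exact: commute_refl.
split=> [|_ _ [i [j ->]] [i' [j' ->]]|_ [i [j ->]]].
- by exists 0%N, 0%N; rewrite !expg0 mulgV.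
- exists (i + i')%N, (j' + j)%N; rewrite !expgnDr invgM !mulgA; congr (_ * _).
  by rewrite -!mulgA (cX i' j).
- by exists j, i; rewrite invgM invgK.
Qed.

Lemma cyc_self (z : Q) : cyc z z.
Proof. by exists 1%N, 0%N; rewrite expg1 expg0 invg1 mulg1. Qed.

Lemma sgp_expg (T : set Q) x n : sgp T -> T x -> T (x ^+ n).
Proof.
move=> [T1 TM _] Tx; elim: n => [|n IH]; first by rewrite expg0.
by rewrite expgS; exact: TM.
Qed.

Lemma cyc_trans (w z g : Q) : cyc w z -> cyc z g -> cyc w g.
Proof.
move=> wz [i [j ->]]; have sw := sgp_cycle w; have [_ wM wV] := sw.
by apply: wM; [exact: sgp_expg | apply: wV; exact: sgp_expg].
Qed.

Hypothesis tf : torsion_free Q.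

(** The subtractive Euclidean algorithm on exponents: for m <= n, a^m = b^n gives (a b^-1)^m = b^(n
    - m). Torsion-freeness settles the case of a zero exponent. *)
Lemma common_root (a b : Q) m n : ctr a -> ctr b -> (0 < m + n)%N -> a ^+ m = b ^+ n ->
  exists w, [/\ ctr w, cyc w a & cyc w b].
Proof.
have cyc1 (w : Q) : cyc w 1 by have [] := sgp_cycle w.
have [k] := ubnP (m + n)%N; elim: k a b m n => // k IH a b m n mnk ca cb mn0 e.
have [m0|m0] := posnP m.
  have b1 : b = 1 by apply: (tf (n := n)); [lia | rewrite -e m0 expg0].
  by exists a; split=> //; [exact: cyc_self | rewrite b1].
have [n0|n0] := posnP n.
  have a1 : a = 1 by apply: (tf (n := m)); [lia | rewrite e n0 expg0].
  by exists b; split=> //; [rewrite a1 | exact: cyc_self].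
have [_ cM cV] := sgp_ctr.
have [mn|nm] := leqP m n.
  have [|||||w [cw wa wb]] := IH (a * b^-1) b m (n - m)%N; [lia|exact: cM ca (cV _ cb)|exact: cb|lia| |].
    rewrite expgMn; last exact: ca.
    by rewrite e expVgn -[in LHS](subnK mn) expgnDr mulgK.
  exists w; split=> //; have [_ wM _] := sgp_cycle w.
  by rewrite -(mulgVK b a); exact: wM.
have [|||||w [cw wa wb]] := IH a (b * a^-1) (m - n)%N n; [lia|exact: ca|exact: cM cb (cV _ ca)|lia| |].
  rewrite expgMn; last exact: cb.
  by rewrite -e expVgn -[in RHS](subnK (ltnW nm)) expgnDr mulgK.
exists w; split=> //; have [_ wM _] := sgp_cycle w.
by rewrite -(mulgVK a b); exact: wM.
Qed.

Hypothesis rk : abelian_rank (center_pred Q) 1.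

(** Rank one forbids an independent pair, and the resulting relation with integer exponents is
    rewritten with natural ones; the alternative records the relative sign. *)
Lemma ctr_relation (a b : Q) : ctr a -> ctr b ->
  exists m n, (0 < m + n)%N /\ (a ^+ m = b ^+ n \/ a ^+ m = b^-1 ^+ n).
Proof.
move=> ca cb; have [_ noR] := rk; pose x (i : 'I_2) := if val i == 0%N then a else b.
have inv_eq (s t : Q) : s * t = 1 -> s^-1 = t by move=> h; rewrite -[t](mulKg s) h mulg1.
have [k [ek [i ki]]] : exists k : 'I_2 -> int,
    \prod_(i < 2) expgz (x i) (k i) = 1 /\ exists i, k i <> 0%R.
  apply: contrapT => h; apply: noR; exists x; split=> [i|k ek i].
    by apply/center_predP; rewrite /x; case: ifP.
  by apply: contrapT => ki; apply: h; exists k; split=> //; exists i.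
move: ek; rewrite !big_ord_recl big_ord0 mulg1 /x /=.
have {ki}: ~ (k ord0 = 0%R /\ k (lift ord0 ord0) = 0%R).
  move=> [k0 k1]; apply: ki; have [j ->|->//] := unliftP ord0 i.
  by rewrite (ord1 j).
case: (k ord0) (k (lift ord0 ord0)) => m [] n /= nz e.
- exists m, n; split; first by case: m n nz e => [|m] [|n] // nz; exfalso; apply: nz.
  by right; rewrite expVgn -(inv_eq _ _ e) invgK.
- exists m, n.+1; split; first by rewrite addnS.
  by left; rewrite -[RHS]invgK -(inv_eq _ _ e) invgK.
- exists m.+1, n; split; first by [].
  by left; rewrite -(inv_eq _ _ e) invgK.
- exists m.+1, n.+1; split; first by [].
  by right; rewrite expVgn -(inv_eq _ _ e) invgK.
Qed.

Lemma ctr_common_root (a b : Q) : ctr a -> ctr b ->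
  exists w, [/\ ctr w, cyc w a & cyc w b].
Proof.
move=> ca cb; have [m [n [mn0 [e|e]]]] := ctr_relation ca cb.
  exact: (common_root ca cb mn0 e).
have cb' : ctr b^-1 by have [_ _ h] := sgp_ctr; exact: h.
have [w [cw wa wb]] := common_root ca cb' mn0 e; exists w; split=> //.
by rewrite -[b]invgK; have [_ _ h] := sgp_cycle w; exact: h.
Qed.

Lemma rank1_ctr_cyclic : fgen ctr ->
  exists z, ctr z /\ forall c, ctr c -> cyc z c.
Proof.
move=> [l lC hl]; have [z [cz zl]] : exists z, ctr z /\ {in l, forall c, cyc z c}.
  elim: l lC {hl} => [|b l IH] lC; first by exists 1; split=> //; have [] := sgp_ctr.
  have [|z [cz zl]] := IH; first by move=> c cl; apply: lC; rewrite inE cl orbT.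
  have [w [cw wz wb]] := ctr_common_root cz (lC b (mem_head _ _)); exists w; split=> //.
  by move=> c; rewrite inE => /predU1P[->//|/zl]; exact: cyc_trans.
by exists z; split=> // c; exact: hl (sgp_cycle z) zl c.
Qed.

End RankOneCenter.

Lemma fgen_enum (G : groupType) (xs : seq G) :
  (forall T, sgp T -> {in xs, forall x, T x} -> forall g, T g) ->
  exists gs : nat -> G, forall g, exists n, gs n = g.
Proof.
move=> gen; pose ys := xs ++ [seq x^-1%g | x <- xs].
pose gw (w : seq nat) := wprod [seq nth 1%g ys i | i <- w].
pose gs n := if unpickle n is Some w then gw w else 1%g; exists gs => g.
have gsw w : gs (pickle w) = gw w by rewrite /gs pickleK.
suff [[w e] _] : (exists w, gw w = g) /\ exists w, gw w = g^-1%g by exists (pickle w); rewrite gsw.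
have ysw y : y \in ys -> exists w, gw w = y.
  by move=> yy; exists [:: index y ys]; rewrite /gw /= mulg1 nth_index.
apply: (gen [set g | (exists w, gw w = g) /\ exists w, gw w = g^-1%g]) => [|x xx].
  split=> [|a b [[w1 <-] [w2 e2]] [[w3 <-] [w4 e4]]|a [h1 h2]].
  - by rewrite /= invg1; split; exists [::].
  - by split; [exists (w1 ++ w3) | exists (w4 ++ w2)]; rewrite ?invgM -?e2 -?e4 /gw map_cat wprod_cat.
  - by split; rewrite ?invgK.
by split; apply: ysw; rewrite mem_cat ?xx // map_f ?orbT.
Qed.

Lemma quotient_gen (G : groupType) (N : normalClosed G) :
  finitely_generated N -> finitely_generated (G := quotient_group N) predT ->
  exists xs : seq G, forall T, sgp T -> {in xs, forall x, T x} -> forall g, T g.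
Proof.
move=> /finitely_generated_fgen[ds dsN hN] /finitely_generated_fgen[s _ hs].
exists (ds ++ [seq repr x | x <- s]) => T sT hT g; have [T1 TM TV] := sT.
have NT : [set x | x \in N] `<=` T.
  by apply: hN => // x xd; apply: hT; rewrite mem_cat xd.
have [t Tt e] : [set k | exists2 t, T t & qproj N t = k] (qproj N g).
  apply: hs => // [|x xs].
    split=> [|_ _ [t1 h1 <-] [t2 h2 <-]|_ [t h <-]].
    - by exists 1%g => //; apply/(qproj1 N); exact: gpred1.
    - by exists (t1 * t2)%g; [exact: TM | exact: qprojM].
    - by exists t^-1%g; [exact: TV | exact: qprojV].
  by exists (repr x); [apply: hT; rewrite mem_cat map_f ?orbT | exact: reprK].
rewrite -(mulVKg t g); apply: TM => //; apply: NT; apply/(qproj1 N).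
by rewrite qprojM qprojV e mulVg.
Qed.

Theorem proposition3p11 (R : realType) (Gamma : groupType)
    (Delta : normalClosed Gamma)
    (Delta_central : {subset Delta <= center_pred Gamma})
    (Delta_fg : finitely_generated Delta)
    (Q_fg : finitely_generated (G := quotient_group Delta) predT)
    (Q_torsion_free : torsion_free (quotient_group Delta))
    (Q_two_step : nilpotent_step 2 (quotient_group Delta))
    (Q_center_rank1 : abelian_rank (center_pred (quotient_group Delta)) 1)
    (A : cstarAlgType R) (u : Gamma -> A) (hA : full_group_cstar u) :
  strongly_quasidiagonal A.
Proof.
set Dl : set Gamma := [set x | x \in Delta]; pose f := qproj Delta.
have sDl : sgp Dl.
  by split=> [|x y hx hy|x hx]; rewrite /Dl /=; [exact: gpred1 | exact: gpredM | rewrite gpredV].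
have cD d g : Dl d -> commute d g by move=> /Delta_central/center_predP h; exact: (h g).
have fM : shom setT f by move=> g h _ _; exact: qprojM.
have f1 g : f g = 1%g <-> Dl g by exact: qproj1.
have fsur k : exists g, f g = k by exact: qproj_sur.
have [xs gen] := quotient_gen Delta_fg Q_fg.
have cl x y w : Dl [~ [~ x, y], w]%g.
  apply/f1; rewrite /f !qprojR.
  have e : @upper_central (quotient_group Delta) 2%N = setT := Q_two_step.
  have h : @upper_central (quotient_group Delta) 2%N (f x) by rewrite e.
  exact: (h (f y) (f w)).
have nG : noeth Gamma.
  apply: (poly_noeth sDl cD (finitely_generated_fgen Delta_fg) (xs := xs)) => //.
  by move=> T sT _; exact: gen.
have nQ : noeth (quotient_group Delta).
  apply: (noeth_quot (G := setT) (f := f)) => // k.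
  by have [g <-] := fsur k; exists g.
(* The noetherian property passes to the quotient and makes its centre finitely generated; with rank
   one and no torsion, the centre is then generated by one element. *)
have [z0 [cz0 zc]] := rank1_ctr_cyclic Q_torsion_free Q_center_rank1 (nQ _ (sgp_ctr _)).
have [z ez] := fsur z0.
have ztE s : zt Dl s <-> ctr (f s).
  split=> [hs y|hs g].
    by have [g <-] := fsur y; apply/commg1_commute; rewrite -qprojR; apply/f1; exact: hs.
  by apply/f1; rewrite /f qprojR; apply/commg1_commute; exact: hs.
have [gs gs_sur] := fgen_enum gen.
have loc (H : hilbertType R) (p : Gamma -> H -> H) : urep p ->
    forall (F : seq Gamma) (e : R), 0 < e -> {in F, forall h, h^-1%g \in F} -> 1%g \in F ->
    forall L, csub p setT L ->
    exists X, [/\ lsub X, invariant p setT X, X `<=` L, exists2 x, X x & x != 0 & qd p F e X].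
  move=> hp F e e0 FV F1 L cL.
  apply: (local_qd hp nG sDl cD cl fM f1 fsur gen (z := z)) => //.
    by apply/ztE; rewrite ez.
  by move=> s /ztE hs; rewrite ez; exact: zc.
have sepA : separable_space A := full_group_cstar_separable hA gs_sur.
split; first exact: sepA.
by move=> H s sepH hs; exact: (star_quasidiagonal hA gs_sur loc sepH hs).
Qed.
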